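(* Let $X,X_1,X_2,\dots$ be i.i.d. $d$-dimensional random vectors such that $X$ has some non-degenerate $d$-variate normal distribution, and let $\gamma>1$. Let $U_n$ be the random element of $\mathrm{L}^2=\mathrm{L}^2(\mathbb{R}^d,\mathcal{B}^d,w_\gamma(t)\,dt)$ defined in the context. Then there is a centered Gaussian random element $W$ of $\mathrm{L}^2$ having covariance kernel $$C(s,t)=e^{s^\top t}+\frac12\left(e^{s^\top t}+e^{-s^\top t}\right)+2\cos(s^\top t)-s^\top t-4,\qquad s,t\in\mathbb{R}^d,$$ such that $U_n$ converges in distribution to $W$ in $\mathrm{L}^2$ as $n\to\infty$.
   Context: Let $\overline X_n=n^{-1}\sum_{j=1}^nX_j$ and $S_n=n^{-1}\sum_{j=1}^n(X_j-\overline X_n)(X_j-\overline X_n)^\top$. For $n\ge d+1$ (assumed throughout) $S_n$ is invertible almost surely, $S_n^{-1/2}$ denotes the symmetric positive definite square root of $S_n^{-1}$, and $Y_{n,j}=S_n^{-1/2}(X_j-\overline X_n)$, $j=1,\dots,n$. Put $$R_n(t)=\frac1n\sum_{j=1}^n\cos(t^\top Y_{n,j}),\quad M_n(t)=\frac1n\sum_{j=1}^n\exp(t^\top Y_{n,j}),\quad U_n(t)=\sqrt n\,(R_n(t)M_n(t)-1),\quad t\in\mathbb{R}^d.$$ The weight function is $w_\gamma(t)=\exp(-\gamma\|t\|^2)$, and $\mathrm{L}^2(\mathbb{R}^d,\mathcal{B}^d,w_\gamma(t)\,dt)$ is the separable Hilbert space of (equivalence classes of) measurable functions $f:\mathbb{R}^d\to\mathbb{R}$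 square integrable with respect to $w_\gamma(t)\,dt$, with inner product $\langle f,g\rangle=\int_{\mathbb{R}^d}f(t)g(t)w_\gamma(t)\,dt$. That a centered Gaussian element $W$ of $\mathrm{L}^2$ has covariance kernel $C$ means $\mathbb{E}[\langle W,f\rangle\langle W,g\rangle]=\iint C(s,t)f(s)g(t)w_\gamma(s)w_\gamma(t)\,ds\,dt$ for all $f,g\in\mathrm{L}^2$. *)

(* Defs.v *)
From HB Require Import structures.
From mathcomp Require Import all_boot all_order all_algebra.
From mathcomp Require Import all_classical all_reals all_analysis.
From mathcomp Require Import measurable_realfun.

Set Implicit Arguments.
Unset Strict Implicit.
Unset Printing Implicit Defensive.

Import Order.TTheory GRing.Theory Num.Theory.
Import numFieldNormedType.Exports.

Local Open Scope classical_set_scope.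
Local Open Scope ring_scope.

Section power_measure.
Context {dT : measure_display} {T : measurableType dT} {R : realType}.

Definition cons_tuple n (p : T * n.-tuple T) : n.+1.-tuple T :=
  [tuple of p.1 :: p.2].

Lemma measurable_cons_tuple n :
  measurable_fun [set: T * n.-tuple T] (@cons_tuple n).
Proof. exact: measurable_cons. Qed.

Section step.
Variables (mu : {sigma_finite_measure set T -> \bar R}) (n : nat).
Variable nu : {sigma_finite_measure set (n.-tuple T) -> \bar R}.

Definition cons_measure : set (n.+1.-tuple T) -> \bar R :=
  pushforward (mu \x nu)%E (@cons_tuple n).

Let cons_measure0 : cons_measure set0 = 0%E.
Proof. by rewrite /cons_measure /pushforward preimage_set0 measure0. Qed.

Let mpre A : measurable A -> measurable (@cons_tuple n @^-1` A).
Proof.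
by move=> mA; rewrite -[X in measurable X]setTI; exact: measurable_cons_tuple.
Qed.

Let cons_measure_ge0 A : (0 <= cons_measure A)%E.
Proof. by rewrite /cons_measure /pushforward measure_ge0. Qed.

Let cons_measure_sigma_additive : semi_sigma_additive cons_measure.
Proof.
move=> F mF tF mUF; rewrite /cons_measure /pushforward preimage_bigcup.
apply: measure_semi_sigma_additive.
- by move=> i; exact: mpre.
- apply/trivIsetP => /= i j _ _ ij; rewrite -preimage_setI.
  by move/trivIsetP : tF => /(_ _ _ _ _ ij) ->//; rewrite preimage_set0.
- by rewrite -preimage_bigcup; exact: mpre.
Qed.

HB.instance Definition _ := isMeasure.Build _ _ _ cons_measure
  cons_measure0 cons_measure_ge0 cons_measure_sigma_additive.

Let cons_measure_sigma_finite : sigma_finite [set: n.+1.-tuple T] cons_measure.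
Proof.
have /sigma_finiteP[F [TF ndF Foo]] := sigma_finiteT mu.
have /sigma_finiteP[G [TG ndG Goo]] := sigma_finiteT nu.
pose g (t : n.+1.-tuple T) : T * n.-tuple T := (thead t, [tuple of behead t]).
have Kg : cancel (@cons_tuple n) g.
  by move=> [x t]; rewrite /g /cons_tuple /=; congr pair; exact/val_inj.
have mg : measurable_fun [set: n.+1.-tuple T] g.
  apply/measurable_fun_pairP; split => /=.
  - exact: (@measurable_tnth _ T n.+1 ord0).
  - exact: measurable_behead.
exists (fun i => g @^-1` (F i `*` G i)).
  rewrite -preimage_bigcup -(preimage_setT g); congr (_ @^-1` _).
  rewrite -setXTT TF TG predeqE => -[x y]; split.
    move=> [/= [k _ Fkx] [l _ Gly]]; exists (maxn k l) => //; split.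
    - by move: x Fkx; exact/subsetPset/ndF/leq_maxl.
    - by move: y Gly; exact/subsetPset/ndG/leq_maxr.
  by move=> [k _ []/= ? ?]; split; exists k.
move=> k; have [? ?] := Foo k; have [? ?] := Goo k; split.
  by rewrite -[X in measurable X]setTI; apply: mg => //; exact: measurableX.
rewrite /cons_measure /pushforward -comp_preimage.
rewrite (_ : g \o _ = id); last by apply/funext => x /=; rewrite Kg.
by rewrite preimage_id product_measure1E// lte_mul_pinfty// ge0_fin_numE.
Qed.

HB.instance Definition _ := Measure_isSigmaFinite.Build _ _ _ cons_measure
  cons_measure_sigma_finite.

End step.

(* n-fold product of mu with itself *)
Fixpoint power_measure (mu : {sigma_finite_measure set T -> \bar R}) (n : nat) :
    {sigma_finite_measure set (n.-tuple T) -> \bar R} :=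
  match n with
  | 0 => dirac [tuple]
  | m.+1 => cons_measure mu (power_measure mu m)
  end.

End power_measure.


Section gaussian_weight.
Context {R : realType}.

Definition vec d : Type := d.-tuple (measurableTypeR R).
HB.instance Definition _ d := Measurable.on (vec d).

Definition colvec d (x : vec d) : 'cV[R]_d := \col_i tnth x i.

Definition dotv d (u v : 'cV[R]_d) : R := (u^T *m v) 0 0.

Definition lebesgue d : {sigma_finite_measure set (vec d) -> \bar R} :=
  power_measure (@lebesgue_measure R) d.

Definition weight d (gamma : R) (t : vec d) : R :=
  expR (- gamma * dotv (colvec t) (colvec t)).

Lemma measurable_weight d gamma : measurable_fun [set: vec d] (@weight d gamma).
Proof.
apply: measurableT_comp => //; apply: measurable_funM => //=.
rewrite /dotv; under eq_fun do rewrite mxE.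
apply: measurable_sum => i; under eq_fun do rewrite !mxE.
by apply: measurable_funM; exact: (@measurable_tnth _ (measurableTypeR R)).
Qed.

Section weighted_measure.
Variables (d : nat) (gamma : R).

(* the measure w_gamma(t) dt *)
Definition wlebesgue (A : set (vec d)) : \bar R :=
  (\int[lebesgue d]_(t in A) (weight gamma t)%:E)%E.

Let wlebesgue0 : wlebesgue set0 = 0%E.
Proof. exact: integral_set0. Qed.

Let wlebesgue_ge0 A : (0 <= wlebesgue A)%E.
Proof. by apply: integral_ge0 => t _; rewrite lee_fin expR_ge0. Qed.

Let wlebesgue_sigma_additive : semi_sigma_additive wlebesgue.
Proof.
move=> F mF tF mUF; rewrite /wlebesgue ge0_integral_bigcup//.
- apply: is_cvg_ereal_nneg_natsum_cond => n _ _.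
  by apply: integral_ge0 => t _; rewrite lee_fin expR_ge0.
- apply/measurable_funTS/measurable_EFinP; exact: measurable_weight.
- by move=> t _; rewrite lee_fin expR_ge0.
Qed.

HB.instance Definition _ := isMeasure.Build _ _ _ wlebesgue
  wlebesgue0 wlebesgue_ge0 wlebesgue_sigma_additive.

End weighted_measure.
End gaussian_weight.
Arguments vec : clear implicits.

Section L2_space.
Context {R : realType} (d : nat) (gamma : R).

Local Notation nu := (@wlebesgue R d gamma).

(* elements are classes of functions modulo equality nu-almost everywhere *)
Definition L2 : Type := LspaceType nu (lee1n 2).

(* a representative of the class *)
Definition L2fun (f : L2) : vec R d -> R := (f : {mfun_ nu, _ >-> _}).

Definition L2dist (f g : L2) : R :=
  fine 'N[nu]_2%:E[EFin \o (L2fun f \- L2fun g)%R].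

Definition L2inner (f g : L2) : R := \int[nu]_t (L2fun f t * L2fun g t).

HB.instance Definition _ := gen_eqMixin L2.
HB.instance Definition _ := gen_choiceMixin L2.

Let mL2fun (f : L2) : measurable_fun setT (L2fun f).
Proof.
exact: (@measurable_funPT _ _ (vec R d) (measurableTypeR R)
  (repr (LebesgueSpace.sort f))).
Qed.

Let mL2B (f g : L2) : measurable_fun setT (L2fun f \- L2fun g).
Proof. exact: measurable_funB. Qed.

Let L2fun_lty (f : L2) : ('N[nu]_2%:E[EFin \o L2fun f] < +oo)%E.
Proof. by case: f => f [[ff]]. Qed.

Let L2N (f g : L2) : ('N[nu]_2%:E[EFin \o (L2fun f \- L2fun g)%R] =
  'N[nu]_2%:E[EFin \o (L2fun g \- L2fun f)%R])%E.
Proof.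
rewrite -oppe_Lnorm; apply: eq_Lnorm => t /=.
by rewrite opprB.
Qed.

Let L2D (g f h : L2) : ('N[nu]_2%:E[EFin \o (L2fun f \- L2fun h)%R] <=
  'N[nu]_2%:E[EFin \o (L2fun f \- L2fun g)%R] +
  'N[nu]_2%:E[EFin \o (L2fun g \- L2fun h)%R])%E.
Proof.
rewrite (_ : L2fun f \- L2fun h =
    (L2fun f \- L2fun g) \+ (L2fun g \- L2fun h))%R; last first.
  by apply/funext => t /=; rewrite addrA subrK.
by apply: eminkowski => //; exact: lee1n.
Qed.

Let L2B_lty (f g : L2) : ('N[nu]_2%:E[EFin \o (L2fun f \- L2fun g)%R] < +oo)%E.
Proof.
have mNg : measurable_fun setT (\- L2fun g) by exact: measurableT_comp.
apply: (le_lt_trans (eminkowski nu (mL2fun f) mNg (lee1n 2))).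
apply: lte_add_pinfty; first exact: L2fun_lty.
rewrite (_ : EFin \o (\- L2fun g)%R = (\- (EFin \o L2fun g))%E)//.
by rewrite oppe_Lnorm; exact: L2fun_lty.
Qed.

Let L2B_fin (f g : L2) :
  ('N[nu]_2%:E[EFin \o (L2fun f \- L2fun g)%R])%E \is a fin_num.
Proof. by rewrite ge0_fin_numE ?L2B_lty// Lnorm_ge0. Qed.

Let L2distxx f : L2dist f f = 0.
Proof.
rewrite /L2dist (_ : L2fun f \- L2fun f = cst 0); last first.
  by apply/funext => t /=; rewrite subrr.
by rewrite Lnorm0// eqe.
Qed.

Let L2dist_positivity f g : L2dist f g = 0 -> f = g.
Proof.
move=> /eqP; rewrite -eqe fineK ?L2B_fin// => /eqP N0.
have m2 : (0%R < 2%:E :> \bar R)%E by rewrite lte_fin.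
have /measurable_EFinP mfg := mL2B f g.
have fg0 := Lnorm_eq0_eq0 mfg m2 N0.
have : (LebesgueSpace.sort f : {mfun_ nu, vec R d >-> measurableTypeR R}) =
    LebesgueSpace.sort g.
  apply/eqP; rewrite -[LebesgueSpace.sort f]reprK -[LebesgueSpace.sort g]reprK.
  rewrite eqmodE; apply/asboolP.
  apply: filterS fg0 => t /= /(_ I) [] /eqP; rewrite subr_eq0 => /eqP.
  by [].
case: f {mfg N0 fg0} => f [[f1]]; case: g => g [[g1]] /= fg.
by rewrite fg in f1 *; congr (LebesgueSpace.Pack (LebesgueSpace.Class _));
  congr isFinLebesgue.Axioms_; exact: Prop_irrelevance.
Qed.

Let L2dist_sym f g : L2dist f g = L2dist g f.
Proof. by rewrite /L2dist L2N. Qed.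

Let L2dist_triangle g f h : L2dist f h <= L2dist f g + L2dist g h.
Proof. by rewrite -lee_fin EFinD !fineK. Qed.

HB.instance Definition _ := isMetric.Build R L2
  L2distxx L2dist_positivity L2dist_sym L2dist_triangle.

End L2_space.

Section statistic.
Context {R : realType} (d : nat).

Definition posdefmx (S : 'M[R]_d) : Prop :=
  forall v : 'cV[R]_d, v != 0 -> 0 < dotv v (S *m v).

Definition is_inv_sqrtmx (S B : 'M[R]_d) : Prop :=
  [/\ S \in unitmx, B^T = B, posdefmx B & B *m B = invmx S].

(* the symmetric positive definite square root of S^-1, unique when it exists;
   0 when it does not, in particular when S is singular *)
Definition inv_sqrtmx (S : 'M[R]_d) : 'M[R]_d :=
  xget 0 [set B | is_inv_sqrtmx S B].

(* the sample X_1, ..., X_n is x 0, ..., x n.-1 *)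
Variables (n : nat) (x : nat -> vec R d).

Definition sample_mean : 'cV[R]_d := n%:R^-1 *: \sum_(j < n) colvec (x j).

Definition sample_cov : 'M[R]_d := n%:R^-1 *:
  \sum_(j < n) ((colvec (x j) - sample_mean) *m (colvec (x j) - sample_mean)^T).

Definition residual (j : nat) : 'cV[R]_d :=
  inv_sqrtmx sample_cov *m (colvec (x j) - sample_mean).

Definition Rstat (t : vec R d) : R :=
  n%:R^-1 * \sum_(j < n) cos (dotv (colvec t) (residual j)).

Definition Mstat (t : vec R d) : R :=
  n%:R^-1 * \sum_(j < n) expR (dotv (colvec t) (residual j)).

Definition Ustat (t : vec R d) : R :=
  Num.sqrt n%:R * (Rstat t * Mstat t - 1).

End statistic.

Definition covkernel {R : realType} (d : nat) (s t : vec R d) : R :=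
  let st := dotv (colvec s) (colvec t) in
  expR st + 2^-1 * (expR st + expR (- st)) + 2 * cos st - st - 4.

Section iid.
Context {R : realType} {dT : measure_display} {T : measurableType dT}.
Context {dE : measure_display} {E : measurableType dE}.
Variables (P : probability T R) (X : nat -> {RV P >-> E}).

Definition mutually_independent : Prop :=
  forall (s : seq nat) (A : nat -> set E), uniq s ->
    (forall i, measurable (A i)) ->
    P (\bigcap_(i in [set` s]) (X i @^-1` A i)) =
    (\prod_(i <- s) P (X i @^-1` A i))%E.

Definition identically_distributed : Prop :=
  forall i j (A : set E), measurable A ->
    distribution P (X i) A = distribution P (X j) A.

End iid.

Section normal_law.
Context {R : realType} (d : nat).

(* law of a vector of d independent N(0, 1) variables *)
Definition std_normal : {measure set (vec R d) -> \bar R} :=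
  power_measure (normal_prob 0 1) d.

Definition affine_map (m : 'cV[R]_d) (A : 'M[R]_d) (z : vec R d) : vec R d :=
  [tuple (m + A *m colvec z) i 0 | i < d].

(* some N_d(m, Sigma), Sigma = A A^T, with A invertible,
   i.e., with Sigma positive definite *)
Definition nondegenerate_normal (mu : set (vec R d) -> \bar R) : Prop :=
  exists (m : 'cV[R]_d) (A : 'M[R]_d), A \in unitmx /\
    forall B, measurable B -> mu B = pushforward std_normal (affine_map m A) B.

End normal_law.

(* N(m, s^2) on the line, where N(m, 0) is the point mass at m *)
Definition normal_law1 {R : realType} (m s : R) (A : set (measurableTypeR R)) :
    \bar R :=
  if s == 0 then \d_m A else normal_prob m s A.

Section random_elements.
Context {R : realType} (d : nat) (gamma : R).
Context {dT : measure_display} {T : measurableType dT}.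
Local Notation L2 := (@L2 R d gamma).

Definition random_element (V : T -> L2) : Prop :=
  forall B : set L2, <<s @open L2 >> B -> measurable (V @^-1` B).

Variables (P : probability T R) (W : T -> L2).

Definition gaussian_element : Prop :=
  random_element W /\
  forall f : L2, exists m s : R, forall A, measurable A ->
    P ((fun w => L2inner (W w) f) @^-1` A) = normal_law1 m s A.

Definition centered : Prop :=
  forall f : L2, ('E_P[fun w => L2inner (W w) f] = 0)%E.

Definition has_covariance_kernel (C : vec R d -> vec R d -> R) : Prop :=
  forall f g : L2,
    'E_P[fun w => (L2inner (W w) f * L2inner (W w) g)%R]%E =
    (\int[wlebesgue gamma]_s \int[wlebesgue gamma]_t
       (C s t * L2fun f s * L2fun g t))%:E.

End random_elements.

Definition cvg_in_distribution {R : realType} (d : nat) (gamma : R)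
    (dT dT' : measure_display) (T : measurableType dT) (T' : measurableType dT')
    (P : probability T R) (U : nat -> T -> L2 d gamma)
    (P' : probability T' R) (W : T' -> L2 d gamma) : Prop :=
  forall h : L2 d gamma -> R, continuous h ->
    (exists M : R, forall f, `|h f| <= M) ->
    ('E_P[h \o U n] @[n --> \oo] --> 'E_P'[h \o W])%E.

(* Main.v *)
(** Write X = m + A Z with Z standard normal.  The matrix S_n^(-1/2) A is close
    to the orthogonal matrix O = (A A^T)^(-1/2) A, so, by affine equivariance,
    U_n(t) is governed by u = O^T t and by the sample Z_1, ..., Z_n.  Replacing
    the empirical mean and covariance of Z by 0 and 1 changes U_n(t) by a
    vanishing multiple of exp(a |t|^2 / 2) with a < gamma, and leaves
    n^(-1/2) sum_j (e^(|u|^2/2) cos(u.Z_j) + e^(u.Z_j - |u|^2/2) - 2 - u.Z_j).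
    Both generating functions expand in the orthonormal Hermite polynomials
    H_k (k a multi-index): the sum is the series over k of
    b(|k|) c_k u^k / sqrt(k!), where c_k = n^(-1/2) sum_j H_k(Z_j) and
    b(l) = 1 + Re i^l - [l = 1] for l > 0.  The c_k are uncorrelated with unit
    variance, so the sum of c_k^2 / rho^|k| has bounded mean for every rho > 1;
    with 1 < rho < gamma this makes the tails of the series uniformly small in
    probability in L^2.  Each truncation depends on finitely many c_k, to which
    Lindeberg's replacement argument applies.  The limit is the series with
    independent N(0, 1) coefficients, and its covariance, the sum of
    b(|k|)^2 s^k t^k / k!, is C(s, t) because
    b(l)^2 = 1 + 2 Re i^l + (1 + (-1)^l) / 2 - [l = 1] - 4 [l = 0]. *)
From HB Require Import structures.
Require Import Defs.
From mathcomp Require Import all_boot all_order all_algebra.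
From mathcomp Require Import all_classical all_reals all_analysis.
From mathcomp Require Import measurable_realfun complex ring lra.
Set Implicit Arguments.
Unset Strict Implicit.
Unset Printing Implicit Defensive.
Import Order.TTheory GRing.Theory Num.Theory.
Import numFieldNormedType.Exports.
Local Open Scope classical_set_scope.
Local Open Scope ring_scope.

(** * Integrable real functions *)

(** The condition gamma > 1 leaves little room: [env rho] is square integrable for w_gamma when rho
    < gamma, while the limit already has standard deviations of order [env 1]. Every error is
    therefore kept below some [env (1 + k * e)] with e small, and two quantities of size [env 1]
    must never be multiplied crudely; this is the difficulty in [centered_statistic]. All estimates
    for the data are deterministic on the intersection of three events (bounded weighted sum of
    squared coefficients, small weighted tail, bounded average of exp(|y|^2 / (2 (1 + e)))), each
    controlled by Markov's inequality. The central limit theorem never differentiates a test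
    function: after Gaussian smoothing, a displacement of the argument is moved into the Gaussian
    density and the density is expanded. Functionals on L^2 are first taken bounded and Lipschitz;
    continuous ones are reached by inf-convolution. Measurability of U_n as an L^2-valued map comes
    from its continuity in the sample where the sample covariance is invertible; elsewhere U_n is
    0. *)

Section real_integral.
Context {R : realType} {dT : measure_display} {T : measurableType dT}.
Variable mu : {measure set T -> \bar R}.
Implicit Types f g : T -> R.

Definition L1 f := mu.-integrable setT (EFin \o f).

Lemma L1_meas f : L1 f -> measurable_fun setT f.
Proof. by move=> /integrableP[/measurable_EFinP]. Qed.

Lemma L1P f : measurable_fun setT f -> (\int[mu]_x `|f x|%:E < +oo)%E -> L1 f.
Proof. by move=> mf h; apply/integrableP; split => //; exact/measurable_EFinP. Qed.

Lemma L1_lty f : L1 f -> (\int[mu]_x `|f x|%:E < +oo)%E.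
Proof. by move=> /integrableP[]. Qed.

Lemma L1_le f g : measurable_fun setT f -> (forall x, `|f x| <= g x) -> L1 g -> L1 f.
Proof.
move=> mf fg; apply: le_integrable => //; first exact/measurable_EFinP.
by move=> x _ /=; rewrite lee_fin (le_trans (fg x))// ler_norm.
Qed.

Lemma L1D f g : L1 f -> L1 g -> L1 (fun x => f x + g x).
Proof.
move=> lf lg; rewrite /L1 (_ : EFin \o _ = ((EFin \o f) \+ (EFin \o g))%E)//.
exact: integrableD.
Qed.

Lemma L1Z k f : L1 f -> L1 (fun x => k * f x).
Proof.
move=> lf; rewrite /L1 (_ : EFin \o _ = (fun x => k%:E * (EFin \o f) x)%E)//.
exact: integrableZl.
Qed.

Lemma L1N f : L1 f -> L1 (fun x => - f x).
Proof. by move=> /(@L1Z (-1)); rewrite /L1; under eq_fun do rewrite /= mulN1r. Qed.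

Lemma L1B f g : L1 f -> L1 g -> L1 (fun x => f x - g x).
Proof. by move=> lf lg; exact: L1D lf (L1N lg). Qed.

Lemma L1_abs f : L1 f -> L1 (fun x => `|f x|).
Proof.
move=> lf; apply: (L1P); first by apply: measurableT_comp => //; exact: L1_meas.
by under eq_integral do rewrite normr_id; exact: L1_lty.
Qed.

Lemma L1_0 : L1 (fun=> 0).
Proof. exact: integrable0. Qed.

Lemma L1_sum (I : Type) (s : seq I) (p : pred I) (F : I -> T -> R) :
  (forall i, p i -> L1 (F i)) -> L1 (fun x => \sum_(i <- s | p i) F i x).
Proof.
move=> lF; elim: s => [|i s IH].
  by rewrite (_ : (fun _ => _) = fun=> 0); [exact: L1_0|apply/funext => x; rewrite big_nil].
rewrite (_ : (fun _ => _) = fun x => if p i then F i x + \sum_(j <- s | p j) F j x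
  else \sum_(j <- s | p j) F j x); last by apply/funext => x; rewrite big_cons.
by case pi : (p i) => //; apply: L1D => //; exact: lF.
Qed.

Lemma L1_bounded M f : (mu setT < +oo)%E -> measurable_fun setT f ->
  (forall x, `|f x| <= M) -> L1 f.
Proof.
move=> mufin mf fM; apply: measurable_bounded_integrable => //.
exists M; split; first exact: num_real.
by move=> x Mx y _ /=; apply: (le_trans (fM y)); exact: ltW.
Qed.

Lemma L1_cst c : (mu setT < +oo)%E -> L1 (fun=> c).
Proof. by move=> mufin; apply: (@L1_bounded `|c|) => //. Qed.

Lemma RintE f : L1 f -> (\int[mu]_x f x)%:E = (\int[mu]_x (f x)%:E)%E.
Proof. by move=> lf; rewrite /Rintegral fineK//; exact: integrable_fin_num. Qed.

Lemma RintD f g : L1 f -> L1 g ->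
  \int[mu]_x (f x + g x) = \int[mu]_x f x + \int[mu]_x g x.
Proof. by move=> lf lg; rewrite RintegralD. Qed.

Lemma RintB f g : L1 f -> L1 g ->
  \int[mu]_x (f x - g x) = \int[mu]_x f x - \int[mu]_x g x.
Proof. by move=> lf lg; rewrite RintegralB. Qed.

Lemma RintZ k f : L1 f -> \int[mu]_x (k * f x) = k * \int[mu]_x f x.
Proof. by move=> lf; rewrite RintegralZl. Qed.

Lemma Rint0 : \int[mu]_x (0 : R) = 0.
Proof. by rewrite /Rintegral integral0. Qed.

Lemma Rint_sum (I : Type) (s : seq I) (p : pred I) (F : I -> T -> R) :
  (forall i, p i -> L1 (F i)) ->
  \int[mu]_x (\sum_(i <- s | p i) F i x) = \sum_(i <- s | p i) \int[mu]_x F i x.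
Proof.
move=> lF; elim: s => [|i s IH].
  by rewrite big_nil; under eq_Rintegral do rewrite big_nil; exact: Rint0.
rewrite big_cons; under eq_Rintegral do rewrite big_cons.
case: ifPn => // pi; rewrite RintD ?IH//; first exact: lF.
exact: L1_sum.
Qed.

Lemma Rint_le f g : L1 f -> L1 g -> (forall x, f x <= g x) ->
  \int[mu]_x f x <= \int[mu]_x g x.
Proof. by move=> lf lg fg; apply: le_Rintegral. Qed.

Lemma Rint_abs f : L1 f -> `|\int[mu]_x f x| <= \int[mu]_x `|f x|.
Proof. by move=> lf; apply: le_normr_Rintegral. Qed.

Lemma Rint_ge0 f : (forall x, 0 <= f x) -> 0 <= \int[mu]_x f x.
Proof. by move=> f0; apply: Rintegral_ge0. Qed.

Lemma L1_sqrM f g : measurable_fun setT f -> measurable_fun setT g ->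
  L1 (fun x => f x ^+ 2) -> L1 (fun x => g x ^+ 2) -> L1 (fun x => f x * g x).
Proof.
move=> mf mg lf lg; apply: (@L1_le _ (fun x => f x ^+ 2 + g x ^+ 2)).
- exact: measurable_funM.
- by move=> x; rewrite ler_norml; apply/andP; split; nra.
- exact: L1D.
Qed.

Lemma Rint_CS f g : measurable_fun setT f -> measurable_fun setT g ->
  L1 (fun x => f x ^+ 2) -> L1 (fun x => g x ^+ 2) ->
  (\int[mu]_x (f x * g x)) ^+ 2 <=
  (\int[mu]_x (f x ^+ 2)) * (\int[mu]_x (g x ^+ 2)).
Proof.
move=> mf mg lf lg; have lfg := L1_sqrM mf mg lf lg.
set a := \int[mu]_x (f x ^+ 2); set b := \int[mu]_x (f x * g x).
set c := \int[mu]_x (g x ^+ 2).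
have a0 : 0 <= a by apply: Rint_ge0 => x; exact: sqr_ge0.
have c0 : 0 <= c by apply: Rint_ge0 => x; exact: sqr_ge0.
have key s : 0 <= a + s * b *+ 2 + s ^+ 2 * c.
  have -> : a + s * b *+ 2 + s ^+ 2 * c = \int[mu]_x ((f x + s * g x) ^+ 2).
    have -> : (fun x => (f x + s * g x) ^+ 2) =
       (fun x => f x ^+ 2 + ((2 * s) * (f x * g x) + s ^+ 2 * g x ^+ 2)).
      by apply/funext => x; ring.
    rewrite RintD//; last by apply: L1D; exact: L1Z.
    rewrite RintD ?RintZ//; [|exact: L1Z..].
    rewrite -/a -/b -/c; ring.
  by apply: Rint_ge0 => x; exact: sqr_ge0.
have [c00|cn0] := eqVneq c 0.
  have [->|b0] := eqVneq b 0; first by rewrite expr0n /= mulr_ge0.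
  (* With c = 0 the form is affine in s, and this s gives it the value -1. *)
  have := key (- (a + 1) / (2 * b)).
  rewrite c00 mulr0 addr0 -mulr_natr.
  rewrite (_ : a + - (a + 1) / (2 * b) * b * 2 = -1); last by field.
  by rewrite lerNr oppr0 => /le_lt_trans /(_ ltr01); rewrite ltxx.
have cp : 0 < c by rewrite lt_neqAle eq_sym cn0.
have := key (- b / c).
rewrite (_ : _ + _ + _ = (a * c - b ^+ 2) / c); last by field.
by rewrite pmulr_lge0 ?invr_gt0// subr_ge0.
Qed.

Lemma DCT (f_ : nat -> T -> R) f g : (forall n, measurable_fun setT (f_ n)) ->
  measurable_fun setT f -> (forall x, f_ ^~ x @ \oo --> f x) -> L1 g ->
  (forall n x, `|f_ n x| <= g x) ->
  L1 f /\ ((\int[mu]_x f_ n x) @[n --> \oo] --> \int[mu]_x f x).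
Proof.
move=> mf_ mf ff lg fg.
have lf_ n : L1 (f_ n) by exact: L1_le (fg n) lg.
have [lf _ h] : [/\ mu.-integrable setT (EFin \o f),
  [sequence \int[mu]_(x in setT) `|(f_ n x)%:E - (f x)%:E|]_n @ \oo --> 0 &
  [sequence \int[mu]_(x in setT) (f_ n x)%:E]_n @ \oo -->
    \int[mu]_(x in setT) (f x)%:E]%E.
  apply: (@dominated_convergence _ _ _ mu setT measurableT
    (fun n x => (f_ n x)%:E) (EFin \o f) (EFin \o g)) => //.
  - by move=> n; apply/measurable_EFinP.
  - exact/measurable_EFinP.
  - by apply: aeW => x _; apply: cvg_EFin; [exact: nearW|exact: ff].
  - by apply: aeW => x n _; rewrite /= lee_fin.
split => //; rewrite /Rintegral; apply: fine_cvg.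
by rewrite fineK ?integrable_fin_num.
Qed.

End real_integral.

(** * Change of variables and densities *)

Section transfer.
Context {R : realType} {d1 d2 : measure_display}.
Context {T1 : measurableType d1} {T2 : measurableType d2}.
Variables (mu : {measure set T1 -> \bar R}) (nu : {measure set T2 -> \bar R}).
Variable phi : T1 -> T2.
Hypothesis mphi : measurable_fun setT phi.
Hypothesis nuE : forall A, measurable A -> nu A = mu (phi @^-1` A).

Lemma ge0_integral_law (f : T2 -> \bar R) : measurable_fun setT f ->
  (forall y, 0 <= f y)%E -> (\int[nu]_y f y = \int[mu]_x f (phi x))%E.
Proof.
move=> mf f0; rewrite (eq_measure_integral (pushforward mu phi)).
  by rewrite ge0_integral_pushforward// preimage_setT.
by move=> A mA _; exact: nuE.
Qed.

Lemma L1_law (f : T2 -> R) : measurable_fun setT f ->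
  L1 nu f <-> L1 mu (f \o phi).
Proof.
move=> mf; have mfp : measurable_fun setT (f \o phi) by exact: measurableT_comp.
have e : (\int[nu]_y `|f y|%:E = \int[mu]_x `|f (phi x)|%:E)%E.
  apply: (ge0_integral_law (f := fun y => `|f y|%:E)) => [|y]; last by rewrite lee_fin.
  by apply/measurable_EFinP; exact: measurableT_comp.
by split=> /L1_lty h; apply: L1P => //=; [rewrite -e|rewrite e].
Qed.

Lemma Rint_law (f : T2 -> R) : L1 nu f -> \int[nu]_y f y = \int[mu]_x f (phi x).
Proof.
move=> lf; rewrite /Rintegral; congr fine.
have mf := L1_meas lf.
rewrite integralE [RHS]integralE; congr (_ - _)%E.
  rewrite (ge0_integral_law (f := (EFin \o f)^\+%E))//.
    by apply: eq_integral => x _; rewrite !funeposE.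
  by apply: measurable_funepos; exact/measurable_EFinP.
rewrite (ge0_integral_law (f := (EFin \o f)^\-%E))//.
  by apply: eq_integral => x _; rewrite !funenegE.
by apply: measurable_funeneg; exact/measurable_EFinP.
Qed.

End transfer.

Section density.
Context {R : realType} {d1 : measure_display} {T : measurableType d1}.
Variables (mu nu : {measure set T -> \bar R}) (g : T -> R).
Hypothesis mg : measurable_fun setT g.
Hypothesis g0 : forall x, 0 <= g x.
Hypothesis nuE : forall A, measurable A -> nu A = (\int[mu]_(x in A) (g x)%:E)%E.
Import HBNNSimple.

(** By monotone convergence both sides are limits along the simple functions increasing to f; for a
    simple function the claim is [nuE] on its level sets. *)
Lemma ge0_integral_density (f : T -> \bar R) : measurable_fun setT f ->
  (forall y, 0 <= f y)%E -> (\int[nu]_y f y = \int[mu]_x (f x * (g x)%:E))%E.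
Proof.
move=> mf f0; pose f_ := nnsfun_approx measurableT mf.
have mgE : measurable_fun setT (EFin \o g) by exact/measurable_EFinP.
have g0' x : (0 <= (g x)%:E)%E by rewrite lee_fin.
have -> : (\int[nu]_y f y = limn (fun n => \int[nu]_y (f_ n y)%:E))%E.
  rewrite -monotone_convergence//.
  - apply: eq_integral => x _; apply/esym/cvg_lim => //.
    exact: cvg_nnsfun_approx.
  - by move=> n; exact/measurable_EFinP.
  - by move=> n x _; rewrite lee_fin.
  - by move=> x _ a b ab; rewrite lee_fin; exact/lefP/nd_nnsfun_approx.
have -> : (\int[mu]_x (f x * (g x)%:E) =
    limn (fun n => \int[mu]_x ((f_ n x)%:E * (g x)%:E)))%E.
  rewrite -monotone_convergence//.
  - apply: eq_integral => x _; apply/esym/cvg_lim => //.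
    by apply: cvgeZr => //; exact: cvg_nnsfun_approx.
  - by move=> n; apply: emeasurable_funM => //; exact/measurable_EFinP.
  - by move=> n x _; rewrite mule_ge0// lee_fin.
  - move=> x _ a b ab; rewrite lee_wpmul2r// lee_fin.
    exact/lefP/nd_nnsfun_approx.
congr (limn _); apply/funext => n.
transitivity (\sum_(y \in range (f_ n)) y%:E * nu (f_ n @^-1` [set y]))%E.
  by rewrite integralT_nnsfun sintegralE.
transitivity (\int[mu]_x (\sum_(y \in range (f_ n))
     (y%:E * ((g x)%:E * (\1_(f_ n @^-1` [set y]) x)%:E))))%E; last first.
  apply: eq_integral => x _; rewrite [in RHS](fimfunE (f_ n) x).
  rewrite -fsumEFin// ge0_mule_fsuml//; last first.
    by move=> y; rewrite EFinM; exact: nnfun_muleindic_ge0.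
  by apply: eq_fsbigr => y _; rewrite EFinM -muleA [X in (_ * X)%E]muleC.
rewrite ge0_integral_fsum//; last 2 first.
  - move=> y; apply: emeasurable_funM => //; apply: emeasurable_funM => //.
    by apply/measurable_EFinP; exact: measurable_indic.
  - move=> y x _; have [xy|xy] := boolP (x \in f_ n @^-1` [set y]).
      rewrite inE /= in xy; rewrite -xy mule_ge0 ?lee_fin//.
      by rewrite mulr_ge0.
    by rewrite indicE (negbTE xy) mule0 mule0.
apply: eq_fsbigr => y; rewrite inE => -[x _ xy].
have y0 : 0 <= y by rewrite -xy.
rewrite ge0_integralZl//; last 2 first.
  - by apply: emeasurable_funM => //; apply/measurable_EFinP; exact: measurable_indic.
  - by move=> z _; rewrite mule_ge0// lee_fin.
congr (_ * _)%E; rewrite nuE// integral_mkcond; apply: eq_integral => z _.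
by rewrite epatch_indic.
Qed.

Lemma L1_density (f : T -> R) : measurable_fun setT f ->
  L1 nu f <-> L1 mu (fun x => f x * g x).
Proof.
move=> mf; have mfp : measurable_fun setT (fun x => f x * g x).
  exact: measurable_funM.
have e : (\int[nu]_y `|f y|%:E = \int[mu]_x `|f x * g x|%:E)%E.
  rewrite (ge0_integral_density (f := fun y => `|f y|%:E)) => [||y];
    [|by apply/measurable_EFinP; exact: measurableT_comp|by rewrite lee_fin].
  by apply: eq_integral => x _; rewrite normrM (ger0_norm (g0 x)).
by split=> /L1_lty h; apply: L1P => //=; [rewrite -e|rewrite e].
Qed.

End density.

(** * Product measures and joint laws *)

Section power_integral.
Context {R : realType} {dT : measure_display} {T : measurableType dT}.
Variable mu : {sigma_finite_measure set T -> \bar R}.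

Lemma ge0_integral_powerS n (F : n.+1.-tuple T -> \bar R) :
  measurable_fun setT F -> (forall t, 0 <= F t)%E ->
  (\int[power_measure mu n.+1]_t F t =
   \int[mu]_x \int[power_measure mu n]_t F (Defs.cons_tuple (x, t)))%E.
Proof.
move=> mF F0.
rewrite (@ge0_integral_law _ _ _ _ _ (mu \x power_measure mu n)%E _
  (@Defs.cons_tuple _ T n))//; last exact: measurable_cons_tuple.
rewrite fubini_tonelli1//.
by apply: measurableT_comp => //; exact: measurable_cons_tuple.
Qed.

Lemma integral_power0 (F : 0.-tuple T -> \bar R) :
  measurable_fun setT F -> (\int[power_measure mu 0]_t F t = F [tuple])%E.
Proof. by move=> mF; rewrite integral_dirac// diracT mul1e. Qed.

Lemma power_measureT n : mu setT = 1%E -> power_measure mu n setT = 1%E.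
Proof.
move=> mu1; elim: n => [|n IH]; first by rewrite /= diracT.
rewrite /= /cons_measure /pushforward preimage_setT -setXTT.
transitivity (1 * 1 : \bar R)%E; last by rewrite mule1.
by rewrite product_measure1E//; congr (_ * _)%E.
Qed.

Lemma cons_tuple0 n (x : T) (t : n.-tuple T) : tnth (Defs.cons_tuple (x, t)) ord0 = x.
Proof. by []. Qed.

Lemma cons_tupleS n (x : T) (t : n.-tuple T) i :
  tnth (Defs.cons_tuple (x, t)) (lift ord0 i) = tnth t i.
Proof. by rewrite /Defs.cons_tuple tnthS. Qed.

(** Induction peels off the first coordinate: Tonelli for the absolute values gives integrability on
    the product space, after which Fubini factors the integral. *)
Lemma L1_power_prod n (f : 'I_n -> T -> R) : mu setT = 1%E ->
  (forall i, L1 mu (f i)) ->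
  L1 (power_measure mu n) (fun t => \prod_(i < n) f i (tnth t i)) /\
  \int[power_measure mu n]_t (\prod_(i < n) f i (tnth t i)) =
    \prod_(i < n) \int[mu]_x f i x.
Proof.
move=> mu1; elim: n f => [|n IH] f lf.
  have e : (fun t : 0.-tuple T => \prod_(i < 0) f i (tnth t i)) = fun=> 1.
    by apply/funext => t; rewrite big_ord0.
  rewrite e big_ord0; split; first by apply: L1_cst; rewrite /= diracT ltry.
  have d1 : power_measure mu 0 setT = 1%E by rewrite /= diracT.
  by rewrite /Rintegral integral_cst// mul1e; exact: (congr1 fine d1).
set nu := power_measure mu n.
have [lg ig] := IH _ (fun i => lf (lift ord0 i)).
set g : n.-tuple T -> R := fun t => \prod_(i < n) f (lift ord0 i) (tnth t i) in lg ig.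
have mF : measurable_fun setT
    (fun t : n.+1.-tuple T => \prod_(i < n.+1) f i (tnth t i)).
  apply: measurable_prod => i _; apply: measurableT_comp; last exact: measurable_tnth.
  exact: L1_meas (lf i).
have consE z : \prod_(i < n.+1) f i (tnth (Defs.cons_tuple z) i) = f ord0 z.1 * g z.2.
  case: z => x t; rewrite big_ord_recl cons_tuple0; congr (_ * _).
  by apply: eq_bigr => i _; rewrite cons_tupleS.
have mphi := @measurable_cons_tuple _ T n.
have lfg : (mu \x nu)%E.-integrable setT (fun z => (f ord0 z.1 * g z.2)%:E)%E.
  apply/integrable12ltyP.
    apply/measurable_EFinP; apply: measurable_funM => /=.
      by apply: (measurableT_comp (L1_meas (lf ord0))).
    by apply: (measurableT_comp (L1_meas lg)).
  have mag : measurable_fun setT (fun t => `|g t|%:E).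
    by apply/measurable_EFinP; apply: measurableT_comp => //; exact: L1_meas lg.
  have maf : measurable_fun setT (fun x => `|f ord0 x|%:E).
    by apply/measurable_EFinP; apply: measurableT_comp => //; exact: L1_meas (lf ord0).
  have g0 : (0 <= \int[nu]_t `|g t|%:E)%E by apply: integral_ge0 => t _; rewrite lee_fin.
  rewrite (eq_integral (fun x => `|f ord0 x|%:E * \int[nu]_t `|g t|%:E)%E); last first.
    move=> x _; rewrite -ge0_integralZl//.
      by apply: eq_integral => t _; rewrite /= normrM EFinM.
  rewrite ge0_integralZr//; apply: lte_mul_pinfty.
  - by apply: integral_ge0 => t _; rewrite lee_fin.
  - rewrite ge0_fin_numE; first exact: L1_lty (lf ord0).
    by apply: integral_ge0 => t _; rewrite lee_fin.
  - exact: L1_lty lg.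
have l : L1 (power_measure mu n.+1) (fun t => \prod_(i < n.+1) f i (tnth t i)).
  apply/(@L1_law _ _ _ _ _ (mu \x nu)%E _ (@Defs.cons_tuple _ T n)) => //.
  by rewrite /L1 (_ : EFin \o _ = fun z => (f ord0 z.1 * g z.2)%:E)//;
    apply/funext => z /=; rewrite consE.
split=> //.
rewrite (@Rint_law _ _ _ _ _ (mu \x nu)%E _ (@Defs.cons_tuple _ T n))//.
rewrite big_ord_recl -ig /Rintegral.
transitivity (fine (\int[(mu \x nu)%E]_z (f ord0 z.1 * g z.2)%:E)%E).
  by congr fine; apply: eq_integral => z _; rewrite consE.
rewrite -integral12_prod_meas1//.
have -> : (fubini_F nu (fun z => (f ord0 z.1 * g z.2)%:E) =
    fun x => (\int[nu]_t g t)%:E * (f ord0 x)%:E)%E.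
  apply/funext => x; rewrite /fubini_F /=.
  under eq_integral do rewrite EFinM.
  by rewrite integralZl// -RintE// muleC.
rewrite integralZl//; last exact: lf.
by rewrite -RintE// -EFinM/= mulrC.
Qed.

End power_integral.

Lemma pushforward_measure_ex {R : realType} {d1 d2 : measure_display}
    (T1 : measurableType d1) (T2 : measurableType d2)
    (m : {measure set T1 -> \bar R}) (f : T1 -> T2) : measurable_fun setT f ->
  exists m' : {measure set T2 -> \bar R}, forall A, m' A = m (f @^-1` A).
Proof.
move=> mf.
by exists (measure_function_pushforward__canonical__measure_function_Measure m mf).
Qed.

Lemma bigcap_seq_cons (U : Type) (a : nat) (r : seq nat) (B : nat -> set U) :
  \bigcap_(i in [set` a :: r]) B i = B a `&` \bigcap_(i in [set` r]) B i.
Proof.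
apply/seteqP; split => [w h|w [h1 h2] i /=].
  by split => [|i ir]; apply: h => /=; rewrite inE ?eqxx// ir orbT.
by rewrite inE => /orP[/eqP ->//|ir]; exact: h2.
Qed.

(** * Joint law of an independent sample *)

Section joint_law.
Context {R : realType} {dT dE : measure_display}.
Context {T : measurableType dT} {E : measurableType dE}.
Variables (P : probability T R) (X : nat -> {RV P >-> E}).
Variable mu : {sigma_finite_measure set E -> \bar R}.
Hypothesis mu1 : mu setT = 1%E.
Hypothesis X_indep : mutually_independent X.
Hypothesis X_law : forall i A, measurable A -> P (X i @^-1` A) = mu A.

Definition sample (s : seq nat) (w : T) : (size s).-tuple E :=
  map_tuple (fun i => X i w) (in_tuple s).

Lemma measurable_RV i : measurable_fun setT (X i : T -> E).
Proof. exact: measurable_funPT. Qed.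

Lemma measurable_RV_pre i A : measurable A -> measurable (X i @^-1` A).
Proof. by move=> mA; rewrite -[X in measurable X]setTI; exact: measurable_RV. Qed.

Lemma measurable_sample s : measurable_fun setT (sample s).
Proof.
apply/measurable_fun_tnthP => i; rewrite (_ : _ \o _ = X (tnth (in_tuple s) i)).
  exact: measurable_RV.
by apply/funext => w /=; rewrite /sample tnth_map.
Qed.

(** The independence hypothesis speaks of events X_i in A_i only, so the induction on s carries
    along such an event with indices r: the head of s moves from the sample into the event, and
    rectangles determine the measure. *)
Lemma independent_event_sample (s r : seq nat) (A : nat -> set E) :
  uniq (s ++ r) -> (forall i, measurable (A i)) -> forall B, measurable B ->
  P ((\bigcap_(i in [set` r]) (X i @^-1` A i)) `&` sample s @^-1` B) =
  (P (\bigcap_(i in [set` r]) (X i @^-1` A i)) * power_measure mu (size s) B)%E.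
Proof.
elim: s r A => [|s0 s IH] r A us mA B mB.
  rewrite /= diracE; case: (boolP ([tuple] \in B)) => [|/negP] h.
    rewrite mule1; congr (P _); apply/setIidPl => w _ /=.
    by rewrite (tuple0 (sample [::] w)); move: h; rewrite inE.
  rewrite mule0 (_ : _ `&` _ = set0) ?measure0//; apply/seteqP; split => // w [_ /=].
  by rewrite (tuple0 (sample [::] w)) => wB; apply: h; rewrite inE.
set Er := \bigcap_(i in [set` r]) (X i @^-1` A i).
have mEr : measurable Er.
  by apply: fin_bigcap_measurable => [|i _]; [exact: finite_seq|exact: measurable_RV_pre].
pose phi w : E * (size s).-tuple E := (X s0 w, sample s w).
have mphi : measurable_fun setT phi.
  apply/measurable_fun_pairP; split; first exact: measurable_RV.
  exact: measurable_sample.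
have mphi' (C : set (E * (size s).-tuple E)%type) : measurable C -> measurable (phi @^-1` C).
  by move=> mC; rewrite -[X in measurable X]setTI; exact: mphi.
pose nu := (mu \x power_measure mu (size s))%E.
have PErfin : P Er \is a fin_num by exact: fin_num_measure.
have PEr0 : 0 <= fine (P Er) by rewrite fine_ge0.
(* [m1] is the law of (X s0, sample s) on the event [Er], [m2] is P(Er) times the product measure;
   both are finite and agree on rectangles. *)
have [m1 m1E] := pushforward_measure_ex (mrestr P mEr) mphi.
pose m2 : {measure set (E * (size s).-tuple E) -> \bar R} :=
  mscale (NngNum PEr0) nu.
have m12 (C : set (E * (size s).-tuple E)%type) : measurable C -> m1 C = m2 C.
  pose G : set (set (E * (size s).-tuple E)) := [set C | exists A, measurable A /\
      exists B, measurable B /\ C = A `*` B].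
  apply: (measure_unique G (fun=> setT)).
  - rewrite measurable_prod_measurableType //; congr (<<s _ >>).
    rewrite predeqE; split => [[C1 mC1 [C2 mC2 <-]]|[C1 [mC1 [C2 [mC2 ->]]]]].
      by exists C1; split => //; exists C2.
    by exists C1 => //; exists C2.
  - move=> /= _ _ [X1 [mX1 [X2 [mX2 ->]]]] [Y1 [mY1 [Y2 [mY2 ->]]]].
    rewrite -setXI; exists (X1 `&` Y1); split; first exact: measurableI.
    by exists (X2 `&` Y2); split => //; exact: measurableI.
  - by move=> _; exists setT; split => //; exists setT; split => //; rewrite setXTT.
  - by rewrite bigcup_const.
  - move=> _ [A1 [mA1 [A2 [mA2 ->]]]].
    have -> : m2 (A1 `*` A2) = (P Er * (mu A1 * power_measure mu (size s) A2))%E.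
      rewrite /m2 /= /mscale /= fineK//; congr (_ * _)%E; exact: product_measure1E.
    rewrite m1E /mrestr.
    (* The condition on X s0 joins the event, which makes the induction hypothesis applicable to s
       with indices s0 :: r. *)
    pose A' i := if i == s0 then A1 else A i.
    have us' : uniq (s ++ s0 :: r).
      by move: us; rewrite -[s0 :: r]cat1s uniq_catCA.
    have mA' i : measurable (A' i) by rewrite /A'; case: ifP.
    have := IH (s0 :: r) A' us' mA' A2 mA2.
    have s0r : s0 \notin r.
      by move: us => /= /andP[+ _]; rewrite mem_cat negb_or => /andP[].
    have A'r i : i \in r -> A' i = A i.
      by rewrite /A' => ir; case: eqP => // ie; rewrite ie (negbTE s0r) in ir.
    have -> : \bigcap_(i in [set` s0 :: r]) (X i @^-1` A' i) = X s0 @^-1` A1 `&` Er.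
      rewrite bigcap_seq_cons /A' eqxx; congr (_ `&` _).
      by apply: eq_bigcapr => i ir; rewrite -/(A' i) A'r.
    move=> IH'; transitivity (P ((X s0 @^-1` A1 `&` Er) `&` sample s @^-1` A2)).
      congr (P _); rewrite /phi; apply/seteqP; split => w /=; tauto.
    rewrite IH' muleA; congr (_ * _)%E.
    have ur : uniq (s0 :: r) by move: us' ; rewrite cat_uniq => /and3P[].
    have := X_indep ur mA'; rewrite bigcap_seq_cons big_cons.
    have -> : \bigcap_(i in [set` r]) (X i @^-1` A' i) = Er.
      by apply: eq_bigcapr => i ir; rewrite A'r.
    rewrite {1 2}/A' eqxx => ->; rewrite X_law// muleC; congr (_ * _)%E.
    have := X_indep (A := A) (s := r); rewrite -/Er => ->//.
      by apply: eq_big_seq => i ir; rewrite A'r.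
    by move: ur => /= /andP[].
  - move=> k; rewrite m1E /mrestr.
    by rewrite (le_lt_trans (probability_le1 _ _))// ?ltry// preimage_setT setTI.
have -> : sample (s0 :: s) @^-1` B = phi @^-1` (@Defs.cons_tuple _ E (size s) @^-1` B).
  rewrite -comp_preimage; congr (_ @^-1` B); apply/funext => w /=.
  exact/val_inj.
have mB' : measurable (@Defs.cons_tuple _ E (size s) @^-1` B).
  by rewrite -[X in measurable X]setTI; exact: measurable_cons_tuple.
rewrite setIC; apply: (eq_trans (esym (m1E _))); rewrite m12//.
by rewrite /m2 /= /mscale /= fineK.
Qed.

Lemma joint_law (s : seq nat) : uniq s -> forall B, measurable B ->
  power_measure mu (size s) B = P (sample s @^-1` B).
Proof.
move=> us B mB; have := @independent_event_sample s [::] (fun=> setT).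
rewrite cats0 => /(_ us (fun=> measurableT) _ mB).
rewrite (_ : \bigcap_(i in _) _ = setT); last by apply/seteqP; split.
by rewrite setTI probability_setT mul1e.
Qed.

End joint_law.

(** * Gaussian measure on the line and Hermite functions *)

Section gaussian1.
Context {R : realType}.
Notation leb := (@lebesgue_measure R).

(** The image of |a| times Lebesgue measure under x -> a x + b gives every half-open interval its
    length, hence is Lebesgue measure. *)
Lemma ge0_integral_affine (a b : R) (F : R -> \bar R) : a != 0 ->
  measurable_fun setT F -> (forall x, 0 <= F x)%E ->
  (\int[leb]_x F x = `|a|%:E * \int[leb]_x F (a * x + b)%R)%E.
Proof.
move=> a0 mF F0.
have na0 : 0 <= `|a| by [].
pose phi (x : measurableTypeR R) : measurableTypeR R := a * x + b.
have mphi : measurable_fun setT phi.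
  by apply: measurable_funD => //; exact: measurable_funM.
have [m mE] := pushforward_measure_ex (mscale (NngNum na0) leb) mphi.
have lebE A : measurable A -> leb A = m A.
  move: A; apply: lebesgue_measure_unique => _ [[u v] _ <-] /=.
  rewrite mE /= /mscale /=.
  have [ap|an] := ltP 0 a.
    rewrite (_ : phi @^-1` _ = [set` `](u - b) / a, (v - b) / a]]); last first.
      apply/seteqP; split=> x; rewrite /phi /= !in_itv /=;
        by rewrite ltr_pdivrMr// ler_pdivlMr// ltrBlDr lerBrDr mulrC.
    rewrite !lebesgue_measure_itv/= !lte_fin ltr_pM2r ?invr_gt0// ltrD2r.
    case: ifPn => uv; last by rewrite mule0.
    by rewrite -!EFinD -EFinM gtr0_norm//; congr EFin; field.
  (* A negative slope exchanges the open and the closed end of the interval. *)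
  have {an} an : a < 0 by rewrite lt_neqAle a0.
  rewrite (_ : phi @^-1` _ = [set` `[(v - b) / a, (u - b) / a[]); last first.
    apply/seteqP; split=> x; rewrite /phi /= !in_itv /=;
      by rewrite ler_ndivrMr// ltr_ndivlMr// ltrBlDr lerBrDr mulrC andbC.
  rewrite !lebesgue_measure_itv/= !lte_fin ltr_nM2r ?invr_lt0// ltrD2r.
  case: ifPn => uv; last by rewrite mule0.
  by rewrite -!EFinD -EFinM ltr0_norm//; congr EFin; field.
rewrite (@ge0_integral_law _ _ _ _ _ (mscale (NngNum na0) leb) leb phi mphi)//.
  by rewrite ge0_integral_mscale//; exact: measurableT_comp.
by move=> A mA; exact: (eq_trans (lebE A mA) (mE A)).
Qed.

Definition N01 : probability (measurableTypeR R) R := normal_prob 0 1.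

Definition phi01 (x : R) : R := normal_pdf 0 1 x.

Lemma phi01E x : phi01 x = normal_peak 1 * expR (- x ^+ 2 / 2).
Proof. by rewrite /phi01 /normal_pdf oner_eq0 /normal_fun subr0 expr1n. Qed.

Lemma phi01_ge0 x : 0 <= phi01 x.
Proof. exact: normal_pdf_ge0. Qed.

Lemma measurable_phi01 : measurable_fun setT phi01.
Proof. exact: measurable_normal_pdf. Qed.
Hint Resolve measurable_phi01 : core.

Lemma phi01_shift x u : phi01 (x - u) = phi01 x * expR (x * u - u ^+ 2 / 2).
Proof. by rewrite !phi01E -mulrA -expRD; congr (_ * expR _); field. Qed.

Lemma phi01N x : phi01 (- x) = phi01 x.
Proof. by rewrite !phi01E sqrrN. Qed.

Lemma ge0_integral_N01 (F : R -> \bar R) : measurable_fun setT F ->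
  (forall x, 0 <= F x)%E -> (\int[N01]_x F x = \int[leb]_x (F x * (phi01 x)%:E))%E.
Proof.
by move=> mF F0; apply: ge0_integral_density => // x; exact: phi01_ge0.
Qed.

Lemma N01T : N01 setT = 1%E.
Proof. exact: probability_setT. Qed.

Lemma N01_lty : (N01 setT < +oo)%E.
Proof. by rewrite N01T ltry. Qed.

Lemma integral_N01_cst (c : \bar R) : (\int[N01]_x c = c)%E.
Proof.
rewrite integral_cst//; transitivity (c * 1)%E; last by rewrite mule1.
by congr (_ * _)%E; exact: N01T.
Qed.

(** Translating the Gaussian density by u multiplies it by exp(x u - u^2 / 2): the Cameron-Martin
    formula on the line. *)
Lemma ge0_N01_shift (F : R -> \bar R) u : measurable_fun setT F ->
  (forall x, 0 <= F x)%E ->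
  (\int[N01]_x F (x + u)%R = \int[N01]_x (F x * (expR (x * u - u ^+ 2 / 2))%:E))%E.
Proof.
move=> mF F0.
have me : measurable_fun setT (fun x : R => expR (x * u - u ^+ 2 / 2)).
  apply: measurableT_comp => //; apply: measurable_funB => //.
  exact: measurable_funM.
have mFs : measurable_fun setT (fun x : R => F (x + u)).
  by apply: (measurableT_comp mF); exact: measurable_funD.
rewrite ge0_integral_N01// ge0_integral_N01//; last 2 first.
- by apply: emeasurable_funM => //; exact/measurable_EFinP.
- by move=> x; rewrite mule_ge0// lee_fin expR_ge0.
rewrite (@ge0_integral_affine 1 (- u)) ?oner_neq0//; last 2 first.
- by apply: emeasurable_funM => //; exact/measurable_EFinP.
- by move=> x; rewrite mule_ge0// lee_fin phi01_ge0.
rewrite normr1 mul1e; apply: eq_integral => x _.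
rewrite mul1r subrK phi01_shift EFinM -!muleA; congr (_ * _)%E.
by rewrite muleC.
Qed.

Lemma ge0_N01_opp (F : R -> \bar R) : measurable_fun setT F ->
  (forall x, 0 <= F x)%E -> (\int[N01]_x F (- x)%R = \int[N01]_x F x)%E.
Proof.
move=> mF F0.
have mFs : measurable_fun setT (fun x : R => F (- x)).
  by apply: (measurableT_comp mF).
rewrite ge0_integral_N01// ge0_integral_N01//.
rewrite (@ge0_integral_affine (- 1) 0) ?oppr_eq0 ?oner_neq0//; last 2 first.
- by apply: emeasurable_funM => //; exact/measurable_EFinP.
- by move=> x; rewrite mule_ge0// lee_fin phi01_ge0.
rewrite normrN1 mul1e; apply: eq_integral => x _.
by rewrite addr0 mulN1r opprK phi01N.
Qed.

(** A sum of independent centred normals is normal with the variances added. The substitution u = s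
    x + t y, Tonelli, the rescaling u = r z and completion of the square leave a normal density in x
    of total mass 1. *)
Lemma ge0_N01_conv (F : R -> \bar R) (s t : R) : measurable_fun setT F ->
  (forall x, 0 <= F x)%E ->
  (\int[N01]_x \int[N01]_y F (s * x + t * y)%R =
   \int[N01]_x F (Num.sqrt (s ^+ 2 + t ^+ 2) * x)%R)%E.
Proof.
move=> mF F0; have [->|t0] := eqVneq t 0.
  under eq_integral => x _.
    under eq_integral do rewrite mul0r addr0.
    rewrite integral_N01_cst.
    over.
  rewrite expr0n addr0 sqrtr_sqr.
  have [s0|s0] := ger0P s; first by [].
  rewrite -[RHS]ge0_N01_opp//; last first.
    by apply: (measurableT_comp mF); exact: measurable_funM.
  by apply: eq_integral => x _; rewrite mulrNN.
set r := Num.sqrt _.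
have rt0 : 0 < s ^+ 2 + t ^+ 2 by rewrite ltr_wpDl ?sqr_ge0// exprn_even_gt0.
have r0 : 0 < r by rewrite sqrtr_gt0.
have r2 : r ^+ 2 = s ^+ 2 + t ^+ 2 by rewrite sqr_sqrtr// ltW.
have rn0 : r != 0 by rewrite gt_eqF.
have nt0 : `|t| != 0 by rewrite normr_eq0.
have mphiE : measurable_fun setT (EFin \o phi01) by exact/measurable_EFinP.
(* F u times the joint density of x and u = s x + t y. *)
pose k (x u : R) : \bar R := (F u * (phi01 ((u - s * x) / t) * phi01 x / `|t|)%:E)%E.
have mk : measurable_fun setT (fun z : measurableTypeR R * measurableTypeR R => k z.1 z.2).
  apply: emeasurable_funM; first exact: (measurableT_comp mF).
  apply/measurable_EFinP; apply: measurable_funM => //; apply: measurable_funM.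
    apply: (measurableT_comp measurable_phi01); apply: measurable_funM => //.
    by apply: measurable_funB => //; exact: measurable_funM.
  exact: (measurableT_comp measurable_phi01).
have mkx x : measurable_fun setT (k x).
  apply: emeasurable_funM => //.
  apply/measurable_EFinP; apply: measurable_funM => //; apply: measurable_funM => //.
  by apply: (measurableT_comp measurable_phi01); apply: measurable_funM => //; exact: measurable_funB.
have k0 z : (0 <= k z.1 z.2)%E.
  by rewrite mule_ge0// lee_fin divr_ge0// mulr_ge0// phi01_ge0.
have inner x : ((\int[N01]_y F (s * x + t * y)%R) * (phi01 x)%:E = \int[leb]_u k x u)%E.
  have mFx : measurable_fun setT (fun y : R => F (s * x + t * y)).
    by apply: (measurableT_comp mF); apply: measurable_funD => //; exact: measurable_funM.
  rewrite ge0_integral_N01// (@ge0_integral_affine t (s * x) (k x))//; last first.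
    by move=> u; exact: (k0 (x, u)).
  rewrite -ge0_integralZr//; last 3 first.
  - by apply: emeasurable_funM.
  - by move=> y _; rewrite mule_ge0// lee_fin phi01_ge0.
  - by rewrite lee_fin phi01_ge0.
  rewrite -ge0_integralZl//; last 2 first.
  - apply: (measurableT_comp (mkx x)).
    by apply: measurable_funD => //; exact: measurable_funM.
  - by move=> y _; exact: (k0 (x, t * y + s * x)).
  apply: eq_integral => y _; rewrite /k addrK addrC.
  rewrite (_ : t * y / t = y); last by rewrite mulrC mulKf.
  rewrite [RHS]muleC -!muleA; congr (_ * _)%E; rewrite -!EFinM; congr EFin.
  by rewrite divfK.
have mint : measurable_fun setT (fun x : R => \int[N01]_y F (s * x + t * y)%R)%E.
  apply: (measurable_fun_fubini_tonelli_F
    (fun z : measurableTypeR R * measurableTypeR R => F (s * z.1 + t * z.2)%R)) => //.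
  apply: (measurableT_comp mF).
  by apply: measurable_funD; exact: measurable_funM.
rewrite ge0_integral_N01//; last by move=> x; exact: integral_ge0.
under eq_integral do rewrite inner.
transitivity (\int[leb]_u \int[leb]_x k x u)%E.
  exact: (@fubini_tonelli _ _ (measurableTypeR R) (measurableTypeR R) R
    leb leb (fun z => k z.1 z.2) mk k0).
have mG : measurable_fun setT (fun u : R => \int[leb]_x k x u)%E.
  exact: (@measurable_fun_fubini_tonelli_G _ _ (measurableTypeR R)
    (measurableTypeR R) R leb (fun z => k z.1 z.2) mk k0).
rewrite ge0_integral_N01//; last by apply: (measurableT_comp mF); exact: measurable_funM.
rewrite (@ge0_integral_affine r 0)//; last first.
  by move=> u; apply: integral_ge0 => x _; exact: (k0 (x, u)).
have mG' : measurable_fun setT (fun u : R => \int[leb]_x k x (r * u + 0)%R)%E.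
  apply: (measurableT_comp mG).
  by apply: measurable_funD => //; exact: measurable_funM.
have G0 u : setT u -> (0 <= \int[leb]_x k x (r * u + 0)%R)%E.
  by move=> _; apply: integral_ge0 => x _; exact: (k0 (x, r * u + 0)).
transitivity (\int[leb]_u (`|r|%:E * \int[leb]_x k x (r * u + 0)%R))%E.
  exact: (esym (@ge0_integralZl_EFin _ _ _ leb setT measurableT _ G0 mG' `|r| (normr_ge0 r))).
apply: eq_integral => z _; rewrite addr0 {1}/k.
pose c := (s * z / t).
(* Completing the square: for u = r z the joint density splits into the density of z and, up to
   scale, the conditional density of x. *)
have key x : phi01 ((r * z - s * x) / t) * phi01 x / `|t| =
    phi01 z * (phi01 (r / t * x - c) / `|t|).
  rewrite mulrA !phi01E; congr (_ / _).
  rewrite mulrACA [RHS]mulrACA -!expRD; congr (_ * expR _); rewrite /c.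
  rewrite (_ : forall x y a b : R, x / 2 + y / 2 = a / 2 + b / 2 <-> x + y = a + b); last first.
    by move=> ? ? ? ?; split; lra.
  have -> : - ((r * z - s * x) / t) ^+ 2 + - x ^+ 2 =
     - (r ^+ 2 * (z ^+ 2 + x ^+ 2) - (r * z * s * x) *+ 2 + (s ^+ 2 + t ^+ 2 - r ^+ 2) * x ^+ 2
        ) / t ^+ 2 by field.
  rewrite r2 subrr mul0r addr0.
  have -> : - z ^+ 2 + - (r / t * x - s * z / t) ^+ 2 =
     - (t ^+ 2 * z ^+ 2 + r ^+ 2 * x ^+ 2 - (r * z * s * x) *+ 2 + s ^+ 2 * z ^+ 2) / t ^+ 2 by field.
  by rewrite r2; field.
under eq_integral do rewrite key.
rewrite ge0_integralZl//; last 2 first.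
- apply/measurable_EFinP; apply: measurable_funM => //; apply: measurable_funM => //.
  by apply: (measurableT_comp measurable_phi01); apply: measurable_funB.
- by move=> x _; rewrite lee_fin mulr_ge0 ?phi01_ge0// divr_ge0// phi01_ge0.
have me : measurable_fun setT (fun x : R => phi01 (r / t * x - c)).
  by apply: (measurableT_comp measurable_phi01); apply: measurable_funB.
under eq_integral do rewrite EFinM.
rewrite ge0_integralZl_EFin//; last 3 first.
- by move=> x _; rewrite lee_fin divr_ge0// phi01_ge0.
- by apply/measurable_EFinP; exact: measurable_funM.
- exact: phi01_ge0.
rewrite muleCA; congr (_ * _)%E.
rewrite muleCA -[RHS]mule1; congr (_ * _)%E.
rewrite (_ : (fun x => (phi01 (r / t * x - c) / `|t|)%:E) =
  (fun x => `|t|^-1%:E * (phi01 (r / t * x - c))%:E)%E); last first.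
  by apply/funext => x; rewrite mulrC EFinM.
rewrite ge0_integralZl_EFin//; last 2 first.
- by move=> x _; rewrite lee_fin phi01_ge0.
- exact/measurable_EFinP.
rewrite muleA -EFinM.
have rt : `|r| / `|t| = `|r / t| by rewrite normrM normfV.
rewrite rt.
have h := @ge0_integral_affine (r / t) (- c) (EFin \o phi01).
rewrite -h/=.
- exact: integral_normal_pdf.
- by rewrite mulf_neq0 ?invr_eq0.
- exact/measurable_EFinP.
- by move=> x; rewrite lee_fin phi01_ge0.
Qed.

End gaussian1.
#[global] Hint Resolve measurable_phi01 : core.

(** * Elementary bounds for the exponential *)

Section exp_bounds.
Context {R : realType}.
Implicit Types a x : R.

Lemma expR_ge1 x : 0 <= x -> 1 <= expR x.
Proof. by rewrite -expR0 ler_expR. Qed.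

Lemma expR_sub1_le a : `|expR a - 1| <= `|a| * expR `|a|.
Proof.
have h x : expR x - 1 <= x * expR x.
  have h1 := expR_ge1Dx (- x); have e0 := expR_gt0 x.
  have em : expR x * expR (- x) = 1 by rewrite -expRD subrr expR0.
  nra.
have [a0|a0] := ger0P a.
  by rewrite ger0_norm ?subr_ge0 ?expR_ge1// h.
rewrite (@ler0_norm _ (expR a - 1)); last by rewrite subr_le0 expR_le1 ltW.
have := expR_ge1Dx a; have := @expR_ge1 (- a); rewrite oppr_ge0 => /(_ (ltW a0)).
nra.
Qed.

Lemma expR_sub2_le a : `|expR a - 1 - a| <= a ^+ 2 * expR `|a|.
Proof.
have h0 := expR_ge1Dx a; have h1 := expR_ge1Dx (- a).
have e0 := expR_gt0 a; have e0' := expR_gt0 (- a).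
have em : expR a * expR (- a) = 1 by rewrite -expRD subrr expR0.
rewrite ger0_norm; last lra.
have h2 : expR a - 1 <= a * expR a by nra.
have [a0|a0] := ger0P a.
  have : 1 <= expR a by exact: expR_ge1.
  nra.
have : 1 <= expR (- a) by apply: expR_ge1; rewrite oppr_ge0 ltW.
have h3 : expR a < 1 by rewrite expR_lt1.
nra.
Qed.

Lemma expR_norm_le x : expR `|x| <= expR x + expR (- x).
Proof.
by have [x0|x0] := ger0P x; rewrite ?lerDl ?lerDr expR_ge0.
Qed.

Lemma normX_le_expR x n : `|x| ^+ n <= expR (n%:R * `|x|).
Proof.
rewrite expRM_natl; apply: lerXn2r; rewrite ?nnegrE ?expR_ge0//.
by have := expR_ge1Dx `|x|; lra.
Qed.

End exp_bounds.

(** * Gaussian moments *)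

Section gaussian_moments.
Context {R : realType}.
Local Notation N01 := (@N01 R).

(** Shifting the constant function 1 shows that exp(x c - c^2 / 2) has integral 1; exp(c x) differs
    from it by a constant factor. *)
Lemma L1_N01_expR (c : R) : L1 N01 (fun x => expR (c * x)).
Proof.
have m1 : measurable_fun setT (fun x : R => expR (c * x)).
  by apply: measurableT_comp => //; exact: measurable_funM.
apply: L1P => //.
have := @ge0_N01_shift R (cst 1%E) c (@measurable_cst _ _ _ _ _ _) (fun=> lee01).
rewrite integral_N01_cst => h.
have h' : (\int[N01]_x (expR (x * c - c ^+ 2 / 2)%R)%:E = 1)%E.
  by rewrite h; apply: eq_integral => x _; rewrite mul1e.
have -> : (\int[N01]_x `|expR (c * x)|%:E =
    \int[N01]_x ((expR (c ^+ 2 / 2))%:E * (expR (x * c - c ^+ 2 / 2)%R)%:E))%E.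
  apply: eq_integral => x _; rewrite ger0_norm ?expR_ge0// -EFinM -expRD.
  by congr (EFin (expR _)); ring.
rewrite ge0_integralZl_EFin ?expR_ge0//.
- by rewrite h' mule1 ltry.
- apply/measurable_EFinP; apply: measurableT_comp => //; apply: measurable_funB => //.
  exact: measurable_funM.
Qed.

Lemma L1_N01_growth (f : R -> R) (K c : R) : measurable_fun setT f ->
  (forall x, `|f x| <= K * expR (c * `|x|)) -> L1 N01 f.
Proof.
move=> mf fK; apply: (@L1_le _ _ _ N01 f (fun x : R => `|K| * (expR (`|c| * x) + expR (- `|c| * x)))) => //.
- move=> x; apply: (le_trans (fK x)); rewrite (le_trans (ler_norm _))//.
  rewrite normrM ler_wpM2l// (ger0_norm (expR_ge0 _)).
  apply: (@le_trans _ _ (expR (Num.norm (`|c| * x)))).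
    by rewrite ler_expR normrM normr_id ler_wpM2r// ler_norm.
  by rewrite mulNr; exact: expR_norm_le.
- by apply/L1Z/L1D; exact: L1_N01_expR.
Qed.

Lemma measurable_monom n : measurable_fun setT (fun x : R => x ^+ n).
Proof. exact: measurable_funX. Qed.

Lemma L1_N01_monom n : L1 N01 (fun x => x ^+ n).
Proof.
apply: (@L1_N01_growth _ 1 n%:R); first exact: measurable_monom.
by move=> x; rewrite mul1r normrX normX_le_expR.
Qed.

Lemma Rint_N01_shift (f : R -> R) (u : R) : measurable_fun setT f ->
  L1 N01 (fun x => f (x + u)) -> L1 N01 (fun x => f x * expR (x * u - u ^+ 2 / 2)) ->
  \int[N01]_x f (x + u) = \int[N01]_x (f x * expR (x * u - u ^+ 2 / 2)).
Proof.
move=> mf l1 l2; rewrite /Rintegral; congr fine.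
have mfE : measurable_fun setT (EFin \o f) by exact/measurable_EFinP.
rewrite integralE [RHS]integralE; congr (_ - _)%E.
  transitivity (\int[N01]_x ((EFin \o f)^\+ (x + u)%R))%E.
    by apply: eq_integral => x _; rewrite !funeposE.
  rewrite (ge0_N01_shift (F := ((EFin \o f)^\+)%E))//; last exact: measurable_funepos.
  apply: eq_integral => x _; rewrite !funeposE EFinM muleC.
  by rewrite maxeMr ?lee_fin ?expR_ge0// mule0 [in RHS]muleC.
transitivity (\int[N01]_x ((EFin \o f)^\- (x + u)%R))%E.
  by apply: eq_integral => x _; rewrite !funenegE.
rewrite (ge0_N01_shift (F := ((EFin \o f)^\-)%E))//; last exact: measurable_funeneg.
apply: eq_integral => x _; rewrite !funenegE EFinM -mulNe muleC.
by rewrite maxeMr ?lee_fin ?expR_ge0// mule0 [in RHS]muleC.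
Qed.

(** The remainder is u^2 times a function of x that is integrable, as the comparison of first-order
    terms in [gauss_ibp] requires. *)
Lemma exprD_sub2_le (x u : R) n : `|u| <= 1 ->
  `|(x + u) ^+ n.+1 - x ^+ n.+1 - n.+1%:R * u * x ^+ n| <=
  n.+1%:R ^+ 2 * u ^+ 2 * (`|x| + 1) ^+ n.+1.
Proof.
move=> u1; elim: n => [|n IH].
  rewrite !expr1 expr0 (_ : _ - _ - _ = 0) ?normr0; last ring.
  by rewrite mulr_ge0 ?addr_ge0// mulr_ge0 ?sqr_ge0.
set e := _ - _ - _ in IH.
rewrite (_ : _ - _ - _ = n.+1%:R * u ^+ 2 * x ^+ n + (x + u) * e); last first.
  by rewrite /e !exprS -[in LHS]natr1; ring.
set B := (`|x| + 1).
have B1 : 1 <= B by rewrite lerDr.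
apply: (le_trans (ler_normD _ _)).
rewrite (normrM (n.+1%:R * u ^+ 2)) (normrM (x + u)) normrX.
rewrite (@ger0_norm _ (n.+1%:R * u ^+ 2)); last by rewrite mulr_ge0 ?sqr_ge0.
have xB : `|x| ^+ n <= B ^+ n.+2.
  apply: (@le_trans _ _ (B ^+ n)).
    by apply: lerXn2r; rewrite ?nnegrE//; [rewrite (le_trans ler01)|rewrite lerDl].
  by rewrite ler_weXn2l// leqW.
have xuB : `|x + u| <= B by rewrite (le_trans (ler_normD _ _))// lerD2l.
apply: (@le_trans _ _ (n.+1%:R * u ^+ 2 * B ^+ n.+2 + B * (n.+1%:R ^+ 2 * u ^+ 2 * B ^+ n.+1))).
  apply: lerD; first by rewrite ler_wpM2l// mulr_ge0// sqr_ge0.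
  by apply: ler_pM.
rewrite (_ : _ + _ = (n.+1%:R + n.+1%:R ^+ 2) * (u ^+ 2 * B ^+ n.+2)); last by rewrite !exprS; ring.
rewrite -[leRHS]mulrA; apply: ler_wpM2r.
  by rewrite mulr_ge0 ?sqr_ge0 ?exprn_ge0 ?(le_trans ler01).
rewrite -[n.+2%:R]natr1; have : 0 <= n.+1%:R :> R by []; nra.
Qed.

(** Replaces the passage to the limit u -> 0 when terms of first order in u are compared. *)
Lemma eq_of_linear_bound (A B K : R) :
  (forall u, 0 < u -> u <= 1 -> `|A - B| <= K * u) -> A = B.
Proof.
move=> h; apply/eqP; rewrite -subr_eq0 -normr_eq0 eq_le normr_ge0 andbT.
have K0 : 0 <= K by have := h 1 ltr01 (lexx _); rewrite mulr1; apply: le_trans.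
apply/ler_addgt0Pr => e e0; rewrite add0r; have Kp : 0 < K + 1 by lra.
pose u := Num.min 1 (e / (K + 1)).
have u0 : 0 < u by rewrite /u lt_min ltr01 divr_gt0.
have u1 : u <= 1 by rewrite /u ge_min lexx.
apply: (le_trans (h u u0 u1)).
apply: (@le_trans _ _ ((K + 1) * u)); first by rewrite ler_wpM2r// ?ltW//; lra.
by rewrite mulrC -ler_pdivlMr// /u ge_min lexx orbT.
Qed.

Lemma L1_N01_dom n (c : R) : L1 N01 (fun x => (`|x| + 1) ^+ n * expR (c * (`|x| + 1))).
Proof.
apply: (@L1_N01_growth _ (expR (n%:R + c)) (n%:R + c)).
  apply: measurable_funM.
    by apply: measurable_funX; apply: measurable_funD => //; exact: measurableT_comp.
  apply: measurableT_comp => //; apply: measurable_funM => //.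
  by apply: measurable_funD => //; exact: measurableT_comp.
move=> x; rewrite normrM (ger0_norm (expR_ge0 _)) ger0_norm ?exprn_ge0 ?addr_ge0//.
have -> : expR (n%:R + c) * expR ((n%:R + c) * `|x|) = expR (n%:R * (`|x| + 1)) * expR (c * (`|x| + 1)).
  by rewrite -!expRD; congr expR; ring.
rewrite ler_wpM2r ?expR_ge0//.
have := normX_le_expR (`|x| + 1) n; rewrite ger0_norm// addr_ge0//.
Qed.

(** Compare the terms of order u in the shift identity E (x + u)^(n+1) = E x^(n+1) exp(x u - u^2 /
    2): they are (n+1) E x^n and E x^(n+2). Both remainders [A] and [B] are u^2 times the integrable
    functions [b1] and [b2] up to constants, so after division by u the two sides differ by a
    multiple of u. *)
Lemma gauss_ibp n :
  \int[N01]_x (x ^+ n.+2) = n.+1%:R * \int[N01]_x (x ^+ n).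
Proof.
have l0 := L1_N01_monom.
pose b1 (x : R) := (`|x| + 1) ^+ n.+1 * expR (0 * (`|x| + 1)).
pose b2 (x : R) := (`|x| + 1) ^+ n.+3 * expR (1 * (`|x| + 1)).
have lb1 : L1 N01 b1 by exact: L1_N01_dom.
have lb2 : L1 N01 b2 by exact: L1_N01_dom.
apply: (@eq_of_linear_bound _ _ (\int[N01]_x (n.+1%:R ^+ 2 * b1 x) + \int[N01]_x (2 * b2 x))) => u u0 u1.
have nu1 : `|u| <= 1 by rewrite gtr0_norm.
pose A (x : R) := (x + u) ^+ n.+1 - x ^+ n.+1 - n.+1%:R * u * x ^+ n.
pose B (x : R) := x ^+ n.+1 * expR (x * u - u ^+ 2 / 2) - x ^+ n.+1 - u * x ^+ n.+2.
have mA : measurable_fun setT A.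
  apply: measurable_funB; last by apply: measurable_funM => //; exact: measurable_monom.
  apply: measurable_funB; last exact: measurable_monom.
  by apply: measurable_funX; exact: measurable_funD.
have mB : measurable_fun setT B.
  apply: measurable_funB; last by apply: measurable_funM => //; exact: measurable_monom.
  apply: measurable_funB; last exact: measurable_monom.
  apply: measurable_funM; first exact: measurable_monom.
  apply: measurableT_comp => //; apply: measurable_funB => //.
  exact: measurable_funM.
have Ab x : `|A x| <= u ^+ 2 * (n.+1%:R ^+ 2 * b1 x).
  rewrite (le_trans (exprD_sub2_le x n nu1))// /b1 mul0r expR0 mulr1.
  by rewrite le_eqVlt; apply/orP; left; apply/eqP; ring.
have Bb x : `|B x| <= u ^+ 2 * (2 * b2 x).
  rewrite /B (_ : _ - _ - _ = x ^+ n.+1 * ((expR (x * u - u ^+ 2 / 2) - 1 - (x * u - u ^+ 2 / 2)) - u ^+ 2 / 2)); last first.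
    by rewrite !exprS; ring.
  rewrite normrM normrX /b2 mul1r.
  set a := x * u - u ^+ 2 / 2; set D := `|x| + 1.
  have x0 : 0 <= `|x| by [].
  have D1 : 1 <= D by rewrite /D lerDr.
  have aD : `|a| <= u * D.
    have u20 : 0 <= u ^+ 2 / 2 by rewrite divr_ge0 ?sqr_ge0.
    rewrite /a (le_trans (ler_normB _ _))// normrM (gtr0_norm u0) (ger0_norm u20) /D.
    nra.
  have eD : expR `|a| <= expR D.
    rewrite ler_expR (le_trans aD)//; nra.
  have e1 : 1 <= expR D by apply: expR_ge1; lra.
  have h1 := expR_sub2_le a.
  have a2 : a ^+ 2 <= u ^+ 2 * D ^+ 2.
    rewrite -exprMn -[a ^+ 2]real_normK ?num_real// ler_sqr ?nnegrE// mulr_ge0//; lra.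
  have h2 : `|expR a - 1 - a - u ^+ 2 / 2| <= 2 * u ^+ 2 * D ^+ 2 * expR D.
    apply: (le_trans (ler_normB _ _)).
    have : a ^+ 2 * expR `|a| <= u ^+ 2 * D ^+ 2 * expR D.
      by apply: ler_pM; rewrite ?sqr_ge0 ?expR_ge0.
    rewrite [`|u ^+ 2 / 2|]ger0_norm; last by rewrite divr_ge0 ?sqr_ge0.
    have : u ^+ 2 / 2 <= u ^+ 2 * D ^+ 2 * expR D.
      have D2 : 1 <= D ^+ 2 * expR D by rewrite -[1]mulr1 ler_pM// expr2; nra.
      have u2 : 0 <= u ^+ 2 by exact: sqr_ge0.
      rewrite -mulrA; nra.
    lra.
  have xD : `|x| ^+ n.+1 <= D ^+ n.+1.
    by apply: lerXn2r; rewrite ?nnegrE//; [rewrite (le_trans ler01)|rewrite lerDl].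
  apply: (le_trans (ler_pM _ _ xD h2)) => //.
  by rewrite le_eqVlt; apply/orP; left; apply/eqP; rewrite !exprS; ring.
have lA : L1 N01 A by apply: (@L1_le _ _ _ N01 _ _ mA Ab); do 2!apply: L1Z.
have lB : L1 N01 B by apply: (@L1_le _ _ _ N01 _ _ mB Bb); do 2!apply: L1Z.
have lAB x : (x + u) ^+ n.+1 = A x + (x ^+ n.+1 + n.+1%:R * u * x ^+ n).
  by rewrite /A; ring.
have lBB x : x ^+ n.+1 * expR (x * u - u ^+ 2 / 2) = B x + (x ^+ n.+1 + u * x ^+ n.+2).
  by rewrite /B; ring.
have lp : L1 N01 (fun x => x ^+ n.+1 + n.+1%:R * u * x ^+ n) by apply: L1D => //; exact: L1Z.
have lq : L1 N01 (fun x => x ^+ n.+1 + u * x ^+ n.+2) by apply: L1D => //; exact: L1Z.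
have key : \int[N01]_x ((x + u) ^+ n.+1) = \int[N01]_x (x ^+ n.+1 * expR (x * u - u ^+ 2 / 2)).
  apply: (@Rint_N01_shift (fun x => x ^+ n.+1)); first exact: measurable_monom.
    by rewrite (_ : (fun _ => _) = fun x => A x + (x ^+ n.+1 + n.+1%:R * u * x ^+ n)); [exact: L1D|apply/funext].
  by rewrite (_ : (fun _ => _) = fun x => B x + (x ^+ n.+1 + u * x ^+ n.+2)); [exact: L1D|apply/funext].
have : \int[N01]_x A x + (\int[N01]_x (x ^+ n.+1) + n.+1%:R * u * \int[N01]_x (x ^+ n)) =
       \int[N01]_x B x + (\int[N01]_x (x ^+ n.+1) + u * \int[N01]_x (x ^+ n.+2)).
  rewrite -!RintZ// -!RintD//; [|exact: L1Z..].
  by under eq_Rintegral do rewrite -lAB; under [RHS]eq_Rintegral do rewrite -lBB.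
have An : `|\int[N01]_x A x| <= u ^+ 2 * \int[N01]_x (n.+1%:R ^+ 2 * b1 x).
  apply: (le_trans (Rint_abs lA)); rewrite -(RintZ (u ^+ 2) (L1Z (n.+1%:R ^+ 2) lb1)).
  apply: Rint_le => //; first exact: L1_abs.
  by do 2!apply: L1Z.
have Bn : `|\int[N01]_x B x| <= u ^+ 2 * \int[N01]_x (2 * b2 x).
  apply: (le_trans (Rint_abs lB)); rewrite -(RintZ (u ^+ 2) (L1Z 2 lb2)).
  apply: Rint_le => //; first exact: L1_abs.
  by do 2!apply: L1Z.
move: An Bn; set a := \int[N01]_x A x; set b := \int[N01]_x B x.
set p := \int[N01]_x (n.+1%:R ^+ 2 * b1 x); set q := \int[N01]_x (2 * b2 x).
set M := \int[N01]_x (x ^+ n.+1); set M0 := \int[N01]_x (x ^+ n); set M2 := \int[N01]_x (x ^+ n.+2).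
move=> An Bn e.
have e2 : u * (M2 - n.+1%:R * M0) = a - b by move: e; set k := n.+1%:R; nra.
rewrite -(ler_pM2l u0) -{1}(gtr0_norm u0) -normrM e2.
apply: (le_trans (ler_normB _ _)); nra.
Qed.

Lemma gauss_mean : \int[N01]_x (x ^+ 1) = 0.
Proof.
have l0 := L1_N01_monom.
have e : \int[N01]_x (x ^+ 1) = \int[N01]_x (- x ^+ 1).
  rewrite /Rintegral; congr fine.
  have mi : measurable_fun setT (EFin \o (fun x : R => x ^+ 1)).
    by apply/measurable_EFinP; exact: measurable_monom.
  rewrite integralE [RHS]integralE; congr (_ - _)%E.
    rewrite -(@ge0_N01_opp R ((EFin \o (fun x : R => (x ^+ 1)%R))^\+)%E)//; last exact: measurable_funepos.
    by apply: eq_integral => x _; rewrite !funeposE /= !expr1.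
  rewrite -(@ge0_N01_opp R ((EFin \o (fun x : R => (x ^+ 1)%R))^\-)%E)//; last exact: measurable_funeneg.
  by apply: eq_integral => x _; rewrite !funenegE /= !expr1.
have : \int[N01]_x (- x ^+ 1) = - \int[N01]_x (x ^+ 1).
  rewrite -mulN1r -RintZ//; by apply: eq_Rintegral => x _; rewrite mulN1r.
rewrite -e; lra.
Qed.

Lemma Rint_N01_cst (c : R) : \int[N01]_x c = c.
Proof. by rewrite /Rintegral integral_N01_cst. Qed.

End gaussian_moments.

(** * Hermite polynomials *)

Section hermite.
Context {R : realType}.
Local Notation N01 := (@N01 R).

(** The probabilists' Hermite polynomials, defined by the raising operator X - d/dx because that
    operator is the adjoint of d/dx under N(0, 1). *)
Fixpoint hermite (k : nat) : {poly R} :=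
  if k is k.+1 then 'X * hermite k - (hermite k)^`() else 1.

Definition gaussL (p : {poly R}) : R := \int[N01]_x p.[x].

Lemma L1_horner (p : {poly R}) : L1 N01 (horner p).
Proof.
rewrite (_ : horner p = fun x => \sum_(i < size p) p`_i * x ^+ i).
  by apply: L1_sum => i _; apply: L1Z; exact: L1_N01_monom.
by apply/funext => x; rewrite horner_coef.
Qed.

Lemma gaussLD p q : gaussL (p + q) = gaussL p + gaussL q.
Proof.
rewrite /gaussL -RintD; [|exact: L1_horner..].
by apply: eq_Rintegral => x _; rewrite hornerD.
Qed.

Lemma gaussLZ c p : gaussL (c *: p) = c * gaussL p.
Proof.
rewrite /gaussL -RintZ; last exact: L1_horner.
by apply: eq_Rintegral => x _; rewrite hornerZ.
Qed.

Lemma gaussLB p q : gaussL (p - q) = gaussL p - gaussL q.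
Proof. by rewrite -scaleN1r gaussLD gaussLZ mulN1r. Qed.

Lemma gaussLXn n : gaussL 'X^n = \int[N01]_x (x ^+ n).
Proof. by apply: eq_Rintegral => x _; rewrite hornerXn. Qed.

(** On monomials this is [gauss_ibp], and [gauss_mean] in degree 0; both sides are linear. *)
Lemma gaussL_ibp p : gaussL ('X * p) = gaussL p^`().
Proof.
have h n : gaussL ('X * 'X^n) = gaussL ('X^n)^`().
  rewrite -exprS; case: n => [|n].
    rewrite expr0 derivC gaussLXn gauss_mean /gaussL.
    by under eq_Rintegral do rewrite horner0; rewrite Rint_N01_cst.
  by rewrite derivXn /= -scaler_nat [RHS]gaussLZ !gaussLXn gauss_ibp.
rewrite -(coefK p) poly_def; elim: (size p) => [|n IH].
  by rewrite big_ord0 mulr0 deriv0.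
rewrite big_ord_recr mulrDr derivD !gaussLD IH; congr (_ + _).
by rewrite -scalerAr derivZ !gaussLZ h.
Qed.

Lemma deriv_hermite k : (hermite k.+1)^`() = k.+1%:R *: hermite k.
Proof.
elim: k => [|k IH]; first by rewrite /= mulr1 derivC subr0 derivX scale1r.
rewrite {1}/hermite -/(hermite k.+1) derivB derivM derivX mul1r IH derivZ.
rewrite -scalerAr -addrA -scalerBr -/(hermite k.+1).
by rewrite -[k.+2%:R]natr1 scalerDl scale1r addrC.
Qed.

Lemma hermiteS k : hermite k.+2 = 'X * hermite k.+1 - k.+1%:R *: hermite k.
Proof. by rewrite -deriv_hermite. Qed.

(** Integration by parts moves X - d/dx to the other factor as d/dx; as differentiation lowers a
    Hermite polynomial, orthogonality follows by lowering both degrees in turn. *)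
Lemma gaussL_hermite k p : gaussL (hermite k.+1 * p) = gaussL (hermite k * p^`()).
Proof.
by rewrite /= mulrBl gaussLB -mulrA gaussL_ibp derivM gaussLD [X in X - _]addrC addrK.
Qed.

Lemma gaussL1 : gaussL 1 = 1.
Proof. by rewrite /gaussL; under eq_Rintegral do rewrite hornerC; rewrite Rint_N01_cst. Qed.

Lemma hermite_orthogonal j k :
  gaussL (hermite j * hermite k) = if j == k then j`!%:R else 0.
Proof.
elim: j k => [|j IH] [|k].
- by rewrite /= mulr1 gaussL1 fact0.
- rewrite mulrC gaussL_hermite /= derivC mulr0 /gaussL.
  by under eq_Rintegral do rewrite horner0; rewrite Rint_N01_cst.
- rewrite gaussL_hermite /= derivC mulr0 /gaussL.
  by under eq_Rintegral do rewrite horner0; rewrite Rint_N01_cst.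
- rewrite gaussL_hermite deriv_hermite -scalerAr gaussLZ IH eqSS.
  case: eqP => [->|_]; last by rewrite mulr0.
  by rewrite factS natrM.
Qed.

Lemma hermite0 (x : R) : (hermite 0).[x] = 1.
Proof. by rewrite /= hornerC. Qed.

Lemma hermite1 (x : R) : (hermite 1).[x] = x.
Proof. by rewrite /= mulr1 derivC subr0 hornerX. Qed.

Lemma hermiteSE k (x : R) :
  (hermite k.+2).[x] = x * (hermite k.+1).[x] - k.+1%:R * (hermite k).[x].
Proof. by rewrite hermiteS hornerD hornerN hornerZ mulrC hornerMX mulrC. Qed.

End hermite.

(** * Series over multi-indices *)

Arguments hermite R k : clear implicits.

Lemma cvgn_ext {R : realType} (u v : nat -> R) (l : R) :
  (forall n, u n = v n) -> v @ \oo --> l -> u @ \oo --> l.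
Proof. by move=> uv; rewrite (_ : u = v)//; apply/funext. Qed.

(** * Everywhere convergent power series and derivatives *)

Section entire.
Context {R : realType}.
Implicit Types (c : R^nat) (x : R).

Definition entire c := forall r, 0 < r -> exists M, forall k, `|c k| * r ^+ k <= M.

Lemma entire_cvg c x : entire c -> cvgn (pseries c x).
Proof.
(* Boundedness at twice the radius leaves a geometric majorant of ratio 1/2. *)
move=> /(_ (2 * (`|x| + 1)))[|M hM]; first by rewrite mulr_gt0// ltr_wpDl.
have M0 : 0 <= M by apply: le_trans (hM 0%N); rewrite mulr1.
apply: normed_cvg; rewrite /normed_series_of /=.
apply: (@series_le_cvg _ _ (geometric M 2^-1)) => [//|n|n|].
- by rewrite /geometric /= mulr_ge0// exprn_ge0// invr_ge0.
- rewrite /geometric /= normrM normrX exprVn ler_pdivlMr ?exprn_gt0//.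
  apply: le_trans (hM n); rewrite -mulrA ler_wpM2l// -exprMn.
  by apply: lerXn2r; rewrite ?nnegrE ?mulr_ge0 ?addr_ge0//; have := normr_ge0 x; lra.
- by apply: is_cvg_geometric_series; rewrite gtr0_norm ?invr_gt0// invf_lt1// ltr1n.
Qed.

(** The factor k + 1 is at most 2^(k+1), which doubling the radius absorbs. *)
Lemma entire_diffs c : entire c -> entire (pseries_diffs c).
Proof.
move=> ec r r0; have [|M hM] := ec (2 * r); first by rewrite mulr_gt0.
exists (M / r) => k; rewrite ler_pdivlMr// /pseries_diffs.
apply: le_trans (hM k.+1); rewrite exprMn normrM (ger0_norm (ler0n _ _)).
have h : k.+1%:R <= 2 ^+ k.+1 :> R by rewrite -natrX ler_nat ltnW// ltn_expl.
rewrite [r ^+ k.+1]exprSr.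
rewrite (_ : _ * _ * _ * r = k.+1%:R * (`|c k.+1| * (r ^+ k * r))); last ring.
rewrite [leRHS]mulrCA.
by rewrite ler_wpM2r// !mulr_ge0 ?exprn_ge0// ltW.
Qed.

Lemma entire_deriv c x : entire c ->
  is_derive x 1 (fun y => limn (pseries c y)) (limn (pseries (pseries_diffs c) x)).
Proof.
move=> ec; apply: (@pseries_snd_diffs _ _ (`|x| + 1)).
- exact: entire_cvg.
- exact/entire_cvg/entire_diffs.
- exact/entire_cvg/entire_diffs/entire_diffs.
- by rewrite [ltRHS]ger0_norm ?addr_ge0// ltrDl.
Qed.

Lemma entire_le c (d : R^nat) : entire c -> (forall k, `|d k| <= `|c k|) -> entire d.
Proof.
move=> ec h r r0; have [M hM] := ec r r0; exists M => k.
apply: (le_trans _ (hM k)); apply: ler_wpM2r => //; apply: exprn_ge0; exact: ltW.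
Qed.

Lemma der_eq (f : R -> R) x a b : is_derive x 1 f a -> a = b -> is_derive x 1 f b.
Proof. by move=> h <-. Qed.

Lemma der_mul (f g : R -> R) x df dg : is_derive x 1 f df -> is_derive x 1 g dg ->
  is_derive x 1 (fun y => f y * g y) (f x * dg + g x * df).
Proof. by move=> hf hg; exact: (@is_deriveM _ _ f g x 1 df dg). Qed.

Lemma der_sub (f g : R -> R) x df dg : is_derive x 1 f df -> is_derive x 1 g dg ->
  is_derive x 1 (fun y => f y - g y) (df - dg).
Proof. by move=> hf hg; exact: (@is_deriveB _ _ _ f g x 1 df dg). Qed.

Lemma der_add (f g : R -> R) x df dg : is_derive x 1 f df -> is_derive x 1 g dg ->
  is_derive x 1 (fun y => f y + g y) (df + dg).
Proof. by move=> hf hg; exact: (@is_deriveD _ _ _ f g x 1 df dg). Qed.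

Lemma der_comp (f g : R -> R) x df dg : is_derive x 1 g dg ->
  is_derive (g x) 1 f df -> is_derive x 1 (fun y => f (g y)) (df * dg).
Proof. by move=> hg hf; exact: (@is_derive1_comp _ f g x df dg). Qed.

Lemma der_lin (a x : R) : is_derive x 1 (fun y => a * y) a.
Proof.
have := der_mul (is_derive_cst a x 1) (is_derive_id x 1).
by rewrite mulr0 addr0 mulr1.
Qed.

Lemma der_sqr (a x : R) : is_derive x 1 (fun y => a * y ^+ 2) (a * (2 * x)).
Proof.
have h := der_mul (is_derive_id x (1 : R)) (is_derive_id x (1 : R)).
have := der_mul (is_derive_cst a x 1) h.
rewrite mulr0 addr0 (_ : (x * 1 + x * 1) = 2 * x); last ring.
by under eq_fun do rewrite -expr2.
Qed.

End entire.

(** * Generating functions of the Hermite polynomials *)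

Section hermite_generating.
Context {R : realType}.
Implicit Types (x z : R).

(** The three-term recurrence gives w_(k+2) <= (|z| r w_(k+1) + r^2 w_k) / (k + 2). Once k + 2
    exceeds |z| r + r^2 no new maximum can arise, so the sum of the first terms bounds the whole
    sequence. *)
Lemma hermite_growth z r : 0 < r ->
  exists M, forall k, `|(hermite R k).[z] / k`!%:R| * r ^+ k <= M.
Proof.
move=> r0; pose w k := `|(hermite R k).[z] / k`!%:R| * r ^+ k.
have w0 k : 0 <= w k by rewrite mulr_ge0// exprn_ge0// ltW.
have wS k : w k.+2 <= (`|z| * r * w k.+1 + r ^+ 2 * w k) / k.+2%:R.
  rewrite /w ler_pdivlMr ?ltr0n//.
  rewrite hermiteSE.
  have -> : (z * (hermite R k.+1).[z] - k.+1%:R * (hermite R k).[z]) / (k.+2)`!%:R =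
      (z * ((hermite R k.+1).[z] / (k.+1)`!%:R) - (hermite R k).[z] / k`!%:R) / k.+2%:R.
    have f0 : k`!%:R != 0 :> R by rewrite pnatr_eq0 -lt0n fact_gt0.
    have n0 : k.+1%:R != 0 :> R by rewrite pnatr_eq0.
    have n1 : k.+2%:R != 0 :> R by rewrite pnatr_eq0.
    rewrite 2!factS !natrM; field.
    by rewrite f0 /= [2 + _]addrC [1 + _]addrC natr1 -natrD addn2 n1 n0.
  set a := (hermite R k.+1).[z] / _; set b := (hermite R k).[z] / _.
  rewrite normrM normfV (ger0_norm (ler0n _ _)).
  rewrite (_ : _ / _ * _ * _ = `|z * a - b| * r ^+ k.+2); last first.
    by move: k.+2%:R (@pnatr_eq0 R k.+2) => q q0; field; rewrite q0.
  rewrite [leRHS](_ : _ = (`|z * a| + `|b|) * r ^+ k.+2); last first.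
    by rewrite (normrM z a) (exprS r k.+1) (exprS r k); ring.
  by apply: ler_wpM2r; [apply: exprn_ge0; exact: ltW|exact: ler_normB].
have [N hN] : exists N : nat, `|z| * r + r ^+ 2 <= N%:R.
  have := archi_boundP (_ : 0 <= `|z| * r + r ^+ 2) => h.
  by eexists; apply: ltW; apply: h; rewrite addr_ge0 ?sqr_ge0// mulr_ge0// ltW.
exists (\sum_(i < N.+2) w i) => k; rewrite -/(w k).
elim/ltn_ind: k => k IH; case: (ltnP k N.+2) => [kN|Nk].
  by rewrite (bigD1 (Ordinal kN))//= lerDl sumr_ge0.
case: k IH Nk => [|[|k]]// IH Nk.
apply: (le_trans (wS k)); rewrite ler_pdivrMr ?ltr0n//.
have h1 := IH k.+1 (ltnSn _); have h2 := IH k (ltnW (ltnSn _)).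
set M := \sum_(i < _) _ in h1 h2 *.
have M0 : 0 <= M by apply: sumr_ge0.
apply: (@le_trans _ _ ((`|z| * r + r ^+ 2) * M)).
  rewrite mulrDl lerD// ler_wpM2l// ?mulr_ge0 ?sqr_ge0// ltW//.
rewrite mulrC ler_wpM2l// (le_trans hN)// ler_nat.
by rewrite (leq_trans _ Nk)// leqW.
Qed.

(** The factor a twists the Hermite generating series: a = 1 yields the exponential, a = Re i^k and
    a = Im i^k the trigonometric functions, and one differentiation formula serves all three. *)
Definition hcoef (a : R^nat) z : R^nat := fun k => a k * ((hermite R k).[z] / k`!%:R).

Definition hsum (a : R^nat) z x : R := limn (pseries (hcoef a z) x).

Lemma hcoef_entire a z : (forall k, `|a k| <= 1) -> entire (hcoef a z).
Proof.
move=> a1; apply: (@entire_le _ (fun k => (hermite R k).[z] / k`!%:R)).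
  by move=> r r0; exact: hermite_growth.
by move=> k; rewrite /hcoef normrM ler_piMl.
Qed.

(** The three-term recurrence summed up. It is exact for partial sums, the last series having one
    term fewer, so the limit can be taken termwise in [hsum_deriv]. *)
Lemma pseries_hcoef_diffs a z x n :
  pseries (pseries_diffs (hcoef a z)) x n.+1 =
  z * pseries (hcoef (fun k => a k.+1) z) x n.+1 -
  x * pseries (hcoef (fun k => a k.+2) z) x n.
Proof.
rewrite /pseries /series /=; elim: n => [|n IH].
  rewrite !big_nat1 big_geq// /pseries_diffs /hcoef expr0 hermite0 hermite1.
  by rewrite fact0 (_ : 1`! = 1)%N//; field.
rewrite big_nat_recr//= IH [in RHS]big_nat_recr//=.
rewrite [X in _ = _ - _ * X]big_nat_recr//=.
set A := \sum_(_ <= _ < _) _; set B := \sum_(_ <= _ < _) _.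
rewrite !mulrDr opprD addrACA; congr (_ + _).
rewrite /pseries_diffs /hcoef hermiteSE.
have f0 : n`!%:R != 0 :> R by rewrite pnatr_eq0 -lt0n fact_gt0.
have n0 : n.+1%:R != 0 :> R by rewrite pnatr_eq0.
have n1 : n.+2%:R != 0 :> R by rewrite pnatr_eq0.
rewrite 2!factS !natrM exprS.
move: (n.+1%:R) (n.+2%:R) n0 n1 => p q n0 n1.
by field; rewrite f0 n0 n1.
Qed.

Lemma hsum_deriv a z x : (forall k, `|a k| <= 1) ->
  is_derive x 1 (hsum a z)
    (z * hsum (fun k => a k.+1) z x - x * hsum (fun k => a k.+2) z x).
Proof.
move=> a1; have := entire_deriv x (@hcoef_entire a z a1).
suff -> : limn (pseries (pseries_diffs (hcoef a z)) x) =
  z * hsum (fun k => a k.+1) z x - x * hsum (fun k => a k.+2) z x by [].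
apply: cvg_lim => //; rewrite -(cvg_shiftS (pseries _ x)) /=.
under eq_fun do rewrite pseries_hcoef_diffs.
have c1 : cvgn (pseries (hcoef (fun k => a k.+1) z) x).
  by apply: entire_cvg; exact: hcoef_entire.
have c2 : cvgn (pseries (hcoef (fun k => a k.+2) z) x).
  by apply: entire_cvg; exact: hcoef_entire.
apply: cvgB; apply: cvgMr => //.
by rewrite (cvg_shiftS (pseries _ x)).
Qed.

Lemma hsumN a z x : (forall k, `|a k| <= 1) -> hsum (fun k => - a k) z x = - hsum a z x.
Proof.
move=> a1; rewrite /hsum -limN; last by apply: entire_cvg; exact: hcoef_entire.
congr (limn _); apply/funext => n.
rewrite (_ : (- pseries (hcoef a z) x) n = - pseries (hcoef a z) x n)//.
rewrite /pseries /series /= -sumrN; apply: eq_bigr => k _.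
by rewrite /hcoef !mulNr.
Qed.

Lemma hsum0 a z : (forall k, `|a k| <= 1) -> hsum a z 0 = a 0%N.
Proof.
move=> a1; apply: cvg_lim => //; rewrite -(cvg_shiftS (pseries _ 0)) /=.
rewrite (_ : (fun _ => _) = cst (a 0%N)); first exact: cvg_cst.
apply/funext => n; rewrite /pseries /series /= big_nat_recl// big1 => [|i _].
  by rewrite /hcoef hermite0 fact0 expr0 divr1 !mulr1 addr0.
by rewrite expr0n mulr0.
Qed.

(** For constant a, [hsum_deriv] says h' = (z - x) h, so the product of h with the inverse of the
    claimed exponential is constant. *)
Lemma hsum_exp z x : hsum (fun=> 1) z x = expR (z * x - x ^+ 2 / 2).
Proof.
have a1 : forall k : nat, `|1 : R| <= 1 by rewrite normr1.
pose g y := hsum (fun=> 1) z y * expR (2^-1 * y ^+ 2 - z * y).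
have dg y : is_derive y (1 : R) g 0.
  have d1 := hsum_deriv z y a1.
  have d2 := der_comp (der_sub (der_sqr 2^-1 y) (der_lin z y)) (is_derive_expR _).
  apply: (der_eq (der_mul d1 d2)).
  set e := expR _; set h := hsum _ _ _; by field.
have := is_derive_0_is_cst x 0 dg; rewrite /g.
rewrite hsum0// expr0n !mulr0 subr0 expR0 mulr1 => h.
have e0 := expR_gt0 (2^-1 * x ^+ 2 - z * x).
apply: (mulIf (lt0r_neq0 e0)); rewrite h -expRD -[LHS]expR0.
by congr expR; field.
Qed.

(* (Re i^k, Im i^k) *)
Fixpoint ipow (k : nat) : R * R :=
  if k is k.+1 then (- (ipow k).2, (ipow k).1) else (1, 0).

Lemma ipow_norm k : `|(ipow k).1| <= 1 /\ `|(ipow k).2| <= 1.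
Proof. by elim: k => [|k [h1 h2]] /=; rewrite ?normr1 ?normr0// normrN. Qed.

(** Shifting the twist by one multiplies i^k by i, so that [hsum_deriv] becomes a linear system for
    C and S. After multiplication by exp(-y^2 / 2) it is the system of cos(z y) and sin(z y). *)
Lemma hsum_trig z x : hsum (fun k => (ipow k).1) z x = expR (x ^+ 2 / 2) * cos (z * x) /\
  hsum (fun k => (ipow k).2) z x = expR (x ^+ 2 / 2) * sin (z * x).
Proof.
have a1 k : `|(ipow k).1| <= 1 by have [] := ipow_norm k.
have a2 k : `|(ipow k).2| <= 1 by have [] := ipow_norm k.
pose C := hsum (fun k => (ipow k).1) z; pose S := hsum (fun k => (ipow k).2) z.
have dC y : is_derive y (1 : R) C (- z * S y + y * C y).
  apply: (der_eq (hsum_deriv z y a1)).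
  by rewrite /= (hsumN z y a2) (hsumN z y a1) -/(C y) -/(S y); ring.
have dS y : is_derive y (1 : R) S (z * C y + y * S y).
  apply: (der_eq (hsum_deriv z y a2)).
  by rewrite /= (hsumN z y a2) -/(C y) -/(S y); ring.
pose e (y : R) := expR (- 2^-1 * y ^+ 2).
have de y : is_derive y (1 : R) e (- y * e y).
  apply: (der_eq (der_comp (der_sqr (- 2^-1) y) (is_derive_expR _))).
  by rewrite -/(e y); field.
pose p (y : R) := C y * e y - cos (z * y); pose q (y : R) := S y * e y - sin (z * y).
have dp y : is_derive y (1 : R) p (- z * q y).
  apply: (der_eq (der_sub (der_mul (dC y) (de y)) (der_comp (der_lin z y) (is_derive_cos _)))).
  by rewrite /q; ring.
have dq y : is_derive y (1 : R) q (z * p y).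
  apply: (der_eq (der_sub (der_mul (dS y) (de y)) (der_comp (der_lin z y) (is_derive_sin _)))).
  by rewrite /p; ring.
(* The differences p and q satisfy p' = -z q and q' = z p, so p^2 + q^2 is constant; it vanishes at
   0. *)
pose F (y : R) := p y * p y + q y * q y.
have dF y : is_derive y (1 : R) F 0.
  apply: (der_eq (der_add (der_mul (dp y) (dp y)) (der_mul (dq y) (dq y)))).
  by ring.
have F0 : F x = 0.
  rewrite (is_derive_0_is_cst x 0 dF) /F /p /q /C /S /e !hsum0//=.
  by rewrite expr0n !mulr0 expR0 cos0 sin0; ring.
have ee : e x * expR (x ^+ 2 / 2) = 1.
  by rewrite -expRD -[RHS]expR0; congr expR; field.
have /eqP := F0; rewrite /F paddr_eq0 -?expr2 ?sqr_ge0// !sqrf_eq0.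
move=> /andP[/eqP p0 /eqP q0]; split.
  have -> : cos (z * x) = C x * e x by move: p0; rewrite /p; lra.
  by rewrite mulrC -mulrA ee mulr1.
have -> : sin (z * x) = S x * e x by move: q0; rewrite /q; lra.
by rewrite mulrC -mulrA ee mulr1.
Qed.

Lemma hsum_cvg (a : R^nat) z x : (forall k, `|a k| <= 1) ->
  (fun m => \sum_(k < m) a k * ((hermite R k).[z] / k`!%:R * x ^+ k)) @ \oo --> hsum a z x.
Proof.
move=> a1; have := @entire_cvg _ _ x (@hcoef_entire a z a1); apply: cvgn_ext => n.
rewrite /pseries /series /= big_mkord; apply: eq_bigr => k _.
by rewrite /hcoef mulrA.
Qed.

Lemma exp_sum_cvg (y : R) : (fun m => \sum_(k < m) y ^+ k / k`!%:R) @ \oo --> expR y.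
Proof.
have := @is_cvg_series_exp_coeff R y; rewrite -/(expR y); apply: cvgn_ext => n.
by rewrite /series /= big_mkord.
Qed.

Lemma ipowE k : ipow k = ((~~ odd k)%:R * (-1) ^+ k./2, (odd k)%:R * (-1) ^+ k.-1./2).
Proof.
elim: k => [|k IH] /=; first by rewrite mulr1 mul0r.
rewrite IH /= negbK; case: k {IH} => [|k] /=; first by rewrite mul0r oppr0 mul1r.
by case: (odd k) => /=; rewrite ?mul1r ?mul0r ?oppr0 ?exprS ?mulN1r ?opprK.
Qed.

Lemma trig_sum_cvg (y : R) :
  (fun m => \sum_(k < m) (ipow k).1 * (y ^+ k / k`!%:R)) @ \oo --> cos y /\
  (fun m => \sum_(k < m) (ipow k).2 * (y ^+ k / k`!%:R)) @ \oo --> sin y.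
Proof.
split.
  rewrite cos.unlock; have := @is_cvg_series_cos_coeff R y; apply: cvgn_ext => n.
  rewrite /series /= big_mkord; apply: eq_bigr => k _.
  by rewrite ipowE /= mulrA.
rewrite sin.unlock; have := @is_cvg_series_sin_coeff R y; apply: cvgn_ext => n.
rewrite /series /= big_mkord; apply: eq_bigr => k _.
by rewrite ipowE /= mulrA.
Qed.

End hermite_generating.

(** * Series along cubes of multi-indices *)

Section boxes.
Context {R : realType} {d : nat}.
Notation J := {ffun 'I_d -> nat}.

(** Series over multi-indices are limits along the cubes {0, ..., m-1}^d, because products of
    one-dimensional partial sums expand exactly over a cube. *)
Definition box (m : nat) : seq J :=
  [seq [ffun i => nat_of_ord (f i)] | f : {ffun 'I_d -> 'I_m}].

Lemma mem_box m (al : J) : (al \in box m) = [forall i, (al i < m)%N].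
Proof.
apply/idP/forallP => [/mapP[f _ ->] i|h]; first by rewrite ffunE.
apply/mapP; exists [ffun i => Ordinal (h i)]; first by rewrite mem_enum.
by apply/ffunP => i; rewrite !ffunE.
Qed.

Lemma box_uniq m : uniq (box m).
Proof.
rewrite map_inj_uniq ?enum_uniq// => f g /ffunP fg.
by apply/ffunP => i; have := fg i; rewrite !ffunE => /val_inj.
Qed.

Lemma big_box (V : nmodType) m (F : J -> V) :
  \sum_(al <- box m) F al = \sum_(f : {ffun 'I_d -> 'I_m}) F [ffun i => nat_of_ord (f i)].
Proof. by rewrite big_map big_enum. Qed.

Lemma box_prod (A : comRingType) m (g : 'I_d -> nat -> A) :
  \sum_(al <- box m) \prod_i g i (al i) = \prod_i \sum_(k < m) g i k.
Proof.
rewrite big_box bigA_distr_bigA; apply: eq_bigr => f _.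
by apply: eq_bigr => i _; rewrite ffunE.
Qed.

Definition deg (al : J) : nat := (\sum_i al i)%N.

Lemma box_prod_cvg (g : 'I_d -> nat -> R) (l : 'I_d -> R) :
  (forall i, (fun m => \sum_(k < m) g i k) @ \oo --> l i) ->
  (fun m => \sum_(al <- box m) \prod_i g i (al i)) @ \oo --> \prod_i l i.
Proof.
move=> h; apply: (@cvgn_ext _ _ (fun m => \prod_i \sum_(k < m) g i k)) => [m|].
  exact: box_prod.
elim: (index_enum _) => [|i s IH].
  by apply: (@cvgn_ext _ _ (cst 1)) => [m|]; rewrite big_nil//; exact: cvg_cst.
rewrite big_cons; apply: cvgn_ext; first by move=> m; rewrite big_cons.
by apply: cvgM.
Qed.

Local Notation Cx := (complex.Complex).

Let ci k : R[i] := Cx (ipow k).1 (ipow k).2.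

Let ciD j k : ci (j + k) = ci j * ci k.
Proof.
elim: j => [|j IH]; first by rewrite add0n /ci /=; simpc.
have ciS n : ci n.+1 = Cx 0 1 * ci n by rewrite /ci /=; simpc.
by rewrite addSn !ciS IH mulrA.
Qed.

Let ci_sum (al : J) : ci (deg al) = \prod_i ci (al i).
Proof. by rewrite /deg; apply: (big_morph ci ciD). Qed.

Let Re_prod_cvg (I : Type) (s : seq I) (u : I -> nat -> R[i]) (l : I -> R[i]) :
  (forall i, (fun m => complex.Re (u i m)) @ \oo --> complex.Re (l i) /\
     (fun m => complex.Im (u i m)) @ \oo --> complex.Im (l i)) ->
  (fun m => complex.Re (\prod_(i <- s) u i m)) @ \oo --> complex.Re (\prod_(i <- s) l i) /\
  (fun m => complex.Im (\prod_(i <- s) u i m)) @ \oo --> complex.Im (\prod_(i <- s) l i).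
Proof.
move=> h; elim: s => [|i s [IH1 IH2]].
  by rewrite !big_nil; split; apply: (@cvgn_ext _ _ (cst _)) => [m|]; rewrite ?big_nil//; exact: cvg_cst.
have [h1 h2] := h i.
have ReM (x y : R[i]) : complex.Re (x * y) = complex.Re x * complex.Re y - complex.Im x * complex.Im y.
  by case: x y => [? ?] [? ?].
have ImM (x y : R[i]) : complex.Im (x * y) = complex.Re x * complex.Im y + complex.Im x * complex.Re y.
  by case: x y => [? ?] [? ?].
rewrite !big_cons ReM ImM; split.
  apply: (@cvgn_ext _ _ (fun m => complex.Re (u i m) * complex.Re (\prod_(j <- s) u j m) -
    complex.Im (u i m) * complex.Im (\prod_(j <- s) u j m))) => [m|].
    by rewrite big_cons ReM.
  by apply: cvgB; apply: cvgM.
apply: (@cvgn_ext _ _ (fun m => complex.Re (u i m) * complex.Im (\prod_(j <- s) u j m) +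
  complex.Im (u i m) * complex.Re (\prod_(j <- s) u j m))) => [m|].
  by rewrite big_cons ImM.
by apply: cvgD; apply: cvgM.
Qed.

(** i^|al| is the product of the i^(al_i), but its real part is not; the factorization over
    coordinates is therefore carried out in the complex numbers and real and imaginary parts are
    taken at the end. *)
Lemma box_trig_cvg (g : 'I_d -> nat -> R) (r th : 'I_d -> R) :
  (forall i, (fun m => \sum_(k < m) (@ipow R k).1 * g i k) @ \oo --> r i * cos (th i) /\
   (fun m => \sum_(k < m) (@ipow R k).2 * g i k) @ \oo --> r i * sin (th i)) ->
  (fun m => \sum_(al <- box m) (@ipow R (deg al)).1 * \prod_i g i (al i)) @ \oo -->
     (\prod_i r i) * cos (\sum_i th i) /\
  (fun m => \sum_(al <- box m) (@ipow R (deg al)).2 * \prod_i g i (al i)) @ \oo -->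
     (\prod_i r i) * sin (\sum_i th i).
Proof.
move=> h.
pose u (i : 'I_d) m : R[i] := \sum_(k < m) ci k * (Cx (g i k) 0).
pose l (i : 'I_d) : R[i] := Cx (r i * cos (th i)) (r i * sin (th i)).
have cD (x y : R[i]) : complex.Re (x + y) = complex.Re x + complex.Re y /\
    complex.Im (x + y) = complex.Im x + complex.Im y by case: x y => [? ?] [? ?].
have Re_sum (I : Type) (s : seq I) (F : I -> R[i]) :
   complex.Re (\sum_(i <- s) F i) = \sum_(i <- s) complex.Re (F i).
  by apply: (big_morph _ (fun x y => (cD x y).1)).
have Im_sum (I : Type) (s : seq I) (F : I -> R[i]) :
   complex.Im (\sum_(i <- s) F i) = \sum_(i <- s) complex.Im (F i).
  by apply: (big_morph _ (fun x y => (cD x y).2)).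
have ul i : (fun m => complex.Re (u i m)) @ \oo --> complex.Re (l i) /\
     (fun m => complex.Im (u i m)) @ \oo --> complex.Im (l i).
  have [h1 h2] := h i; split; rewrite /u /l /=.
    apply: cvgn_ext h1 => m; rewrite Re_sum; apply: eq_bigr => k _.
    by rewrite /= mulr0 subr0.
  apply: cvgn_ext h2 => m; rewrite Im_sum; apply: eq_bigr => k _.
  by rewrite /= mulr0 add0r.
have [k1 k2] := @Re_prod_cvg _ (index_enum 'I_d) u l ul.
have lE : \prod_i l i = Cx ((\prod_i r i) * cos (\sum_i th i)) ((\prod_i r i) * sin (\sum_i th i)).
  elim: (index_enum _) => [|i s IH].
    by rewrite !big_nil cos0 sin0 mulr0 mulr1.
  rewrite !big_cons IH /l cosD sinD; simpc; congr Cx; ring.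
have prodC (al : J) : \prod_i Cx (g i (al i)) 0 = Cx (\prod_i g i (al i)) 0 :> R[i].
  apply/esym; apply: (big_morph (fun x => Cx x 0 : R[i])) => // x y; by simpc.
have uE m : \prod_i u i m = \sum_(al <- box m) ci (deg al) * Cx (\prod_i g i (al i)) 0.
  rewrite /u -(box_prod m (fun i k => ci k * Cx (g i k) 0)); apply: eq_bigr => al _.
  by rewrite big_split /= -ci_sum prodC.
rewrite lE /= in k1 k2; split.
  apply: cvgn_ext k1 => m; rewrite uE Re_sum; apply: eq_bigr => al _.
  by rewrite /= mulr0 subr0.
apply: cvgn_ext k2 => m; rewrite uE Im_sum; apply: eq_bigr => al _.
by rewrite /= mulr0 add0r.
Qed.

End boxes.

(** * Gaussian vectors *)

Section vectors.
Context {R : realType}.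
Implicit Types k : nat.
Local Notation vec k := (vec R k).

Definition vax k (x : vec k) (s : R) (z : vec k) : vec k :=
  [tuple tnth x i + s * tnth z i | i < k].

Definition vdot k (x y : vec k) : R := \sum_(i < k) tnth x i * tnth y i.

Definition vtail k (x : vec k.+1) : vec k := [tuple tnth x (lift ord0 i) | i < k].

Lemma tnth_vax k (x : vec k) s z i : tnth (vax x s z) i = tnth x i + s * tnth z i.
Proof. by rewrite tnth_mktuple. Qed.

Lemma measurable_tnthR k (i : 'I_k) : measurable_fun setT (fun x : vec k => tnth x i : R).
Proof. exact: (@measurable_tnth _ (measurableTypeR R)). Qed.

Lemma measurable_vecP (dT : measure_display) (T : measurableType dT) k (f : T -> vec k) :
  (forall i, measurable_fun setT (fun w => tnth (f w) i : R)) -> measurable_fun setT f.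
Proof. by move=> h; apply/measurable_fun_tnthP. Qed.

Lemma measurable_vax (dT : measure_display) (T : measurableType dT) k (a b : T -> vec k) s :
  measurable_fun setT a -> measurable_fun setT b ->
  measurable_fun setT (fun w => vax (a w) s (b w)).
Proof.
move=> ma mb; apply: measurable_vecP => i; under eq_fun do rewrite tnth_vax.
apply: measurable_funD; first exact: (measurableT_comp (measurable_tnthR i) ma).
by apply: measurable_funM => //; exact: (measurableT_comp (measurable_tnthR i) mb).
Qed.

Lemma measurable_vdot (dT : measure_display) (T : measurableType dT) k (a b : T -> vec k) :
  measurable_fun setT a -> measurable_fun setT b ->
  measurable_fun setT (fun w => vdot (a w) (b w)).
Proof.
move=> ma mb; apply: measurable_sum => i.
by apply: measurable_funM; [exact: (measurableT_comp (measurable_tnthR i) ma)|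
  exact: (measurableT_comp (measurable_tnthR i) mb)].
Qed.

Lemma vax_cons k (x : vec k.+1) s (z0 : R) (z : vec k) :
  vax x s (Defs.cons_tuple (z0, z)) =
  Defs.cons_tuple (tnth x ord0 + s * z0, vax (vtail x) s z).
Proof.
apply: eq_from_tnth => i; rewrite tnth_vax.
case: (unliftP ord0 i) => [j ->|->]; last by rewrite !cons_tuple0.
by rewrite !cons_tupleS tnth_vax tnth_mktuple.
Qed.

Lemma cons_vax k (x0 : R) (x : vec k) s (z : vec k.+1) :
  vax (Defs.cons_tuple (x0, x)) s z =
  Defs.cons_tuple (x0 + s * tnth z ord0, vax x s (vtail z)).
Proof.
apply: eq_from_tnth => i; rewrite tnth_vax.
case: (unliftP ord0 i) => [j ->|->]; last by rewrite !cons_tuple0.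
by rewrite !cons_tupleS tnth_vax tnth_mktuple.
Qed.

Lemma vtail_cons k (x0 : R) (x : vec k) : vtail (Defs.cons_tuple (x0, x)) = x.
Proof. by apply: eq_from_tnth => i; rewrite tnth_mktuple cons_tupleS. Qed.

Lemma vdot_cons k (x0 : R) (x : vec k) (z : vec k.+1) :
  vdot (Defs.cons_tuple (x0, x)) z = x0 * tnth z ord0 + vdot x (vtail z).
Proof.
rewrite /vdot big_ord_recl cons_tuple0; congr (_ + _).
by apply: eq_bigr => i _; rewrite cons_tupleS tnth_mktuple.
Qed.

Lemma vdot_recl k (x y : vec k.+1) :
  vdot x y = tnth x ord0 * tnth y ord0 + vdot (vtail x) (vtail y).
Proof.
rewrite /vdot big_ord_recl; congr (_ + _).
by apply: eq_bigr => i _; rewrite !tnth_mktuple.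
Qed.

Lemma vdot_ge0 k (x : vec k) : 0 <= vdot x x.
Proof. by apply: sumr_ge0 => i _; rewrite -expr2 sqr_ge0. Qed.

End vectors.

Section gaussian_vector.
Context {R : realType}.
Local Notation vec k := (vec R k).
Local Notation N01 := (@N01 R).

Definition gauss k := power_measure N01 k.

Lemma gaussT k : gauss k setT = 1%E.
Proof. by apply: power_measureT; exact: N01T. Qed.

Lemma gauss_lty k : (gauss k setT < +oo)%E.
Proof. by rewrite gaussT ltry. Qed.

Lemma measurable_cons_x (dT : measure_display) (T : measurableType dT) k (a : T -> R) (b : T -> vec k) :
  measurable_fun setT a -> measurable_fun setT b ->
  measurable_fun setT (fun w => Defs.cons_tuple (a w : measurableTypeR R, b w)).
Proof.
move=> ma mb; apply: (measurableT_comp (@measurable_cons_tuple _ (measurableTypeR R) k)).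
exact: measurable_fun_pair.
Qed.

(** Density of the standard normal law translated by u with respect to that law. *)
Definition tilt k (u z : vec k) : R := expR (vdot z u - vdot u u / 2).

Lemma measurable_tilt k (u : vec k) : measurable_fun setT (tilt u).
Proof.
apply: measurableT_comp => //; apply: measurable_funB => //.
exact: measurable_vdot.
Qed.

Lemma ge0_gauss_shift k (u : vec k) (F : vec k -> \bar R) : measurable_fun setT F ->
  (forall z, 0 <= F z)%E ->
  (\int[gauss k]_z F (vax z 1%R u) = \int[gauss k]_z (F z * (tilt u z)%:E))%E.
Proof.
elim: k u F => [|k IH] u F mF F0.
  rewrite !integral_power0//.
  - rewrite /tilt /vdot !big_ord0 mul0r subr0 expR0 mule1.
    by congr F; apply: eq_from_tnth => -[].
  - by apply: emeasurable_funM => //; apply/measurable_EFinP; exact: measurable_tilt.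
  - by apply: (measurableT_comp mF); exact: measurable_vax.
rewrite ge0_integral_powerS//; last first.
  by apply: (measurableT_comp mF); exact: measurable_vax.
have m2 : measurable_fun setT (fun z => F z * (tilt u z)%:E)%E.
  by apply: emeasurable_funM => //; apply/measurable_EFinP; exact: measurable_tilt.
have p2 z : (0 <= F z * (tilt u z)%:E)%E by rewrite mule_ge0// lee_fin expR_ge0.
apply: (eq_trans _ (esym (@ge0_integral_powerS _ _ _ N01 k _ m2 p2))).
set u0 := tnth u ord0; set u' := vtail u.
pose H (x : measurableTypeR R) := (\int[gauss k]_t (F (Defs.cons_tuple (x, t)) * (tilt u' t)%:E))%E.
have mHx (x : R) : measurable_fun setT (fun t => (F (Defs.cons_tuple (x : measurableTypeR R, t)) * (tilt u' t)%:E))%E.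
  apply: emeasurable_funM; last by apply/measurable_EFinP; exact: measurable_tilt.
  by apply: (measurableT_comp mF); exact: measurable_cons_x.
have mH : measurable_fun setT H.
  apply: (measurable_fun_fubini_tonelli_F
    (fun z => F (Defs.cons_tuple z) * (tilt u' z.2)%:E)%E); last first.
    by move=> z; rewrite mule_ge0// lee_fin expR_ge0.
  apply: emeasurable_funM.
    by apply: (measurableT_comp mF); exact: measurable_cons_tuple.
  by apply/measurable_EFinP; apply: (measurableT_comp (measurable_tilt u')).
have H0 x : (0 <= H x)%E.
  by apply: integral_ge0 => t _; rewrite mule_ge0// lee_fin expR_ge0.
transitivity (\int[N01]_x H (x + u0)%R)%E.
  apply: eq_integral => x _.
  transitivity (\int[gauss k]_t F (Defs.cons_tuple ((x + u0)%R : measurableTypeR R, vax t 1%R u')))%E.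
    by apply: eq_integral => t _; rewrite cons_vax mul1r.
  rewrite (IH u' (fun t => F (Defs.cons_tuple ((x + u0)%R : measurableTypeR R, t))))//.
  by apply: (measurableT_comp mF); exact: measurable_cons_x.
apply: (eq_trans (ge0_N01_shift u0 mH H0)); apply: eq_integral => x _.
rewrite /H muleC -ge0_integralZl_EFin ?expR_ge0//; last first.
  by move=> t _; rewrite mule_ge0// lee_fin expR_ge0.
apply: eq_integral => t _; rewrite muleCA; congr (_ * _)%E; rewrite -EFinM.
rewrite /tilt -expRD vdot_cons (vdot_recl u u) -/u0 -/u'; congr (EFin (expR _)).
by rewrite expr2; field.
Qed.

(** Tonelli brings the two first coordinates together for [ge0_N01_conv]; the remaining coordinates
    are left to the induction hypothesis. *)
Lemma ge0_gauss_conv k (x : vec k) (s t : R) (F : vec k -> \bar R) : measurable_fun setT F ->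
  (forall z, 0 <= F z)%E ->
  (\int[gauss k]_z \int[gauss k]_y F (vax (vax x s z) t y) =
   \int[gauss k]_z F (vax x (Num.sqrt (s ^+ 2 + t ^+ 2)) z))%E.
Proof.
elim: k x F => [|k IH] x F mF F0.
  have e0 (a b : vec 0) : a = b by apply: eq_from_tnth => -[].
  rewrite !integral_power0//.
  - by congr F; exact: e0.
  - by apply: (measurableT_comp mF); exact: measurable_vax.
  - by apply: (measurableT_comp mF); exact: measurable_vax.
  - rewrite (_ : (fun _ => _) = cst (F [tuple]))//.
    apply/funext => z; rewrite integral_power0//.
      by congr F; exact: e0.
    by apply: (measurableT_comp mF); exact: measurable_vax.
set r := Num.sqrt _; set x0 := tnth x ord0; set x' := vtail x.
have m_in z : measurable_fun setT (fun y : vec k.+1 => F (vax (vax x s z) t y)).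
  by apply: (measurableT_comp mF); exact: measurable_vax.
have m_out : measurable_fun setT (fun z : vec k.+1 => \int[gauss k.+1]_y F (vax (vax x s z) t y))%E.
  apply: (measurable_fun_fubini_tonelli_F
    (fun p : vec k.+1 * vec k.+1 => F (vax (vax x s p.1) t p.2))) => //.
  apply: (measurableT_comp mF); apply: measurable_vax => //.
  exact: measurable_vax.
rewrite ge0_integral_powerS//; last by move=> z; exact: integral_ge0.
pose f (a b : R) (z y : vec k) :=
  F (Defs.cons_tuple ((x0 + (s * a + t * b))%R : measurableTypeR R, vax (vax x' s z) t y)).
have mf (dT : measure_display) (T : measurableType dT) (a b : T -> R) (z y : T -> vec k) :
    measurable_fun setT a -> measurable_fun setT b -> measurable_fun setT z ->
    measurable_fun setT y -> measurable_fun setT (fun w => f (a w) (b w) (z w) (y w)).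
  move=> ma mb mz my; apply: (measurableT_comp mF); apply: measurable_cons_x.
    by apply: measurable_funD => //; apply: measurable_funD; exact: measurable_funM.
  by apply: measurable_vax => //; exact: measurable_vax.
have f0 a b z y : (0 <= f a b z y)%E by exact: F0.
pose H (v : R) := (\int[gauss k]_z F (Defs.cons_tuple (v : measurableTypeR R, vax x' r z)))%E.
have mH : measurable_fun setT H.
  apply: (measurable_fun_fubini_tonelli_F
    (fun p : measurableTypeR R * vec k => F (Defs.cons_tuple (p.1, vax x' r p.2)))) => //.
  apply: (measurableT_comp mF); apply: measurable_cons_x => //.
  exact: measurable_vax.
have H0 v : (0 <= H v)%E by exact: integral_ge0.
transitivity (\int[N01]_a \int[N01]_b H (x0 + (s * a + t * b))%R)%E.
  apply: eq_integral => a _.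
  transitivity (\int[gauss k]_z \int[N01]_b \int[gauss k]_y f a b z y)%E.
    apply: eq_integral => z _; rewrite (@ge0_integral_powerS _ _ _ N01 k _ (m_in _)); last by move=> y; exact: F0.
    apply: eq_integral => b _; apply: eq_integral => y _.
    rewrite /f; congr F; rewrite vax_cons !vax_cons cons_tuple0 addrA.
    by rewrite vtail_cons.
  have mm : measurable_fun setT (fun p : vec k * measurableTypeR R =>
      \int[gauss k]_y f a p.2 p.1 y)%E.
    apply: (measurable_fun_fubini_tonelli_F
      (fun p : (vec k * measurableTypeR R) * vec k => f a p.1.2 p.1.1 p.2)) => //.
    apply: mf => //; apply: (measurableT_comp _ measurable_fst); [exact: measurable_snd|exact: measurable_fst].
  have mm0 p : (0 <= \int[gauss k]_y f a p.2 p.1 y)%E by exact: integral_ge0.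
  apply: (eq_trans (@fubini_tonelli _ _ _ _ R (gauss k) N01
    (fun p : vec k * measurableTypeR R => \int[gauss k]_y f a p.2 p.1 y)%E mm mm0)).
  apply: eq_integral => b _ /=.
  rewrite (IH x' (fun z => F (Defs.cons_tuple ((x0 + (s * a + t * b))%R : measurableTypeR R, z))))//.
  by apply: (measurableT_comp mF); exact: measurable_cons_x.
have mHx : measurable_fun setT (fun v => H (x0 + v)).
  by apply: (measurableT_comp mH); exact: measurable_funD.
apply: (eq_trans (ge0_N01_conv s t mHx (fun v => H0 (x0 + v)))).
have m3 : measurable_fun setT (fun z => F (vax x r z)).
  by apply: (measurableT_comp mF); exact: measurable_vax.
apply: (eq_trans _ (esym (@ge0_integral_powerS _ _ _ N01 k _ m3 (fun z => F0 _)))).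
apply: eq_integral => a _; apply: eq_integral => z _.
by rewrite vax_cons.
Qed.

(** Each coordinate merges with the others by [ge0_N01_conv]. It reduces integrals of functions of a
    linear form to the line. *)
Lemma ge0_gauss_linear k (a : vec k) (c : R) (f : R -> \bar R) : measurable_fun setT f ->
  (forall x, 0 <= f x)%E ->
  (\int[gauss k]_z f (c + vdot z a)%R = \int[N01]_x f (c + Num.sqrt (vdot a a) * x)%R)%E.
Proof.
move=> mf f0; elim: k a c => [|k IH] a c.
  rewrite integral_power0; last first.
    apply: (measurableT_comp mf); apply: measurable_funD => //; exact: measurable_vdot.
  rewrite /vdot !big_ord0 sqrtr0; under eq_integral do rewrite mul0r.
  by rewrite integral_N01_cst.
have mz (dT : measure_display) (T : measurableType dT) (b : T -> R) : measurable_fun setT b ->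
    measurable_fun setT (fun w => f (c + b w)).
  by move=> mb; apply: (measurableT_comp mf); exact: measurable_funD.
rewrite ge0_integral_powerS//; last by apply: mz; exact: measurable_vdot.
set a0 := tnth a ord0; set a' := vtail a.
transitivity (\int[N01]_x \int[N01]_y f (c + (a0 * x + Num.sqrt (vdot a' a') * y))%R)%E.
  apply: eq_integral => x _.
  transitivity (\int[gauss k]_z f ((c + a0 * x) + vdot z a')%R)%E.
    by apply: eq_integral => z _; rewrite vdot_cons -/a0 -/a' addrA [x * _]mulrC.
  by rewrite IH; apply: eq_integral => y _; rewrite addrA.
apply: (eq_trans (ge0_N01_conv a0 _ (mz _ _ _ (@measurable_id _ _ _)) (fun v => f0 (c + v)%R))).
rewrite sqr_sqrtr ?vdot_ge0//; apply: eq_integral => x _.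
by rewrite vdot_recl -expr2.
Qed.

Lemma Rint_gauss_shift k (u : vec k) (f : vec k -> R) : measurable_fun setT f ->
  \int[gauss k]_z f (vax z 1 u) = \int[gauss k]_z (f z * tilt u z).
Proof.
move=> mf; rewrite /Rintegral; congr fine.
have mfE : measurable_fun setT (EFin \o f) by exact/measurable_EFinP.
rewrite integralE [RHS]integralE; congr (_ - _)%E.
  transitivity (\int[gauss k]_z ((EFin \o f)^\+ (vax z 1%R u)))%E.
    by apply: eq_integral => x _; rewrite !funeposE.
  rewrite (ge0_gauss_shift u (F := ((EFin \o f)^\+)%E))//; last exact: measurable_funepos.
  apply: eq_integral => x _; rewrite !funeposE EFinM muleC.
  by rewrite maxeMr ?lee_fin ?expR_ge0// mule0 [in RHS]muleC.
transitivity (\int[gauss k]_z ((EFin \o f)^\- (vax z 1%R u)))%E.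
  by apply: eq_integral => x _; rewrite !funenegE.
rewrite (ge0_gauss_shift u (F := ((EFin \o f)^\-)%E))//; last exact: measurable_funeneg.
apply: eq_integral => x _; rewrite !funenegE EFinM -mulNe muleC.
by rewrite maxeMr ?lee_fin ?expR_ge0// mule0 [in RHS]muleC.
Qed.

Lemma Rint_gauss_linear k (a : vec k) (f : R -> R) : measurable_fun setT f ->
  \int[gauss k]_z f (vdot z a) = \int[N01]_x f (Num.sqrt (vdot a a) * x).
Proof.
move=> mf; rewrite /Rintegral; congr fine.
have mfE : measurable_fun setT (EFin \o f) by exact/measurable_EFinP.
rewrite integralE [RHS]integralE; congr (_ - _)%E.
  have h := @ge0_gauss_linear k a 0 ((EFin \o f)^\+)%E (measurable_funepos mfE) (funepos_ge0 _).
  transitivity (\int[gauss k]_z ((EFin \o f)^\+ (0 + vdot z a)%R))%E.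
    by apply: eq_integral => z _; rewrite !funeposE add0r.
  by rewrite h; apply: eq_integral => z _; rewrite !funeposE add0r.
have h := @ge0_gauss_linear k a 0 ((EFin \o f)^\-)%E (measurable_funeneg mfE) (funeneg_ge0 _).
transitivity (\int[gauss k]_z ((EFin \o f)^\- (0 + vdot z a)%R))%E.
  by apply: eq_integral => z _; rewrite !funenegE add0r.
by rewrite h; apply: eq_integral => z _; rewrite !funenegE add0r.
Qed.

End gaussian_vector.

(** * The central limit theorem by Lindeberg replacement *)

Section exp_third_order.
Context {R : realType}.

Lemma expR_sub3_le (a : R) : `|expR a - 1 - a - a ^+ 2 / 2| <= `|a| ^+ 3 * expR `|a|.
Proof.
pose f (t : R) := expR t - (1 + t + 2^-1 * t ^+ 2).
have df t : is_derive t (1 : R) f (expR t - 1 - t).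
  have d1 : is_derive t (1 : R) (fun y : R => 1 + y) 1.
    have := der_add (is_derive_cst (1 : R) t 1) (is_derive_id t (1 : R)).
    by rewrite add0r.
  have := der_sub (is_derive_expR t) (der_add d1 (der_sqr 2^-1 t)).
  by move=> h; apply: (der_eq h); field.
have cf : continuous f.
  move=> t; apply: differentiable_continuous; apply/derivable1_diffP.
  by have [] := df t.
have f0 : f 0 = 0 by rewrite /f expR0 expr0n mulr0 !addr0 subrr.
have fE : expR a - 1 - a - a ^+ 2 / 2 = f a by rewrite /f; field.
have key c : `|c| <= `|a| -> `|(expR c - 1 - c) * a| <= `|a| ^+ 3 * expR `|a|.
  move=> ca; rewrite normrM [X in _ <= X](_ : _ = (`|a| ^+ 2 * expR `|a|) * `|a|); last ring.
  apply: ler_wpM2r => //; apply: (le_trans (expR_sub2_le c)).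
  apply: ler_pM; rewrite ?sqr_ge0 ?expR_ge0 ?ler_expR//.
  by rewrite -[c ^+ 2]real_normK ?num_real// ler_sqr ?nnegrE.
rewrite fE; have [->|a0] := eqVneq a 0; first by rewrite f0 normr0 expr0n mul0r.
have [ap|an] := ltP 0 a.
  have [|c] := @MVT R f _ 0 a ap (fun x _ => df x).
    exact: continuous_subspaceT.
  rewrite f0 !subr0 in_itv /= => /andP[c0 ca] ->; apply: key.
  by rewrite !gtr0_norm// ltW.
have {}an : a < 0 by rewrite lt_neqAle a0.
have [|c] := @MVT R f _ a 0 an (fun x _ => df x).
  exact: continuous_subspaceT.
rewrite f0 in_itv /= => /andP[ca c0] h.
have -> : f a = (expR c - 1 - c) * a by lra.
by apply: key; rewrite !ltr0_norm// lerN2 ltW.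
Qed.

Local Notation N01 := (@N01 R).

(** Remainder of the Hermite generating function after degree 2. *)
Definition hrem (t x : R) : R := expR (t * x - t ^+ 2 / 2) - 1 - t * x - t ^+ 2 * (x ^+ 2 - 1) / 2.

Lemma L1_tilt1 (t : R) : L1 N01 (fun x => expR (t * x - t ^+ 2 / 2)) /\
  \int[N01]_x expR (t * x - t ^+ 2 / 2) = 1.
Proof.
have me : measurable_fun setT (fun x : R => expR (t * x - t ^+ 2 / 2)).
  by apply: measurableT_comp => //; apply: measurable_funB.
have e : (fun x : R => expR (t * x - t ^+ 2 / 2)) = fun x => expR (- (t ^+ 2 / 2)) * expR (t * x).
  by apply/funext => x; rewrite -expRD; congr expR; ring.
split; first by rewrite e; apply: L1Z; exact: L1_N01_expR.
transitivity (\int[N01]_x (cst (1 : R) x * expR (x * t - t ^+ 2 / 2))).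
  by apply: eq_Rintegral => x _; rewrite mul1r mulrC.
rewrite -(@Rint_N01_shift _ (cst 1) t) ?Rint_N01_cst//.
- by apply: L1_cst; exact: N01_lty.
- rewrite (_ : (fun _ => _) = fun x => expR (- (t ^+ 2 / 2)) * expR (t * x)).
    by apply: L1Z; exact: L1_N01_expR.
  by apply/funext => x; rewrite mul1r -expRD; congr expR; ring.
Qed.

Lemma L1_hrem t : L1 N01 (hrem t).
Proof.
apply: L1B; last first.
  rewrite (_ : (fun _ => _) = fun x => (t ^+ 2 / 2) * (x ^+ 2 - 1)); last by apply/funext => x; ring.
  by apply/L1Z/L1B; [exact: L1_N01_monom|apply: L1_cst; exact: N01_lty].
apply: L1B; last by apply: L1Z; exact: (L1_N01_monom 1).
by apply: L1B; [exact: (L1_tilt1 t).1|apply: L1_cst; exact: N01_lty].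
Qed.

Lemma hrem_bound : exists C : R, 0 <= C /\
  forall t, 0 <= t -> \int[N01]_x `|hrem t x| <= C * t ^+ 3.
Proof.
pose b (x : R) := (`|x| + 1) ^+ 3 * expR (1 * (`|x| + 1)).
have lb : L1 N01 b by exact: L1_N01_dom.
have b0 x : 0 <= b x by rewrite mulr_ge0 ?expR_ge0// exprn_ge0// addr_ge0.
pose c (x : R) := 2 + `|x| + x ^+ 2.
have lc : L1 N01 c.
  apply: L1D; last exact: L1_N01_monom.
  by apply: L1D; [apply: L1_cst; exact: N01_lty|apply: L1_abs; exact: (L1_N01_monom 1)].
have c0 x : 0 <= c x by rewrite !addr_ge0 ?sqr_ge0.
have B0 : 0 <= \int[N01]_x b x by exact: Rint_ge0.
have C0 : 0 <= \int[N01]_x c x by exact: Rint_ge0.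
exists (2 * \int[N01]_x b x + (1 + \int[N01]_x c x)); split.
  by rewrite addr_ge0// ?mulr_ge0// addr_ge0.
(* For t <= 1 this is a Taylor estimate. For t > 1 every term of [hrem] is in mean at most a
   multiple of t^3 already. *)
move=> t t0; have [t1|t1] := leP t 1.
  apply: (@le_trans _ _ (\int[N01]_x (2 * t ^+ 3 * b x))).
    apply: Rint_le; [by apply: L1_abs; exact: L1_hrem|exact: L1Z|move=> x].
    set a := t * x - t ^+ 2 / 2; set D := `|x| + 1.
    have x0 : 0 <= `|x| by [].
    have D1 : 1 <= D by rewrite /D lerDr.
    have aD : `|a| <= t * D.
      have t20 : 0 <= t ^+ 2 / 2 by rewrite divr_ge0 ?sqr_ge0.
      rewrite /a (le_trans (ler_normB _ _))// normrM (ger0_norm t0) (ger0_norm t20) /D; nra.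
    have eD : expR `|a| <= expR D by rewrite ler_expR (le_trans aD)//; nra.
    have e1 : 1 <= expR D by apply: expR_ge1; lra.
    (* The Taylor expansion at a = t x - t^2 / 2 differs from the Hermite expansion by the terms of
       a^2 / 2 of order t^3 and t^4. *)
    have -> : hrem t x = (expR a - 1 - a - a ^+ 2 / 2) + (- (t ^+ 3 * x / 2) + t ^+ 4 / 8).
      by rewrite /hrem -/a; move: (expR a) => e; rewrite /a; field.
    apply: (le_trans (ler_normD _ _)).
    have h1 : `|expR a - 1 - a - a ^+ 2 / 2| <= t ^+ 3 * (D ^+ 3 * expR D).
      apply: (le_trans (expR_sub3_le a)); rewrite mulrA -exprMn.
      apply: ler_pM; rewrite ?expR_ge0 ?exprn_ge0//.
      by apply: lerXn2r; rewrite ?nnegrE// mulr_ge0//; lra.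
    have t30 : 0 <= t ^+ 3 by rewrite exprn_ge0.
    have h2 : `|- (t ^+ 3 * x / 2) + t ^+ 4 / 8| <= t ^+ 3 * D.
      apply: (le_trans (ler_normD _ _)); rewrite normrN (normrM (t ^+ 3 * x)) (normrM (t ^+ 3)) normfV (ger0_norm t30).
      rewrite [`|2|]ger0_norm// [`|t ^+ 4 / 8|]ger0_norm ?divr_ge0 ?exprn_ge0//.
      have : t ^+ 4 <= t ^+ 3 by rewrite exprS; nra.
      rewrite /D; nra.
    have D3 : D <= D ^+ 3 * expR D.
      have D2 : 1 <= D ^+ 2 by rewrite expr2; nra.
      have h3 : 1 <= D ^+ 2 * expR D by nra.
      by rewrite exprS -mulrA ler_peMr//; lra.
    rewrite /b mul1r -/D; nra.
  rewrite RintZ//; have : 0 <= t ^+ 3 by rewrite exprn_ge0.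
  nra.
apply: (@le_trans _ _ (\int[N01]_x (expR (t * x - t ^+ 2 / 2) + t ^+ 3 * c x))).
  apply: Rint_le; [by apply: L1_abs; exact: L1_hrem|apply: L1D; [exact: (L1_tilt1 t).1|exact: L1Z]|move=> x].
  rewrite /hrem -!addrA; apply: (le_trans (ler_normD _ _)).
  rewrite (ger0_norm (expR_ge0 _)) lerD2l.
  have x0 : 0 <= `|x| by [].
  have x2 : 0 <= x ^+ 2 by exact: sqr_ge0.
  have t2 : t <= t ^+ 2 by rewrite expr2; nra.
  have t3 : t ^+ 2 <= t ^+ 3 by rewrite [t ^+ 3]exprS; nra.
  apply: (le_trans (ler_normD _ _)); rewrite normrN normr1.
  apply: (@le_trans _ _ (1 + (t * `|x| + t ^+ 2 * (x ^+ 2 + 1) / 2))).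
    rewrite lerD2l (le_trans (ler_normD _ _))// !normrN lerD//.
      by rewrite normrM (ger0_norm t0).
    rewrite ler_norml; apply/andP; split; nra.
  rewrite /c; nra.
rewrite RintD; [|exact: (L1_tilt1 t).1|exact: L1Z].
rewrite (L1_tilt1 t).2 RintZ//.
have t31 : 1 <= t ^+ 3 by rewrite -(expr1n _ 3); apply: lerXn2r; rewrite ?nnegrE// ltW.
nra.
Qed.

End exp_third_order.

(** * Integrals of bounded functions *)

Section bounded_integrals.
Context {R : realType}.

Lemma bint (d : measure_display) (T : measurableType d) (m : {measure set T -> \bar R})
  (f : T -> R) M : m setT = 1%E -> measurable_fun setT f -> (forall x, 0 <= f x <= M) ->
  [/\ L1 m f, (\int[m]_x f x)%:E = (\int[m]_x (f x)%:E)%E & 0 <= \int[m]_x f x <= M].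
Proof.
move=> m1 mf fM; have mlt : (m setT < +oo)%E by rewrite m1 ltry.
have lf : L1 m f.
  apply: (L1_bounded (M := M)) => // x.
  by have /andP[f0 fm] := fM x; rewrite ger0_norm.
split => //; first exact: RintE.
apply/andP; split; first by apply: Rint_ge0 => x; have /andP[] := fM x.
have -> : M = \int[m]_x M by rewrite /Rintegral integral_cst// m1 mule1.
by apply: Rint_le => //; [exact: L1_cst|move=> x; have /andP[] := fM x].
Qed.

Lemma Rint_close (d : measure_display) (T : measurableType d) (m : {measure set T -> \bar R})
  (f g : T -> R) D : m setT = 1%E -> L1 m f -> L1 m g -> (forall x, `|f x - g x| <= D) ->
  `|\int[m]_x f x - \int[m]_x g x| <= D.
Proof.
move=> m1 lf lg fg; rewrite -RintB//.
apply: (le_trans (Rint_abs (L1B lf lg))).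
have -> : D = \int[m]_x D by rewrite /Rintegral integral_cst// m1 mule1.
apply: Rint_le => //; first by apply/L1_abs/L1B.
by apply: L1_cst; rewrite m1 ltry.
Qed.

Lemma measurable_Rint_param (d1 d2 : measure_display) (T1 : measurableType d1)
  (T2 : measurableType d2) (m : {sigma_finite_measure set T2 -> \bar R}) (f : T1 * T2 -> R) :
  measurable_fun setT f -> (forall p, 0 <= f p) ->
  measurable_fun setT (fun x => \int[m]_y f (x, y)).
Proof.
move=> mf f0; apply: (measurableT_comp (@fine_measurable _ _ measurableT)).
apply: (measurable_fun_fubini_tonelli_F (fun p => (f p)%:E)) => //.
  exact/measurable_EFinP.
Qed.

Lemma Rint_swap (d1 d2 : measure_display) (T1 : measurableType d1)
  (T2 : measurableType d2) (m1 : {sigma_finite_measure set T1 -> \bar R})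
  (m2 : {sigma_finite_measure set T2 -> \bar R}) (f : T1 * T2 -> R) M :
  m1 setT = 1%E -> m2 setT = 1%E -> measurable_fun setT f -> (forall p, 0 <= f p <= M) ->
  \int[m1]_x \int[m2]_y f (x, y) = \int[m2]_y \int[m1]_x f (x, y).
Proof.
move=> h1 h2 mf fM.
have f0 p : 0 <= f p by have /andP[] := fM p.
have mx x : measurable_fun setT (fun y => f (x, y)).
  by apply: (measurableT_comp mf); exact: measurable_pair1.
have my y : measurable_fun setT (fun x => f (x, y)).
  by apply: (measurableT_comp mf); exact: measurable_pair2.
have mfE : measurable_fun setT (EFin \o f) by exact/measurable_EFinP.
have f0E p : (0 <= (EFin \o f) p)%E by rewrite lee_fin.
have i1 x := bint h2 (mx x) (fun y => fM (x, y)).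
have i2 y := bint h1 (my y) (fun x => fM (x, y)).
rewrite [LHS]/Rintegral [RHS]/Rintegral; congr fine.
have e1 : (\int[m1]_x (\int[m2]_y f (x, y))%:E = \int[m1]_x \int[m2]_y (f (x, y))%:E)%E.
  by apply: eq_integral => x _; have [_ ->] := i1 x.
have e2 : (\int[m2]_y (\int[m1]_x f (x, y))%:E = \int[m2]_y \int[m1]_x (f (x, y))%:E)%E.
  by apply: eq_integral => y _; have [_ ->] := i2 y.
by rewrite e1 e2; exact: (@fubini_tonelli _ _ _ _ R m1 m2 (EFin \o f) mfE f0E).
Qed.

Lemma Rint_powerS (d : measure_display) (T : measurableType d)
  (mu : {sigma_finite_measure set T -> \bar R}) n (F : n.+1.-tuple T -> R) M :
  mu setT = 1%E -> measurable_fun setT F -> (forall p, 0 <= F p <= M) ->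
  \int[power_measure mu n.+1]_t F t =
  \int[mu]_x \int[power_measure mu n]_t F (Defs.cons_tuple (x, t)).
Proof.
move=> h1 mF FM; have hn := power_measureT n h1.
have F0 p : 0 <= F p by have /andP[] := FM p.
have mx x : measurable_fun setT (fun t => F (Defs.cons_tuple (x, t))).
  apply: (measurableT_comp mF); apply: (measurableT_comp (@measurable_cons_tuple _ T n)).
  exact: measurable_pair1.
have i1 x := bint hn (mx x) (fun t => FM (Defs.cons_tuple (x, t))).
have mFE : measurable_fun setT (EFin \o F) by exact/measurable_EFinP.
have F0E p : (0 <= (EFin \o F) p)%E by rewrite lee_fin.
rewrite [LHS]/Rintegral [RHS]/Rintegral; congr fine.
have e1 : (\int[mu]_x (\int[power_measure mu n]_t F (Defs.cons_tuple (x, t)))%:E =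
    \int[mu]_x \int[power_measure mu n]_t (F (Defs.cons_tuple (x, t)))%:E)%E.
  by apply: eq_integral => x _; have [_ ->] := i1 x.
by rewrite e1; exact: (@ge0_integral_powerS _ _ _ mu n (EFin \o F) mFE F0E).
Qed.

Lemma Rint_power0 (d : measure_display) (T : measurableType d)
  (mu : {sigma_finite_measure set T -> \bar R}) (F : 0.-tuple T -> R) :
  measurable_fun setT F -> \int[power_measure mu 0]_t F t = F [tuple].
Proof.
by move=> mF; rewrite /Rintegral integral_power0//; exact/measurable_EFinP.
Qed.

End bounded_integrals.

Lemma Rint_cst1 (R : realType) (d : measure_display) (T : measurableType d)
  (m : {measure set T -> \bar R}) (c : R) : m setT = 1%E -> \int[m]_x c = c.
Proof. by move=> m1; rewrite /Rintegral integral_cst// m1 mule1. Qed.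

Section gauss_moments.
Context {R : realType}.
Local Notation vec k := (vec R k).
Local Notation N01 := (@N01 R).
Local Notation gauss := (@gauss R).

Lemma gauss_monomial k (m : 'I_k -> nat) :
  L1 (gauss k) (fun z => \prod_i tnth z i ^+ m i) /\
  \int[gauss k]_z (\prod_i tnth z i ^+ m i) = \prod_i \int[N01]_x (x ^+ m i).
Proof.
apply: (@L1_power_prod _ _ _ N01 k (fun i x => x ^+ m i)); first exact: N01T.
by move=> i; exact: L1_N01_monom.
Qed.

Lemma N01_var : \int[N01]_x (x ^+ 2) = 1.
Proof. by rewrite gauss_ibp mul1r; under eq_Rintegral do rewrite expr0; rewrite Rint_N01_cst. Qed.

Lemma N01_moment0 : \int[N01]_x (x ^+ 0) = 1.
Proof. by under eq_Rintegral do rewrite expr0; rewrite Rint_N01_cst. Qed.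

Lemma prod_delta k (a : 'I_k) (z : vec k) : \prod_i tnth z i ^+ (i == a) = tnth z a.
Proof.
rewrite (bigD1 a)//= eqxx expr1 big1 ?mulr1// => i /negbTE ->; by rewrite expr0.
Qed.

Lemma gauss_coord k (a : 'I_k) : L1 (gauss k) (fun z => tnth z a) /\
  \int[gauss k]_z tnth z a = 0.
Proof.
have [l e] := gauss_monomial (fun i => (i == a)%N).
have E : (fun z : vec k => \prod_i tnth z i ^+ (i == a)) = fun z => tnth z a.
  by apply/funext => z; exact: prod_delta.
rewrite E in l e; split => //; rewrite e (bigD1 a)//= eqxx.
by rewrite (gauss_mean (R := R)) mul0r.
Qed.

Lemma gauss_coord2 k (a b : 'I_k) : L1 (gauss k) (fun z => tnth z a * tnth z b) /\
  \int[gauss k]_z (tnth z a * tnth z b) = (a == b)%:R.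
Proof.
have [l e] := gauss_monomial (fun i => ((i == a) + (i == b))%N).
have E : (fun z : vec k => \prod_i tnth z i ^+ ((i == a) + (i == b))) =
    fun z => tnth z a * tnth z b.
  apply/funext => z; under eq_bigr do rewrite exprD.
  by rewrite big_split /= !prod_delta.
rewrite E in l e; split => //; rewrite e; case: eqVneq => [<-|ab].
  rewrite (bigD1 a)//= eqxx N01_var mul1r big1// => i /negbTE ->.
  exact: N01_moment0.
by rewrite (bigD1 a)//= eqxx (negbTE ab) (gauss_mean (R := R)) mul0r.
Qed.

Lemma gauss_coord4 k (a b : 'I_k) : L1 (gauss k) (fun z => tnth z a ^+ 2 * tnth z b ^+ 2).
Proof.
have [l _] := gauss_monomial (fun i => (2 * (i == a) + 2 * (i == b))%N).
have E : (fun z : vec k => \prod_i tnth z i ^+ (2 * (i == a) + 2 * (i == b))) =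
    fun z => tnth z a ^+ 2 * tnth z b ^+ 2.
  apply/funext => z; under eq_bigr do rewrite exprD mulnC exprM mulnC exprM.
  rewrite big_split /= !prodrXl !prod_delta//.
by rewrite E in l.
Qed.

Lemma gauss_sqn2 k : L1 (gauss k) (fun z => vdot z z ^+ 2).
Proof.
rewrite (_ : (fun _ => _) = fun z => \sum_(a < k) \sum_(b < k) (tnth z a ^+ 2 * tnth z b ^+ 2)).
  by apply: L1_sum => a _; apply: L1_sum => b _; exact: gauss_coord4.
apply/funext => z; rewrite expr2 /vdot mulr_suml; apply: eq_bigr => a _.
by rewrite mulr_sumr; apply: eq_bigr => b _; rewrite -!expr2.
Qed.

End gauss_moments.

(** * Gaussian smoothing of a bounded function *)

Section smoothing.
Context {R : realType} {k : nat}.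
Local Notation vec := (vec R k).
Local Notation N01 := (@N01 R).
Local Notation gauss := (@gauss R k).
Variables (g : vec -> R) (M : R).
Hypothesis mg : measurable_fun setT g.
Hypothesis gM : forall x, 0 <= g x <= M.

Definition smooth (s : R) (x : vec) : R := \int[gauss]_z g (vax x s z).

Lemma M_ge0 : 0 <= M.
Proof. by have /andP[h1 h2] := gM [tuple 0 | i < k]; exact: le_trans h1 h2. Qed.

Let mgx x s : measurable_fun setT (fun z => g (vax x s z)).
Proof. by apply: (measurableT_comp mg); exact: measurable_vax. Qed.

Let bx x s := bint (gaussT k) (mgx x s) (fun z => gM _).

Lemma smooth_bound s x : 0 <= smooth s x <= M.
Proof. by have [] := bx x s. Qed.

Lemma measurable_smooth s : measurable_fun setT (smooth s).
Proof.
apply: (@measurable_Rint_param _ _ _ _ _ gauss (fun p => g (vax p.1 s p.2))) => [|p].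
  by apply: (measurableT_comp mg); exact: measurable_vax.
by have /andP[] := gM (vax p.1 s p.2).
Qed.

Lemma smooth_conv s t x :
  \int[gauss]_z smooth t (vax x s z) = smooth (Num.sqrt (s ^+ 2 + t ^+ 2)) x.
Proof.
rewrite /smooth [LHS]/Rintegral [RHS]/Rintegral; congr fine.
have mgE : measurable_fun setT (EFin \o g) by exact/measurable_EFinP.
have g0E p : (0 <= (EFin \o g) p)%E by rewrite lee_fin; have /andP[] := gM p.
rewrite -(@ge0_gauss_conv R k x s t (EFin \o g) mgE g0E).
by apply: eq_integral => z _; have [_ -> _] := bx (vax x s z) t.
Qed.

(** The second factor is [tilt u] expanded to second order in u, so that [quad s x u] approximates
    the smoothed function at x + s u without derivatives of g. *)
Definition quad (s : R) (x u : vec) : R :=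
  \int[gauss]_z (g (vax x s z) * (1 + vdot z u + (vdot z u ^+ 2 - vdot u u) / 2)).

Lemma L1_gM s x (f : vec -> R) : measurable_fun setT f -> L1 gauss f ->
  L1 gauss (fun z => g (vax x s z) * f z).
Proof.
move=> mf lf; apply: (L1_le (g := fun z => M * `|f z|)).
- by apply: measurable_funM => //; exact: mgx.
- move=> z; have /andP[g0 g1] := gM (vax x s z).
  by rewrite normrM (ger0_norm g0) ler_wpM2r.
- by apply/L1Z/L1_abs.
Qed.

(** By Cameron-Martin the displacement s u turns into the factor [tilt u] under the integral, and
    only that factor is expanded. Its remainder depends on z through z.u, which is distributed as
    |u| times a standard normal variable, so [hrem_bound] gives an error of order |u|^3. *)
Lemma smooth_quad : exists C : R, 0 <= C /\ forall s x (y u : vec), s != 0 ->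
  (forall i, tnth y i = s * tnth u i) ->
  `|smooth s (vax x 1 y) - quad s x u| <= C * (vdot u u * Num.sqrt (vdot u u)).
Proof.
have [C0 [C00 hC]] := @hrem_bound R.
exists (M * C0); split; first by rewrite mulr_ge0// M_ge0.
move=> s x y u s0 yu; set q := vdot u u; have q0 : 0 <= q by exact: vdot_ge0.
pose rho (w : R) := expR (w - q / 2) - 1 - w - (w ^+ 2 - q) / 2.
have sq : Num.sqrt q ^+ 2 = q by rewrite sqr_sqrtr.
have mrho : measurable_fun setT rho.
  apply: measurable_funB; last by apply: measurable_funM => //; apply: measurable_funB => //; exact: measurable_monom.
  apply: measurable_funB => //; apply: measurable_funB => //.
  by apply: measurableT_comp => //; exact: measurable_funB.
have mar : measurable_fun setT (fun w => `|rho w|) by exact: measurableT_comp.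
have rhoE x' : rho (Num.sqrt q * x') = hrem (Num.sqrt q) x'.
  rewrite /rho /hrem exprMn sq; congr (expR _ - _ - _ - _).
  by field.
have mr : measurable_fun setT (fun z : vec => rho (vdot z u)).
  by apply: (measurableT_comp mrho); exact: measurable_vdot.
have lr : L1 gauss (fun z => rho (vdot z u)).
  apply: L1P => //.
  have := @ge0_gauss_linear R k u 0 (fun w => `|rho w|%:E) _ _.
  move=> /(_ _ (fun w => normr_ge0 _)) h.
  rewrite (_ : (\int[gauss]_x0 _)%E = (\int[N01]_x `|hrem (Num.sqrt q) x|%:E)%E).
    exact/L1_lty/L1_hrem.
  transitivity (\int[gauss]_z (`|rho (0 + vdot z u)%R|%:E))%E.
    by apply: eq_integral => z _; rewrite add0r.
  rewrite h; first by apply: eq_integral => z _; rewrite add0r rhoE.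
  exact/measurable_EFinP.
have ir : \int[gauss]_z `|rho (vdot z u)| <= C0 * (q * Num.sqrt q).
  rewrite (Rint_gauss_linear u mar).
  under eq_Rintegral do rewrite rhoE.
  apply: (le_trans (hC _ (sqrtr_ge0 q))).
  by rewrite exprSr sq.
have e1 : smooth s (vax x 1 y) = \int[gauss]_z (g (vax x s z) * tilt u z).
  rewrite -(Rint_gauss_shift u (mgx x s)) /smooth; apply: eq_Rintegral => z _.
  by congr g; apply: eq_from_tnth => i; rewrite !tnth_vax yu; ring.
have lp : L1 gauss (fun z => 1 + vdot z u + (vdot z u ^+ 2 - q) / 2).
  have lw : L1 gauss (fun z => vdot z u).
    apply: L1_sum => i _; rewrite (_ : (fun _ => _) = fun z => tnth u i * tnth z i).
      by apply: L1Z; exact: (gauss_coord i).1.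
    by apply/funext => z; rewrite mulrC.
  have lw2 : L1 gauss (fun z => vdot z u ^+ 2).
    rewrite (_ : (fun _ => _) = fun z => \sum_(i < k) \sum_(j < k) (tnth u i * tnth u j) * (tnth z i * tnth z j)).
      by apply: L1_sum => i _; apply: L1_sum => j _; apply: L1Z; exact: (gauss_coord2 i j).1.
    apply/funext => z; rewrite expr2 /vdot mulr_suml; apply: eq_bigr => i _.
    by rewrite mulr_sumr; apply: eq_bigr => j _; ring.
  apply: L1D; first by apply: L1D => //; apply: L1_cst; exact: gauss_lty.
  rewrite (_ : (fun _ => _) = fun z => 2^-1 * (vdot z u ^+ 2 - q)); last by apply/funext => z; rewrite mulrC.
  by apply/L1Z/L1B => //; apply: L1_cst; exact: gauss_lty.
have lpg := L1_gM s x (L1_meas lp) lp.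
have lrg := L1_gM s x (L1_meas lr) lr.
have e2 : smooth s (vax x 1 y) - quad s x u = \int[gauss]_z (g (vax x s z) * rho (vdot z u)).
  rewrite e1 /quad -RintB//.
    by apply: eq_Rintegral => z _; rewrite /rho /tilt -/q; ring.
  rewrite (_ : (fun _ => _) = fun z => g (vax x s z) * rho (vdot z u) +
     g (vax x s z) * (1 + vdot z u + (vdot z u ^+ 2 - q) / 2)).
    exact: L1D.
  by apply/funext => z; rewrite /rho /tilt -/q; ring.
rewrite e2; apply: (le_trans (Rint_abs lrg)).
apply: (@le_trans _ _ (\int[gauss]_z (M * `|rho (vdot z u)|))).
  apply: Rint_le; [exact: L1_abs|by apply/L1Z/L1_abs|move=> z].
  have /andP[g0 g1] := gM (vax x s z).
  by rewrite normrM (ger0_norm g0) ler_wpM2r.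
rewrite RintZ; last exact: L1_abs.
by rewrite -mulrA ler_wpM2l// M_ge0.
Qed.

Section one_step.
Context {dE : measure_display} {E : measurableType dE}.
Variables (nu : {sigma_finite_measure set E -> \bar R}) (Y : E -> vec).
Hypothesis nu1 : nu setT = 1%E.
Hypothesis mY : measurable_fun setT Y.
Hypothesis Y2 : L1 nu (fun e => vdot (Y e) (Y e) ^+ 2).
Hypothesis Ymean : forall a, \int[nu]_e tnth (Y e) a = 0.
Hypothesis Ycov : forall a b, \int[nu]_e (tnth (Y e) a * tnth (Y e) b) = (a == b)%:R.

Let nulty : (nu setT < +oo)%E. Proof. by rewrite nu1 ltry. Qed.

Let mYa a : measurable_fun setT (fun e => tnth (Y e) a : R).
Proof. exact: (measurableT_comp (measurable_tnthR a) mY). Qed.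

Let sqY a e : tnth (Y e) a ^+ 2 <= vdot (Y e) (Y e).
Proof.
rewrite /vdot (bigD1 a)//= -expr2 lerDl sumr_ge0// => i _.
by rewrite -expr2 sqr_ge0.
Qed.

Lemma L1_Yq : L1 nu (fun e => vdot (Y e) (Y e)).
Proof.
apply: (L1_le (g := fun e => 1 + vdot (Y e) (Y e) ^+ 2)).
- exact: measurable_vdot.
- by move=> e; rewrite ger0_norm ?vdot_ge0//; nra.
- by apply: L1D => //; exact: L1_cst.
Qed.

Lemma L1_Y2 a b : L1 nu (fun e => tnth (Y e) a * tnth (Y e) b).
Proof.
apply: (L1_le (g := fun e => vdot (Y e) (Y e))); last exact: L1_Yq.
- by apply: measurable_funM; exact: mYa.
- move=> e; have := sqY a e; have := sqY b e; rewrite ler_norml => h1 h2.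
  apply/andP; split; nra.
Qed.

Lemma L1_Y a : L1 nu (fun e => tnth (Y e) a).
Proof.
apply: (L1_le (g := fun e => 1 + vdot (Y e) (Y e))); first exact: mYa.
- move=> e; have := sqY a e; rewrite ler_norml => h1.
  apply/andP; split; nra.
- by apply: L1D; [exact: L1_cst|exact: L1_Yq].
Qed.

Definition norm3 e := vdot (Y e) (Y e) * Num.sqrt (vdot (Y e) (Y e)).

Lemma L1_norm3 : L1 nu norm3.
Proof.
apply: (L1_le (g := fun e => vdot (Y e) (Y e) + vdot (Y e) (Y e) ^+ 2)); last by apply: L1D => //; exact: L1_Yq.
- apply: measurable_funM; first exact: measurable_vdot.
  apply: (measurableT_comp (continuous_measurable_fun (@sqrt_continuous R))).
  exact: measurable_vdot.
- move=> e; rewrite /norm3; set q := vdot _ _.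
  have q0 : 0 <= q by exact: vdot_ge0.
  have s0 := sqrtr_ge0 q; have s2 := sqr_sqrtr q0.
  by rewrite ger0_norm ?mulr_ge0//; nra.
Qed.

(** A quadratic polynomial in Y has a mean determined by the first two moments of Y, so the
    right-hand side is the same for every centred Y with identity covariance. *)
Lemma quad_mean s x (r : R) :
  let qe e := quad s x [tuple r * tnth (Y e) i | i < k] in
  L1 nu qe /\
  \int[nu]_e qe e = smooth s x +
    r ^+ 2 / 2 * ((\sum_i \int[gauss]_z (g (vax x s z) * tnth z i ^+ 2)) - k%:R * smooth s x).
Proof.
pose G1 a := \int[gauss]_z (g (vax x s z) * tnth z a).
pose G2 a b := \int[gauss]_z (g (vax x s z) * (tnth z a * tnth z b)).
have l1 a : L1 gauss (fun z => g (vax x s z) * tnth z a).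
  by apply: L1_gM; [exact: measurable_tnthR|exact: (gauss_coord a).1].
have l2 a b : L1 gauss (fun z => g (vax x s z) * (tnth z a * tnth z b)).
  by apply: L1_gM; [apply: measurable_funM; exact: measurable_tnthR|exact: (gauss_coord2 a b).1].
have [l0 _ _] := bx x s.
have qE (u : vec) : quad s x u = smooth s x * (1 - vdot u u / 2) +
   (\sum_a tnth u a * G1 a + 2^-1 * \sum_a \sum_b (tnth u a * tnth u b) * G2 a b).
  rewrite /quad.
  transitivity (\int[gauss]_z ((1 - vdot u u / 2) * g (vax x s z) +
    ((\sum_a tnth u a * (g (vax x s z) * tnth z a)) +
     2^-1 * \sum_a \sum_b (tnth u a * tnth u b) * (g (vax x s z) * (tnth z a * tnth z b))))).
    apply: eq_Rintegral => z _; set G := g _.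
    have -> : \sum_a tnth u a * (G * tnth z a) = G * vdot z u.
      by rewrite /vdot mulr_sumr; apply: eq_bigr => a _; ring.
    have -> : \sum_a \sum_b (tnth u a * tnth u b) * (G * (tnth z a * tnth z b)) = G * vdot z u ^+ 2.
      rewrite expr2 /vdot mulr_suml mulr_sumr; apply: eq_bigr => a _.
      by rewrite mulr_sumr mulr_sumr; apply: eq_bigr => b _; ring.
    by field.
  have lA : L1 gauss (fun z => \sum_a tnth u a * (g (vax x s z) * tnth z a)).
    by apply: L1_sum => a _; exact: L1Z.
  have lB : L1 gauss (fun z => \sum_a \sum_b (tnth u a * tnth u b) * (g (vax x s z) * (tnth z a * tnth z b))).
    by apply: L1_sum => a _; apply: L1_sum => b _; exact: L1Z.
  rewrite RintD; [|exact: L1Z|by apply: L1D => //; exact: L1Z].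
  rewrite RintZ// mulrC; congr (_ + _); rewrite RintD//; last exact: L1Z.
  congr (_ + _).
    rewrite Rint_sum; last by move=> a _; exact: L1Z.
    by apply: eq_bigr => a _; rewrite RintZ.
  rewrite RintZ//; congr (_ * _); rewrite Rint_sum; last by move=> a _; apply: L1_sum => b _; exact: L1Z.
  apply: eq_bigr => a _; rewrite Rint_sum; last by move=> b _; exact: L1Z.
  by apply: eq_bigr => b _; rewrite RintZ.
pose V := fun e => vdot (Y e) (Y e).
have qeE e : quad s x [tuple r * tnth (Y e) i | i < k] =
   smooth s x + (- (smooth s x * (r ^+ 2 / 2))) * V e +
   (\sum_a (r * G1 a) * tnth (Y e) a +
    (r ^+ 2 / 2) * \sum_a \sum_b G2 a b * (tnth (Y e) a * tnth (Y e) b)).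
  rewrite qE; congr (_ + (_ + _)).
  - have -> : vdot [tuple r * tnth (Y e) i | i < k] [tuple r * tnth (Y e) i | i < k] = r ^+ 2 * V e.
      by rewrite /V /vdot mulr_sumr; apply: eq_bigr => a _; rewrite tnth_mktuple; ring.
    by field.
  - by apply: eq_bigr => a _; rewrite tnth_mktuple; ring.
  - rewrite !mulr_sumr; apply: eq_bigr => a _; rewrite !mulr_sumr.
    by apply: eq_bigr => b _; rewrite !tnth_mktuple; ring.
have lA : L1 nu (fun e => \sum_a (r * G1 a) * tnth (Y e) a).
  by apply: L1_sum => a _; apply: L1Z; exact: L1_Y.
have lB : L1 nu (fun e => \sum_a \sum_b G2 a b * (tnth (Y e) a * tnth (Y e) b)).
  by apply: L1_sum => a _; apply: L1_sum => b _; apply: L1Z; exact: L1_Y2.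
have lC : L1 nu (fun e => smooth s x + (- (smooth s x * (r ^+ 2 / 2))) * V e).
  by apply: L1D; [exact: L1_cst|apply: L1Z; exact: L1_Yq].
have iV : \int[nu]_e V e = k%:R.
  rewrite /V /vdot Rint_sum; last by move=> a _; exact: L1_Y2.
  rewrite (eq_bigr (fun=> 1)); last by move=> a _; rewrite Ycov eqxx.
  by rewrite sumr_const card_ord.
split.
  rewrite (_ : (fun _ => _) = fun e => smooth s x + (- (smooth s x * (r ^+ 2 / 2))) * V e +
   (\sum_a (r * G1 a) * tnth (Y e) a +
    (r ^+ 2 / 2) * \sum_a \sum_b G2 a b * (tnth (Y e) a * tnth (Y e) b))).
    by apply: L1D => //; apply: L1D => //; exact: L1Z.
  by apply/funext => e; rewrite qeE.
under eq_Rintegral do rewrite qeE.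
rewrite RintD//; last by apply: L1D => //; exact: L1Z.
rewrite RintD; [|exact: L1_cst|by apply: L1Z; exact: L1_Yq].
rewrite RintZ; last exact: L1_Yq.
rewrite iV RintD//; last exact: L1Z.
rewrite RintZ//.
rewrite Rint_sum; last by move=> a _; apply: L1Z; exact: L1_Y.
rewrite big1; last by move=> a _; rewrite RintZ ?Ymean ?mulr0//; exact: L1_Y.
rewrite Rint_sum; last by move=> a _; apply: L1_sum => b _; apply: L1Z; exact: L1_Y2.
have -> : \sum_a \int[nu]_e (\sum_b G2 a b * (tnth (Y e) a * tnth (Y e) b)) = \sum_a G2 a a.
  apply: eq_bigr => a _; rewrite Rint_sum; last by move=> b _; apply: L1Z; exact: L1_Y2.
  rewrite (bigD1 a)//= RintZ; last exact: L1_Y2.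
  rewrite Ycov eqxx mulr1 big1 ?addr0// => b ba.
  rewrite RintZ; last exact: L1_Y2.
  by rewrite Ycov eq_sym (negbTE ba) mulr0.
have -> : \sum_a G2 a a = \sum_i \int[gauss]_z (g (vax x s z) * tnth z i ^+ 2).
  by apply: eq_bigr => a _; apply: eq_Rintegral => z _; rewrite expr2.
rewrite (Rint_cst1 _ nu1); ring.
Qed.

End one_step.

End smoothing.

(** * Replacing one summand, then all of them *)

Section one_step_compare.
Context {R : realType} {k : nat}.
Local Notation vec := (vec R k).
Local Notation gauss := (@gauss R k).
Variables (g : vec -> R) (M : R).
Hypothesis mg : measurable_fun setT g.
Hypothesis gM : forall x, 0 <= g x <= M.

Lemma one_step_err (dE : measure_display) (E : measurableType dE)
    (nu : {sigma_finite_measure set E -> \bar R}) (Y : E -> vec) :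
  nu setT = 1%E -> measurable_fun setT Y ->
  L1 nu (fun e => vdot (Y e) (Y e) ^+ 2) ->
  (forall a, \int[nu]_e tnth (Y e) a = 0) ->
  (forall a b, \int[nu]_e (tnth (Y e) a * tnth (Y e) b) = (a == b)%:R) ->
  exists C, 0 <= C /\ forall s r x, 0 < s -> 0 <= r ->
  `|\int[nu]_e smooth g s (vax x r (Y e)) - (smooth g s x +
    (r / s) ^+ 2 / 2 * ((\sum_i \int[gauss]_z (g (vax x s z) * tnth z i ^+ 2)) - k%:R * smooth g s x))|
   <= C * (r / s) ^+ 3.
Proof.
move=> nu1 mY Y2 Ym Yc; have [C [C0 hC]] := smooth_quad mg gM.
exists (C * \int[nu]_e norm3 Y e); split.
  rewrite mulr_ge0//; apply: Rint_ge0 => e.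
  by rewrite mulr_ge0 ?vdot_ge0 ?sqrtr_ge0.
move=> s r x s0 r0; have [lq <-] := quad_mean mg gM nu1 mY Y2 Ym Yc s x (r / s).
have mS : measurable_fun setT (fun e => smooth g s (vax x r (Y e))).
  by apply: (measurableT_comp (measurable_smooth mg gM s)); exact: measurable_vax.
have [lS _ _] := bint nu1 mS (fun e => smooth_bound mg gM s _).
rewrite -RintB//; apply: (le_trans (Rint_abs (L1B lS lq))).
have lN := L1_norm3 nu1 mY Y2.
have -> : C * (\int[nu]_e norm3 Y e) * (r / s) ^+ 3 = \int[nu]_e ((C * (r / s) ^+ 3) * norm3 Y e).
  by rewrite RintZ//; ring.
apply: Rint_le; [exact/L1_abs/L1B|exact: L1Z|move=> e].
set u := [tuple (r / s) * tnth (Y e) i | i < k].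
have rs0 : 0 <= r / s by rewrite divr_ge0// ltW.
have uu : vdot u u = (r / s) ^+ 2 * vdot (Y e) (Y e).
  by rewrite /vdot mulr_sumr; apply: eq_bigr => a _; rewrite tnth_mktuple; ring.
have -> : vax x r (Y e) = vax x 1 [tuple r * tnth (Y e) i | i < k].
  by apply: eq_from_tnth => i; rewrite !tnth_vax tnth_mktuple mul1r.
apply: (le_trans (hC s x _ u (lt0r_neq0 s0) _)).
  by move=> i; rewrite !tnth_mktuple; field; exact: lt0r_neq0.
rewrite uu sqrtrM ?sqr_ge0// sqrtr_sqr (ger0_norm rs0) /norm3.
rewrite [leRHS](_ : _ = C * ((r / s) ^+ 2 * vdot (Y e) (Y e) * (r / s * Num.sqrt (vdot (Y e) (Y e))))) //.
by ring.
Qed.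

Lemma gauss_sigma : (forall a : 'I_k, \int[gauss]_z tnth z a = 0) /\
  (forall a b : 'I_k, \int[gauss]_z (tnth z a * tnth z b) = (a == b)%:R).
Proof. by split=> *; [exact: (gauss_coord _).2|exact: (gauss_coord2 _ _).2]. Qed.

Section clt_smooth.
Context {dE : measure_display} {E : measurableType dE}.
Variables (nu : {sigma_finite_measure set E -> \bar R}) (Y : E -> vec).
Hypothesis nu1 : nu setT = 1%E.
Hypothesis mY : measurable_fun setT Y.
Hypothesis Y2 : L1 nu (fun e => vdot (Y e) (Y e) ^+ 2).
Hypothesis Ymean : forall a, \int[nu]_e tnth (Y e) a = 0.
Hypothesis Ycov : forall a b, \int[nu]_e (tnth (Y e) a * tnth (Y e) b) = (a == b)%:R.

(** Both the step by Y and the step by a standard normal vector lie within a multiple of (r / s)^3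
    of the same quadratic value; by [smooth_conv] the normal step only increases the smoothing
    level. *)
Lemma one_step_cmp : exists C, 0 <= C /\ forall s r x, 0 < s -> 0 <= r ->
  `|\int[nu]_e smooth g s (vax x r (Y e)) - smooth g (Num.sqrt (r ^+ 2 + s ^+ 2)) x|
   <= C * (r / s) ^+ 3.
Proof.
have [C1 [C10 h1]] := one_step_err nu1 mY Y2 Ymean Ycov.
have [C2 [C20 h2]] := one_step_err (Y := id) (gaussT k) (@measurable_id _ _ _)
  (gauss_sqn2 k) gauss_sigma.1 gauss_sigma.2.
exists (C1 + C2); split; first by rewrite addr_ge0.
move=> s r x s0 r0; rewrite -(smooth_conv mg gM r s x).
move: (h1 s r x s0 r0) (h2 s r x s0 r0); set a := \int[nu]_e _; set b := \int[gauss]_z _; set c := (smooth g s x + _).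
move=> ac bc; rewrite mulrDl; have -> : a - b = (a - c) - (b - c) by ring.
by rewrite (le_trans (ler_normB _ _))// lerD.
Qed.

Definition psum (r : R) n (t : n.-tuple E) : vec :=
  [tuple r * \sum_(i < n) tnth (Y (tnth t i)) a | a < k].

Lemma psum_cons r n e (t : n.-tuple E) :
  psum r (Defs.cons_tuple (e, t)) = vax (psum r t) r (Y e).
Proof.
apply: eq_from_tnth => a; rewrite tnth_vax !tnth_mktuple big_ord_recl cons_tuple0.
under eq_bigr do rewrite cons_tupleS.
by rewrite mulrDr addrC.
Qed.

Lemma measurable_psum r n : measurable_fun setT (@psum r n).
Proof.
apply: measurable_vecP => a; under eq_fun do rewrite tnth_mktuple.
apply: measurable_funM => //; apply: measurable_sum => i.
apply: (measurableT_comp (measurable_tnthR a)); apply: (measurableT_comp mY).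
exact: measurable_tnth.
Qed.

(** Lindeberg's replacement as an induction on n: the first summand is exchanged for normal noise,
    which raises the smoothing level s. For this s is left free above a fixed sigma. *)
Lemma clt_smooth : exists C, 0 <= C /\ forall sigma r n s, 0 < sigma -> 0 <= r -> sigma <= s ->
  `|\int[power_measure nu n]_t smooth g s (psum r t) -
     smooth g (Num.sqrt (s ^+ 2 + n%:R * r ^+ 2)) [tuple 0 | i < k]|
   <= n%:R * (C * (r / sigma) ^+ 3).
Proof.
have [C [C0 hC]] := one_step_cmp; exists C; split => // sigma r n s sg0 r0.
elim: n s => [|n IH] s sgs; have s0 : 0 < s by exact: lt_le_trans sgs.
  rewrite Rint_power0; last first.
    by apply: (measurableT_comp (measurable_smooth mg gM s)); exact: measurable_psum.
  rewrite (_ : psum _ _ = [tuple 0 | i < k]); last first.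
    by apply: eq_from_tnth => i; rewrite !tnth_mktuple big_ord0 mulr0.
  by rewrite mul0r addr0 sqrtr_sqr (gtr0_norm s0) subrr normr0 mul0r.
have mS : measurable_fun setT (fun p : E * n.-tuple E => smooth g s (vax (psum r p.2) r (Y p.1))).
  apply: (measurableT_comp (measurable_smooth mg gM s)); apply: measurable_vax.
    by apply: (measurableT_comp _ measurable_snd); exact: measurable_psum.
  exact: (measurableT_comp mY).
have pn := power_measureT n nu1.
have e1 : \int[power_measure nu n.+1]_t smooth g s (psum r t) =
   \int[power_measure nu n]_t \int[nu]_e smooth g s (vax (psum r t) r (Y e)).
  have mP : measurable_fun setT (fun t : n.+1.-tuple E => smooth g s (psum r t)).
    by apply: (measurableT_comp (measurable_smooth mg gM s)); exact: measurable_psum.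
  apply: (eq_trans (Rint_powerS nu1 mP (fun t => smooth_bound mg gM s _))).
  apply: (eq_trans _ (Rint_swap nu1 pn mS (fun p => smooth_bound mg gM s _))).
  by apply: eq_Rintegral => e _; apply: eq_Rintegral => t _; rewrite psum_cons.
(* The new level s' is again at least sigma, so every step costs the same. *)
set s' := Num.sqrt (r ^+ 2 + s ^+ 2).
have ss' : s <= s'.
  have -> : s = Num.sqrt (s ^+ 2) by rewrite sqrtr_sqr gtr0_norm.
  rewrite /s'; apply: ler_wsqrtr.
  by rewrite lerDr sqr_ge0.
have s'2 : s' ^+ 2 = r ^+ 2 + s ^+ 2 by rewrite sqr_sqrtr// addr_ge0// sqr_ge0.
have := IH s' (le_trans sgs ss').
have -> : s' ^+ 2 + n%:R * r ^+ 2 = s ^+ 2 + n.+1%:R * r ^+ 2 by rewrite s'2 -natr1; ring.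
have mT : measurable_fun setT (fun p : n.-tuple E * E => smooth g s (vax (psum r p.1) r (Y p.2))).
  apply: (measurableT_comp (measurable_smooth mg gM s)); apply: measurable_vax.
    by apply: (measurableT_comp _ measurable_fst); exact: measurable_psum.
  exact: (measurableT_comp mY).
have mI : measurable_fun setT (fun t : n.-tuple E => \int[nu]_e smooth g s (vax (psum r t) r (Y e))).
  apply: (measurable_Rint_param nu mT) => p.
  by have /andP[] := smooth_bound mg gM s (vax (psum r p.1) r (Y p.2)).
have bI (t : n.-tuple E) : 0 <= \int[nu]_e smooth g s (vax (psum r t) r (Y e)) <= M.
  have mt : measurable_fun setT (fun e => smooth g s (vax (psum r t) r (Y e))).
    by apply: (measurableT_comp (measurable_smooth mg gM s)); apply: measurable_vax.
  by have [] := bint nu1 mt (fun e => smooth_bound mg gM s _).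
have mS' : measurable_fun setT (fun t : n.-tuple E => smooth g s' (psum r t)).
  by apply: (measurableT_comp (measurable_smooth mg gM s')); exact: measurable_psum.
have [lI _ _] := bint pn mI bI.
have [lS _ _] := bint pn mS' (fun t => smooth_bound mg gM s' _).
have cl : `|\int[power_measure nu n]_t (\int[nu]_e smooth g s (vax (psum r t) r (Y e))) -
    \int[power_measure nu n]_t smooth g s' (psum r t)| <= C * (r / sigma) ^+ 3.
  apply: Rint_close => // t; apply: (le_trans (hC s r (psum r t) s0 r0)).
  have rs : 0 <= r / s by rewrite divr_ge0// ltW.
  have rg : 0 <= r / sigma by rewrite divr_ge0// ltW.
  by rewrite ler_wpM2l// lerXn2r ?nnegrE// ler_wpM2l// lef_pV2.
rewrite e1 => h; set x := smooth _ _ _ in h *.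
rewrite -natr1 mulrDl mul1r.
apply: (le_trans (ler_distD (\int[power_measure nu n]_t smooth g s' (psum r t)) _ _)).
by rewrite addrC lerD.
Qed.

Lemma clt_lip_pos (L : R) : 0 <= L ->
  (forall x y, `|g x - g y| <= L * \sum_(a < k) `|tnth x a - tnth y a|) ->
  (fun n => \int[power_measure nu n]_t g (psum (Num.sqrt n%:R)^-1 t)) @ \oo --> \int[gauss]_z g z.
Proof.
move=> L0 gL; have [C [C0 hC]] := clt_smooth.
pose K := L * \sum_(a < k) \int[gauss]_z `|tnth z a|.
have K0 : 0 <= K by rewrite mulr_ge0// sumr_ge0// => a _; apply: Rint_ge0.
have lip s x : 0 < s -> `|smooth g s x - g x| <= s * K.
  move=> s0; have -> : g x = \int[gauss]_z g x by rewrite Rint_cst1//; exact: gaussT.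
  have mx : measurable_fun setT (fun z => g (vax x s z)).
    by apply: (measurableT_comp mg); exact: measurable_vax.
  have [lx _ _] := bint (gaussT k) mx (fun z => gM _).
  have lc : L1 gauss (fun=> g x) by apply: L1_cst; exact: gauss_lty.
  have la a : L1 gauss (fun z => `|tnth z a|) by apply/L1_abs; exact: (gauss_coord a).1.
  rewrite /smooth -RintB//; apply: (le_trans (Rint_abs (L1B lx lc))).
  have -> : s * K = \int[gauss]_z ((s * L) * \sum_(a < k) `|tnth z a|).
    rewrite RintZ; last by apply: L1_sum => a _; exact: la.
    by rewrite Rint_sum// /K mulrA.
  apply: Rint_le; [exact/L1_abs/L1B|by apply/L1Z/L1_sum => a _; exact: la|move=> z].
  apply: (le_trans (gL _ _)); rewrite (mulrC s) -mulrA; apply: ler_wpM2l => //.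
  rewrite mulr_sumr; apply: ler_sum => a _; by rewrite tnth_vax addrC addKr normrM (gtr0_norm s0).
apply/cvgrPdist_le => e e0.
(* Smoothing at level sigma moves a Lipschitz function by at most sigma K, here at most e / 4; this
   is spent twice. *)
pose sigma := e / (4 * (K + 1)).
have K1 : 0 < K + 1 by lra.
have sg0 : 0 < sigma by rewrite divr_gt0// mulr_gt0.
have sgK : sigma * K <= e / 4.
  have : sigma * (4 * (K + 1)) = e by rewrite /sigma divfK// lt0r_neq0// mulr_gt0.
  by move: sg0; nra.
pose D := C / sigma ^+ 3.
have D0 : 0 <= D by rewrite divr_ge0// exprn_ge0// ltW.
(* The n replacements cost n C (n^(-1/2) / sigma)^3 = D / sqrt n in total, which is at most e / 2
   from N on. *)
pose N := (Num.truncn (4 * D * D / (e * e))).+1.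
exists N => // n /= Nn.
have n0 : (0 < n)%N by exact: leq_trans Nn.
have nR : 0 < n%:R :> R by rewrite ltr0n.
set q := Num.sqrt n%:R; have q0 : 0 < q by rewrite sqrtr_gt0.
have q2 : q ^+ 2 = n%:R by rewrite sqr_sqrtr// ltW.
have nD : D / q <= e / 2.
  rewrite ler_pdivrMr//; have : (4 * D * D / (e * e)) < n%:R.
    apply: (lt_le_trans (truncnS_gt _)); by rewrite ler_nat.
  rewrite ltr_pdivrMr ?mulr_gt0// -q2 => h.
  rewrite -(@ler_pXn2r _ 2)// ?nnegrE//; last by rewrite mulr_ge0// ltW// divr_gt0.
  nra.
have := hC sigma q^-1 n sigma sg0 _ (lexx _); rewrite invr_ge0 ltW// => /(_ isT).
have -> : n%:R * q^-1 ^+ 2 = 1 by rewrite exprVn q2 mulfV// gt_eqF.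
have -> : n%:R * (C * (q^-1 / sigma) ^+ 3) = D / q.
  by rewrite -q2 /D; field; rewrite !lt0r_neq0.
(* The normal noise that replaced the summands has variance 1 in total; [smooth_conv] separates it
   from the smoothing. *)
have -> : smooth g (Num.sqrt (sigma ^+ 2 + 1)) [tuple 0 | i < k] =
   \int[gauss]_z smooth g sigma z.
  rewrite addrC -(expr1n _ 2) -(smooth_conv mg gM); apply: eq_Rintegral => z _.
  by congr smooth; apply: eq_from_tnth => i; rewrite tnth_vax tnth_mktuple mul1r add0r.
move=> h1.
have pn := power_measureT n nu1.
have h2 : `|\int[power_measure nu n]_t smooth g sigma (psum q^-1 t) -
  \int[power_measure nu n]_t g (psum q^-1 t)| <= e / 4.
  have ma : measurable_fun setT (fun t : n.-tuple E => smooth g sigma (psum q^-1 t)).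
    by apply: (measurableT_comp (measurable_smooth mg gM _)); exact: measurable_psum.
  have mb : measurable_fun setT (fun t : n.-tuple E => g (psum q^-1 t)).
    by apply: (measurableT_comp mg); exact: measurable_psum.
  have [la _ _] := bint pn ma (fun t => smooth_bound mg gM _ _).
  have [lb _ _] := bint pn mb (fun t => gM _).
  by apply: Rint_close => // t; apply: le_trans sgK; exact: lip.
have h3 : `|\int[gauss]_z smooth g sigma z - \int[gauss]_z g z| <= e / 4.
  have [la _ _] := bint (gaussT k) (measurable_smooth mg gM sigma) (smooth_bound mg gM _).
  have [lb _ _] := bint (gaussT k) mg gM.
  by apply: Rint_close => //; [exact: gaussT|move=> t; apply: le_trans sgK; exact: lip].
move: h1 h2 h3; rewrite !ler_norml => /andP[? ?] /andP[? ?] /andP[? ?].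
apply/andP; split; lra.
Qed.

End clt_smooth.
End one_step_compare.

(** Adding M makes g nonnegative; the constant is subtracted from both integrals afterwards. *)
Lemma clt_lip {R : realType} {k : nat} (dE : measure_display) (E : measurableType dE)
    (nu : {sigma_finite_measure set E -> \bar R}) (Y : E -> vec R k) (g : vec R k -> R) (M L : R) :
  nu setT = 1%E -> measurable_fun setT Y ->
  L1 nu (fun e => vdot (Y e) (Y e) ^+ 2) ->
  (forall a, \int[nu]_e tnth (Y e) a = 0) ->
  (forall a b, \int[nu]_e (tnth (Y e) a * tnth (Y e) b) = (a == b)%:R) ->
  measurable_fun setT g -> (forall x, `|g x| <= M) -> 0 <= L ->
  (forall x y, `|g x - g y| <= L * \sum_(a < k) `|tnth x a - tnth y a|) ->
  (fun n => \int[power_measure nu n]_t g (psum Y (Num.sqrt n%:R)^-1 t)) @ \oo --> \int[gauss k]_z g z.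
Proof.
move=> nu1 mY Y2 Ym Yc mg gM L0 gL.
have mg' : measurable_fun setT (fun x => g x + M) by exact: measurable_funD.
have gM' x : 0 <= g x + M <= M + M.
  by have := gM x; rewrite ler_norml => /andP[h1 h2]; apply/andP; split; lra.
have gL' x y : `|(g x + M) - (g y + M)| <= L * \sum_(a < k) `|tnth x a - tnth y a|.
  by rewrite opprD addrACA subrr addr0.
have h := clt_lip_pos mg' gM' nu1 mY Y2 Ym Yc L0 gL'.
have e (d : measure_display) (T : measurableType d) (m : {measure set T -> \bar R}) (f : T -> vec R k) :
    m setT = 1%E -> measurable_fun setT f -> \int[m]_t (g (f t) + M) - M = \int[m]_t g (f t).
  move=> m1 mf; have ml : (m setT < +oo)%E by rewrite m1 ltry.
  rewrite RintD; last exact: L1_cst.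
    by rewrite Rint_cst1// addrK.
  by apply: (L1_bounded (M := M)) => //; exact: (measurableT_comp mg).
rewrite -(e _ _ _ id)//; last exact: gaussT.
apply: (cvgn_ext (v := fun n => \int[power_measure nu n]_t (g (psum Y (Num.sqrt n%:R)^-1 t) + M) - M)).
  move=> n; apply/esym/e; [exact: power_measureT|exact: measurable_psum].
by apply: cvgB => //; exact: cvg_cst.
Qed.

(** * Inverse square roots of matrices *)

Section matrix_norm.
Context {R : realType}.

Definition mxN m n (A : 'M[R]_(m, n)) : R := \sum_i \sum_j `|A i j|.

Lemma mxN_ge0 m n (A : 'M[R]_(m, n)) : 0 <= mxN A.
Proof. by apply: sumr_ge0 => i _; apply: sumr_ge0. Qed.

Lemma mxN_entry m n (A : 'M[R]_(m, n)) i j : `|A i j| <= mxN A.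
Proof.
rewrite /mxN (bigD1 i)//= (bigD1 j)//= -addrA lerDl addr_ge0//.
  by apply: sumr_ge0.
by apply: sumr_ge0 => a _; apply: sumr_ge0.
Qed.

Lemma mxND m n (A B : 'M[R]_(m, n)) : mxN (A + B) <= mxN A + mxN B.
Proof.
rewrite /mxN -big_split /=; apply: ler_sum => i _; rewrite -big_split /=.
by apply: ler_sum => j _; rewrite mxE ler_normD.
Qed.

Lemma mxNN m n (A : 'M[R]_(m, n)) : mxN (- A) = mxN A.
Proof. by apply: eq_bigr => i _; apply: eq_bigr => j _; rewrite mxE normrN. Qed.

Lemma mxN_tr m n (A : 'M[R]_(m, n)) : mxN A^T = mxN A.
Proof.
rewrite /mxN exchange_big /=; apply: eq_bigr => i _; apply: eq_bigr => j _.
by rewrite mxE.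
Qed.

Lemma mxNM m n p (A : 'M[R]_(m, n)) (B : 'M[R]_(n, p)) : mxN (A *m B) <= mxN A * mxN B.
Proof.
apply: (@le_trans _ _ (\sum_i \sum_j \sum_k `|A i k| * `|B k j|)).
  apply: ler_sum => i _; apply: ler_sum => j _; rewrite mxE (le_trans (ler_norm_sum _ _ _))//.
  by apply: ler_sum => k _; rewrite normrM.
rewrite {1}/mxN mulr_suml; apply: ler_sum => i _; rewrite exchange_big /= mulr_suml.
apply: ler_sum => k _; rewrite -mulr_sumr ler_wpM2l// /mxN [leRHS](bigD1 k)//= lerDl.
by apply: sumr_ge0 => a _; apply: sumr_ge0.
Qed.

End matrix_norm.

Lemma quad_CS {R : realFieldType} (a b c : R) :
  (forall s t, 0 <= s ^+ 2 * a + 2 * s * t * b + t ^+ 2 * c) -> b ^+ 2 <= a * c.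
Proof.
move=> q; have a0 : 0 <= a by have := q 1 0; nra.
have c0 : 0 <= c by have := q 0 1; nra.
have [cp|] := ltP 0 c.
  have := q c (- b); rewrite [X in 0 <= X](_ : _ = c * (a * c - b ^+ 2)); last ring.
  by rewrite pmulr_rge0// subr_ge0.
move=> cn; have c00 : c = 0 by lra.
have [ap|an] := ltP 0 a.
  have := q (- b) a; rewrite c00 [X in 0 <= X](_ : _ = a * (- b ^+ 2)); last ring.
  by rewrite pmulr_rge0// mulr0 oppr_ge0.
have a00 : a = 0 by lra.
by have := q 1 (- b); rewrite a00 c00; have := sqr_ge0 b; nra.
Qed.

(** * Quadratic forms and operator bounds *)

Section quadratic_forms.
Context {R : realType} {d : nat}.
Implicit Types (u v w : 'cV[R]_d) (K : 'M[R]_d).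

Lemma dotvE u v : dotv u v = \sum_i u i 0 * v i 0.
Proof. by rewrite /dotv mxE; apply: eq_bigr => i _; rewrite mxE. Qed.

Lemma dotvC u v : dotv u v = dotv v u.
Proof. by rewrite !dotvE; apply: eq_bigr => i _; rewrite mulrC. Qed.

Lemma dotvDr u v w : dotv u (v + w) = dotv u v + dotv u w.
Proof. by rewrite /dotv mulmxDr mxE. Qed.

Lemma dotvZr u v a : dotv u (a *: v) = a * dotv u v.
Proof. by rewrite /dotv -scalemxAr mxE. Qed.

Lemma dotvDl u v w : dotv (v + w) u = dotv v u + dotv w u.
Proof. by rewrite dotvC dotvDr !(dotvC u). Qed.

Lemma dotvZl u v a : dotv (a *: v) u = a * dotv v u.
Proof. by rewrite dotvC dotvZr (dotvC u). Qed.

Lemma dotv_mulmx u v K : dotv u (K *m v) = dotv (K^T *m u) v.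
Proof. by rewrite /dotv trmx_mul trmxK mulmxA. Qed.

Lemma dotv_ge0 u : 0 <= dotv u u.
Proof. by rewrite dotvE; apply: sumr_ge0 => i _; rewrite -expr2 sqr_ge0. Qed.

Lemma dotv_entry u i : u i 0 ^+ 2 <= dotv u u.
Proof.
rewrite dotvE (bigD1 i)//= -expr2 lerDl; apply: sumr_ge0 => j _.
by rewrite -expr2 sqr_ge0.
Qed.

Lemma dotv_gt0 u : u != 0 -> 0 < dotv u u.
Proof.
move=> u0; rewrite lt_neqAle dotv_ge0 andbT eq_sym; apply: contra u0 => /eqP.
move=> h; apply/eqP/matrixP => i j; rewrite ord1 mxE; apply/eqP.
by rewrite -sqrf_eq0 eq_le sqr_ge0 andbT -h dotv_entry.
Qed.

Definition psd K := forall v, 0 <= dotv v (K *m v).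

Lemma posdef_psd K : posdefmx K -> psd K.
Proof.
move=> pK v; have [->|v0] := eqVneq v 0; last exact/ltW/pK.
by rewrite mulmx0 dotvE sumr_ge0// => i _; rewrite mxE mul0r.
Qed.

Lemma form_CS K u v : K^T = K -> psd K ->
  dotv u (K *m v) ^+ 2 <= dotv u (K *m u) * dotv v (K *m v).
Proof.
move=> sK pK; set a := dotv u (K *m u); set b := dotv u _; set c := dotv v _.
have q (s t : R) : 0 <= s ^+ 2 * a + 2 * s * t * b + t ^+ 2 * c.
  have := pK (s *: u + t *: v).
  rewrite mulmxDr -!scalemxAr !dotvDr !dotvDl !dotvZr !dotvZl.
  rewrite (_ : dotv v (K *m u) = b); last by rewrite dotvC /b dotv_mulmx sK.
  rewrite -/a -/b -/c; congr (0 <= _); ring.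
exact: quad_CS.
Qed.

Lemma psd1 : psd 1%:M.
Proof. by move=> v; rewrite mul1mx dotv_ge0. Qed.

Lemma dotv_CS u v : dotv u v ^+ 2 <= dotv u u * dotv v v.
Proof. by have := form_CS u v (trmx1 _ _) psd1; rewrite !mul1mx. Qed.

Lemma form_bound K v : `|dotv v (K *m v)| <= mxN K * dotv v v.
Proof.
rewrite dotvE (le_trans (ler_norm_sum _ _ _))// /mxN mulr_suml; apply: ler_sum => i _.
rewrite mxE normrM (le_trans (ler_wpM2l (normr_ge0 _) (ler_norm_sum _ _ _)))//.
rewrite mulr_sumr mulr_suml; apply: ler_sum => j _; rewrite normrM mulrCA ler_wpM2l//.
have := dotv_entry v i; have := dotv_entry v j.
rewrite -normrM ler_norml => h1 h2; apply/andP; split; nra.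
Qed.

Lemma posdef_unit K : posdefmx K -> K \in unitmx.
Proof.
move=> pK; rewrite -row_free_unit -kermx_eq0; apply/eqP/row_matrixP => i; rewrite row0.
apply/eqP; apply: contraT => h.
have v0 : (row i (kermx K))^T != 0 by rewrite -(trmx0 R 1 d) (inj_eq (@trmx_inj _ _ _)).
have := pK _ v0; rewrite /dotv trmxK mulmxA.
rewrite (_ : row i (kermx K) *m K = 0); last by rewrite -row_mul mulmx_ker row0.
by rewrite mul0mx mxE ltxx.
Qed.

(** Cauchy-Schwarz for the form of K between v and K^-1 v gives |v|^4 <= (v.Kv)(v.K^-1 v), and the
    last factor is at most the norm of K^-1 times |v|^2. No eigenvalues are involved. *)
Lemma posdef_lower K : K^T = K -> posdefmx K ->
  exists c, 0 < c /\ forall v, c * dotv v v <= dotv v (K *m v).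
Proof.
move=> sK pK; have uK := posdef_unit pK; have pp := posdef_psd pK.
exists (mxN (invmx K) + 1)^-1; have N0 : 0 < mxN (invmx K) + 1 by have := mxN_ge0 (invmx K); lra.
split; first by rewrite invr_gt0.
move=> v; rewrite mulrC ler_pdivrMr//.
have [->|v0] := eqVneq v 0; first by rewrite mulmx0 !dotvE !big1 ?mul0r// => i _; rewrite mxE mul0r.
have vv := dotv_gt0 v0.
have := form_CS v (invmx K *m v) sK pp; rewrite mulmxA mulmxV// mul1mx => h.
have h2 : dotv (invmx K *m v) v <= mxN (invmx K) * dotv v v.
  by rewrite dotvC; exact: le_trans (ler_norm _) (form_bound _ _).
have h3 := pp v.
rewrite -(ler_pM2r vv) -expr2; apply: (le_trans h); rewrite -mulrA ler_wpM2l//.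
by rewrite (le_trans h2)// mulrDl mul1r lerDl dotv_ge0.
Qed.

Lemma psd_tr_ge0 K (D : 'M[R]_d) c : (forall v, c * dotv v v <= dotv v (K *m v)) ->
  c * \sum_i \sum_j D i j ^+ 2 <= \tr (D^T *m K *m D).
Proof.
move=> h; rewrite exchange_big mulr_sumr /mxtrace; apply: ler_sum => j _.
have := h (col j D); rewrite -mulmxA.
rewrite (_ : dotv (col j D) (col j D) = \sum_i D i j ^+ 2); last first.
  by rewrite dotvE; apply: eq_bigr => i _; rewrite !mxE expr2.
congr (_ <= _); rewrite dotvE [RHS]mxE; apply: eq_bigr => i _.
by rewrite !mxE; congr (_ * _); apply: eq_bigr => k _; rewrite !mxE.
Qed.

(** With D = B - C one has B^2 - C^2 = B D + D C. Multiplying by D and taking traces gives tr(D B D)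
    + tr(D C D), at least c times the squared Frobenius norm of D. The factor d^2 compares that norm
    with the entrywise norm [mxN]. *)
Lemma sqrtmx_perturb (B C : 'M[R]_d) c : 0 < c -> B^T = B -> C^T = C -> psd B ->
  (forall v, c * dotv v v <= dotv v (C *m v)) ->
  mxN (B - C) <= (d * d)%:R / c * mxN (B *m B - C *m C).
Proof.
move=> c0 sB sC pB pC; set D := B - C; set E := B *m B - C *m C.
have sD : D^T = D by rewrite /D linearB /= sB sC.
have ED : E = B *m D + D *m C by rewrite /D mulmxBr mulmxBl addrA subrK.
have trE : \tr (D *m E) = \tr (D^T *m B *m D) + \tr (D^T *m C *m D).
  rewrite ED mulmxDr raddfD /= sD mulmxA; congr (_ + _).
  by rewrite mxtrace_mulC.
have h1 : 0 <= \tr (D^T *m B *m D).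
  have := @psd_tr_ge0 B D 0 _; rewrite mul0r; apply=> v; rewrite mul0r; exact: pB.
have h2 := psd_tr_ge0 D pC.
have h3 : \tr (D *m E) <= mxN D * mxN E.
  apply: le_trans (mxNM D E); rewrite /mxtrace /mxN; apply: ler_sum => i _.
  rewrite (bigD1 i)//= (le_trans (ler_norm _))// lerDl; exact: sumr_ge0.
have h4 : mxN D ^+ 2 <= (d * d)%:R * \sum_i \sum_j D i j ^+ 2.
  have cs (f : 'I_d -> R) : (\sum_i f i) ^+ 2 <= d%:R * \sum_i f i ^+ 2.
    have := dotv_CS (const_mx 1) (\col_i f i); rewrite !dotvE.
    under eq_bigr do rewrite !mxE mul1r.
    under [X in X * _]eq_bigr do rewrite !mxE mul1r.
    under [X in _ * X]eq_bigr do rewrite !mxE -expr2.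
    by rewrite sumr_const card_ord.
  rewrite /mxN (le_trans (cs _))// natrM -mulrA ler_wpM2l// mulr_sumr.
  apply: ler_sum => i _; apply: (le_trans (cs _)); rewrite ler_wpM2l//.
  by apply: ler_sum => j _; rewrite real_normK ?num_real.
have [D0|D0] := leP (mxN D) 0.
  by rewrite (le_trans D0)// mulr_ge0 ?mxN_ge0// divr_ge0// ltW.
have q0 : 0 <= (d * d)%:R / c by rewrite divr_ge0// ltW.
rewrite -(ler_pM2r D0) -expr2 (le_trans h4)// mulrAC -!mulrA ler_wpM2l//.
rewrite ler_pdivlMl//; move: h1 h2 h3; rewrite trE; lra.
Qed.

(** For c >= 0: the Euclidean operator norm is at most c. *)
Definition opb (c : R) K := forall v, dotv (K *m v) (K *m v) <= c ^+ 2 * dotv v v.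

Lemma dotv_le u v a b : 0 <= a -> 0 <= b -> dotv u u <= a ^+ 2 -> dotv v v <= b ^+ 2 ->
  `|dotv u v| <= a * b.
Proof.
move=> a0 b0 ua vb; rewrite -ler_sqr ?nnegrE ?mulr_ge0// real_normK ?num_real//.
by rewrite (le_trans (dotv_CS _ _))// exprMn ler_pM ?dotv_ge0.
Qed.

Lemma opbD a b K M : 0 <= a -> 0 <= b -> opb a K -> opb b M -> opb (a + b) (K + M).
Proof.
move=> a0 b0 hK hM v; rewrite mulmxDl dotvDr !dotvDl.
set x := K *m v; set y := M *m v; set n := Num.sqrt (dotv v v).
have nE : n ^+ 2 = dotv v v by rewrite sqr_sqrtr ?dotv_ge0.
have n0 : 0 <= n by exact: sqrtr_ge0.
have h1 : dotv x x <= (a * n) ^+ 2 by rewrite exprMn nE; exact: hK.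
have h2 : dotv y y <= (b * n) ^+ 2 by rewrite exprMn nE; exact: hM.
have := dotv_le (mulr_ge0 a0 n0) (mulr_ge0 b0 n0) h1 h2.
rewrite (dotvC y x) -nE ler_norml => /andP[_ h3].
have -> : (a + b) ^+ 2 * n ^+ 2 = (a * n) ^+ 2 + 2 * (a * n * (b * n)) + (b * n) ^+ 2 by ring.
lra.
Qed.

Lemma opbM a b K M : opb a K -> opb b M -> opb (a * b) (K *m M).
Proof.
move=> hK hM v; rewrite -mulmxA exprMn -mulrA; apply: (le_trans (hK _)).
by apply: ler_wpM2l; rewrite ?sqr_ge0//; exact: hM.
Qed.

Lemma opbZ a b K : opb b K -> opb (a * b) (a *: K).
Proof.
move=> hK v; rewrite -scalemxAl dotvZr dotvZl mulrA -expr2 exprMn -[leRHS]mulrA.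
by apply: ler_wpM2l; rewrite ?sqr_ge0//; exact: hK.
Qed.

Lemma opb_le a b K : 0 <= a <= b -> opb a K -> opb b K.
Proof.
move=> /andP[a0 ab] hK v; rewrite (le_trans (hK _))// ler_wpM2r ?dotv_ge0//.
by rewrite lerXn2r// nnegrE// (le_trans a0).
Qed.

Lemma opb_entry a K i j : 0 <= a -> opb a K -> `|K i j| <= a.
Proof.
move=> a0 hK; rewrite -ler_sqr ?nnegrE// real_normK ?num_real//.
have := hK (delta_mx j 0); have := dotv_entry (K *m delta_mx j 0) i.
rewrite -colE mxE => h1 h2; rewrite (le_trans h1)// (le_trans h2)//.
rewrite (_ : dotv _ _ = 1) ?mulr1// dotvE (bigD1 j)//= mxE !eqxx mulr1 big1 ?addr0// => k kj.
by rewrite mxE (negbTE kj) mul0r.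
Qed.

(** Cauchy-Schwarz for the form of K between v and K v gives |Kv|^4 <= (a |v|^2)(a |Kv|^2). *)
Lemma opb_psd K a : K^T = K -> psd K -> 0 <= a -> (forall v, dotv v (K *m v) <= a * dotv v v) ->
  opb a K.
Proof.
move=> sK pK a0 hK v; set x := dotv (K *m v) (K *m v).
have x0 : 0 <= x by exact: dotv_ge0.
have := form_CS v (K *m v) sK pK; rewrite dotv_mulmx sK -/x => h.
have h2 : x ^+ 2 <= (a * dotv v v) * (a * x) by rewrite (le_trans h)// ler_pM ?hK.
have [xp|] := ltP 0 x; last by move=> /le_trans-> //; rewrite mulr_ge0 ?sqr_ge0 ?dotv_ge0.
rewrite -(ler_pM2r xp) -expr2 (le_trans h2)// [leLHS](_ : _ = a ^+ 2 * dotv v v * x)//; ring.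
Qed.

End quadratic_forms.

Lemma Rlim_unique {R : realType} (u : nat -> R) (l l' : R) :
  u @ \oo --> l -> u @ \oo --> l' -> l = l'.
Proof. by move=> h /(cvg_lim (@Rhausdorff R)) <-; rewrite (cvg_lim (@Rhausdorff R) h). Qed.

Lemma Rcvg_sum {R : realType} (I : Type) (r : seq I) (F : I -> nat -> R) (l : I -> R) :
  (forall i, F i @ \oo --> l i) -> (fun n => \sum_(i <- r) F i n) @ \oo --> \sum_(i <- r) l i.
Proof.
move=> h; elim: r => [|i r IH].
  by rewrite big_nil; apply: (cvgn_ext (v := fun=> 0)) => [n|]; [rewrite big_nil|exact: cvg_cst].
rewrite big_cons; apply: (cvgn_ext (v := fun n => F i n + \sum_(j <- r) F j n)).
  by move=> n; rewrite big_cons.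
by apply: cvgD.
Qed.

(** * Square root of 1 - K by iteration *)

Section matrix_sqrt.
Context {R : realType} {d : nat}.
Variables (K : 'M[R]_d) (c : R).
Hypothesis sK : K^T = K.
Hypothesis pK : psd K.
Hypothesis c01 : 0 < c < 1.
Hypothesis Kc : forall v, dotv v (K *m v) <= (1 - c) * dotv v v.

(* the iteration y = (x + y^2) / 2 for y = 1 - sqrt (1 - x) *)
Fixpoint sqrt_iter j : 'M[R]_d :=
  if j is i.+1 then 2^-1 *: (K + sqrt_iter i *m sqrt_iter i) else 0.

Local Notation Y := sqrt_iter.

(** Fixed point of the scalar iteration with x = 1 - c; it bounds the operator norm of all
    iterates. *)
Let rho := 1 - Num.sqrt c.

Let rhoE : (1 - c + rho ^+ 2) / 2 = rho.
Proof.
have /andP[c0 c1] := c01.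
have : Num.sqrt c ^+ 2 = c by rewrite sqr_sqrtr// ltW.
by rewrite /rho; move: (Num.sqrt c) => s <-; field.
Qed.

Let rho01 : 0 <= rho < 1.
Proof.
have /andP[c0 c1] := c01; rewrite /rho subr_ge0 -[leRHS]sqrtr1 ler_wsqrtr ?ltW//=.
by rewrite ltrBlDr ltrDl sqrtr_gt0.
Qed.

Let rho0 : 0 <= rho. Proof. by have /andP[] := rho01. Qed.

Let c1 : 0 <= 1 - c. Proof. by have /andP[_ h] := c01; rewrite subr_ge0 ltW. Qed.

Let sY j : (Y j)^T = Y j.
Proof.
elim: j => [|j IH] /=; first by rewrite trmx0.
by rewrite linearZ linearD /= trmx_mul sK IH.
Qed.

Let YC M j : M *m K = K *m M -> M *m Y j = Y j *m M.
Proof.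
move=> MK; elim: j => [|j IH] /=; first by rewrite mulmx0 mul0mx.
by rewrite -scalemxAr -scalemxAl mulmxDr mulmxDl MK mulmxA IH -!mulmxA IH.
Qed.

Let opbK : opb (1 - c) K. Proof. exact: opb_psd. Qed.

Let opbY j : opb rho (Y j).
Proof.
elim: j => [|j IH] /=.
  move=> v; rewrite mul0mx dotvE big1 ?mulr_ge0 ?sqr_ge0 ?dotv_ge0// => i _.
  by rewrite mxE mul0r.
rewrite -{1}rhoE mulrC expr2; apply: opbZ; apply: opbD => //; first exact: mulr_ge0.
exact: opbM.
Qed.

(** The iterates are polynomials in K and commute, so each increment is half the product of the
    preceding increment with the sum of two iterates, whose norm is at most 2 rho. *)
Let opbYB j : opb (rho ^+ j) (Y j.+1 - Y j).
Proof.
elim: j => [|j IH].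
  rewrite subr0 expr0; apply: (@opb_le _ _ rho); last exact: opbY.
  by rewrite rho0 ltW//; have /andP[] := rho01.
have -> : Y j.+2 - Y j.+1 = 2^-1 *: ((Y j.+1 + Y j) *m (Y j.+1 - Y j)).
  rewrite [Y j.+2]/= {2}[Y j.+1]/= -scalerBr; congr (_ *: _).
  rewrite mulmxDl !mulmxBr -(YC (M := Y j.+1) j).
    by rewrite addrA subrK opprD addrACA subrr add0r.
  by apply/esym/YC.
have -> : rho ^+ j.+1 = 2^-1 * ((rho + rho) * rho ^+ j) by rewrite exprS; field.
by apply: opbZ; apply: opbM => //; apply: opbD.
Qed.

Let cvgY a b : exists l : R, (fun j => Y j a b) @ \oo --> l.
Proof.
have /andP[_ r1] := rho01.
pose u (j : nat) := (Y j.+1 - Y j) a b.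
have uE n : series u n = Y n a b.
  elim: n => [|n IH]; first by rewrite /series /= big_geq// mxE.
  by rewrite seriesSr IH /u mxE [X in _ + (_ + X)]mxE addrC subrK.
have cu : cvgn (series u).
  apply: normed_cvg; apply: (series_le_cvg (v_ := geometric 1 rho)) => //=.
  - by move=> n; rewrite mul1r exprn_ge0.
  - by move=> n; rewrite mul1r; apply: opb_entry; [exact: exprn_ge0|exact: opbYB].
  - by apply: is_cvg_geometric_series; rewrite ger0_norm.
by exists (limn (series u)); apply: (cvgn_ext (v := series u)).
Qed.

(** The increments are summable, so the iterates converge entrywise to some L with 2 L = K + L^2,
    that is (1 - L)^2 = 1 - K; the bound rho < 1 on L makes 1 - L positive definite. *)
Lemma sqrt_one_minus : exists B : 'M[R]_d, [/\ B^T = B, posdefmx B & B *m B = 1%:M - K].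
Proof.
have [l hl] := choice (fun ab : 'I_d * 'I_d => cvgY ab.1 ab.2).
pose L := \matrix_(a, b) l (a, b).
have cL a b : (fun j => Y j a b) @ \oo --> L a b by rewrite mxE; exact: (hl (a, b)).
have fix_L : L = 2^-1 *: (K + L *m L).
  apply/matrixP => a b; apply: (Rlim_unique (u := fun j => Y j.+1 a b)).
    by have := cL a b; rewrite -(cvg_shiftS (fun j => Y j a b)).
  rewrite !mxE; apply: (cvgn_ext (v := fun j => 2^-1 * (K a b + \sum_k Y j a k * Y j k b))).
    by move=> j; rewrite /= !mxE.
  apply: cvgMr; apply: cvgD; first exact: cvg_cst.
  apply: (Rcvg_sum (F := fun k j => Y j a k * Y j k b)) => k.
  by apply: cvgM; exact: cL.
have sL : L^T = L.
  apply/matrixP => a b; rewrite mxE; apply: (Rlim_unique (u := fun j => Y j a b)) => //.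
  apply: (cvgn_ext (v := fun j => Y j b a)) => //.
  by move=> j; rewrite -{1}(sY j) mxE.
have bL v : dotv v (L *m v) <= rho * dotv v v.
  have cv : (fun j => dotv v (Y j *m v)) @ \oo --> dotv v (L *m v).
    rewrite dotvE; apply: (cvgn_ext (v := fun j => \sum_i v i 0 * \sum_k Y j i k * v k 0)).
      by move=> j; rewrite dotvE; apply: eq_bigr => i _; rewrite mxE.
    apply: (Rcvg_sum (F := fun i j => v i 0 * \sum_k Y j i k * v k 0)) => i.
    apply: cvgMr; rewrite mxE; apply: (Rcvg_sum (F := fun k j => Y j i k * v k 0)) => k.
    by apply: cvgMl.
  rewrite -(cvg_lim (@Rhausdorff R) cv); apply: limr_le; first by apply/cvg_ex; exists (dotv v (L *m v)).
  near=> j; apply: (le_trans (ler_norm _)).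
  have n2 : dotv v v = Num.sqrt (dotv v v) ^+ 2 by rewrite sqr_sqrtr ?dotv_ge0.
  have n0 := sqrtr_ge0 (dotv v v).
  have := @dotv_le _ _ v (Y j *m v) (Num.sqrt (dotv v v)) (rho * Num.sqrt (dotv v v)) n0 (mulr_ge0 rho0 n0).
  rewrite mulrCA -expr2 -n2; apply => //.
  by rewrite exprMn -n2; exact: opbY.
exists (1%:M - L); split.
- by rewrite linearB /= trmx1 sL.
- move=> v v0; rewrite mulmxBl mul1mx dotvDr -mulNmx -scaleN1r -scalemxAl dotvZr.
  have := bL v; have := dotv_gt0 v0; have /andP[_ r1] := rho01; nra.
- rewrite mulmxBr !mulmxBl !mul1mx mulmx1.
  have h : L + L = K + L *m L.
    by rewrite {1 2}fix_L -scalerDl (_ : 2^-1 + 2^-1 = 1) ?scale1r//; field.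
  have -> : K = L + L - L *m L by rewrite h addrK.
  by rewrite -addrA -opprD addrA.
Unshelve. all: by end_near. Qed.

End matrix_sqrt.

(** * Existence and Lipschitz dependence of S^(-1/2) *)

Section inverse_sqrt.
Context {R : realType} {d : nat}.
Implicit Types S : 'M[R]_d.

Lemma posdef_sqrt S : S^T = S -> posdefmx S ->
  exists B : 'M[R]_d, [/\ B^T = B, posdefmx B & B *m B = S].
Proof.
move=> sS pS; have [c [c0 hc]] := posdef_lower sS pS.
have N1 : 0 < mxN S + 1 by have := mxN_ge0 S; lra.
(* The scaling l makes l S at most 1, so K = 1 - l S is positive semidefinite; K stays below 1 - e,
   where e is capped at 1/2 to be less than 1. *)
pose l := (mxN S + 1)^-1; have l0 : 0 < l by rewrite invr_gt0.
have lN : l * mxN S <= 1 by rewrite /l ler_pdivrMl// mulr1 lerDl.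
pose e := Num.min (l * c) 2^-1.
have e01 : 0 < e < 1.
  rewrite /e lt_min gt_min mulr_gt0// invr_gt0 ltr0n /=.
  by apply/orP; right; rewrite invf_lt1// ltr1n.
pose K := 1%:M - l *: S.
have KE v : dotv v (K *m v) = dotv v v - l * dotv v (S *m v).
  by rewrite /K mulmxBl mul1mx dotvDr -scaleN1r -scalemxAl !dotvZr mulN1r.
have sK : K^T = K by rewrite linearB linearZ /= trmx1 sS.
have pK : psd K.
  move=> v; rewrite KE subr_ge0; have := le_trans (ler_norm _) (form_bound S v) => h.
  apply: (le_trans (ler_wpM2l (ltW l0) h)); rewrite mulrA -[leRHS]mul1r.
  by rewrite ler_wpM2r ?dotv_ge0.
have Ke v : dotv v (K *m v) <= (1 - e) * dotv v v.
  have h1 : e * dotv v v <= l * c * dotv v v.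
    by rewrite ler_wpM2r ?dotv_ge0// /e ge_min lexx.
  have h2 := ler_wpM2l (ltW l0) (hc v).
  rewrite KE mulrBl mul1r lerD2l lerN2; apply: (le_trans h1); by rewrite -mulrA.
have [B [sB pB BB]] := sqrt_one_minus sK pK e01 Ke.
pose q := Num.sqrt l^-1.
have q0 : 0 < q by rewrite sqrtr_gt0 invr_gt0.
exists (q *: B); split.
- by rewrite linearZ /= sB.
- by move=> v v0; rewrite -scalemxAl dotvZr mulr_gt0// pB.
- rewrite -scalemxAr -scalemxAl BB scalerA -expr2 sqr_sqrtr ?invr_ge0 ?ltW//.
  by rewrite opprB addrC subrK scalerA mulVf ?scale1r// gt_eqF.
Qed.

Lemma posdef_invmx S : S^T = S -> posdefmx S -> posdefmx (invmx S).
Proof.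
move=> sS pS v v0; have uS := posdef_unit pS.
have w0 : invmx S *m v != 0.
  apply: contra v0 => /eqP h; apply/eqP.
  by rewrite -[v]mul1mx -(mulmxV uS) -mulmxA h mulmx0.
by have := pS _ w0; rewrite mulmxA mulmxV// mul1mx dotvC.
Qed.

Lemma inv_sqrtmxP S : S^T = S -> posdefmx S -> is_inv_sqrtmx S (inv_sqrtmx S).
Proof.
move=> sS pS; have sI : (invmx S)^T = invmx S by rewrite trmx_inv sS.
have [B [sB pB BB]] := posdef_sqrt sI (posdef_invmx sS pS).
rewrite /inv_sqrtmx; apply: (@xgetPex _ 0 [set B | is_inv_sqrtmx S B]).
by exists B; split => //; exact: posdef_unit.
Qed.

Lemma inv_sqrtmx_lip S0 : S0^T = S0 -> posdefmx S0 -> exists e C : R,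
  [/\ 0 < e, 0 <= C & forall S, S^T = S -> mxN (S - S0) <= e -> posdefmx S /\
    mxN (inv_sqrtmx S - inv_sqrtmx S0) <= C * mxN (S - S0)].
Proof.
move=> sS0 pS0; have [c [c0 hc]] := posdef_lower sS0 pS0.
have [u0 sR pR RR] := inv_sqrtmxP sS0 pS0.
have [c' [c'0 hc']] := posdef_lower sR pR.
pose p := mxN (invmx S0); have p0 : 0 <= p by exact: mxN_ge0.
(* A perturbation below c / 2 keeps S positive definite, and one below 1 / (2 (p + 1)) keeps the
   norm of S^-1 below 2 p. Then S^-1 moves by at most 2 p p times the perturbation, and
   [sqrtmx_perturb] supplies the other factor of C. *)
pose e := Num.min (c / 2) (2 * (p + 1))^-1.
pose C := (d * d)%:R / c' * (2 * p * p).
exists e, C; split.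
- by rewrite /e lt_min divr_gt0//= invr_gt0 mulr_gt0//; lra.
- by rewrite !mulr_ge0// invr_ge0 ltW.
move=> S sS; set n := mxN (S - S0) => ne.
have n0 : 0 <= n by exact: mxN_ge0.
have [ne1 ne2] : n <= c / 2 /\ n <= (2 * (p + 1))^-1.
  by move: ne; rewrite /e le_min => /andP[].
have pS : posdefmx S.
  move=> v v0; have vv := dotv_gt0 v0.
  have := hc v; have := form_bound (S - S0) v; rewrite -/n.
  rewrite mulmxBl dotvDr -scaleN1r dotvZr mulN1r ler_norml => /andP[h _].
  have : n * dotv v v <= c / 2 * dotv v v by rewrite ler_wpM2r// ltW.
  have : 0 < c / 2 * dotv v v by rewrite mulr_gt0// divr_gt0.
  lra.
split => //; have [uS sB pB BB] := inv_sqrtmxP sS pS.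
have E : invmx S - invmx S0 = invmx S *m (S0 - S) *m invmx S0.
  by rewrite mulmxBr mulmxBl -mulmxA mulmxV// mulmx1 mulVmx// mul1mx.
set b := mxN (invmx S).
have b0 : 0 <= b by exact: mxN_ge0.
have nE : mxN (S0 - S) = n by rewrite -opprB mxNN.
have hE : mxN (invmx S - invmx S0) <= b * n * p.
  rewrite E; apply: (le_trans (mxNM _ _)); rewrite -/p ler_wpM2r//.
  by rewrite -nE; exact: mxNM.
have hb : b <= 2 * p.
  have h1 : b <= p + b * n * p.
    rewrite /b -[X in mxN X <= _](subrK (invmx S0)) [p + _]addrC.
    by apply: (le_trans (mxND _ _)); rewrite lerD2r.
  have h2 : n * p <= 2^-1.
    have := ler_wpM2r p0 ne2 => /le_trans; apply.
    by rewrite ler_pdivrMl ?mulr_gt0//; lra.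
  nra.
rewrite (le_trans (sqrtmx_perturb c'0 sB sR (posdef_psd pB) hc'))// BB RR /C -[leRHS]mulrA.
apply: ler_wpM2l; first by rewrite divr_ge0// ltW.
apply: (le_trans hE).
rewrite [leRHS](_ : _ = 2 * p * n * p); last ring.
by rewrite ler_wpM2r// ler_wpM2r.
Qed.

Lemma gram_posdef (A : 'M[R]_d) : A \in unitmx -> posdefmx (A *m A^T).
Proof.
move=> uA v v0; rewrite -mulmxA dotv_mulmx; apply: dotv_gt0.
apply: contra v0 => /eqP h; apply/eqP.
have uT : A^T \in unitmx by rewrite unitmx_tr.
by rewrite -[v]mul1mx -(mulVmx uT) -mulmxA h mulmx0.
Qed.

Lemma gram_sym (A : 'M[R]_d) : (A *m A^T)^T = A *m A^T.
Proof. by rewrite trmx_mul trmxK. Qed.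

Lemma inv_sqrtmx_orth (A : 'M[R]_d) : A \in unitmx ->
  let O := inv_sqrtmx (A *m A^T) *m A in O^T *m O = 1%:M /\ O *m O^T = 1%:M.
Proof.
move=> uA O; have [uS sR pR RR] := inv_sqrtmxP (gram_sym A) (gram_posdef uA).
have OO : O^T *m O = 1%:M.
  rewrite /O trmx_mul sR !mulmxA -(mulmxA A^T) RR.
  have -> : invmx (A *m A^T) = invmx A^T *m invmx A.
    have uT : A^T \in unitmx by rewrite unitmx_tr.
    rewrite -[RHS](mulKmx uS) -mulmxA (mulmxA A^T) mulmxV// mul1mx mulmxV//.
    by rewrite mulmx1.
  by rewrite mulmxA mulmxV ?unitmx_tr// mul1mx mulVmx.
by split => //; exact: mulmx1C.
Qed.

End inverse_sqrt.

(** * The weighted L2 space *)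

Section L1_almost_everywhere.
Context {R : realType} {d : measure_display} {T : measurableType d}.
Variable mu : {measure set T -> \bar R}.

Lemma L1_ae (f g : T -> R) : measurable_fun setT g -> f = g %[ae mu] -> L1 mu f -> L1 mu g.
Proof.
move=> mg fg lf; apply: L1P => //.
rewrite (@ae_eq_integral _ _ _ mu setT (fun x => `|f x|%:E) (fun x => `|g x|%:E))//.
- exact: L1_lty.
- by apply/measurable_EFinP; exact: measurableT_comp.
- by apply/measurable_EFinP; apply: measurableT_comp => //; exact: L1_meas lf.
- by apply: filterS fg => x /= h Dx; rewrite h.
Qed.

Lemma Rint_ae (f g : T -> R) : measurable_fun setT f -> measurable_fun setT g ->
  f = g %[ae mu] -> \int[mu]_x f x = \int[mu]_x g x.
Proof.
move=> mf mg fg; rewrite /Rintegral; congr fine; apply: ae_eq_integral => //.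
- exact/measurable_EFinP.
- exact/measurable_EFinP.
- by apply: filterS fg => x /= h Dx; rewrite h.
Qed.

End L1_almost_everywhere.

(** * Gaussian envelopes *)

Section envelope.
Context {R : realType} {d : nat}.
Local Notation vec := (vec R d).

Lemma dotv_colvec (s t : vec) : dotv (colvec s) (colvec t) = vdot s t.
Proof. by rewrite dotvE; apply: eq_bigr => i _; rewrite !mxE. Qed.

(* the growth scale of all bounds: square integrable for rho < gamma *)
Definition env (rho : R) (t : vec) : R := expR (rho * vdot t t / 2).

Lemma env_ge0 rho t : 0 <= env rho t. Proof. exact: expR_ge0. Qed.

Lemma measurable_env rho : measurable_fun setT (env rho).
Proof.
apply: measurableT_comp => //; apply: measurable_funM => //.
by apply: measurable_funM => //; exact: measurable_vdot.
Qed.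

Lemma envM a b t : env a t * env b t = env (a + b) t.
Proof. by rewrite /env -expRD; congr expR; ring. Qed.

Lemma env_le a b t : a <= b -> env a t <= env b t.
Proof.
by move=> ab; rewrite ler_expR ler_wpM2r// ler_wpM2r// vdot_ge0.
Qed.

Lemma env_sqr a t : env a t ^+ 2 = env (2 * a) t.
Proof. by rewrite expr2 envM mulr_natl mulr2n. Qed.

Lemma integral_exp_sqr_lty (a : R) : 0 < a ->
  (\int[@lebesgue_measure R]_x (expR (- a * x ^+ 2))%:E < +oo)%E.
Proof.
move=> a0; pose s := Num.sqrt (2 * a)^-1.
have s0 : 0 < s by rewrite sqrtr_gt0 invr_gt0 mulr_gt0.
have s2 : s ^+ 2 = (2 * a)^-1 by rewrite sqr_sqrtr// invr_ge0 mulr_ge0// ltW.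
have sn : s != 0 by exact: lt0r_neq0.
have p0 : 0 < normal_peak s by exact: normal_peak_gt0.
have -> : (\int[@lebesgue_measure R]_x (expR (- a * x ^+ 2))%:E =
   \int[@lebesgue_measure R]_x (((normal_peak s)^-1)%:E * (normal_pdf 0 s x)%:E))%E.
  apply: eq_integral => x _; rewrite (_ : normal_pdf 0 s x = normal_peak s * normal_fun 0 s x); last by rewrite normal_pdfE.
  rewrite -EFinM mulKf ?gt_eqF// /normal_fun.
  by congr (expR _)%:E; rewrite subr0 s2; field; exact: lt0r_neq0.
rewrite ge0_integralZl//.
- by rewrite integral_normal_pdf// mule1 ltry.
- by apply/measurable_EFinP; exact: measurable_normal_pdf.
- by move=> x _; rewrite lee_fin normal_pdf_ge0.
- by rewrite lee_fin invr_ge0 ltW.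
Qed.

Variable gamma : R.
Local Notation nu := (@wlebesgue R d gamma).

(** Times the weight, the envelope is exp(-(gamma - rho / 2) |t|^2), a product of Gaussian
    functions. Since the square of [env rho] is [env (2 * rho)], this yields square integrability
    for rho < gamma. *)
Lemma L1_env rho : rho < 2 * gamma -> L1 nu (env rho).
Proof.
move=> rg; have me := measurable_env rho.
apply/(L1_density (g := weight gamma) (mu := lebesgue d)) => //.
- exact: measurable_weight.
- by move=> x; exact: expR_ge0.
pose a := gamma - rho / 2; have a0 : 0 < a by rewrite /a; lra.
have mE n : measurable_fun setT (fun t : Defs.vec R n => expR (- a * vdot t t)).
  by apply: measurableT_comp => //; apply: measurable_funM => //; exact: measurable_vdot.
have e : (fun t => env rho t * weight gamma t) = fun t => expR (- a * vdot t t).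
  by apply/funext => t; rewrite /env /weight dotv_colvec -expRD /a; congr expR; field.
apply: L1P; first by rewrite e; exact: mE.
under eq_integral do rewrite [env _ _ * _](congr1 (fun f => f _) e) ger0_norm ?expR_ge0//.
have mg1 : measurable_fun setT (fun x : measurableTypeR R => expR (- a * x ^+ 2)).
  by apply: measurableT_comp => //; apply: measurable_funM => //; exact: measurable_monom.
clear e me; elim: {rg}d => [|n IH].
  by rewrite integral_power0 ?ltry//; apply/measurable_EFinP; exact: mE.
rewrite ge0_integral_powerS//; last by apply/measurable_EFinP; exact: mE.
set I := (\int[_]_t _)%E in IH.
rewrite (eq_integral (fun x : measurableTypeR R => (expR (- a * x ^+ 2))%:E * I)%E); last first.
  move=> x _; rewrite /I -ge0_integralZl ?lee_fin ?expR_ge0//; last first.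
    by apply/measurable_EFinP; exact: mE.
  apply: eq_integral => t _; rewrite -EFinM -expRD vdot_recl vtail_cons cons_tuple0.
  by congr (expR _)%:E; ring.
have I0 : (0 <= I)%E by apply: integral_ge0 => t _; rewrite lee_fin expR_ge0.
rewrite ge0_integralZr//.
- apply: lte_mul_pinfty => //.
  + by apply: integral_ge0 => t _; rewrite lee_fin expR_ge0.
  + rewrite ge0_fin_numE ?integral_exp_sqr_lty//.
    by apply: integral_ge0 => t _; rewrite lee_fin expR_ge0.
- exact/measurable_EFinP.
Qed.

End envelope.

(** * Representatives, distance and inner product *)

Section L2_elements.
Context {R : realType} {d : nat} {gamma : R}.
Local Notation vec := (vec R d).
Local Notation nu := (@wlebesgue R d gamma).
Local Notation L2 := (L2 d gamma).
Implicit Types (f g : vec -> R) (F G H : L2).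

Lemma measurable_L2fun F : measurable_fun setT (L2fun F).
Proof.
exact: (@measurable_funPT _ _ vec (measurableTypeR R) (repr (LebesgueSpace.sort F))).
Qed.

Lemma integral_sqr_Lnorm f : (\int[nu]_t (f t ^+ 2)%:E = 'N[nu]_2%:E[EFin \o f] `^ 2)%E.
Proof.
rewrite poweR_Lnorm//; apply: eq_integral => t _ /=.
by rewrite powR_mulrn// real_normK ?num_real.
Qed.

Lemma L1_sqr_Lnorm f : measurable_fun setT f ->
  L1 nu (fun t => f t ^+ 2) <-> ('N[nu]_2%:E[EFin \o f] < +oo)%E.
Proof.
move=> mf; have E : (\int[nu]_t `|f t ^+ 2|%:E = 'N[nu]_2%:E[EFin \o f] `^ 2)%E.
  rewrite -integral_sqr_Lnorm; apply: eq_integral => t _.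
  by rewrite ger0_norm// sqr_ge0.
split=> [/L1_lty|h].
  rewrite E; have := Lnorm_ge0 nu 2%:E (EFin \o f); case: ('N[nu]_2%:E[EFin \o f])%E => [r _ _|_|//].
    by rewrite ltry.
  by rewrite /poweR (negbTE (lt0r_neq0 _)).
apply: L1P; first exact: measurable_funX.
by rewrite E; exact: poweR_lty.
Qed.

Lemma L2fun_sqr F : L1 nu (fun t => L2fun F t ^+ 2).
Proof.
by apply/L1_sqr_Lnorm; [exact: measurable_L2fun|case: F => f [[]]].
Qed.

(** The representative chosen from the class of f agrees with f only almost everywhere, hence the
    form of the conclusion here and in all later constructions. *)
Lemma L2_exists f : measurable_fun setT f -> L1 nu (fun t => f t ^+ 2) ->
  exists F : L2, L2fun F = f %[ae nu].
Proof.
move=> mf lf.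
have mf' : (f : vec -> measurableTypeR R) \in @mfun _ _ vec (measurableTypeR R) by rewrite inE.
pose g := mfun_Sub mf'.
pose G : {mfun_ nu, vec >-> measurableTypeR R} := \pi_({mfun_ nu, vec >-> measurableTypeR R})%qT g.
have Gg : repr G = g %[ae nu].
  have : (repr G == g %[mod {mfun_ nu, vec >-> measurableTypeR R}])%qT by rewrite reprK.
  by rewrite eqmodE => /asboolP.
have fin : finite_norm nu 2%:E G.
  rewrite /finite_norm; apply/L1_sqr_Lnorm.
    exact: (@measurable_funPT _ _ vec (measurableTypeR R) (repr G)).
  apply: (L1_ae (f := fun t => f t ^+ 2)) => //.
    apply: measurable_funX; exact: (@measurable_funPT _ _ vec (measurableTypeR R) (repr G)).
  by apply: filterS Gg => t /= h _; rewrite -(h I).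
by exists (LebesgueSpace.Pack (LebesgueSpace.Class (@isFinLebesgue.Axioms_ _ _ _ _ _ _ G fin))).
Qed.

(** Frees all later estimates from the representatives [L2fun]. *)
Lemma L2distE F G f g : measurable_fun setT f -> measurable_fun setT g ->
  L2fun F = f %[ae nu] -> L2fun G = g %[ae nu] ->
  L1 nu (fun t => (f t - g t) ^+ 2) /\
  L2dist F G = Num.sqrt (\int[nu]_t ((f t - g t) ^+ 2)).
Proof.
move=> mf mg Ff Gg.
have mFG : measurable_fun setT (L2fun F \- L2fun G).
  by apply: measurable_funB; exact: measurable_L2fun.
have lFG : L1 nu (fun t => (L2fun F \- L2fun G) t ^+ 2).
  apply: (L1_le (g := fun t => 2 * L2fun F t ^+ 2 + 2 * L2fun G t ^+ 2)).
  - exact: measurable_funX.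
  - move=> t /=; rewrite ger0_norm ?sqr_ge0//.
    have := sqr_ge0 (L2fun F t + L2fun G t); rewrite sqrrD sqrrB; lra.
  - by apply: L1D; apply: L1Z; exact: L2fun_sqr.
have e : (fun t => (L2fun F \- L2fun G) t ^+ 2) = (fun t => (f t - g t) ^+ 2) %[ae nu].
  by apply: filterS2 Ff Gg => t /= h1 h2 _; rewrite h1// h2.
have mfg : measurable_fun setT (fun t => (f t - g t) ^+ 2).
  by apply: measurable_funX; exact: measurable_funB.
split; first exact: L1_ae lFG.
rewrite -(Rint_ae (L1_meas lFG) mfg e) /L2dist.
have := integral_sqr_Lnorm (L2fun F \- L2fun G); rewrite -(RintE lFG).
have := Lnorm_ge0 nu 2%:E (EFin \o (L2fun F \- L2fun G)).
case: ('N[nu]_2%:E[EFin \o (L2fun F \- L2fun G)%R])%E => [r| |//] /=; last first.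
  by move=> _; rewrite pnatr_eq0.
  rewrite lee_fin => r0 /=; rewrite powR_mulrn// => -[->].
  by rewrite sqrtr_sqr ger0_norm.
Qed.

Lemma L2dist_ge0 F G : 0 <= L2dist F G.
Proof. by apply: fine_ge0; exact: Lnorm_ge0. Qed.

Lemma L2dist_env F G f g c rho : measurable_fun setT f -> measurable_fun setT g ->
  L2fun F = f %[ae nu] -> L2fun G = g %[ae nu] -> 0 <= c -> rho < gamma ->
  (forall t, `|f t - g t| <= c * env rho t) ->
  L2dist F G <= c * Num.sqrt (\int[nu]_t env (2 * rho) t).
Proof.
move=> mf mg Ff Gg c0 rg fg; have [lfg ->] := L2distE mf mg Ff Gg.
have le := L1_env (d := d) (rho := 2 * rho) (gamma := gamma) ltac:(by rewrite ltr_pM2l).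
rewrite -{1}(ger0_norm c0) -sqrtr_sqr -sqrtrM ?sqr_ge0//; apply: ler_wsqrtr.
rewrite -RintZ//; apply: Rint_le => //; first exact: L1Z.
move=> t; rewrite -env_sqr -exprMn -[leLHS]real_normK ?num_real//.
by rewrite lerXn2r ?nnegrE// mulr_ge0// env_ge0.
Qed.

Lemma L2_exists_env f c rho : measurable_fun setT f -> rho < gamma ->
  (forall t, `|f t| <= c * env rho t) -> exists F : L2, L2fun F = f %[ae nu].
Proof.
move=> mf rg fe; apply: L2_exists => //.
have le := L1_env (d := d) (rho := 2 * rho) (gamma := gamma) ltac:(by rewrite ltr_pM2l).
apply: (L1_le (g := fun t => c ^+ 2 * env (2 * rho) t)); last exact: L1Z.
- exact: measurable_funX.
- move=> t; rewrite normrX -env_sqr -exprMn lerXn2r ?nnegrE//.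
  by rewrite (le_trans _ (fe t)).
Qed.

Lemma L2innerE F G f g : measurable_fun setT f -> measurable_fun setT g ->
  L2fun F = f %[ae nu] -> L2fun G = g %[ae nu] ->
  L2inner F G = \int[nu]_t (f t * g t).
Proof.
move=> mf mg Ff Gg; apply: Rint_ae.
- by apply: measurable_funM; exact: measurable_L2fun.
- exact: measurable_funM.
- by apply: filterS2 Ff Gg => t /= h1 h2 _; rewrite h1// h2.
Qed.

Lemma L2inner_lip F G H : `|L2inner F H - L2inner G H| <=
  L2dist F G * Num.sqrt (\int[nu]_t (L2fun H t ^+ 2)).
Proof.
have mF := measurable_L2fun F; have mG := measurable_L2fun G; have mH := measurable_L2fun H.
have [lFG ->] := L2distE mF mG (aeW _ (fun t _ => erefl)) (aeW _ (fun t _ => erefl)).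
rewrite /L2inner -RintB; [|by apply: L1_sqrM => //; exact: L2fun_sqr..].
under eq_Rintegral do rewrite -mulrBl.
have := Rint_CS (measurable_funB mF mG) mH lFG (L2fun_sqr H).
have I0 : 0 <= \int[nu]_t ((L2fun F t - L2fun G t) ^+ 2) by apply: Rint_ge0 => t; rewrite sqr_ge0.
have H0 : 0 <= \int[nu]_t (L2fun H t ^+ 2) by apply: Rint_ge0 => t; rewrite sqr_ge0.
by rewrite -ler_sqrt ?mulr_ge0// sqrtr_sqr sqrtrM.
Qed.

Lemma L2ball F (e : R) G : ball F e G <-> L2dist F G < e.
Proof. by rewrite ballEmdist. Qed.

End L2_elements.

(** * Open sets and random elements *)

Section L2_topology.
Context {R : realType} {d : nat} {gamma : R}.
Local Notation L2 := (L2 d gamma).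
Implicit Types (F G H : L2) (O : set L2).

Lemma L2distC F G : L2dist F G = L2dist G F.
Proof. exact: (@metric_sym R L2). Qed.

Lemma L2dist_tri G F H : L2dist F H <= L2dist F G + L2dist G H.
Proof. exact: (@metric_triangle R L2). Qed.

Lemma L2distxx F : L2dist F F = 0.
Proof. exact: (@mdistxx R L2). Qed.

Lemma L2_openP O : open O <->
  forall F, O F -> exists e : R, 0 < e /\ forall G, L2dist F G < e -> O G.
Proof.
rewrite openE; split=> h F /h.
  move=> /nbhs_ballP[e /= e0 he]; exists e; split => // G FG; exact: he.
move=> [e [e0 he]]; apply/nbhs_ballP; exists e => //= G /L2ball; exact: he.
Qed.

Lemma L2_continuous_at (h : L2 -> R) F : continuous h -> forall e : R, 0 < e ->
  exists a : R, 0 < a /\ forall G, L2dist F G < a -> `|h F - h G| < e.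
Proof.
move=> ch e e0; have /cvgrPdist_lt/(_ _ e0)/nbhs_ballP[a /= a0 ha] := ch F.
by exists a; split => // G FG; apply: ha; exact/L2ball.
Qed.

Lemma L2_lip_continuous (h : L2 -> R) (L : R) :
  (forall F G, `|h F - h G| <= L * L2dist F G) -> continuous h.
Proof.
move=> hL F; apply/(@cvgrPdist_lt _ _ _ (nbhs F)) => e e0; apply/nbhs_ballP.
have L1 : 0 < `|L| + 1 by rewrite ltr_pwDr.
exists (e / (`|L| + 1)); rewrite /= ?divr_gt0// => G /L2ball.
rewrite ltr_pdivlMr// => h1; apply: le_lt_trans h1; apply: (le_trans (hL F G)).
rewrite mulrC ler_wpM2l ?L2dist_ge0//; have := ler_norm L; lra.
Qed.

Section random.
Context {dT : measure_display} {T : measurableType dT}.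
Implicit Types V : T -> L2.

Lemma random_elementP V : (forall O, open O -> measurable (V @^-1` O)) -> random_element V.
Proof.
move=> h B hB; apply: (hB [set B | measurable (V @^-1` B)]); split => //.
split => /=; first by rewrite preimage_set0.
- by move=> A mA; rewrite setTD preimage_setC; exact: measurableC.
- by move=> A mA; rewrite preimage_bigcup; exact: bigcupT_measurable.
Qed.

Lemma random_element_open V O : random_element V -> open O -> measurable (V @^-1` O).
Proof. by move=> rV oO; apply: rV; exact: sub_sigma_algebra. Qed.

Lemma measurable_comp_random V (h : L2 -> R) : random_element V -> continuous h ->
  measurable_fun setT (h \o V).
Proof.
move=> rV ch mD; apply: (measurability _ (RGenOInfty.measurableE R)) => //.
move=> _ [_ [a ->] <-]; rewrite setTI comp_preimage; apply: random_element_open => //.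
by apply: open_comp => //; exact: open_gt.
Qed.

(** V w lies in the open set O exactly when, for some j, all late V_m w lie in the shrunk set [Oj j]
    of points having a ball of radius larger than 1 / (j + 1) inside O. The strict inequality makes
    [Oj j] open, and only countable operations occur. *)
Lemma random_element_lim (V_ : nat -> T -> L2) V : (forall m, random_element (V_ m)) ->
  (forall w (e : R), 0 < e -> exists N, forall m, (N <= m)%N -> L2dist (V_ m w) (V w) < e) ->
  random_element V.
Proof.
move=> rV hV; apply: random_elementP => O /L2_openP oO.
pose Oj (j : nat) : set L2 := [set F | exists e : R, j.+1%:R^-1 < e /\ forall G, L2dist F G < e -> O G].
have oOj j : open (Oj j).
  rewrite /Oj; set u := j.+1%:R^-1.
  apply/L2_openP => F [e [je he]]; pose t := (e - u) / 2.
  exists t; split; first by rewrite /t divr_gt0// subr_gt0.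
  move=> G FG; exists (e - t); split; first by rewrite /t; lra.
  by move=> H GH; apply: he; apply: (le_lt_trans (L2dist_tri G _ _)); lra.
have -> : V @^-1` O = \bigcup_j \bigcup_N \bigcap_m (V_ (N + m)%N @^-1` Oj j).
  apply/seteqP; split => w /=.
    move=> /oO[e [e0 he]]; pose j := Num.truncn (2 / e).
    have je : j.+1%:R^-1 < e / 2.
      rewrite -[e / 2]invrK ltf_pV2 ?posrE ?invr_gt0 ?divr_gt0// invf_div.
      exact: truncnS_gt.
    have [N hN] := hV w (e / 2) (divr_gt0 e0 (ltr0Sn _ 1)).
    exists j => //; exists N => // m _ /=; exists (e / 2); split => // G mG; apply: he.
    apply: (le_lt_trans (L2dist_tri (V_ (N + m)%N w) _ _)).
    by rewrite L2distC; have := hN _ (leq_addr m N); lra.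
  move=> [j _ [N _ h]].
  have j0 : 0 < j.+1%:R^-1 :> R by rewrite invr_gt0.
  have [N' hN'] := hV w _ j0.
  have [e [je he]] := h N' I; apply: he; apply: lt_trans je; apply: hN'.
  exact: leq_addl.
apply: bigcupT_measurable => j; apply: bigcupT_measurable => N.
by apply: bigcapT_measurable => m; exact: random_element_open.
Qed.

(* preimages of open sets are cut out by countably many rational boxes *)
Lemma random_element_cont k (phi : T -> vec R k) (C : set (vec R k)) (Phi : vec R k -> L2)
    (F0 : L2) (V : T -> L2) :
  measurable_fun setT phi -> measurable (phi @^-1` C) ->
  (forall w, C (phi w) -> V w = Phi (phi w)) -> (forall w, ~ C (phi w) -> V w = F0) ->
  (forall x, C x -> forall e : R, 0 < e -> exists a : R, 0 < a /\ forall y, C y ->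
     (forall i, `|tnth y i - tnth x i| < a) -> L2dist (Phi x) (Phi y) < e) ->
  random_element V.
Proof.
move=> mphi mC VC VnC cont; apply: random_elementP => O /L2_openP oO.
pose bx (p : k.-tuple rat * rat) : set (vec R k) :=
  [set y | forall i, `|tnth y i - ratr (tnth p.1 i)| < ratr p.2].
have mbx p : measurable (phi @^-1` bx p).
  have -> : phi @^-1` bx p = \bigcap_(i in [set: 'I_k])
     ((fun w => `|tnth (phi w) i - ratr (tnth p.1 i)|) @^-1` `]-oo, (ratr p.2 : R)[).
    apply/seteqP; split => w /=; first by move=> h i _; rewrite /= in_itv /=; exact: h.
    by move=> h i; have := h i I; rewrite /= in_itv.
  apply: fin_bigcap_measurable => // i _; rewrite -[X in measurable X]setTI.
  suff h : measurable_fun setT (fun w => `|tnth (phi w) i - ratr (tnth p.1 i)| : R) by exact: h.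
  apply: measurableT_comp => //; apply: measurable_funB => //.
  exact: (measurableT_comp (measurable_tnthR i) mphi).
pose good p := `[< forall y, C y -> bx p y -> O (Phi y) >].
pose F (n : nat) : set T := if unpickle n is Some p then
  (if good p then phi @^-1` bx p else set0) else set0.
have mF n : measurable (F n) by rewrite /F; case: unpickle => // p; case: ifP.
have -> : V @^-1` O = (phi @^-1` C `&` \bigcup_n F n) `|`
    (~` (phi @^-1` C) `&` [set w | O F0]).
  apply/seteqP; split => w /=.
    have [cw|cw] := pselect (C (phi w)); last by rewrite (VnC _ cw); right.
    rewrite (VC _ cw) => /oO[e [e0 he]]; left; split => //.
    have [a [a0 ha]] := cont _ cw e e0.
    have [r /andP[r0 ra]] : exists r : rat, 0 < (ratr r : R) < a / 2.
      have [r] := rat_in_itvoo (divr_gt0 a0 (ltr0Sn _ 1)).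
      by rewrite in_itv /= => h; exists r.
    have /choice[q hq] i : exists q : rat, `|tnth (phi w) i - ratr q| < ratr r.
      have lt1 : tnth (phi w) i - ratr r < tnth (phi w) i by rewrite ltrBlDr ltrDl.
      have [q] := rat_in_itvoo lt1; rewrite in_itv /= => /andP[q1 q2].
      by exists q; rewrite gtr0_norm; lra.
    pose p : k.-tuple rat * rat := ([tuple q i | i < k], r).
    exists (pickle p) => //; rewrite /F pickleK.
    have hp : bx p (phi w) by move=> i /=; rewrite tnth_mktuple.
    suff -> : good p by [].
    apply/asboolP => y Cy hy; apply: he; apply: ha => // i.
    have := hp i; have := hy i; rewrite !ltr_norml /= => /andP[h1 h2] /andP[h3 h4].
    by apply/andP; split; lra.
  move=> [[cw [n _]]|[cw]].
    rewrite /F; case: (unpickle n) => [p|//]; case: ifP => // /asboolP gp hp.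
    by rewrite (VC _ cw); exact: gp.
  by rewrite (VnC _ cw).
apply: measurableU; first by apply: measurableI => //; exact: bigcupT_measurable.
apply: measurableI; first exact: measurableC.
have [OF|OF] := pselect (O F0).
  by rewrite (_ : [set w | _] = setT)//; apply/seteqP; split.
by rewrite (_ : [set w | _] = set0)//; apply/seteqP; split.
Qed.

End random.

End L2_topology.

(** * Multivariate Hermite functions *)

Section multi_hermite.
Context {R : realType} {d : nat}.
Local Notation vec := (vec R d).
Local Notation J := {ffun 'I_d -> nat}.
Local Notation box := (@box d).
Implicit Types (al be : J) (z t s : vec).

Definition sqf (k : nat) : R := Num.sqrt (k`!%:R).

Lemma sqf_gt0 k : 0 < sqf k. Proof. by rewrite sqrtr_gt0 ltr0n fact_gt0. Qed.

Lemma sqf2 k : sqf k * sqf k = k`!%:R.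
Proof. by rewrite -expr2 sqr_sqrtr. Qed.

(** Monomials scaled so that the products [mono s al * mono t al] add up to exp(s.t). *)
Definition mono t al : R := \prod_i (tnth t i ^+ al i / sqf (al i)).

(** The orthonormal Hermite polynomial of index al. *)
Definition heta z al : R := \prod_i ((hermite R (al i)).[tnth z i] / sqf (al i)).

Lemma degX (r : R) al : r ^+ deg al = \prod_i r ^+ al i.
Proof. by rewrite /deg prodrXr. Qed.

Lemma mono_cvg (r : R) s t :
  (fun m => \sum_(al <- box m) r ^+ deg al * (mono s al * mono t al)) @ \oo -->
    expR (r * vdot s t).
Proof.
pose g (i : 'I_d) k := (r * (tnth s i * tnth t i)) ^+ k / k`!%:R.
have -> : expR (r * vdot s t) = \prod_i expR (r * (tnth s i * tnth t i)).
  rewrite /vdot mulr_sumr; exact: (big_morph _ (@expRD R) (@expR0 R)).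
have h := box_prod_cvg (g := g) (fun i => @exp_sum_cvg R (r * (tnth s i * tnth t i))).
apply: cvgn_ext h => m.
apply: eq_bigr => al _; rewrite degX -!big_split; apply: eq_bigr => i _ /=.
by rewrite /g !exprMn -sqf2; field; rewrite lt0r_neq0 ?sqf_gt0.
Qed.

Lemma mono_trig_cvg s t :
  (fun m => \sum_(al <- box m) (@ipow R (deg al)).1 * (mono s al * mono t al)) @ \oo -->
    cos (vdot s t).
Proof.
pose g (i : 'I_d) k := (tnth s i * tnth t i) ^+ k / k`!%:R.
have h i : (fun m => \sum_(k < m) (@ipow R k).1 * g i k) @ \oo --> 1 * cos (tnth s i * tnth t i) /\
   (fun m => \sum_(k < m) (@ipow R k).2 * g i k) @ \oo --> 1 * sin (tnth s i * tnth t i).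
  by rewrite !mul1r; exact: trig_sum_cvg.
have [h1 _] := box_trig_cvg h; rewrite big1_eq mul1r in h1.
apply: cvgn_ext h1 => m; apply: eq_bigr => al _; congr (_ * _).
rewrite -!big_split; apply: eq_bigr => i _ /=.
by rewrite /g !exprMn -sqf2; field; rewrite lt0r_neq0 ?sqf_gt0.
Qed.

Let hetaE z t al : heta z al * mono t al =
  \prod_i ((hermite R (al i)).[tnth z i] / (al i)`!%:R * tnth t i ^+ al i).
Proof.
rewrite -big_split; apply: eq_bigr => i _ /=.
by rewrite -sqf2; field; rewrite lt0r_neq0 ?sqf_gt0.
Qed.

Lemma heta_exp_cvg z t :
  (fun m => \sum_(al <- box m) heta z al * mono t al) @ \oo -->
    expR (vdot t z - vdot t t / 2).
Proof.
pose g (i : 'I_d) k := (hermite R k).[tnth z i] / k`!%:R * tnth t i ^+ k.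
have h i : (fun m => \sum_(k < m) g i k) @ \oo --> expR (tnth z i * tnth t i - tnth t i ^+ 2 / 2).
  have h1 (k : nat) : `|1 : R| <= 1 by rewrite normr1.
  rewrite -hsum_exp; apply: cvgn_ext (@hsum_cvg R (fun=> 1) (tnth z i) (tnth t i) h1) => m.
  by apply: eq_bigr => k _; rewrite mul1r.
have -> : expR (vdot t z - vdot t t / 2) = \prod_i expR (tnth z i * tnth t i - tnth t i ^+ 2 / 2).
  rewrite -(big_morph _ (@expRD R) (@expR0 R)); congr expR.
  rewrite sumrB /vdot mulr_suml; congr (_ - _); apply: eq_bigr => i _; by rewrite mulrC.
apply: cvgn_ext (box_prod_cvg h) => m.
by apply: eq_bigr => al _; rewrite hetaE.
Qed.

Lemma heta_trig_cvg z t :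
  (fun m => \sum_(al <- box m) (@ipow R (deg al)).1 * (heta z al * mono t al)) @ \oo -->
    expR (vdot t t / 2) * cos (vdot t z) /\
  (fun m => \sum_(al <- box m) (@ipow R (deg al)).2 * (heta z al * mono t al)) @ \oo -->
    expR (vdot t t / 2) * sin (vdot t z).
Proof.
pose g (i : 'I_d) k := (hermite R k).[tnth z i] / k`!%:R * tnth t i ^+ k.
have h i : (fun m => \sum_(k < m) (@ipow R k).1 * g i k) @ \oo -->
     expR (tnth t i ^+ 2 / 2) * cos (tnth t i * tnth z i) /\
   (fun m => \sum_(k < m) (@ipow R k).2 * g i k) @ \oo -->
     expR (tnth t i ^+ 2 / 2) * sin (tnth t i * tnth z i).
  rewrite [tnth t i * _]mulrC; have [<- <-] := hsum_trig (tnth z i) (tnth t i).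
  by split; apply: hsum_cvg => k; have [] := @ipow_norm R k.
have -> : expR (vdot t t / 2) = \prod_i expR (tnth t i ^+ 2 / 2).
  rewrite -(big_morph _ (@expRD R) (@expR0 R)); congr expR.
  by rewrite /vdot mulr_suml; apply: eq_bigr => i _; rewrite expr2.
by have [h1 h2] := box_trig_cvg h; split; [apply: cvgn_ext h1|apply: cvgn_ext h2] => m;
  apply: eq_bigr => al _; rewrite hetaE.
Qed.

Lemma box_sub (V : zmodType) (F : J -> V) m n : (m <= n)%N ->
  \sum_(al <- box n) F al = \sum_(al <- box m) F al + \sum_(al <- box n | al \notin box m) F al.
Proof.
move=> mn; rewrite (bigID (fun al => al \in box m)) /=; congr (_ + _).
rewrite -big_filter; apply: perm_big; apply: uniq_perm.
- by rewrite filter_uniq// box_uniq.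
- exact: box_uniq.
- move=> al; rewrite mem_filter; have [am|//] := boolP (al \in box m).
  rewrite mem_box; apply/forallP => i; move: am; rewrite mem_box => /forallP/(_ i) h.
  exact: leq_trans mn.
Qed.

Lemma box_le_lim (F : J -> R) l m (p : pred J) : (forall al, 0 <= F al) ->
  (fun n => \sum_(al <- box n) F al) @ \oo --> l -> \sum_(al <- box m | p al) F al <= l.
Proof.
move=> F0 Fl; apply: (@le_trans _ _ (\sum_(al <- box m) F al)).
  by rewrite [leRHS](bigID p)/= lerDl sumr_ge0.
rewrite -(cvg_lim (@Rhausdorff R) Fl); apply: limr_ge; first by apply/cvg_ex; exists l.
near=> n; have mn : (m <= n)%N by near: n; exact: nbhs_infty_ge.
by rewrite (box_sub _ mn) lerDl sumr_ge0.
Unshelve. all: by end_near. Qed.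

Lemma seq_CS (I : Type) (r : seq I) (p : pred I) (u v : I -> R) :
  (\sum_(i <- r | p i) u i * v i) ^+ 2 <=
  (\sum_(i <- r | p i) u i ^+ 2) * \sum_(i <- r | p i) v i ^+ 2.
Proof.
apply: quad_CS => a b; rewrite !mulr_sumr -!big_split /=.
by apply: sumr_ge0 => i _; have := sqr_ge0 (a * u i + b * v i); rewrite sqrrD; nra.
Qed.

Section weighted.
Variables (rho B : R) (a : nat -> R).
Hypothesis rho0 : 0 < rho.
Hypothesis aB : forall k, `|a k| <= B.

Let wt al : 0 < rho ^+ deg al. Proof. by rewrite exprn_gt0. Qed.

Let B0 : 0 <= B. Proof. exact: le_trans (aB 0). Qed.

(** The weight rho^|al| is split between the factors: dividing by it makes random coefficients of
    bounded variance summable, multiplying by it costs only a larger exponent in the envelope. *)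
Lemma weighted_CS m (p : pred J) (x f : J -> R) :
  `|\sum_(al <- box m | p al) a (deg al) * x al * f al| <=
  B * Num.sqrt ((\sum_(al <- box m | p al) x al ^+ 2 / rho ^+ deg al) *
    \sum_(al <- box m | p al) rho ^+ deg al * f al ^+ 2).
Proof.
pose u al := x al / Num.sqrt (rho ^+ deg al).
pose v al := a (deg al) * (Num.sqrt (rho ^+ deg al) * f al).
have q0 al : 0 < Num.sqrt (rho ^+ deg al) by rewrite sqrtr_gt0.
have q2 al : Num.sqrt (rho ^+ deg al) ^+ 2 = rho ^+ deg al by rewrite sqr_sqrtr// ltW.
have U0 : 0 <= \sum_(al <- box m | p al) x al ^+ 2 / rho ^+ deg al.
  by apply: sumr_ge0 => al _; rewrite divr_ge0 ?sqr_ge0// ltW.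
have V0 : 0 <= \sum_(al <- box m | p al) rho ^+ deg al * f al ^+ 2.
  by apply: sumr_ge0 => al _; rewrite mulr_ge0 ?sqr_ge0// ltW.
have -> : \sum_(al <- box m | p al) a (deg al) * x al * f al = \sum_(al <- box m | p al) u al * v al.
  by apply: eq_bigr => al _; rewrite /u /v; field; rewrite gt_eqF.
rewrite -ler_sqr ?nnegrE ?mulr_ge0 ?sqrtr_ge0// real_normK ?num_real//.
rewrite (le_trans (seq_CS _ _ _ _))// exprMn sqr_sqrtr ?mulr_ge0// mulrCA.
have -> : \sum_(al <- box m | p al) u al ^+ 2 = \sum_(al <- box m | p al) x al ^+ 2 / rho ^+ deg al.
  by apply: eq_bigr => al _; rewrite /u exprMn exprVn q2.
apply: ler_wpM2l => //; rewrite mulr_sumr; apply: ler_sum => al _.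
rewrite /v exprMn exprMn q2; apply: ler_wpM2r; first by rewrite mulr_ge0 ?sqr_ge0// ltW.
by rewrite -[leLHS]real_normK ?num_real// lerXn2r ?nnegrE.
Qed.

(** In [weighted_CS] the sum of rho^|al| [mono t al]^2 is at most exp(rho |t|^2), the square of
    [env rho t]. *)
Lemma series_bound m (p : pred J) (x : J -> R) t :
  `|\sum_(al <- box m | p al) a (deg al) * x al * mono t al| <=
  B * Num.sqrt (\sum_(al <- box m | p al) x al ^+ 2 / rho ^+ deg al) * env rho t.
Proof.
apply: (le_trans (weighted_CS _ _ _ _)); rewrite -mulrA ler_wpM2l// sqrtrM; last first.
  by apply: sumr_ge0 => al _; rewrite divr_ge0 ?sqr_ge0// ltW.
rewrite ler_wpM2l ?sqrtr_ge0//.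
have -> : env rho t = Num.sqrt (expR (rho * vdot t t)).
  have -> : expR (rho * vdot t t) = env rho t ^+ 2 by rewrite /env expr2 -expRD; congr expR; field.
  by rewrite sqrtr_sqr ger0_norm// env_ge0.
apply: ler_wsqrtr; apply: (box_le_lim (F := fun al => rho ^+ deg al * mono t al ^+ 2)).
  by move=> al; rewrite mulr_ge0 ?sqr_ge0// ltW.
by apply: cvgn_ext (@mono_cvg rho t t) => n; apply: eq_bigr => al _; rewrite expr2.
Qed.

(** The same with f the difference of the monomials at s and t, whose weighted squares add up to the
    squared distance of s and t for the kernel exp(rho s.t). *)
Lemma series_lip m (x : J -> R) s t :
  `|\sum_(al <- box m) a (deg al) * x al * mono s al -
    \sum_(al <- box m) a (deg al) * x al * mono t al| <=
  B * Num.sqrt ((\sum_(al <- box m) x al ^+ 2 / rho ^+ deg al) *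
    (expR (rho * vdot s s) + expR (rho * vdot t t) - 2 * expR (rho * vdot s t))).
Proof.
rewrite -sumrB (eq_bigr (fun al => a (deg al) * x al * (mono s al - mono t al))); last first.
  by move=> al _; rewrite mulrBr.
apply: (le_trans (weighted_CS _ xpredT _ _)); rewrite ler_wpM2l//; apply: ler_wsqrtr.
apply: ler_wpM2l; first by apply: sumr_ge0 => al _; rewrite divr_ge0 ?sqr_ge0// ltW.
apply: (box_le_lim (F := fun al => rho ^+ deg al * (mono s al - mono t al) ^+ 2)).
  by move=> al; rewrite mulr_ge0 ?sqr_ge0// ltW.
pose P a b n := \sum_(al <- box n) rho ^+ deg al * (mono a al * mono b al).
apply: (cvgn_ext (v := fun n => P s s n + P t t n - 2 * P s t n)); last first.
  by apply: cvgB; [apply: cvgD|apply: cvgMr]; exact: mono_cvg.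
move=> n; rewrite /P mulr_sumr -big_split -sumrB /=; apply: eq_bigr => al _.
by ring.
Qed.

End weighted.

Lemma gauss_heta2 al be : L1 (@gauss R d) (fun z => heta z al * heta z be) /\
  \int[@gauss R d]_z (heta z al * heta z be) = (al == be)%:R.
Proof.
pose f (i : 'I_d) (x : R) := (sqf (al i) * sqf (be i))^-1 * ((hermite R (al i) * hermite R (be i)).[x]).
have [l e] := @L1_power_prod _ _ _ (@N01 R) d f (@N01T R) (fun i => L1Z _ (L1_horner _)).
have E : (fun z : vec => \prod_i f i (tnth z i)) = fun z => heta z al * heta z be.
  apply/funext => z; rewrite /heta -big_split; apply: eq_bigr => i _ /=.
  by rewrite /f hornerM invfM; ring.
rewrite E in l e; split => //; rewrite e.
rewrite (eq_bigr (fun i => (sqf (al i) * sqf (be i))^-1 * (if al i == be i then (al i)`!%:R else 0))); last first.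
  move=> i _; rewrite /f RintZ; last exact: L1_horner.
  by congr (_ * _); exact: hermite_orthogonal.
have [->|ne] := eqVneq al be.
  by rewrite big1// => i _; rewrite eqxx sqf2 mulVf// pnatr_eq0 -lt0n fact_gt0.
have [i hi] : exists i, al i != be i.
  by apply/existsP; apply: contraNT ne; rewrite negb_exists => /forallP h;
     apply/eqP/ffunP => i; have := h i; rewrite negbK => /eqP.
by rewrite (bigD1 i)//= (negbTE hi) mulr0 mul0r.
Qed.

Lemma heta0 z : heta z [ffun=> 0%N] = 1.
Proof.
by rewrite /heta big1// => i _; rewrite ffunE hermite0 /sqf fact0 sqrtr1 divr1.
Qed.

Lemma measurable_heta al : measurable_fun setT (fun z => heta z al).
Proof.
have := L1_meas (gauss_heta2 al [ffun=> 0%N]).1; apply: eq_measurable_fun => z _ /=.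
by rewrite heta0 mulr1.
Qed.

Lemma gauss_heta al : L1 (@gauss R d) (fun z => heta z al) /\
  \int[@gauss R d]_z heta z al = (al == [ffun=> 0%N])%:R.
Proof.
have [l e] := gauss_heta2 al [ffun=> 0%N].
have E : (fun z : vec => heta z al * heta z [ffun=> 0%N]) = fun z => heta z al.
  by apply/funext => z; rewrite heta0 mulr1.
by rewrite E in l e.
Qed.

Lemma gauss_heta4 al be : L1 (@gauss R d) (fun z => heta z al ^+ 2 * heta z be ^+ 2).
Proof.
pose f (i : 'I_d) (x : R) := (sqf (al i) * sqf (be i))^-1 ^+ 2 *
  ((hermite R (al i) ^+ 2 * hermite R (be i) ^+ 2).[x]).
have [l _] := @L1_power_prod _ _ _ (@N01 R) d f (@N01T R) (fun i => L1Z _ (L1_horner _)).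
rewrite (_ : (fun _ => _) = fun z : vec => \prod_i f i (tnth z i))//.
apply/funext => z; rewrite /heta -!prodrXl -big_split; apply: eq_bigr => i _ /=.
by rewrite /f hornerM !horner_exp invfM; ring.
Qed.

End multi_hermite.

(** * Hermite expansion of the statistic *)

Section data_coefficients.
Context {R : realType} {d : nat}.
Local Notation vec := (vec R d).
Local Notation J := {ffun 'I_d -> nat}.
Local Notation box := (@box d).
Implicit Types (al : J) (t : vec).

Definition j0 : J := [ffun=> 0%N].

Definition ei (i : 'I_d) : J := [ffun k => (k == i) : nat].

Definition eij (i j : 'I_d) : J := [ffun k => ((k == i) + (k == j))%N].

Lemma deg0P al : (deg al == 0)%N = (al == j0).
Proof.
rewrite /deg sum_nat_eq0; apply/forallP/eqP => [h|-> i]; last by rewrite ffunE.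
by apply/ffunP => i; rewrite ffunE; have /= /eqP := h i.
Qed.

Lemma deg_ei i : deg (ei i) = 1%N.
Proof.
rewrite /deg (bigD1 i)//= ffunE eqxx big1// => k /negbTE ki; by rewrite ffunE ki.
Qed.

Lemma deg_eij i j : deg (eij i j) = 2%N.
Proof.
rewrite /deg; under eq_bigr do rewrite ffunE; rewrite big_split /=.
by rewrite -[RHS]/(1 + 1)%N -{1}(deg_ei i) -(deg_ei j); congr addn; apply: eq_bigr => k _; rewrite ffunE.
Qed.

Lemma deg1P al : (deg al == 1)%N -> exists i, al = ei i.
Proof.
move=> /eqP d1; have [i ai] : exists i, (0 < al i)%N.
  apply/existsP; apply: contraPT d1; rewrite negb_exists => /forallP h.
  by rewrite /deg big1// => i _; have := h i; rewrite -eqn0Ngt => /eqP.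
exists i; move: d1; rewrite /deg (bigD1 i)//=.
case ak : (al i) ai => [//|k] _; rewrite addSn => -[] /eqP; rewrite addn_eq0 => /andP[/eqP k0].
rewrite sum_nat_eq0 => /forallP h; apply/ffunP => l; rewrite ffunE.
by have [->|li] := eqVneq l i; [rewrite ak k0|have := h l; rewrite li => /eqP].
Qed.

Lemma ei_inj : injective ei.
Proof. by move=> i j /ffunP/(_ i); rewrite !ffunE eqxx; case: eqP. Qed.

Lemma j0_box m : j0 \in box m.+1.
Proof. by rewrite mem_box; apply/forallP => i; rewrite ffunE. Qed.

Lemma ei_box i m : ei i \in box m.+2.
Proof. by rewrite mem_box; apply/forallP => k; rewrite ffunE; case: (k == i). Qed.

Lemma eij_box i j : eij i j \in box 3.
Proof. by rewrite mem_box; apply/forallP => k; rewrite ffunE; case: (k == i); case: (k == j). Qed.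

Lemma sum_deg0 (F : J -> R) m : \sum_(al <- box m.+1) (deg al == 0)%:R * F al = F j0.
Proof.
rewrite (bigD1_seq j0) ?box_uniq ?j0_box//= (_ : (deg j0 == 0)%N = true); last by rewrite deg0P eqxx.
by rewrite mul1r big1 ?addr0// => al; rewrite deg0P => /negbTE ->; rewrite mul0r.
Qed.

Lemma sum_deg1 (F : J -> R) m : \sum_(al <- box m.+2) (deg al == 1)%:R * F al = \sum_i F (ei i).
Proof.
rewrite (bigID (fun al => al \in [seq ei i | i <- enum 'I_d])) /= [X in _ + X]big1 ?addr0; last first.
  move=> al; case: eqP => [/eqP /deg1P[i ->]|_ _]; last by rewrite mul0r.
  by rewrite map_f// mem_enum.
rewrite -big_filter (perm_big [seq ei i | i <- enum 'I_d]) /=; last first.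
  apply: uniq_perm.
  - by rewrite filter_uniq// box_uniq.
  - by rewrite map_inj_uniq ?enum_uniq//; exact: ei_inj.
  - move=> al; rewrite mem_filter; case: (boolP (al \in [seq ei i | i <- enum 'I_d])) => //= /mapP[i _ ->].
    exact: ei_box.
rewrite big_map big_enum /=; apply: eq_bigr => i _.
by rewrite deg_ei eqxx mul1r.
Qed.

Lemma sqf0 : sqf 0 = 1 :> R. Proof. by rewrite /sqf fact0 sqrtr1. Qed.

Lemma sqf1 : sqf 1 = 1 :> R. Proof. by rewrite /sqf sqrtr1. Qed.

Lemma heta_ei (z : vec) i : heta z (ei i) = tnth z i.
Proof.
rewrite /heta (bigD1 i)//= ffunE eqxx hermite1 sqf1 divr1 big1 ?mulr1// => k /negbTE ki.
by rewrite ffunE ki hermite0 sqf0 divr1.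
Qed.

Lemma mono_ei t i : mono t (ei i) = tnth t i.
Proof.
rewrite /mono (bigD1 i)//= ffunE eqxx expr1 sqf1 divr1 big1 ?mulr1// => k /negbTE ki.
by rewrite ffunE ki expr0 sqf0 divr1.
Qed.

Lemma mono_j0 t : mono t j0 = 1.
Proof. by rewrite /mono big1// => i _; rewrite ffunE expr0 sqf0 divr1. Qed.

Lemma heta_eij (z : vec) i j : i != j -> heta z (eij i j) = tnth z i * tnth z j.
Proof.
move=> ij; rewrite /heta (bigD1 i)//= (bigD1 j) 1?eq_sym//= mulrA.
rewrite !ffunE !eqxx (negbTE ij) eq_sym (negbTE ij) /= !hermite1 !sqf1 !divr1.
rewrite big1 ?mulr1// => k /andP[/negbTE ki /negbTE kj].
by rewrite ffunE ki kj hermite0 sqf0 divr1.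
Qed.

Lemma heta_eii (z : vec) i : heta z (eij i i) = (tnth z i ^+ 2 - 1) / Num.sqrt 2.
Proof.
rewrite /heta (bigD1 i)//= ffunE eqxx hermiteSE hermite1 hermite0 mul1r -expr2.
rewrite big1 ?mulr1// => k /negbTE ki.
by rewrite ffunE ki hermite0 sqf0 divr1.
Qed.

Variables (n : nat) (z : nat -> vec).

Local Notation rt := (Num.sqrt (n%:R : R)).

(** The constant Hermite polynomial is left out, as its coefficient would be the deterministic sqrt
    n. *)
Definition coef al : R := if al == j0 then 0 else rt^-1 * \sum_(j < n) heta (z j) al.

(** Dropping the index 0 from [coef] is the same as subtracting a(0) from each limit l j. The shift
    by one ensures that [j0] lies in the box. *)
Lemma coef_series (a : nat -> R) (l : nat -> R) t :
  (forall j, (fun m => \sum_(al <- box m) a (deg al) * (heta (z j) al * mono t al)) @ \oo --> l j) ->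
  (fun m => \sum_(al <- box m) a (deg al) * coef al * mono t al) @ \oo -->
    rt^-1 * \sum_(j < n) (l j - a 0%N).
Proof.
move=> h; rewrite -cvg_shiftS.
pose u m j := \sum_(al <- box m) a (deg al) * (heta (z j) al * mono t al).
apply: (cvgn_ext (v := fun m => rt^-1 * \sum_(j < n) (u m.+1 j - a 0%N))); last first.
  apply: cvgMr; apply: (@Rcvg_sum _ _ _ (fun (j : 'I_n) m => u m.+1 j - a 0%N)) => j.
  by apply: cvgB; [have := h j; rewrite -cvg_shiftS|exact: cvg_cst].
move=> m /=.
have uE j : u m.+1 j - a 0%N = \sum_(al <- box m.+1 | al != j0) a (deg al) * (heta (z j) al * mono t al).
  rewrite /u (bigD1_seq j0) ?box_uniq ?j0_box//= heta0 mono_j0 !mulr1.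
  by rewrite (eqP (_ : deg j0 == 0%N)) ?deg0P// addrC addrK.
under [in RHS]eq_bigr do rewrite uE.
rewrite exchange_big mulr_sumr (bigD1_seq j0) ?box_uniq ?j0_box//= {1}/coef eqxx mulr0 mul0r add0r.
apply: eq_bigr => al /negbTE a0; rewrite /coef a0 mulr_sumr mulr_sumr mulr_suml mulr_sumr.
by apply: eq_bigr => j _; ring.
Qed.

(* on this event all estimates below are deterministic *)
Definition coef_le (rho K : R) :=
  forall m, \sum_(al <- box m) coef al ^+ 2 / rho ^+ deg al <= K ^+ 2.

Lemma lim_norm_le (u : nat -> R) l c : u @ \oo --> l -> (forall k, `|u k| <= c) -> `|l| <= c.
Proof.
move=> ul uc; have nl : (fun k => `|u k|) @ \oo --> `|l| by exact: cvg_norm.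
rewrite -(cvg_lim (@Rhausdorff R) nl); apply: limr_le; first by apply/cvg_ex; exists `|l|.
by near=> k.
Unshelve. all: by end_near. Qed.

Lemma coef_bound (rho K B : R) (a : nat -> R) t l : 0 < rho -> 0 <= K -> coef_le rho K ->
  (forall k, `|a k| <= B) ->
  (fun m => \sum_(al <- box m) a (deg al) * coef al * mono t al) @ \oo --> l ->
  `|l| <= B * K * env rho t.
Proof.
move=> r0 K0 cK aB al; apply: (lim_norm_le al) => m.
apply: (le_trans (series_bound r0 aB m xpredT coef t)); rewrite ler_wpM2r ?env_ge0//.
rewrite ler_wpM2l ?(le_trans (normr_ge0 _) (aB 0%N))//.
by rewrite -[leRHS]ger0_norm// -sqrtr_sqr; apply: ler_wsqrtr; exact: cK.
Qed.

Lemma coef_entry (rho K : R) al m : 0 < rho -> 0 <= K -> coef_le rho K -> al \in box m ->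
  coef al ^+ 2 <= rho ^+ deg al * K ^+ 2.
Proof.
move=> r0 K0 cK am; rewrite mulrC -ler_pdivrMr ?exprn_gt0//.
apply: le_trans (cK m); rewrite (bigD1_seq al) ?box_uniq//= lerDl sumr_ge0// => be _.
by rewrite divr_ge0 ?sqr_ge0// exprn_ge0// ltW.
Qed.

(* the cosine contributes Re i^k, the exponential 1; centering kills k = 0 and
   subtracts the linear term *)
Definition bco (k : nat) : R := if k == 0%N then 0 else 1 + (@ipow R k).1 - (k == 1%N)%:R.

Lemma bco_norm k : `|bco k| <= 2.
Proof.
case: k => [|[|k]]; first by rewrite /bco /= normr0.
  by rewrite /bco /= oppr0 addr0 subrr normr0.
rewrite /bco subr0.
have [h _] := @ipow_norm R k; rewrite (le_trans (ler_normD _ _))// normr1 normrN.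
by rewrite -[leRHS]/(1 + 1 : R) lerD2l.
Qed.

Definition qexp t : R := expR (vdot t t / 2).

Definition Vstat t : R := rt^-1 * \sum_(j < n)
  (qexp t * cos (vdot t (z j)) + expR (vdot t (z j) - vdot t t / 2) - 2 - vdot t (z j)).

Lemma Vstat_cvg t :
  (fun m => \sum_(al <- box m) bco (deg al) * coef al * mono t al) @ \oo --> Vstat t.
Proof.
have -> : Vstat t = rt^-1 * \sum_(j < n) (
  (qexp t * cos (vdot t (z j)) + expR (vdot t (z j) - vdot t t / 2) - vdot t (z j) - 2) - bco 0).
  congr (_ * _); apply: eq_bigr => j _; rewrite /bco subr0; ring.
apply: (coef_series (l := fun j => qexp t * cos (vdot t (z j)) +
  expR (vdot t (z j) - vdot t t / 2) - vdot t (z j) - 2)) => j; rewrite -(cvg_shiftS _ _) -(cvg_shiftS _ _) /=.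
pose F al := heta (z j) al * mono t al.
pose u m := \sum_(al <- box m) (@ipow R (deg al)).1 * F al.
pose v m := \sum_(al <- box m) F al.
apply: (cvgn_ext (v := fun m => u m.+2 + v m.+2 - vdot t (z j) - 2)); last first.
  have [h1 _] := heta_trig_cvg (z j) t; have h2 := @heta_exp_cvg R d (z j) t.
  apply: cvgB; last exact: cvg_cst.
  apply: cvgB; last exact: cvg_cst.
  by apply: cvgD; [move: h1|move: h2]; rewrite -cvg_shiftS -cvg_shiftS.
(* From m + 2 on the box contains [j0] and all [ei i], so the linear term and the constant 2 are
   themselves sums over the box and the four series combine termwise. *)
move=> m /=; have -> : vdot t (z j) = \sum_(al <- box m.+2) (deg al == 1)%:R * F al.
  by rewrite sum_deg1 /vdot; apply: eq_bigr => i _; rewrite /F heta_ei mono_ei mulrC.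
have {1}-> : 2 = \sum_(al <- box m.+2) (deg al == 0)%:R * (2 * F al).
  by rewrite sum_deg0 /F heta0 mono_j0 !mulr1.
rewrite /u /v -big_split -!sumrB /=; apply: eq_bigr => al _; rewrite -/(F al) /bco.
by case: (deg al) => [|k] /=; ring.
Qed.

End data_coefficients.

Section elementary_bounds.
Context {R : realType}.

Lemma norm_sin_le (x : R) : `|sin x| <= `|x|.
Proof.
wlog x0 : x / 0 <= x.
  move=> h; have [x0|x0] := leP 0 x; first exact: h.
  by rewrite -normrN -sinN -[leRHS]normrN; apply: h; rewrite oppr_ge0 ltW.
have [->|xn] := eqVneq x 0; first by rewrite sin0 normr0.
have xp : 0 < x by rewrite lt_neqAle eq_sym xn.
have [|c _] := @MVT R sin cos 0 x xp (fun y _ => is_derive_sin y).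
  exact: continuous_subspaceT (@continuous_sin R).
rewrite sin0 !subr0 => ->; rewrite normrM ler_piMl// cos_max//.
Qed.

Lemma norm_cos_sub1_le (x : R) : `|cos x - 1| <= x ^+ 2.
Proof.
have -> : cos x - 1 = - (2 * sin (x / 2) ^+ 2).
  by rewrite {1}(splitr x) cosD -!expr2 cos2sin2; ring.
have h := norm_sin_le (x / 2).
rewrite normrN (@ger0_norm _ (2 * _ ^+ 2)); last by apply: mulr_ge0 => //; exact: sqr_ge0.
have : sin (x / 2) ^+ 2 <= (x / 2) ^+ 2.
  by rewrite -[leLHS]real_normK ?num_real// -[leRHS]real_normK ?num_real// lerXn2r ?nnegrE.
by have := sqr_ge0 x; nra.
Qed.

Lemma exp_sin_bound (x : R) : `|expR (- x) * sin x| <= `|x| * expR `|x|.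
Proof.
rewrite normrM (ger0_norm (expR_ge0 _)) mulrC ler_pM ?expR_ge0 ?norm_sin_le//.
by rewrite ler_expR -normrN ler_norm.
Qed.

Lemma exp_cos_bound (x : R) : `|expR (- x) * cos x - 1 + x| <= 2 * x ^+ 2 * expR `|x|.
Proof.
have -> : expR (- x) * cos x - 1 + x =
  (expR (- x) - 1 - - x) * cos x + (1 - x) * (cos x - 1) by ring.
rewrite (le_trans (ler_normD _ _))// !normrM -mulrA mulr_natl mulr2n lerD//.
  have := expR_sub2_le (- x); rewrite normrN sqrrN => h.
  by rewrite -[leRHS]mulr1 ler_pM// cos_max.
rewrite mulrC ler_pM// ?norm_cos_sub1_le//.
rewrite (le_trans (ler_normB _ _))// normr1; exact: expR_ge1Dx.
Qed.

End elementary_bounds.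

Section one_norm.
Context {R : realType} {d : nat}.
Local Notation vec := (vec R d).

Definition onorm (t : vec) : R := \sum_(a < d) `|tnth t a|.

Lemma onorm_ge0 t : 0 <= onorm t.
Proof. by apply: sumr_ge0. Qed.

(** By Young's inequality B |x| <= B^2 / (2 eta) + eta x^2 / 2 in each coordinate: exponentials of
    linear growth cost an arbitrarily small amount eta in the envelope. *)
Lemma exp_onorm_env (B eta : R) : 0 <= B -> 0 < eta ->
  exists C : R, 1 <= C /\ forall t, expR (B * onorm t) <= C * env eta t.
Proof.
move=> B0 e0; exists (expR (\sum_(a < d) (B ^+ 2 / (2 * eta)))); split.
  by apply: expR_ge1; apply: sumr_ge0 => a _; rewrite divr_ge0 ?sqr_ge0// mulr_ge0// ltW.
move=> t; rewrite /env -expRD ler_expR /onorm /vdot mulr_sumr.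
rewrite -mulrA mulr_suml mulr_sumr -big_split /=; apply: ler_sum => a _.
rewrite -expr2 -[tnth t a ^+ 2]real_normK ?num_real//; set x := `|tnth t a|.
have : 0 <= (B - eta * x) ^+ 2 / (2 * eta) by rewrite divr_ge0 ?sqr_ge0// mulr_ge0// ltW.
have -> : (B - eta * x) ^+ 2 / (2 * eta) = B ^+ 2 / (2 * eta) + eta * (x ^+ 2 / 2) - B * x.
  by field; exact: lt0r_neq0.
lra.
Qed.

End one_norm.

(** * Effect of centering the sample *)

Section centering.
Context {R : realType} {d : nat}.
Local Notation vec := (vec R d).
Variables (n : nat) (z : nat -> vec).
Local Notation rt := (Num.sqrt (n%:R : R)).

Definition avg (f : vec -> R) : R := n%:R^-1 * \sum_(j < n) f (z j).

(** U_n with residuals that are centred but not rescaled; by [Ustat_affine], U_n itself is this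
    function at a transformed argument. *)
Definition Fstat (t : vec) : R :=
  let th := avg (vdot t) in
  rt * (avg (fun z => cos (vdot t z - th)) * avg (fun z => expR (vdot t z - th)) - 1).

Lemma avgZ c f : avg (fun z => c * f z) = c * avg f.
Proof. by rewrite /avg -mulr_sumr mulrCA. Qed.

Lemma avgD f g : avg (fun z => f z + g z) = avg f + avg g.
Proof. by rewrite /avg big_split mulrDr. Qed.

Lemma avg_le f g : (forall z, f z <= g z) -> avg f <= avg g.
Proof. by move=> h; rewrite ler_wpM2l ?invr_ge0//; apply: ler_sum => j _; exact: h. Qed.

Hypothesis n0 : (0 < n)%N.

Let rt0 : 0 < rt. Proof. by rewrite sqrtr_gt0 ltr0n. Qed.

Let rt2 : rt * rt = n%:R. Proof. by rewrite -expr2 sqr_sqrtr. Qed.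

Lemma avg_cst c : avg (fun=> c) = c.
Proof. by rewrite /avg sumr_const card_ord -[c *+ n]mulr_natl mulKf// pnatr_eq0 -lt0n. Qed.

Lemma avg_rt (f : vec -> R) (c : R) : rt^-1 * \sum_(j < n) (f (z j) - c) = rt * (avg f - c).
Proof.
rewrite sumrB sumr_const card_ord /avg -[c *+ n]mulr_natl.
move: rt0 rt2; set r := Num.sqrt _ => r0 <-.
by field; exact: lt0r_neq0.
Qed.

Variables (rho K : R).
Hypothesis rho1 : 1 <= rho.
Hypothesis rho2 : rho <= 2.
Hypothesis K0 : 0 <= K.
Hypothesis cK : coef_le n z rho K.

Let rho0 : 0 < rho. Proof. exact: lt_le_trans rho1. Qed.

(** The deviation from 1 is n^(-1/2) times a series in [coef] with factors Re i^k, to which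
    [coef_bound] applies; the sine and the exponential averages are treated alike. *)
Lemma avg_cos_bound t : `|qexp t * avg (fun z => cos (vdot t z)) - 1| <= rt^-1 * (K * env rho t).
Proof.
have h : (fun m => \sum_(al <- @box d m) (@ipow R (deg al)).1 * coef n z al * mono t al) @ \oo -->
    rt^-1 * \sum_(j < n) (qexp t * cos (vdot t (z j)) - (@ipow R 0).1).
  apply: (coef_series (a := fun k => (@ipow R k).1) (l := fun j => qexp t * cos (vdot t (z j)))) => j.
  by have [] := heta_trig_cvg (z j) t.
have a1 k : `|(@ipow R k).1| <= 1 by have [] := @ipow_norm R k.
have := coef_bound (a := fun k => (@ipow R k).1) rho0 K0 cK a1 h; rewrite mul1r /=.
rewrite (avg_rt (fun z => qexp t * cos (vdot t z))) avgZ normrM (gtr0_norm rt0) => h1.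
by rewrite -ler_pdivrMl ?invr_gt0// invrK.
Qed.

Lemma avg_sin_bound t : `|qexp t * avg (fun z => sin (vdot t z))| <= rt^-1 * (K * env rho t).
Proof.
have h : (fun m => \sum_(al <- @box d m) (@ipow R (deg al)).2 * coef n z al * mono t al) @ \oo -->
    rt^-1 * \sum_(j < n) (qexp t * sin (vdot t (z j)) - (@ipow R 0).2).
  apply: (coef_series (a := fun k => (@ipow R k).2) (l := fun j => qexp t * sin (vdot t (z j)))) => j.
  by have [] := heta_trig_cvg (z j) t.
have a1 k : `|(@ipow R k).2| <= 1 by have [] := @ipow_norm R k.
have := coef_bound (a := fun k => (@ipow R k).2) rho0 K0 cK a1 h; rewrite mul1r /=.
rewrite (avg_rt (fun z => qexp t * sin (vdot t z))) avgZ subr0 normrM (gtr0_norm rt0) => h1.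
by rewrite -ler_pdivrMl ?invr_gt0// invrK.
Qed.

Lemma avg_exp_bound t : `|(qexp t)^-1 * avg (fun z => expR (vdot t z)) - 1| <= rt^-1 * (K * env rho t).
Proof.
have a1 (k : nat) : `|1 : R| <= 1 by rewrite normr1.
have h : (fun m => \sum_(al <- @box d m) 1 * coef n z al * mono t al) @ \oo -->
    rt^-1 * \sum_(j < n) (expR (vdot t (z j) - vdot t t / 2) - 1).
  apply: (coef_series (a := fun=> 1) (l := fun j => expR (vdot t (z j) - vdot t t / 2))) => j; apply: cvgn_ext (@heta_exp_cvg R d (z j) t) => m.
  by apply: eq_bigr => al _; rewrite mul1r.
have := coef_bound (a := fun=> 1) rho0 K0 cK a1 h; rewrite mul1r /=.
rewrite (avg_rt (fun z => expR (vdot t z - vdot t t / 2))).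
have -> : avg (fun z => expR (vdot t z - vdot t t / 2)) = (qexp t)^-1 * avg (fun z => expR (vdot t z)).
  by rewrite -avgZ; congr avg; apply/funext => y; rewrite expRD expRN mulrC.
rewrite normrM (gtr0_norm rt0) => h1.
by rewrite -ler_pdivrMl ?invr_gt0// invrK.
Qed.

Lemma avg_coord_bound a : `|avg (fun z => tnth z a)| <= rt^-1 * (2 * K).
Proof.
have : coef n z (ei a) = rt * avg (fun z => tnth z a).
  rewrite /coef -deg0P deg_ei /=; under eq_bigr do rewrite heta_ei.
  by rewrite -[avg _]subr0 -avg_rt; congr (_ * _); apply: eq_bigr => j _; rewrite subr0.
have := coef_entry rho0 K0 cK (ei_box a 0); rewrite deg_ei expr1 => h e.
rewrite -ler_pdivrMl ?invr_gt0// invrK -{1}(gtr0_norm rt0) -normrM -e.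
rewrite -ler_sqr ?nnegrE ?mulr_ge0// real_normK ?num_real// (le_trans h)// exprMn ler_wpM2r ?sqr_ge0//.
by rewrite (le_trans rho2)//; lra.
Qed.

Lemma avg_lin_bound t : `|avg (vdot t)| <= rt^-1 * (2 * K * onorm t).
Proof.
have -> : avg (vdot t) = \sum_a tnth t a * avg (fun z => tnth z a).
  rewrite /avg /vdot exchange_big mulr_sumr; apply: eq_bigr => a _.
  by rewrite -mulr_sumr mulrCA.
rewrite (le_trans (ler_norm_sum _ _ _))// /onorm mulr_sumr mulr_sumr; apply: ler_sum => a _.
by rewrite normrM [leRHS](_ : _ = `|tnth t a| * (rt^-1 * (2 * K))) ?ler_wpM2l ?avg_coord_bound//; ring.
Qed.

End centering.

Section centered_statistic.
Context {R : realType} {d : nat}.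
Local Notation vec := (vec R d).

Lemma Vstat_avg n (z : nat -> vec) t : (0 < n)%N ->
  Vstat n z t = Num.sqrt n%:R * (qexp t * avg n z (fun y => cos (vdot t y)) +
    (qexp t)^-1 * avg n z (fun y => expR (vdot t y)) - 2 - avg n z (vdot t)).
Proof.
move=> n0; rewrite /Vstat.
have := avg_rt z n0 (fun y => qexp t * cos (vdot t y) + expR (vdot t y - vdot t t / 2) + (- 1) * vdot t y) 2.
rewrite !avgD !avgZ (_ : avg n z (fun y => expR _) = (qexp t)^-1 * avg n z (fun y => expR (vdot t y))).
  by move=> h; rewrite [RHS](_ : _ = Num.sqrt n%:R * (qexp t * avg n z (fun z0 => cos (vdot t z0)) +
    (qexp t)^-1 * avg n z (fun z0 => expR (vdot t z0)) + -1 * avg n z (vdot t) - 2)); [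
    rewrite -h; congr (_ * _); apply: eq_bigr => j _; ring|congr (_ * _); ring].
by rewrite -avgZ; congr avg; apply/funext => y; rewrite expRD expRN mulrC.
Qed.

Lemma Fstat_avg n (z : nat -> vec) t : let th := avg n z (vdot t) in
  Fstat n z t = Num.sqrt n%:R * (expR (- th) * (cos th * avg n z (fun y => cos (vdot t y)) +
    sin th * avg n z (fun y => sin (vdot t y))) * avg n z (fun y => expR (vdot t y)) - 1).
Proof.
move=> th; rewrite /Fstat -/th; congr (_ * (_ - 1)).
have -> : avg n z (fun y => cos (vdot t y - th)) =
    cos th * avg n z (fun y => cos (vdot t y)) + sin th * avg n z (fun y => sin (vdot t y)).
  rewrite -!avgZ -avgD; congr avg; apply/funext => y; rewrite cosB; ring.
have -> : avg n z (fun y => expR (vdot t y - th)) = expR (- th) * avg n z (fun y => expR (vdot t y)).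
  by rewrite -avgZ; congr avg; apply/funext => y; rewrite expRD mulrC.
ring.
Qed.

Lemma vdot_young (rho : R) (t y : vec) : 0 < rho ->
  vdot t y <= rho * vdot t t / 2 + vdot y y / (2 * rho).
Proof.
move=> r0; rewrite /vdot mulr_sumr !mulr_suml -big_split /=; apply: ler_sum => i _.
have : 0 <= (rho * tnth t i - tnth y i) ^+ 2 / (2 * rho).
  by rewrite divr_ge0 ?sqr_ge0// mulr_ge0// ltW.
have -> : (rho * tnth t i - tnth y i) ^+ 2 / (2 * rho) =
  rho * (tnth t i * tnth t i) / 2 + tnth y i * tnth y i / (2 * rho) - tnth t i * tnth y i.
  by field; exact: lt0r_neq0.
by rewrite subr_ge0.
Qed.

(** After subtracting [Vstat], only products of two deviations of order n^(-1/2) remain, against one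
    factor sqrt n. Bounding both factors by [env rho] would however produce [env (2 * rho)], which
    is not in L^2 for gamma <= 2. The bound on the average of exp(|y|^2 / (2 rho)) gives [hM2], M <=
    K [env e], which does not decrease with n but grows slowly in t and is used instead for one
    factor. *)
Lemma centered_statistic (e : R) (K : R) (delta : R) : 0 < e -> e <= 1 -> 0 <= K -> 0 < delta ->
  exists N, forall n (z : nat -> vec), (N < n)%N -> coef_le n z (1 + e) K ->
    avg n z (fun y => expR (vdot y y / (2 * (1 + e)))) <= K ->
    forall t, `|Fstat n z t - Vstat n z t| <= delta * env (1 + 3 * e) t.
Proof.
move=> e0 e1 K0 de0; set rho := 1 + e.
have rho1 : 1 <= rho by rewrite /rho; lra.
have rho2 : rho <= 2 by rewrite /rho; lra.
have rho0 : 0 < rho by lra.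
pose D := 2 * K; have D0 : 0 <= D by rewrite mulr_ge0.
(* D w bounds the mean term th, and w^k <= exp(2 w) for k <= 2: hence the exponent D + 2. *)
have [H [H1 hH]] := @exp_onorm_env R d (D + 2) e ltac:(lra) e0.
(* Beyond |t|^2 = L the inequality exp(x) >= 1 + x makes [env e t] at least 2 K (K + 1) / delta, the
   growth needed for T4. *)
pose L := 4 * K * (K + 1) / (e * delta).
have L0 : 0 <= L.
  by apply: divr_ge0; [rewrite !mulr_ge0//; lra|apply: mulr_ge0; exact: ltW].
(* The constants of the contributions of order r^-2 to T1, ..., T4; N is such that B / r <= delta /
   2. *)
pose B := 2 * D ^+ 2 * K * H + D * H * (K ^+ 2 + K) + D * H * K ^+ 2 + K ^+ 2 * expR (rho * L / 2).
exists (Num.truncn ((2 * B / delta) ^+ 2)) => n z nN cK hK t.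
have n0 : (0 < n)%N by exact: leq_ltn_trans nN.
set r := Num.sqrt (n%:R : R).
have r1 : 1 <= r by rewrite -[leLHS]sqrtr1 ler_wsqrtr// ler1n.
have r0 : 0 < r by exact: lt_le_trans r1.
have B0 : 0 <= B.
  have h1 : 0 <= H by lra.
  by rewrite /B !addr_ge0// !mulr_ge0 ?expR_ge0 ?sqr_ge0 ?addr_ge0 ?sqr_ge0.
have rB : B / r <= delta / 2.
  have : (2 * B / delta) ^+ 2 < n%:R.
    by apply: (lt_le_trans (truncnS_gt _)); rewrite ler_nat.
  rewrite -[n%:R]sqr_sqrtr// -/r ltr_pXn2r ?nnegrE ?divr_ge0 ?mulr_ge0 ?(ltW de0) ?(ltW r0)//.
  rewrite ltr_pdivrMr// => h; rewrite ler_pdivrMr//; lra.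
set th := avg n z (vdot t).
set w := onorm t; have w0 : 0 <= w by exact: onorm_ge0.
have hth : `|th| <= r^-1 * (D * w) by exact: (avg_lin_bound n0 rho1 rho2 K0 cK).
pose C' := qexp t * avg n z (fun y => cos (vdot t y)) - 1.
pose S := qexp t * avg n z (fun y => sin (vdot t y)).
pose M := (qexp t)^-1 * avg n z (fun y => expR (vdot t y)).
have hC : `|C'| <= r^-1 * (K * env rho t) by exact: (avg_cos_bound n0 rho1 K0 cK).
have hS : `|S| <= r^-1 * (K * env rho t) by exact: (avg_sin_bound n0 rho1 K0 cK).
have hM : `|M - 1| <= r^-1 * (K * env rho t) by exact: (avg_exp_bound n0 rho1 K0 cK).
have q0 : 0 < qexp t by exact: expR_gt0.
have M0 : 0 <= M.
  rewrite mulr_ge0 ?invr_ge0 ?(ltW q0)// mulr_ge0 ?invr_ge0//.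
  by apply: sumr_ge0 => j _; exact: expR_ge0.
have mK : avg n z (fun y => expR (vdot t y)) <= K * env rho t.
  rewrite mulrC; apply: (@le_trans _ _ (env rho t * avg n z (fun y => expR (vdot y y / (2 * rho))))).
    rewrite -avgZ; apply: avg_le => y; rewrite /env -expRD ler_expR; exact: vdot_young.
  by rewrite ler_wpM2l ?env_ge0.
have qE : env 1 t = qexp t by rewrite /env /qexp mul1r.
have hM2 : M <= K * env e t.
  rewrite /M ler_pdivrMl// (le_trans mK)// -qE mulrCA ler_wpM2l//.
  by rewrite envM lexx.
have cs : avg n z (fun y => cos (vdot t y)) * avg n z (fun y => expR (vdot t y)) = (1 + C') * M.
  by rewrite /C' /M addrC subrK; field; exact: lt0r_neq0.
have ss : avg n z (fun y => sin (vdot t y)) * avg n z (fun y => expR (vdot t y)) = S * M.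
  by rewrite /S /M; field; exact: lt0r_neq0.
have hCM : `|(1 + C') * M| <= K * env rho t.
  rewrite -cs normrM -[leRHS]mul1r ler_pM//.
    rewrite /avg normrM ger0_norm ?invr_ge0// ler_pdivrMl ?ltr0n// mulr1.
    rewrite (le_trans (ler_norm_sum _ _ _))//.
    apply: (@le_trans _ _ (\sum_(j < n) (1 : R))); last by rewrite sumr_const card_ord.
    by apply: ler_sum => j _; exact: cos_max.
  by rewrite ger0_norm// mulr_ge0 ?invr_ge0// sumr_ge0// => j _; exact: expR_ge0.
(* Each summand is small twice: th^2, th times a deviation, sin th times S, and C' times M - 1. *)
have -> : Fstat n z t - Vstat n z t = r * ((expR (- th) * cos th - 1 + th) * ((1 + C') * M)
   - th * (C' * M + (M - 1)) + (expR (- th) * sin th) * (S * M) + C' * (M - 1)).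
  rewrite Fstat_avg Vstat_avg// -/r -/th -cs -ss.
  set E := expR (- th); set c := cos th; set s := sin th.
  set c1 := avg n z (fun y => cos _); set s1 := avg n z (fun y => sin _).
  have -> : C' * M + (M - 1) = c1 * avg n z (fun y => expR (vdot t y)) - 1.
    by rewrite cs; ring.
  have -> : C' * (M - 1) = c1 * avg n z (fun y => expR (vdot t y)) - M - C'.
    by rewrite cs; ring.
  by rewrite /C' /M -/c1; ring.
set G := env (1 + 3 * e) t.
have G0 : 0 <= G by exact: env_ge0.
have eD k x : (k <= 2)%N -> 0 <= x <= D * w -> w ^+ k * expR x <= H * env e t.
  move=> k2 /andP[x0 xD]; apply: le_trans (hH t); rewrite mulrDl expRD mulrC ler_pM ?expR_ge0 ?exprn_ge0// ?ler_expR//.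
  have := normX_le_expR w k; rewrite (ger0_norm w0) => /le_trans; apply.
  by rewrite ler_expR ler_wpM2r// ler_nat.
have thD : `|th| <= D * w.
  by rewrite (le_trans hth)// ler_piMl ?mulr_ge0// invf_le1.
have ri : 0 <= r^-1 by rewrite invr_ge0 ltW.
have T1 : `|(expR (- th) * cos th - 1 + th) * ((1 + C') * M)| <= r^-1 ^+ 2 * (2 * D ^+ 2 * K * H * G).
  rewrite normrM; apply: (@le_trans _ _ ((2 * th ^+ 2 * expR `|th|) * (K * env rho t))).
    by rewrite ler_pM// exp_cos_bound.
  have h1 : th ^+ 2 <= r^-1 ^+ 2 * D ^+ 2 * w ^+ 2.
    by rewrite -!exprMn -mulrA -[leLHS]real_normK ?num_real// lerXn2r ?nnegrE// !mulr_ge0.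
  have h2 := eD 2%N `|th| (leqnn 2) ltac:(by rewrite normr_ge0 thD).
  apply: (@le_trans _ _ (2 * (r^-1 ^+ 2 * D ^+ 2 * w ^+ 2) * expR `|th| * (K * env rho t))).
    by rewrite ler_wpM2r ?mulr_ge0 ?env_ge0// ler_wpM2r ?expR_ge0// ler_wpM2l.
  rewrite [leLHS](_ : _ = r^-1 ^+ 2 * (2 * D ^+ 2 * K * ((w ^+ 2 * expR `|th|) * env rho t))); last ring.
  rewrite ler_wpM2l ?sqr_ge0// [leRHS](_ : _ = 2 * D ^+ 2 * K * (H * G)); last ring.
  have c0 : 0 <= 2 * D ^+ 2 * K by rewrite !mulr_ge0 ?sqr_ge0.
  rewrite ler_wpM2l//.
  apply: (le_trans (ler_wpM2r (env_ge0 _ _) h2)); rewrite -mulrA envM ler_wpM2l ?(le_trans ler01)//.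
  by apply: env_le; rewrite /rho; lra.
have T2 : `|th * (C' * M + (M - 1))| <= r^-1 ^+ 2 * (D * H * (K ^+ 2 + K) * G).
  have h0 : `|C' * M + (M - 1)| <= r^-1 * ((K ^+ 2 + K) * env (1 + 2 * e) t).
    rewrite (le_trans (ler_normD _ _))//.
    rewrite [leRHS](_ : _ = r^-1 * (K ^+ 2 * env (1 + 2 * e) t) + r^-1 * (K * env (1 + 2 * e) t)); last ring.
    apply: lerD.
      rewrite normrM (ger0_norm M0); apply: (le_trans (ler_pM (normr_ge0 _) M0 hC hM2)).
      rewrite [leLHS](_ : _ = r^-1 * (K ^+ 2 * (env rho t * env e t))); last ring.
      by rewrite envM ler_wpM2l// ler_wpM2l ?sqr_ge0// env_le// /rho; lra.
    by rewrite (le_trans hM)// ler_wpM2l// ler_wpM2l// env_le// /rho; lra.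
  rewrite normrM; apply: (le_trans (ler_pM (normr_ge0 _) (normr_ge0 _) hth h0)).
  have h2 := eD 1%N 0 isT ltac:(by rewrite lexx mulr_ge0).
  rewrite expr1 expR0 mulr1 in h2.
  rewrite [leLHS](_ : _ = r^-1 ^+ 2 * (D * (K ^+ 2 + K) * (w * env (1 + 2 * e) t))); last ring.
  rewrite ler_wpM2l ?sqr_ge0// [leRHS](_ : _ = D * (K ^+ 2 + K) * (H * G)); last ring.
  rewrite ler_wpM2l ?mulr_ge0 ?addr_ge0 ?sqr_ge0//.
  apply: (le_trans (ler_wpM2r (env_ge0 _ _) h2)); rewrite -mulrA envM ler_wpM2l ?(le_trans ler01)//.
  by apply: env_le; lra.
have T3 : `|(expR (- th) * sin th) * (S * M)| <= r^-1 ^+ 2 * (D * H * K ^+ 2 * G).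
  rewrite normrM; have h1 := exp_sin_bound th.
  have h0 : `|S * M| <= r^-1 * (K ^+ 2 * env (1 + 2 * e) t).
    rewrite normrM (ger0_norm M0); apply: (le_trans (ler_pM (normr_ge0 _) M0 hS hM2)).
    rewrite [leLHS](_ : _ = r^-1 * (K ^+ 2 * (env rho t * env e t))); last ring.
    by rewrite envM ler_wpM2l// ler_wpM2l ?sqr_ge0// env_le// /rho; lra.
  have h2 := eD 1%N `|th| isT ltac:(by rewrite normr_ge0 thD).
  rewrite expr1 in h2.
  apply: (@le_trans _ _ ((r^-1 * (D * w) * expR `|th|) * (r^-1 * (K ^+ 2 * env (1 + 2 * e) t)))).
    by rewrite ler_pM// (le_trans h1)// ler_wpM2r ?expR_ge0.
  rewrite [leLHS](_ : _ = r^-1 ^+ 2 * (D * K ^+ 2 * ((w * expR `|th|) * env (1 + 2 * e) t))); last ring.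
  rewrite ler_wpM2l ?sqr_ge0// [leRHS](_ : _ = D * K ^+ 2 * (H * G)); last ring.
  rewrite ler_wpM2l ?mulr_ge0 ?sqr_ge0//.
  apply: (le_trans (ler_wpM2r (env_ge0 _ _) h2)); rewrite -mulrA envM ler_wpM2l ?(le_trans ler01)//.
  by apply: env_le; lra.
(* either t is bounded and M - 1 is small, or t is large and env absorbs M - 1 *)
have T4 : `|C' * (M - 1)| <= r^-1 ^+ 2 * (K ^+ 2 * expR (rho * L / 2) * G) + r^-1 * (delta / 2 * G).
  rewrite normrM; have [tL|tL] := leP (vdot t t) L.
    apply: (le_trans (ler_pM (normr_ge0 _) (normr_ge0 _) hC hM)).
    rewrite [leLHS](_ : _ = r^-1 ^+ 2 * (K ^+ 2 * env rho t * env rho t)); last ring.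
    rewrite -[leLHS]addr0; apply: lerD; last by rewrite !mulr_ge0// ?divr_ge0// ltW.
    rewrite ler_wpM2l ?sqr_ge0//; apply: ler_pM; rewrite ?mulr_ge0 ?env_ge0 ?sqr_ge0//.
      rewrite ler_wpM2l ?sqr_ge0// ler_expR ler_wpM2r// ler_wpM2l// ltW//.
    by apply: env_le; rewrite /rho; lra.
  have h1 : `|M - 1| <= (K + 1) * env e t.
    rewrite mulrDl mul1r (le_trans (ler_normB _ _))// normr1 (ger0_norm M0) lerD//.
    by apply: expR_ge1; rewrite divr_ge0// mulr_ge0 ?vdot_ge0// ltW.
  have h2 : K * (K + 1) * env e t <= delta / 2 * env (2 * e) t.
    have h3 : 2 * K * (K + 1) / delta <= env e t.
      apply: (@le_trans _ _ (e * vdot t t / 2)); last by have := expR_ge1Dx (e * vdot t t / 2); rewrite /env; lra.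
      have -> : 2 * K * (K + 1) / delta = e * L / 2 by rewrite /L; field; rewrite !lt0r_neq0.
      by rewrite ler_wpM2r// ler_wpM2l// ltW.
    rewrite -env_sqr expr2 mulrA ler_wpM2r ?env_ge0//.
    move: h3; rewrite ler_pdivrMr//; lra.
  rewrite -[leLHS]add0r; apply: lerD; first by rewrite !mulr_ge0 ?expR_ge0 ?sqr_ge0.
  apply: (le_trans (ler_pM (normr_ge0 _) (normr_ge0 _) hC h1)).
  rewrite [leLHS](_ : _ = r^-1 * (env rho t * (K * (K + 1) * env e t))); last ring.
  rewrite ler_wpM2l//; apply: (le_trans (ler_wpM2l (env_ge0 _ _) h2)).
  rewrite mulrCA envM ler_wpM2l ?divr_ge0 ?(ltW de0)//.
  by apply: env_le; rewrite /rho; lra.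
rewrite normrM (gtr0_norm r0).
apply: (@le_trans _ _ (r * (r^-1 ^+ 2 * (B * G) + r^-1 * (delta / 2 * G)))).
  rewrite ler_wpM2l ?(ltW r0)//.
  apply: (le_trans (ler_normD _ _)); apply: (le_trans (lerD (le_trans (ler_normD _ _) (lerD (ler_normB _ _) (lexx _))) (lexx _))).
  apply: (le_trans (lerD (lerD (lerD T1 T2) T3) T4)).
  by rewrite le_eqVlt; apply/orP; left; apply/eqP; rewrite /B; ring.
have -> : r * (r^-1 ^+ 2 * (B * G) + r^-1 * (delta / 2 * G)) = (B / r + delta / 2) * G.
  by field; exact: lt0r_neq0.
by rewrite ler_wpM2r//; lra.
Qed.

End centered_statistic.

(** * Effect of the sample covariance *)

Section change_of_variables.
Context {R : realType} {d : nat}.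
Local Notation vec := (vec R d).

Definition mxv (M : 'M[R]_d) (t : vec) : vec := [tuple (M *m colvec t) i 0 | i < d].

Lemma colvec_mxv M t : colvec (mxv M t) = M *m colvec t.
Proof. by apply/matrixP => i j; rewrite ord1 mxE tnth_mktuple. Qed.

Lemma vdot_mxv M t y : vdot (mxv M t) y = dotv (M *m colvec t) (colvec y).
Proof. by rewrite -dotv_colvec colvec_mxv. Qed.

Lemma opb_mxN (M : 'M[R]_d) : opb (mxN M) M.
Proof.
move=> v; rewrite dotvE /mxN.
have ve k : `|v k 0| <= Num.sqrt (dotv v v).
  by rewrite -sqrtr_sqr; apply: ler_wsqrtr; exact: dotv_entry.
pose s i := \sum_j `|M i j|.
have s0 i : 0 <= s i by apply: sumr_ge0.
apply: (@le_trans _ _ (\sum_i s i ^+ 2 * dotv v v)).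
  apply: ler_sum => i _; rewrite -expr2 -[leLHS]real_normK ?num_real//.
  rewrite -[dotv v v]sqr_sqrtr ?dotv_ge0// -exprMn lerXn2r ?nnegrE ?mulr_ge0 ?sqrtr_ge0//.
  rewrite mxE (le_trans (ler_norm_sum _ _ _))// mulr_suml; apply: ler_sum => j _.
  by rewrite normrM ler_wpM2l.
rewrite -mulr_suml ler_wpM2r ?dotv_ge0// expr2 mulr_suml; apply: ler_sum => i _.
rewrite expr2 ler_wpM2l// -/(s _) (bigD1 i)//= -/(s i) lerDl sumr_ge0// => j _; exact: s0.
Qed.

Lemma vdot_mxv_le M c t : opb c M -> vdot (mxv M t) (mxv M t) <= c ^+ 2 * vdot t t.
Proof. by move=> h; rewrite -!dotv_colvec colvec_mxv; exact: h. Qed.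

Section residuals.
Variables (n : nat) (z : nat -> vec) (m : 'cV[R]_d) (A : 'M[R]_d).
Hypothesis n0 : (0 < n)%N.
Local Notation x := (fun j => affine_map m A (z j)).

Let n0R : n%:R != 0 :> R. Proof. by rewrite pnatr_eq0 -lt0n. Qed.

Let colx j : colvec (x j) = m + A *m colvec (z j).
Proof. by apply/matrixP => i k; rewrite ord1 mxE tnth_mktuple. Qed.

Lemma sample_mean_affine : sample_mean n x = m + A *m sample_mean n z.
Proof.
rewrite /sample_mean; under eq_bigr do rewrite colx.
rewrite big_split /= sumr_const card_ord scalerDr -[m *+ n]scaler_nat scalerA mulVf// scale1r.
by rewrite -mulmx_sumr scalemxAr.
Qed.

Let cent j : colvec (x j) - sample_mean n x = A *m (colvec (z j) - sample_mean n z).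
Proof. by rewrite sample_mean_affine colx mulmxBr opprD addrACA subrr add0r. Qed.

Lemma sample_cov_affine : sample_cov n x = A *m sample_cov n z *m A^T.
Proof.
rewrite /sample_cov; under eq_bigr do rewrite cent trmx_mul mulmxA -(mulmxA A).
by rewrite -mulmx_suml -mulmx_sumr -scalemxAr -scalemxAl.
Qed.

Lemma residual_affine j :
  residual n x j = inv_sqrtmx (A *m sample_cov n z *m A^T) *m A *m (colvec (z j) - sample_mean n z).
Proof. by rewrite /residual sample_cov_affine cent mulmxA. Qed.

(** The shift m cancels in the residuals, and the matrix in front of z_j passes to the argument t as
    its transpose. *)
Lemma Ustat_affine t : Ustat n x t =
  Fstat n z (mxv (inv_sqrtmx (A *m sample_cov n z *m A^T) *m A)^T t).
Proof.
set B := inv_sqrtmx _ *m A; set s := mxv _ _.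
have e j : dotv (colvec t) (residual n x j) = vdot s (z j) - avg n z (vdot s).
  rewrite residual_affine -/B dotv_mulmx -scaleN1r dotvDr dotvZr mulN1r -vdot_mxv -/s; congr (_ - _).
  rewrite /sample_mean dotvZr -colvec_mxv -/s /avg; congr (_ * _).
  by rewrite /dotv mulmx_sumr summxE; apply: eq_bigr => k _; rewrite -dotv_colvec.
rewrite /Ustat /Fstat /Rstat /Mstat /avg.
by congr (_ * (_ * _ * (_ * _) - 1)); apply: eq_bigr => j _; rewrite e.
Qed.

End residuals.

Lemma sample_cov_avg n (z : nat -> vec) a b : (0 < n)%N ->
  sample_cov n z a b = avg n z (fun y => tnth y a * tnth y b) -
    avg n z (fun y => tnth y a) * avg n z (fun y => tnth y b).
Proof.
move=> n0; have mE c : sample_mean n z c 0 = avg n z (fun y => tnth y c).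
  by rewrite /sample_mean mxE summxE; congr (_ * _); apply: eq_bigr => j _; rewrite mxE.
rewrite /sample_cov mxE summxE.
rewrite -/(avg n z (fun y => ((colvec y - sample_mean n z) *m (colvec y - sample_mean n z)^T) a b)).
transitivity (avg n z (fun y => tnth y a * tnth y b + - (sample_mean n z b 0) * tnth y a +
   - (sample_mean n z a 0) * tnth y b + sample_mean n z a 0 * sample_mean n z b 0)).
  by congr avg; apply/funext => y; rewrite mxE big_ord1 !mxE; ring.
rewrite !avgD !avgZ avg_cst// !mE; ring.
Qed.

Lemma sample_cov_sym n (z : nat -> vec) : (sample_cov n z)^T = sample_cov n z.
Proof.
rewrite /sample_cov linearZ /= linear_sum /=; congr (_ *: _); apply: eq_bigr => j _.
by rewrite trmx_mul trmxK.
Qed.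

(** The entries of the second-moment matrix minus 1 are degree-2 coefficients, up to the factor sqrt
    2 on the diagonal; each is at most 2 K as rho <= 2. The product of two means is of order 1 / n
    and is bounded by n^(-1/2) times 4 K^2. *)
Lemma sample_cov_bound n (z : nat -> vec) rho K : (0 < n)%N -> 1 <= rho -> rho <= 2 -> 0 <= K ->
  coef_le n z rho K ->
  mxN (sample_cov n z - 1%:M) <= (Num.sqrt n%:R)^-1 * ((d * d)%:R * (4 * K + 4 * K ^+ 2)).
Proof.
move=> n0 rho1 rho2 K0 cK; set r := Num.sqrt (n%:R : R).
have r1 : 1 <= r by rewrite -[leLHS]sqrtr1 ler_wsqrtr// ler1n.
have r0 : 0 < r by exact: lt_le_trans r1.
have ri : 0 <= r^-1 by rewrite invr_ge0 ltW.
have ri1 : r^-1 <= 1 by rewrite invf_le1.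
have rho0 : 0 < rho by exact: lt_le_trans rho1.
have hc a b : `|coef n z (eij a b)| <= 2 * K.
  have := coef_entry rho0 K0 cK (eij_box a b); rewrite deg_eij -exprMn => h.
  rewrite -ler_sqr ?nnegrE ?mulr_ge0// real_normK ?num_real// (le_trans h)//.
  by rewrite lerXn2r ?nnegrE ?mulr_ge0 ?(ltW rho0)// ler_wpM2r.
have hE a b : coef n z (eij a b) = r * avg n z (fun y => heta y (eij a b)).
  rewrite /coef -deg0P deg_eij /= -[avg _ _ _]subr0 -avg_rt//.
  by congr (_ * _); apply: eq_bigr => j _; rewrite subr0.
have h2 a b : `|avg n z (fun y => tnth y a * tnth y b) - (a == b)%:R| <= r^-1 * (4 * K).
  have := hc a b; rewrite hE normrM (gtr0_norm r0); have [<-|ab] := eqVneq a b.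
    have -> : avg n z (fun y => heta y (eij a a)) =
       (Num.sqrt 2)^-1 * (avg n z (fun y => tnth y a * tnth y a) - 1).
      transitivity (avg n z (fun y => (Num.sqrt 2)^-1 * (tnth y a * tnth y a + (- 1)))).
        by congr avg; apply/funext => y; rewrite heta_eii expr2 mulrC.
      by rewrite avgZ avgD avg_cst.
    have s2 : 0 < Num.sqrt (2 : R) by rewrite sqrtr_gt0.
    have s22 : Num.sqrt (2 : R) <= 2.
      by rewrite -[leRHS]ger0_norm// -sqrtr_sqr ler_wsqrtr// expr2; lra.
    rewrite normrM gtr0_norm ?invr_gt0// => h.
    rewrite -ler_pdivrMl ?invr_gt0// invrK.
    move: h; set v := `|_|; rewrite mulrCA ler_pdivrMl// => h; apply: (le_trans h).
    have -> : 4 * K = 2 * (2 * K) by ring.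
    by rewrite ler_wpM2r// mulr_ge0.
  have -> : avg n z (fun y => heta y (eij a b)) = avg n z (fun y => tnth y a * tnth y b).
    by congr avg; apply/funext => y; rewrite heta_eij.
  rewrite subr0 => h; rewrite -ler_pdivrMl ?invr_gt0// invrK; lra.
rewrite /mxN mulrCA.
apply: (@le_trans _ _ (\sum_(i < d) \sum_(j < d) r^-1 * (4 * K + 4 * K ^+ 2))); last first.
  by rewrite !sumr_const card_ord -mulrnA -[leLHS]mulr_natl.
apply: ler_sum => a _; apply: ler_sum => b _; 
rewrite (_ : (sample_cov n z - 1%:M) a b = sample_cov n z a b - (a == b)%:R); last first.
  by rewrite mxE [X in _ + X]mxE [X in _ - X]mxE.
rewrite sample_cov_avg//.
have -> : forall u v w : R, u - v - w = (u - w) - v by move=> *; ring.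
rewrite (le_trans (ler_normB _ _))// [leRHS]mulrDr; apply: lerD; first exact: h2.
have ha := avg_coord_bound n0 rho1 rho2 K0 cK.
rewrite normrM (le_trans (ler_pM (normr_ge0 _) (normr_ge0 _) (ha a) (ha b)))//.
have -> : r^-1 * (2 * K) * (r^-1 * (2 * K)) = r^-1 * (4 * K ^+ 2) * r^-1 by ring.
by rewrite ler_piMr// mulr_ge0 ?mulr_ge0 ?sqr_ge0.
Qed.

Lemma exp_diff_bound (x y c : R) : x <= c -> y <= c -> expR x - expR y <= `|x - y| * expR c.
Proof.
move=> xc yc; have := expR_ge1Dx (y - x) => h.
have : expR x - expR y <= (x - y) * expR x.
  have -> : expR y = expR x * expR (y - x) by rewrite -expRD; congr expR; ring.
  have := expR_gt0 x; nra.
move=> /le_trans; apply; apply: (@le_trans _ _ (`|x - y| * expR x)).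
  by rewrite ler_wpM2r ?expR_ge0// ler_norm.
by rewrite ler_wpM2l// ler_expR.
Qed.

(** Apply [series_lip] at the two arguments s and u. Both |s|^2 - s.u and |u|^2 - s.u are at most (1
    + eta) eta |t|^2 in absolute value, so the kernel distance is of first order in eta. *)
Lemma Vstat_lip n (z : nat -> vec) rho K eta (O B : 'M[R]_d) t : 0 < rho -> 0 <= K -> 0 <= eta ->
  coef_le n z rho K -> O *m O^T = 1%:M -> mxN (B - O) <= eta ->
  `|Vstat n z (mxv B^T t) - Vstat n z (mxv O^T t)| <=
  2 * Num.sqrt (K ^+ 2 * (2 * rho * (1 + eta) * eta * vdot t t * expR (rho * (1 + eta) ^+ 2 * vdot t t))).
Proof.
move=> rho0 K0 eta0 cK OO BO; set s := mxv B^T t; set u := mxv O^T t; set T := vdot t t.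
have T0 : 0 <= T by exact: vdot_ge0.
have uu : vdot u u = T.
  by rewrite -dotv_colvec colvec_mxv dotv_mulmx trmxK mulmxA OO mul1mx dotv_colvec.
have opO : opb 1 O^T.
  move=> v; rewrite dotv_mulmx trmxK mulmxA OO mul1mx expr1n mul1r lexx//.
have opD : opb eta (B - O)^T.
  apply: (opb_le _ (opb_mxN _)); rewrite mxN_tr BO andbT; exact: mxN_ge0.
have opB : opb (1 + eta) B^T.
  have -> : B^T = O^T + (B - O)^T by rewrite linearB /= addrC subrK.
  by apply: opbD.
pose q := Num.sqrt T; have q0 : 0 <= q by exact: sqrtr_ge0.
have q2 : q ^+ 2 = T by rewrite sqr_sqrtr.
have sE : colvec s = B^T *m colvec t by rewrite colvec_mxv.
have uE : colvec u = O^T *m colvec t by rewrite colvec_mxv.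
have tE : dotv (colvec t) (colvec t) = q ^+ 2 by rewrite dotv_colvec.
have sq : dotv (colvec s) (colvec s) <= ((1 + eta) * q) ^+ 2.
  by rewrite exprMn -tE sE; exact: opB.
have uq : dotv (colvec u) (colvec u) <= q ^+ 2 by rewrite dotv_colvec uu q2.
have dq : dotv (colvec s - colvec u) (colvec s - colvec u) <= (eta * q) ^+ 2.
  by rewrite exprMn -tE sE uE -mulmxBl -linearB; exact: opD.
have e1 : 0 <= 1 + eta by lra.
have h1 : `|dotv (colvec s) (colvec s - colvec u)| <= (1 + eta) * eta * T.
  rewrite (le_trans (dotv_le _ _ sq dq)) ?mulr_ge0// -q2 le_eqVlt; apply/orP; left; apply/eqP; ring.
have h2 : `|dotv (colvec u) (colvec s - colvec u)| <= (1 + eta) * eta * T.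
  rewrite (le_trans (dotv_le _ _ uq dq)) ?mulr_ge0// -q2.
  rewrite [leLHS](_ : _ = eta * q ^+ 2); last ring.
  by rewrite ler_wpM2r ?sqr_ge0// ler_peMl//; lra.
have h1' : `|vdot s s - vdot s u| <= (1 + eta) * eta * T.
  by rewrite -!dotv_colvec; move: h1; rewrite -scaleN1r dotvDr dotvZr mulN1r.
have h2' : `|vdot u u - vdot s u| <= (1 + eta) * eta * T.
  rewrite -!dotv_colvec distrC; move: h2; rewrite -scaleN1r dotvDr dotvZr mulN1r.
  by rewrite (dotvC (colvec u) (colvec s)).
have ss : vdot s s <= (1 + eta) ^+ 2 * T by rewrite -q2 -exprMn -dotv_colvec.
have us : vdot s u <= (1 + eta) ^+ 2 * T.
  rewrite -dotv_colvec (le_trans (ler_norm _))// (le_trans (dotv_le _ _ sq uq)) ?mulr_ge0// -q2.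
  rewrite [leLHS](_ : _ = (1 + eta) * q ^+ 2); last ring.
  by rewrite ler_wpM2r ?sqr_ge0// expr2 ler_peMl//; lra.
have uu' : vdot u u <= (1 + eta) ^+ 2 * T.
  by rewrite uu -[leLHS]mul1r ler_wpM2r// expr_ge1//; lra.
set c := rho * (1 + eta) ^+ 2 * T.
have key : expR (rho * vdot s s) + expR (rho * vdot u u) - 2 * expR (rho * vdot s u) <=
  2 * rho * (1 + eta) * eta * T * expR c.
  have le_c x : x <= (1 + eta) ^+ 2 * T -> rho * x <= c by rewrite /c -mulrA ler_pM2l.
  have k1 := exp_diff_bound (le_c _ ss) (le_c _ us).
  have k2 := exp_diff_bound (le_c _ uu') (le_c _ us).
  have e0 := expR_ge0 c.
  have l1 : `|rho * vdot s s - rho * vdot s u| * expR c <= rho * ((1 + eta) * eta * T) * expR c.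
    by rewrite ler_wpM2r// -mulrBr normrM (gtr0_norm rho0) ler_pM2l.
  have l2 : `|rho * vdot u u - rho * vdot s u| * expR c <= rho * ((1 + eta) * eta * T) * expR c.
    by rewrite ler_wpM2r// -mulrBr normrM (gtr0_norm rho0) ler_pM2l.
  rewrite [leRHS](_ : _ = rho * ((1 + eta) * eta * T) * expR c + rho * ((1 + eta) * eta * T) * expR c); last ring.
  lra.
have cv : (fun m => \sum_(al <- @box d m) bco (deg al) * coef n z al * mono s al -
   \sum_(al <- @box d m) bco (deg al) * coef n z al * mono u al) @ \oo -->
   Vstat n z s - Vstat n z u by apply: cvgB; exact: Vstat_cvg.
apply: (lim_norm_le cv) => m.
apply: (le_trans (series_lip rho0 (@bco_norm R) m (coef n z) s u)).
rewrite ler_wpM2l//; apply: ler_wsqrtr; apply: ler_pM => //.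
- by apply: sumr_ge0 => al _; rewrite divr_ge0 ?sqr_ge0// exprn_ge0// ltW.
- have := sqr_ge0 (env rho s - env rho u); rewrite sqrrB.
  have -> : env rho s ^+ 2 = expR (rho * vdot s s) by rewrite env_sqr /env; congr expR; field.
  have -> : env rho u ^+ 2 = expR (rho * vdot u u) by rewrite env_sqr /env; congr expR; field.
  have eu : expR (rho * vdot s u) <= env rho s * env rho u.
    rewrite /env -expRD ler_expR.
    have := vdot_ge0 (vax s (- 1) u).
    rewrite (_ : vdot (vax s (- 1) u) _ = vdot s s + vdot u u - 2 * vdot s u); last first.
      rewrite /vdot mulr_sumr -big_split -sumrB /=; apply: eq_bigr => i _.
      by rewrite !tnth_vax; ring.
    by move=> /(mulr_ge0 (ltW rho0)); lra.
  move=> h; apply: (le_trans h); rewrite mulr2n; lra.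
Qed.

(** Two errors of delta / 2 each: [centered_statistic] at the argument B^T t, where B is the
    empirical standardization, and [Vstat_lip] for the passage from B to O. The norm of B^T is at
    most 1 + eta, which turns 1 + 3 e into 1 + 5 e. *)
Lemma statistic_approx (A : 'M[R]_d) (m : 'cV[R]_d) (e K delta : R) : A \in unitmx ->
  0 < e -> e <= 1 -> 0 <= K -> 0 < delta ->
  let O := inv_sqrtmx (A *m A^T) *m A in
  exists N, forall n (z : nat -> vec), (N < n)%N -> coef_le n z (1 + e) K ->
    avg n z (fun y => expR (vdot y y / (2 * (1 + e)))) <= K ->
    forall t, `|Ustat n (fun j => affine_map m A (z j)) t - Vstat n z (mxv O^T t)| <=
      delta * env (1 + 5 * e) t.
Proof.
move=> uA e0 e1 K0 de0 O; have [OO1 OO2] := inv_sqrtmx_orth uA.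
have d2 : 0 < delta / 2 by rewrite divr_gt0.
have [N1 hN1] := centered_statistic (d := d) e0 e1 K0 d2.
have [a [C [a0 C0 hC]]] := inv_sqrtmx_lip (gram_sym A) (gram_posdef uA).
pose rho := 1 + e; have rho0 : 0 < rho by rewrite /rho; lra.
pose X := 16 * K ^+ 2 * 8 / e.
have X0 : 0 <= X by rewrite divr_ge0 ?mulr_ge0 ?sqr_ge0// ltW.
(* The bound e / 6 keeps the exponents below 1 + 5 e. The bound with X makes K^2 times 2 rho (1 +
   eta) eta / e at most delta^2 / 16, as 2 rho (1 + eta) <= 8. *)
pose eta := Num.min (e / 6) (delta ^+ 2 / (X + 1)).
have eta0 : 0 < eta by rewrite /eta lt_min !divr_gt0// ?exprn_gt0//; lra.
have eta1 : eta <= e / 6 by rewrite /eta ge_min lexx.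
have eta2 : X * eta <= delta ^+ 2.
  apply: (@le_trans _ _ ((X + 1) * eta)); first by rewrite ler_wpM2r ?(ltW eta0)//; lra.
  by rewrite mulrC -ler_pdivlMr ?/eta ?ge_min ?lexx ?orbT//; lra.
pose W := (d * d)%:R * (4 * K + 4 * K ^+ 2).
have W0 : 0 <= W by rewrite mulr_ge0 ?addr_ge0 ?mulr_ge0 ?sqr_ge0.
pose Q := mxN A * W * mxN A.
have Q0 : 0 <= Q by apply: mulr_ge0 (mxN_ge0 _); exact: mulr_ge0 (mxN_ge0 _) W0.
(* Once sqrt n >= Z, the first summand places S within the radius a of A A^T, and the second places
   B within eta of O. *)
pose Z := Q / a + C * Q * mxN A / eta.
have P0 : 0 <= C * Q * mxN A := mulr_ge0 (mulr_ge0 C0 Q0) (mxN_ge0 _).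
have Z0 : 0 <= Z := addr_ge0 (divr_ge0 Q0 (ltW a0)) (divr_ge0 P0 (ltW eta0)).
exists (maxn N1 (Num.truncn (Z ^+ 2))) => n z; rewrite gtn_max => /andP[nN1 nN2] cK hK t.
have n0 : (0 < n)%N by exact: leq_ltn_trans nN1.
set r := Num.sqrt (n%:R : R).
have r0 : 0 < r by rewrite sqrtr_gt0 ltr0n.
have rZ : Z <= r.
  rewrite -[leLHS]ger0_norm// -sqrtr_sqr; apply: ler_wsqrtr; apply: ltW.
  by apply: (lt_le_trans (truncnS_gt _)); rewrite ler_nat.
set S := A *m sample_cov n z *m A^T.
have SS : S^T = S by rewrite /S !trmx_mul trmxK sample_cov_sym mulmxA.
have rho1 : 1 <= rho by rewrite /rho; lra.
have rho2 : rho <= 2 by rewrite /rho; lra.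
have nS : mxN (S - A *m A^T) <= r^-1 * Q.
  have -> : S - A *m A^T = A *m (sample_cov n z - 1%:M) *m A^T.
    by rewrite mulmxBr mulmxBl mulmx1.
  rewrite (le_trans (mxNM _ _))// mxN_tr (le_trans (ler_wpM2r (mxN_ge0 _) (mxNM _ _)))//.
  rewrite [leRHS](_ : _ = mxN A * (r^-1 * W) * mxN A); last by rewrite /Q; ring.
  rewrite ler_wpM2r ?mxN_ge0// ler_wpM2l ?mxN_ge0//.
  exact: (sample_cov_bound n0 rho1 rho2 K0 cK).
have rQ : r^-1 * Q <= a.
  rewrite ler_pdivrMl// -ler_pdivrMr// (le_trans _ rZ)// /Z lerDl.
  exact: divr_ge0 P0 (ltW eta0).
have [pS hS] := hC S SS (le_trans nS rQ).
set B := inv_sqrtmx S *m A.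
have BO : mxN (B - O) <= eta.
  rewrite /B /O -mulmxBl (le_trans (mxNM _ _))//.
  apply: (@le_trans _ _ (C * (r^-1 * Q) * mxN A)).
    by rewrite ler_wpM2r ?mxN_ge0// (le_trans hS)// ler_wpM2l.
  rewrite [leLHS](_ : _ = r^-1 * (C * Q * mxN A)); last ring.
  rewrite ler_pdivrMl// -ler_pdivrMr// (le_trans _ rZ)// /Z lerDr.
  exact: divr_ge0 Q0 (ltW a0).
rewrite Ustat_affine// -/S -/B; set s := mxv B^T t; set u := mxv O^T t.
set T := vdot t t; have T0 : 0 <= T by exact: vdot_ge0.
have et : 0 <= eta by exact: ltW.
have opB : opb (1 + eta) B^T.
  have -> : B^T = O^T + (B - O)^T by rewrite linearB /= addrC subrK.
  apply: opbD => //.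
    by move=> v; rewrite dotv_mulmx trmxK mulmxA OO2 mul1mx expr1n mul1r lexx.
  by apply: (opb_le _ (opb_mxN _)); rewrite mxN_tr BO andbT; exact: mxN_ge0.
have hs : vdot s s <= (1 + eta) ^+ 2 * T by exact: vdot_mxv_le.
have hF : `|Fstat n z s - Vstat n z s| <= delta / 2 * env (1 + 5 * e) t.
  apply: (le_trans (hN1 n z nN1 cK hK s)); rewrite ler_wpM2l ?(ltW d2)// ler_expR.
  rewrite ler_wpM2r// (le_trans (ler_wpM2l _ hs))//; first lra.
  by rewrite mulrA ler_wpM2r//; nra.
have hV : `|Vstat n z s - Vstat n z u| <= delta / 2 * env (1 + 5 * e) t.
  apply: (le_trans (Vstat_lip t rho0 K0 et cK OO2 BO)); rewrite -/T.
  have E : delta / 2 * env (1 + 5 * e) t = 2 * Num.sqrt ((delta / 4 * env (1 + 5 * e) t) ^+ 2).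
    have p0 : 0 <= delta / 4 * env (1 + 5 * e) t.
      by rewrite mulr_ge0 ?env_ge0// divr_ge0// ltW.
    by rewrite sqrtr_sqr (ger0_norm p0); field.
  rewrite E ler_wpM2l//; apply: ler_wsqrtr.
  have e2 : env (1 + 5 * e) t ^+ 2 = expR ((1 + 5 * e) * T) by rewrite env_sqr /env; congr expR; rewrite -/T; field.
  rewrite exprMn e2.
  (* The polynomial factor |t|^2 from [Vstat_lip] is paid for with a further e in the exponent. *)
  have eT : T <= e^-1 * expR (e * T).
    by rewrite ler_pdivlMl//; have := expR_ge1Dx (e * T); lra.
  have eE : expR (e * T) * expR (rho * (1 + eta) ^+ 2 * T) <= expR ((1 + 5 * e) * T).
    by rewrite -expRD ler_expR -mulrDl ler_wpM2r// /rho; nra.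
  have c0 : 0 <= K ^+ 2 * (2 * rho * (1 + eta) * eta) by rewrite !mulr_ge0 ?sqr_ge0 ?(ltW rho0)//; lra.
  have e3 := expR_ge0 (rho * (1 + eta) ^+ 2 * T).
  apply: (@le_trans _ _ (K ^+ 2 * (2 * rho * (1 + eta) * eta) * (e^-1 * expR ((1 + 5 * e) * T)))).
    rewrite [leLHS](_ : _ = K ^+ 2 * (2 * rho * (1 + eta) * eta) * (T * expR (rho * (1 + eta) ^+ 2 * T))); last ring.
    rewrite ler_wpM2l//; apply: (le_trans (ler_wpM2r e3 eT)).
    by rewrite -[leLHS]mulrA; apply: ler_wpM2l => //; rewrite invr_ge0 ltW.
  rewrite [leLHS]mulrA; apply: ler_wpM2r; first exact: expR_ge0.
  apply: (@le_trans _ _ (X * eta / 16)); last by rewrite ler_pdivrMr//; lra.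
  rewrite [leLHS](_ : _ = (K ^+ 2 * e^-1 * eta) * (2 * rho * (1 + eta))); last ring.
  rewrite [leRHS](_ : _ = (K ^+ 2 * e^-1 * eta) * 8); last by rewrite /X; field; exact: lt0r_neq0.
  rewrite ler_wpM2l ?mulr_ge0 ?sqr_ge0 ?invr_ge0 ?(ltW e0)//; nra.
rewrite (le_trans (ler_distD (Vstat n z s) _ _))// (le_trans (lerD hF hV))//.
by rewrite -mulrDl -splitr.
Qed.

End change_of_variables.

(** * Laws and moments of the sample *)

Section probability_tools.
Context {R : realType} {dT : measure_display} {T : measurableType dT}.
Variable P : probability T R.

Lemma RV_ex (dE : measure_display) (E : measurableType dE) (f : T -> E) :
  measurable_fun setT f -> exists V : {RV P >-> E}, (V : T -> E) = f.
Proof.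
move=> mf; have mf' : f \in @mfun _ _ T E by rewrite inE.
by exists (mfun_Sub mf').
Qed.

Lemma prob1 : P setT = 1%E. Proof. exact: probability_setT. Qed.

Lemma prob_lty : (P setT < +oo)%E. Proof. by rewrite prob1 ltry. Qed.

Lemma markov_R (f : T -> R) (a : R) : L1 P f -> (forall w, 0 <= f w) -> 0 < a ->
  (P [set w | (a < f w)%R] <= (a^-1 * \int[P]_w f w)%:E)%E.
Proof.
move=> lf f0 a0; have mf := L1_meas lf.
have mA : measurable [set w | a < f w].
  rewrite (_ : [set w | _] = f @^-1` `]a, +oo[).
    by rewrite -[X in measurable X]setTI; exact: mf.
  by apply/seteqP; split => w /=; rewrite in_itv /= andbT.
have -> : (P [set w | (a < f w)%R] = \int[P]_w (\1_[set w | (a < f w)%R] w)%:E)%E.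
  by rewrite integral_indic// setIT.
rewrite -RintZ// RintE; last exact: L1Z.
apply: ge0_le_integral => //.
- by apply/measurable_EFinP; exact: measurable_indic.
- by apply/measurable_EFinP; apply: measurable_funM.
- move=> w _; rewrite lee_fin indicE; case: (boolP (w \in _)) => [|_].
    by rewrite inE /= => h; rewrite mulrC ler_pdivlMr// mul1r ltW.
  by rewrite mulr_ge0// invr_ge0 ltW.
Qed.

(** The events increase with m, so the uniform Markov bound passes to their union by continuity from
    below: the estimate then holds for all truncations at once. *)
Lemma sup_markov (f : nat -> T -> R) (a C : R) : (forall m, L1 P (f m)) ->
  (forall m w, 0 <= f m w) -> (forall m w, f m w <= f m.+1 w) ->
  (forall m, \int[P]_w f m w <= C) -> 0 < a ->
  measurable (\bigcup_m [set w | a < f m w]) /\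
  (P (\bigcup_m [set w | (a < f m w)%R]) <= (a^-1 * C)%:E)%E.
Proof.
move=> lf f0 fS fC a0.
have mF m : measurable [set w | a < f m w].
  rewrite (_ : [set w | _] = f m @^-1` `]a, +oo[).
    by rewrite -[X in measurable X]setTI; exact: (L1_meas (lf m)).
  by apply/seteqP; split => w /=; rewrite in_itv /= andbT.
have mU : measurable (\bigcup_m [set w | a < f m w]) by exact: bigcupT_measurable.
split => //.
have nd : nondecreasing_seq (fun m => [set w | a < f m w]).
  apply/nondecreasing_seqP => m; apply/subsetPset => w /= h.
  exact: lt_le_trans (fS m w).
have cv := @nondecreasing_cvg_mu _ _ _ P _ mF mU nd.
rewrite -(cvg_lim _ cv)//; apply: lime_le; first by apply/cvg_ex; eexists; exact: cv.
apply: nearW => m /=; apply: (le_trans (markov_R (lf m) (f0 m) a0)).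
by rewrite lee_fin ler_wpM2l// invr_ge0 ltW.
Qed.

Section functions_of_iid.
Context {dE dF : measure_display} {E : measurableType dE} {F : measurableType dF}.
Variables (X : nat -> {RV P >-> E}) (g : E -> F) (Y : nat -> {RV P >-> F}).
Hypothesis mg : measurable_fun setT g.
Hypothesis YE : forall i w, Y i w = g (X i w).

Lemma indep_comp : mutually_independent X -> mutually_independent Y.
Proof.
move=> iX s A us mA.
have mgA i : measurable (g @^-1` A i) by rewrite -[X in measurable X]setTI; exact: mg.
have e i : Y i @^-1` A i = X i @^-1` (g @^-1` A i).
  by apply/seteqP; split => w /=; rewrite YE.
have := iX s (fun i => g @^-1` A i) us mgA.
have -> : \bigcap_(i in [set` s]) (X i @^-1` (g @^-1` A i)) = \bigcap_(i in [set` s]) (Y i @^-1` A i).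
  by apply: eq_bigcapr => i _; rewrite e.
by move=> ->; apply: eq_bigr => i _; rewrite e.
Qed.

End functions_of_iid.

Section tuple_law.
Context {dE : measure_display} {E : measurableType dE}.
Variables (X : nat -> {RV P >-> E}) (mu : {sigma_finite_measure set E -> \bar R}).
Hypothesis X_indep : mutually_independent X.
Hypothesis X_law : forall i A, measurable A -> P (X i @^-1` A) = mu A.

Definition tup n (s : nat -> nat) (w : T) : n.-tuple E := [tuple X (s k) w | k < n].

Lemma measurable_tup n s : measurable_fun setT (tup n s).
Proof.
apply/measurable_fun_tnthP => i; rewrite (_ : _ \o _ = (X (s i) : T -> E)).
  exact: measurable_RV.
by apply/funext => w /=; rewrite tnth_mktuple.
Qed.

Lemma tup_law n (s : nat -> nat) : {in gtn n &, injective s} -> forall B, measurable B ->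
  power_measure mu n B = P (tup n s @^-1` B).
Proof.
move=> si B mB.
(* The indices are listed in a duplicate-free sequence r for [joint_law]. The equation [size r = n]
   is kept general so that it can be eliminated, the tuple types depending on it. *)
suff h (r : seq nat) (e : size r = n) : uniq r -> (forall k, (k < n)%N -> nth 0%N r k = s k) ->
    power_measure mu n B = P (tup n s @^-1` B).
  apply: (h [seq s k | k <- iota 0 n]); first by rewrite size_map size_iota.
    rewrite map_inj_in_uniq ?iota_uniq// => i j; rewrite !mem_iota !add0n => /andP[_ i_n] /andP[_ j_n].
    exact: si.
  by move=> k kn; rewrite (nth_map 0%N) ?size_iota// nth_iota.
move=> ur rs; clear si; case: n / e B mB rs => B mB rs.
rewrite (joint_law X_indep X_law ur mB); congr (P (_ @^-1` B)).
apply/funext => w; apply: eq_from_tnth => k; rewrite tnth_mktuple tnth_map.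
by rewrite (tnth_nth 0%N) /= rs.
Qed.

Lemma tup_L1 n (s : nat -> nat) (F : n.-tuple E -> R) : {in gtn n &, injective s} -> L1 (power_measure mu n) F ->
  L1 P (F \o tup n s) /\ \int[power_measure mu n]_t F t = \int[P]_w F (tup n s w).
Proof.
move=> si lF; split.
  apply/(L1_law (nu := power_measure mu n) (@measurable_tup n s)) => //; last exact: L1_meas lF.
  by move=> A mA; exact: tup_law.
by apply: (Rint_law (@measurable_tup n s)) => // A mA; exact: tup_law.
Qed.

Lemma RV_L1 i (f : E -> R) : L1 mu f -> L1 P (fun w => f (X i w)) /\
  \int[P]_w f (X i w) = \int[mu]_x f x.
Proof.
move=> lf; have mX := measurable_RV X i.
split; first by apply/(L1_law mX (nu := mu)) => //; [move=> A mA; exact/esym/X_law|exact: L1_meas lf].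
by rewrite -(Rint_law mX (nu := mu)) => // A mA; exact/esym/X_law.
Qed.

End tuple_law.

Lemma power_pair (dE : measure_display) (E : measurableType dE)
   (mu : {sigma_finite_measure set E -> \bar R}) n (f g : E -> R) (j k : 'I_n) :
  mu setT = 1%E -> L1 mu f -> L1 mu g -> L1 mu (fun x => f x * g x) ->
  L1 (power_measure mu n) (fun t => f (tnth t j) * g (tnth t k)) /\
  \int[power_measure mu n]_t (f (tnth t j) * g (tnth t k)) =
    if j == k then \int[mu]_x (f x * g x) else \int[mu]_x f x * \int[mu]_x g x.
Proof.
move=> mu1 lf lg lfg; have mlt : (mu setT < +oo)%E by rewrite mu1 ltry.
have l1 : L1 mu (fun=> 1) by exact: L1_cst.
pose h i x := (if i == j then f x else 1) * (if i == k then g x else 1).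
have lh i : L1 mu (h i).
  by rewrite /h; case: eqP => _; case: eqP => _ //; under eq_fun do rewrite ?mul1r ?mulr1.
have [l e] := L1_power_prod mu1 lh.
have E1 : (fun t : n.-tuple E => \prod_i h i (tnth t i)) = fun t => f (tnth t j) * g (tnth t k).
  apply/funext => t; rewrite big_split /=; congr (_ * _).
    by rewrite (bigD1 j)//= eqxx big1 ?mulr1// => i /negbTE ->.
  by rewrite (bigD1 k)//= eqxx big1 ?mulr1// => i /negbTE ->.
rewrite E1 in l e; split => //; rewrite e; case: eqVneq => [jk|jk].
  rewrite (bigD1 j)//= big1 ?mulr1.
    by apply: eq_Rintegral => x _; rewrite /h -jk eqxx.
  by move=> i /negbTE ij; rewrite /h -jk ij; under eq_Rintegral do rewrite mul1r; rewrite Rint_cst1.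
rewrite (bigD1 j)//= (bigD1 k) 1?eq_sym//= mulrA [X in _ * X]big1 ?mulr1.
  congr (_ * _); apply: eq_Rintegral => x _; rewrite /h eqxx ?(negbTE jk) ?mulr1//.
  by rewrite eq_sym (negbTE jk) mul1r.
move=> i /andP[/negbTE ij /negbTE ik]; rewrite /h ij ik.
by under eq_Rintegral do rewrite mul1r; rewrite Rint_cst1.
Qed.

Lemma power_sum_sqr (dE : measure_display) (E : measurableType dE)
   (mu : {sigma_finite_measure set E -> \bar R}) n (f : E -> R) :
  mu setT = 1%E -> L1 mu f -> L1 mu (fun x => f x ^+ 2) -> \int[mu]_x f x = 0 ->
  L1 (power_measure mu n) (fun t => (\sum_(j < n) f (tnth t j)) ^+ 2) /\
  \int[power_measure mu n]_t ((\sum_(j < n) f (tnth t j)) ^+ 2) = n%:R * \int[mu]_x (f x ^+ 2).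
Proof.
move=> mu1 lf lf2 f0.
have lff : L1 mu (fun x => f x * f x) by under eq_fun do rewrite -expr2.
have pp j k := power_pair j k mu1 lf lf lff (n := n).
have E1 : (fun t : n.-tuple E => (\sum_(j < n) f (tnth t j)) ^+ 2) =
    fun t => \sum_j \sum_k f (tnth t j) * f (tnth t k).
  apply/funext => t; rewrite expr2 mulr_suml; apply: eq_bigr => j _.
  by rewrite mulr_sumr.
have l2 j : L1 (power_measure mu n) (fun t => \sum_(k < n) f (tnth t j) * f (tnth t k)).
  by apply: L1_sum => k _; exact: (pp j k).1.
rewrite E1; split; first by apply: L1_sum => j _; exact: l2.
rewrite Rint_sum//.
rewrite (eq_bigr (fun=> \int[mu]_x (f x ^+ 2))); last first.
  move=> j _; rewrite Rint_sum => [|k _]; last exact: (pp j k).1.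
  rewrite (bigD1 j)//= (pp j j).2 eqxx big1 ?addr0.
    by apply: eq_Rintegral => x _; rewrite expr2.
  by move=> k kj; rewrite (pp j k).2 eq_sym (negbTE kj) f0 mulr0.
by rewrite sumr_const card_ord mulr_natl.
Qed.

End probability_tools.

(** * Truncated expansions *)

Section geometric_weights.
Context {R : realType} {d : nat} {dT : measure_display} {T : measurableType dT}.
Variable P : probability T R.
Local Notation J := {ffun 'I_d -> nat}.
Local Notation box := (@box d).
Variable rho : R.
Hypothesis rho1 : 1 < rho.

Let rho0 : 0 < rho. Proof. exact: lt_trans rho1. Qed.

Definition wsum (m : nat) : R := \sum_(al <- box m) rho^-1 ^+ deg al.

Lemma wsum_cvg : exists l : R, wsum @ \oo --> l.
Proof.
exists (\prod_(i < d) (1 - rho^-1)^-1).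
pose g (i : 'I_d) (k : nat) : R := rho^-1 ^+ k.
have h i : (fun m => \sum_(k < m) g i k) @ \oo --> (1 - rho^-1)^-1.
  have r1 : `|rho^-1| < 1 by rewrite ger0_norm ?invr_ge0 ?(ltW rho0)// invf_lt1.
  have := @cvg_geometric_series R 1 _ r1; rewrite mul1r; apply: cvgn_ext => m.
  by rewrite /series /= big_mkord; apply: eq_bigr => k _; rewrite /geometric /= mul1r.
apply: cvgn_ext (box_prod_cvg h) => m; apply: eq_bigr => al _.
by rewrite degX.
Qed.

Let w0 (al : J) : 0 <= rho^-1 ^+ deg al. Proof. by rewrite exprn_ge0// invr_ge0 ltW. Qed.

Lemma wsum_tail : exists C : R, 0 <= C /\ (forall m, wsum m <= C) /\
  forall e, 0 < e -> exists m0, forall m, (m0 <= m)%N -> forall n,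
    \sum_(al <- box (m + n) | al \notin box m) rho^-1 ^+ deg al <= e.
Proof.
have [l hl] := wsum_cvg; exists l.
have le_l m : wsum m <= l by apply: (@box_le_lim _ _ (fun al => rho^-1 ^+ deg al) _ m xpredT) => // al; exact: w0.
split; [|split => //].
  by apply: le_trans (le_l 0%N); apply: sumr_ge0.
move=> e e0; have /cvgrPdist_le/(_ e e0)[m0 _ hm] := hl.
exists m0 => m mm n; have := hm m mm; rewrite /= ger0_norm ?subr_ge0// => h.
have := box_sub (fun al => rho^-1 ^+ deg al) (leq_addr n m); rewrite -/(wsum _) => E.
have := le_l (m + n)%N; rewrite /wsum E -/(wsum m); lra.
Qed.

Section random_coefficients.
Variable xi : J -> T -> R.
Hypothesis xi2 : forall al, L1 P (fun w => xi al w ^+ 2) /\ \int[P]_w (xi al w ^+ 2) <= 1.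

(** Used for the coefficients of the data as well as for the normal coefficients of the limit:
    second moments at most 1 are all they share. *)
Definition xisum (m : nat) (p : pred J) (w : T) : R :=
  \sum_(al <- box m | p al) xi al w ^+ 2 / rho ^+ deg al.

Lemma L1_xisum m p : L1 P (xisum m p) /\
  \int[P]_w xisum m p w <= \sum_(al <- box m | p al) rho^-1 ^+ deg al.
Proof.
have E : xisum m p = fun w => \sum_(al <- box m | p al) rho^-1 ^+ deg al * xi al w ^+ 2.
  by apply/funext => w; apply: eq_bigr => al _; rewrite exprVn mulrC.
have l al : L1 P (fun w => rho^-1 ^+ deg al * xi al w ^+ 2) by apply: L1Z; exact: (xi2 al).1.
rewrite E; split; first by apply: L1_sum => al _; exact: l.
rewrite Rint_sum// ?ler_sum// => al _.
have [l2 i2] := xi2 al; rewrite RintZ//.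
by rewrite -[leRHS]mulr1 ler_wpM2l.
Qed.

Lemma xisum_ge0 m p w : 0 <= xisum m p w.
Proof. by apply: sumr_ge0 => al _; rewrite divr_ge0 ?sqr_ge0// exprn_ge0// ltW. Qed.

Lemma xisum_le m n p w : (m <= n)%N -> xisum m p w <= xisum n p w.
Proof.
move=> mn; have F0 al : 0 <= (if p al then xi al w ^+ 2 / rho ^+ deg al else 0).
  by case: ifP => // _; rewrite divr_ge0 ?sqr_ge0// exprn_ge0// ltW.
by rewrite /xisum big_mkcond [leRHS]big_mkcond /= (box_sub _ mn) lerDl sumr_ge0.
Qed.

Lemma xisum_event (C a : R) : (forall m, wsum m <= C) -> 0 < a ->
  measurable (\bigcup_m [set w | a < xisum m xpredT w]) /\
  (P (\bigcup_m [set w | (a < xisum m xpredT w)%R]) <= (a^-1 * C)%:E)%E.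
Proof.
move=> wC a0; apply: sup_markov => //.
- by move=> m; exact: (L1_xisum m xpredT).1.
- by move=> m w; exact: xisum_ge0.
- by move=> m w; exact: xisum_le.
- by move=> m; exact: le_trans (L1_xisum m xpredT).2 (wC m).
Qed.

Lemma xisum_tail_event m (e a : R) : 0 < a ->
  (forall n, \sum_(al <- box (m + n) | al \notin box m) rho^-1 ^+ deg al <= a * e) ->
  measurable (\bigcup_n [set w | a < xisum (m + n) [pred al | al \notin box m] w]) /\
  (P (\bigcup_n [set w | (a < xisum (m + n) [pred al | al \notin box m] w)%R]) <= e%:E)%E.
Proof.
move=> a0 hm.
have h := @sup_markov _ _ _ P (fun n w => xisum (m + n) [pred al | al \notin box m] w) a (a * e).
have [] := h; rewrite ?mulKf ?gt_eqF//.
- by move=> n; exact: (L1_xisum _ _).1.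
- by move=> n w; exact: xisum_ge0.
- by move=> n w; apply: xisum_le; rewrite leq_add2l.
- by move=> n; exact: le_trans (L1_xisum _ _).2 (hm n).
Qed.

End random_coefficients.
End geometric_weights.

(** * Truncated series as functions of finitely many coefficients *)

Section finite_dimensional.
Context {R : realType} {d : nat} {gamma : R}.
Hypothesis gamma1 : 1 < gamma.
Local Notation vec := (vec R d).
Local Notation J := {ffun 'I_d -> nat}.
Local Notation L2 := (L2 d gamma).
Local Notation nu := (@wlebesgue R d gamma).
Variable O : 'M[R]_d.
Hypothesis OO : O *m O^T = 1%:M.

(** Without the index 0 the Hermite vector of a standard normal point is centred and has identity
    covariance, as [clt_lip] requires. *)
Definition bx m : seq J := [seq al <- @box d m | al != j0].

Lemma sum_bx m (F : J -> R) : F j0 = 0 ->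
  \sum_(i < size (bx m)) F (nth j0 (bx m) i) = \sum_(al <- @box d m) F al.
Proof.
move=> F0; rewrite -(big_mkord xpredT (fun i => F (nth j0 (bx m) i))) -(big_nth j0 xpredT F).
rewrite big_filter [RHS](bigID (fun al => al != j0)) /= [X in _ + X]big1 ?addr0// => al.
by rewrite negbK => /eqP ->.
Qed.

Lemma measurable_mxv (M : 'M[R]_d) : measurable_fun setT (mxv M).
Proof.
apply: measurable_vecP => i; under eq_fun do rewrite tnth_mktuple mxE.
apply: measurable_sum => j; apply: measurable_funM => //; under eq_fun do rewrite mxE.
exact: measurable_tnthR.
Qed.

Lemma measurable_mono al : measurable_fun setT (fun t : vec => mono t al).
Proof.
apply: measurable_prod => i _; apply: measurable_funM => //.
by apply: measurable_funX; exact: measurable_tnthR.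
Qed.

Lemma env_orth a t : env a (mxv O^T t) = env a t.
Proof.
rewrite /env -(dotv_colvec (mxv _ _)) colvec_mxv dotv_mulmx trmxK mulmxA OO mul1mx.
by rewrite dotv_colvec.
Qed.

(** A single term of [series_bound] with rho = 1. *)
Lemma mono_env (t : vec) al : `|mono t al| <= env 1 t.
Proof.
have [m am] : exists m, al \in @box d m.
  exists (\sum_i al i).+1; rewrite mem_box; apply/forallP => i.
  by rewrite ltnS (bigD1 i)//= leq_addr.
have a1 (k : nat) : `|1 : R| <= 1 by rewrite normr1.
have := series_bound ltr01 a1 m (pred1 al) (fun=> 1) t.
rewrite -big_filter -[X in _ <= _ * Num.sqrt X * _]big_filter.
have -> : [seq i <- @box d m | pred1 al i] = [:: al].
  apply: perm_small_eq => //; apply: uniq_perm; rewrite ?filter_uniq ?box_uniq// => be.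
  rewrite mem_filter mem_seq1 /=; case: eqVneq => [->|//]; exact: am.
by rewrite !big_seq1 !mul1r !expr1n divr1 sqrtr1 mul1r.
Qed.

Definition psi m (x : Defs.vec R (size (bx m))) (t : vec) : R :=
  \sum_(i < size (bx m)) bco (deg (nth j0 (bx m) i)) * tnth x i * mono (mxv O^T t) (nth j0 (bx m) i).

Lemma measurable_psi m x : measurable_fun setT (@psi m x).
Proof.
apply: measurable_sum => i; apply: measurable_funM => //.
exact: (measurableT_comp (measurable_mono _) (measurable_mxv _)).
Qed.

Lemma psi_lip m x y t : `|@psi m x t - @psi m y t| <=
  (2 * \sum_i `|tnth x i - tnth y i|) * env 1 t.
Proof.
rewrite /psi -sumrB (le_trans (ler_norm_sum _ _ _))// mulr_sumr mulr_suml.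
apply: ler_sum => i _; rewrite -mulrBl -mulrBr !normrM ler_pM//.
  by rewrite ler_pM// bco_norm.
by rewrite -(env_orth 1 t) mono_env.
Qed.

Lemma Phi_ex m x : exists F : L2, L2fun F = @psi m x %[ae nu].
Proof.
apply: (@L2_exists_env _ _ _ _ (2 * \sum_i `|tnth x i|) 1) => //; first exact: measurable_psi.
move=> t; have := psi_lip x [tuple 0 | i < _] t.
rewrite (_ : psi [tuple 0 | i < _] t = 0) ?subr0; last first.
  by rewrite /psi big1// => i _; rewrite tnth_mktuple mulr0 mul0r.
move=> h; apply: (le_trans h); rewrite ler_wpM2r ?env_ge0// ler_wpM2l//.
by apply: ler_sum => i _; rewrite tnth_mktuple subr0.
Qed.

(** Being Lipschitz in x ([Phi_lip]), it pulls Lipschitz functionals on L^2 back to Lipschitz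
    functions of finitely many coefficients, where [clt_lip] applies. *)
Definition Phi m x : L2 := projT1 (cid (@Phi_ex m x)).

Lemma PhiE m x : L2fun (@Phi m x) = @psi m x %[ae nu].
Proof. exact: (projT2 (cid (@Phi_ex m x))). Qed.

Definition env_norm (a : R) : R := Num.sqrt (\int[nu]_t env (2 * a) t).

Lemma Phi_lip m x y : L2dist (@Phi m x) (@Phi m y) <=
  (2 * env_norm 1) * \sum_i `|tnth x i - tnth y i|.
Proof.
rewrite mulrAC; apply: (L2dist_env (f := psi x) (g := psi y)) => //.
- exact: measurable_psi.
- exact: measurable_psi.
- exact: PhiE.
- exact: PhiE.
- by rewrite mulr_ge0// sumr_ge0.
- by move=> t; exact: psi_lip.
Qed.

Lemma env_norm_ge0 a : 0 <= env_norm a. Proof. exact: sqrtr_ge0. Qed.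

Lemma Phi_random m (dT : measure_display) (T : measurableType dT) (phi : T -> Defs.vec R (size (bx m))) :
  measurable_fun setT phi -> random_element (fun w => Phi (phi w)).
Proof.
move=> mphi; apply: (random_element_cont (C := setT) (Phi := @Phi m) (F0 := Phi [tuple 0 | i < size (bx m)]) mphi) => //.
- by rewrite preimage_setT.
- by move=> w /(_ I).
move=> x _ e e0; set k := size (bx m); have N := env_norm_ge0 1.
have c0 : 0 < 2 * env_norm 1 * k%:R + 1 by rewrite ltr_pwDr// !mulr_ge0.
exists (e / (2 * env_norm 1 * k%:R + 1)); split; first by rewrite divr_gt0.
move=> y _ hy; apply: (le_lt_trans (Phi_lip _ _)).
apply: (@le_lt_trans _ _ (2 * env_norm 1 * (k%:R * (e / (2 * env_norm 1 * k%:R + 1))))).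
  rewrite ler_wpM2l ?mulr_ge0//.
  apply: (@le_trans _ _ (\sum_(i < k) (e / (2 * env_norm 1 * k%:R + 1)))).
    by apply: ler_sum => i _; rewrite distrC; exact/ltW/hy.
  by rewrite sumr_const card_ord [leRHS]mulr_natl.
by rewrite mulrA mulrA ltr_pdivrMr// mulrC ltr_pM2l// ltrDl.
Qed.

Lemma clt_Phi m (h : L2 -> R) (M L : R) : (forall F, `|h F| <= M) -> 0 <= L ->
  (forall F G, `|h F - h G| <= L * L2dist F G) ->
  (fun n => \int[power_measure (@gauss R d) n]_t
     h (Phi (psum (fun z => [tuple heta z (nth j0 (bx m) i) | i < size (bx m)]) (Num.sqrt n%:R)^-1 t)))
    @ \oo --> \int[@gauss R (size (bx m))]_x h (@Phi m x).
Proof.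
move=> hM L0 hL; pose Y (z : vec) := [tuple heta z (nth j0 (bx m) i) | i < size (bx m)].
have N := env_norm_ge0 1.
have inb (i : 'I_(size (bx m))) : nth j0 (bx m) i != j0.
  by have := mem_nth j0 (ltn_ord i); rewrite mem_filter => /andP[].
have ub : uniq (bx m) by rewrite filter_uniq// box_uniq.
apply: (clt_lip (g := fun x => h (@Phi m x)) (M := M) (L := L * (2 * env_norm 1))).
- exact: gaussT.
- by apply: measurable_vecP => i; under eq_fun do rewrite tnth_mktuple; exact: measurable_heta.
- have -> : (fun z : vec => vdot (Y z) (Y z) ^+ 2) = fun z => \sum_(i < size (bx m)) \sum_(j < size (bx m))
     (heta z (nth j0 (bx m) i) ^+ 2 * heta z (nth j0 (bx m) j) ^+ 2).
    apply/funext => z; rewrite expr2 /vdot mulr_suml; apply: eq_bigr => i _.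
    by rewrite mulr_sumr; apply: eq_bigr => j _; rewrite !tnth_mktuple -!expr2.
  by apply: L1_sum => i _; apply: L1_sum => j _; exact: gauss_heta4.
- move=> i; under eq_Rintegral do rewrite tnth_mktuple.
  by rewrite (gauss_heta _).2 -/j0 (negbTE (inb i)).
- move=> i j; under eq_Rintegral do rewrite !tnth_mktuple.
  by rewrite (gauss_heta2 _ _).2 nth_uniq.
- apply: (measurable_comp_random (V := @Phi m)).
    exact: (Phi_random (phi := id)).
  exact: (L2_lip_continuous hL).
- by [].
- by rewrite !mulr_ge0.
- move=> x y; apply: (le_trans (hL _ _)); rewrite -mulrA ler_wpM2l//; exact: Phi_lip.
Qed.

End finite_dimensional.

Section good_events.
Context {R : realType} {dT : measure_display} {T : measurableType dT}.
Variable P : probability T R.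

Lemma Rint_event_close (f g : T -> R) (G : set T) (c B p : R) : L1 P f -> L1 P g -> measurable G ->
  0 <= c -> 0 <= B -> (forall w, G w -> `|f w - g w| <= c) -> (forall w, `|f w - g w| <= B) ->
  (P (~` G) <= p%:E)%E -> `|\int[P]_w f w - \int[P]_w g w| <= c + B * p.
Proof.
move=> lf lg mG c0 B0 fc fB Pp; rewrite -RintB//; apply: (le_trans (Rint_abs (L1B lf lg))).
have mGc : measurable (~` G) by exact: measurableC.
have l1 : L1 P (\1_(~` G) : T -> R).
  apply: (L1_bounded (M := 1)) => [||w]; [exact: prob_lty|exact: measurable_indic|].
  by rewrite indicE; case: (w \in _); rewrite ?normr1 ?normr0.
have lc : L1 P (fun=> c) by apply: L1_cst; exact: prob_lty.
apply: (@le_trans _ _ (\int[P]_w (c + B * (\1_(~` G) w : R)))).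
  apply: Rint_le; [exact/L1_abs/L1B|by apply: L1D => //; exact: L1Z|move=> w].
  rewrite indicE; case: (boolP (w \in ~` G)) => [_|h].
    by rewrite mulr1 (le_trans (fB w))// lerDr.
  by rewrite mulr0 addr0; apply: fc; apply: contrapT => nG; move/negP: h; apply; rewrite inE.
rewrite RintD//; last exact: L1Z.
rewrite RintZ// (Rint_cst1 _ (prob1 P)) lerD2l ler_wpM2l//.
by rewrite -lee_fin RintE// integral_indic// setIT.
Qed.

Lemma bound_L1 (f : T -> R) M : measurable_fun setT f -> (forall w, `|f w| <= M) -> L1 P f.
Proof. by move=> mf fM; apply: (L1_bounded (M := M)) => //; exact: prob_lty. Qed.

Lemma prob_setC3 (A B C : set T) (p : R) : measurable A -> measurable B -> measurable C ->
  (P A <= p%:E)%E -> (P B <= p%:E)%E -> (P C <= p%:E)%E ->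
  (P (~` (~` A `&` ~` B `&` ~` C)) <= (3 * p)%:E)%E.
Proof.
move=> mA mB mC pA pB pC; rewrite !setCI !setCK.
have -> : (3 * p)%:E = (p%:E + p%:E + p%:E)%E by rewrite -!EFinD; congr EFin; ring.
apply: (le_trans (measureU2 _ (measurableU _ _ mA mB) mC)); apply: leeD => //.
by apply: (le_trans (measureU2 _ mA mB)); exact: leeD.
Qed.

End good_events.

Section exp_sqr_gauss.
Context {R : realType}.

(** Together with the Gaussian density the exponent is -(1 - 1 / kappa) x^2 / 2 in each coordinate,
    negative because kappa > 1. *)
Lemma L1_gauss_exp_sqr d (kappa : R) : 1 < kappa ->
  L1 (@gauss R d) (fun y => expR (vdot y y / (2 * kappa))).
Proof.
move=> k1; have k0 : 0 < kappa by exact: lt_trans k1.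
have me : measurable_fun setT (fun x : R => expR (x ^+ 2 / (2 * kappa))).
  by apply: measurableT_comp => //; apply: measurable_funM => //; exact: measurable_monom.
have l : L1 (@N01 R) (fun x : R => expR (x ^+ 2 / (2 * kappa))).
  apply: L1P => //; rewrite (ge0_integral_N01 (F := fun x => `|expR (x ^+ 2 / (2 * kappa))|%:E)); last 2 first.
  - by apply/measurable_EFinP; exact: measurableT_comp.
  - by move=> x; rewrite lee_fin.
  pose a := (1 - kappa^-1) / 2.
  have a0 : 0 < a by rewrite divr_gt0// subr_gt0 invf_lt1.
  rewrite (_ : (\int[_]_x _)%E = (\int[@lebesgue_measure R]_x ((normal_peak 1)%:E * (expR (- a * x ^+ 2))%:E))%E).
    rewrite ge0_integralZl//.
    - apply: lte_mul_pinfty; rewrite ?integral_exp_sqr_lty// lee_fin; exact: normal_peak_ge0.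
    - by apply/measurable_EFinP; apply: measurableT_comp => //; apply: measurable_funM => //; exact: measurable_monom.
    - by rewrite lee_fin normal_peak_ge0.
  apply: eq_integral => x _; rewrite ger0_norm ?expR_ge0// phi01E -!EFinM mulrCA -expRD.
  by congr (_ * expR _)%:E; rewrite /a; field; exact: lt0r_neq0.
have [lp _] := @L1_power_prod _ _ _ (@N01 R) d (fun _ x => expR (x ^+ 2 / (2 * kappa))) (@N01T R) (fun=> l).
rewrite (_ : (fun _ => _) = fun t : Defs.vec R d => \prod_(i < d) expR (tnth t i ^+ 2 / (2 * kappa)))//.
apply/funext => t; rewrite -(big_morph _ (@expRD R) (@expR0 R)); congr expR.
by rewrite /vdot mulr_suml; apply: eq_bigr => i _; rewrite expr2.
Qed.

End exp_sqr_gauss.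

(** The differences of partial sums are sums over the indices outside the box, so [series_bound]
    with that predicate applies before the limit is taken. *)
Lemma series_tail_bound {R : realType} {d : nat} (rho B D : R) (a : nat -> R)
    (x : {ffun 'I_d -> nat} -> R) (t : Defs.vec R d) (l : R) m : 0 < rho -> (forall k, `|a k| <= B) -> 0 <= D ->
  (fun n => \sum_(al <- @box d n) a (deg al) * x al * mono t al) @ \oo --> l ->
  (forall n, \sum_(al <- @box d (m + n) | al \notin @box d m) x al ^+ 2 / rho ^+ deg al <= D ^+ 2) ->
  `|l - \sum_(al <- @box d m) a (deg al) * x al * mono t al| <= B * D * env rho t.
Proof.
move=> r0 aB D0 hl hD; set s := \sum_(al <- _) _.
have cv : (fun n => \sum_(al <- @box d (m + n)) a (deg al) * x al * mono t al - s) @ \oo --> l - s.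
  apply: cvgB; last exact: cvg_cst.
  by move: hl; rewrite -(cvg_shiftn m); under eq_fun do rewrite addnC.
apply: (lim_norm_le cv) => n; rewrite (box_sub _ (leq_addr n m)) -/s addrAC subrr add0r.
apply: (le_trans (series_bound r0 aB (m + n) [pred al | al \notin @box d m] x t)).
rewrite ler_wpM2r ?env_ge0// ler_wpM2l ?(le_trans (normr_ge0 _) (aB 0%N))//.
by rewrite -[leRHS]ger0_norm// -sqrtr_sqr; apply: ler_wsqrtr; exact: hD.
Qed.

(** * Moments of the coefficients of the sample *)

Section sample_moments.
Context {R : realType} {d : nat} {dT : measure_display} {T : measurableType dT}.
Variables (P : probability T R) (Z : nat -> {RV P >-> Defs.vec R d}).
Hypothesis Z_indep : mutually_independent Z.
Hypothesis Z_law : forall i A, measurable A -> P (Z i @^-1` A) = @gauss R d A.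
Local Notation zs w := (fun j => Z j w).

Lemma measurable_coef n al : measurable_fun setT (fun w => coef n (zs w) al).
Proof.
rewrite /coef; case: eqVneq => _; first exact: measurable_cst.
apply: measurable_funM => //.
apply: measurable_sum => j; exact: (measurableT_comp (measurable_heta al) (measurable_RV Z j)).
Qed.

Lemma coef_moment n al : (0 < n)%N -> L1 P (fun w => coef n (zs w) al ^+ 2) /\
  \int[P]_w (coef n (zs w) al ^+ 2) <= 1.
Proof.
move=> n0; rewrite /coef; case: eqVneq => [_|aln].
  split; first by under eq_fun do rewrite expr0n; exact: L1_0.
  by under eq_Rintegral do rewrite expr0n; rewrite Rint0.
have l1 := (@gauss_heta R d al).1.
have l2 : L1 (@gauss R d) (fun z => heta z al ^+ 2).
  by under eq_fun do rewrite expr2; exact: (gauss_heta2 al al).1.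
have i0 : \int[@gauss R d]_z heta z al = 0 by rewrite (gauss_heta al).2 -/j0 (negbTE aln).
have [lp ip] := power_sum_sqr n (gaussT d) l1 l2 i0.
have si : {in gtn n &, injective (fun i : nat => i)} by [].
have [lq iq] := tup_L1 Z_indep Z_law si lp.
have E : (fun w => ((Num.sqrt n%:R)^-1 * \sum_(j < n) heta (Z j w) al) ^+ 2) =
   fun w => n%:R^-1 * (((fun t : n.-tuple (Defs.vec R d) => (\sum_(j < n) heta (tnth t j) al) ^+ 2) \o tup Z n id) w).
  apply/funext => w /=; rewrite exprMn exprVn sqr_sqrtr//; congr (_ * _ ^+ 2).
  by apply: eq_bigr => j _; rewrite tnth_mktuple.
rewrite E; split; first exact: L1Z.
rewrite RintZ//= -iq ip.
have -> : \int[@gauss R d]_x (heta x al ^+ 2) = 1.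
  by under eq_Rintegral do rewrite expr2; rewrite (gauss_heta2 al al).2 eqxx.
by rewrite mulr1 mulVf// pnatr_eq0 -lt0n.
Qed.

Lemma avg_moment (kappa : R) : 1 < kappa -> exists C, forall n,
  L1 P (fun w => avg n (zs w) (fun y => expR (vdot y y / (2 * kappa)))) /\
  \int[P]_w avg n (zs w) (fun y => expR (vdot y y / (2 * kappa))) <= C.
Proof.
move=> k1; have lg := @L1_gauss_exp_sqr R d _ k1.
set f := fun y => _ in lg; exists (\int[@gauss R d]_y f y) => n.
have lZ j := RV_L1 Z_law j lg.
have lS : L1 P (fun w => \sum_(j < n) f (Z j w)) by apply: L1_sum => j _; exact: (lZ j).1.
rewrite /avg; split; first exact: L1Z.
rewrite RintZ// Rint_sum; last by move=> j _; exact: (lZ j).1.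
rewrite (eq_bigr (fun=> \int[@gauss R d]_y f y)); last by move=> j _; exact: (lZ j).2.
rewrite sumr_const card_ord -[\int[_]_y _ *+ n]mulr_natl; have [->|n0] := posnP n.
  by rewrite mul0r mulr0; apply: Rint_ge0 => y; exact: expR_ge0.
by rewrite mulKf// pnatr_eq0 -lt0n.
Qed.

End sample_moments.

(** * The limit element *)

(** F is the difference of F + |F| and |F|, whose partial sums along boxes are nondecreasing and
    bounded. *)
Lemma box_abs_cvg {R : realType} {d : nat} (F : {ffun 'I_d -> nat} -> R) (C : R) :
  (forall m, \sum_(al <- @box d m) `|F al| <= C) ->
  exists l : R, (fun m => \sum_(al <- @box d m) F al) @ \oo --> l.
Proof.
move=> hC.
have key (G : {ffun 'I_d -> nat} -> R) B : (forall al, 0 <= G al) ->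
    (forall m, \sum_(al <- @box d m) G al <= B) ->
    cvgn (fun m => \sum_(al <- @box d m) G al).
  move=> G0 GB; apply: nondecreasing_is_cvgn.
    apply/nondecreasing_seqP => m; rewrite (box_sub G (leqnSn m)) lerDl.
    by apply: sumr_ge0.
  by exists B => _ [m _ <-].
have c1 := key (fun al => `|F al|) C (fun al => normr_ge0 _) hC.
have c2 : cvgn (fun m => \sum_(al <- @box d m) (F al + `|F al|)).
  apply: (key _ (C + C)) => [al|m].
    by have := ler_norm (- F al); rewrite normrN; lra.
  rewrite big_split /=; apply: lerD => //.
  by apply: le_trans (hC m); apply: ler_sum => al _; exact: ler_norm.
exists (limn (fun m => \sum_(al <- @box d m) (F al + `|F al|)) - limn (fun m => \sum_(al <- @box d m) `|F al|)).
apply: (cvgn_ext (v := fun m => \sum_(al <- @box d m) (F al + `|F al|) - \sum_(al <- @box d m) `|F al|)).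
  by move=> m; rewrite big_split /= addrK.
by apply: cvgB.
Qed.

Section limit_element.
Context {R : realType} {d : nat} {gamma : R}.
Hypothesis gamma1 : 1 < gamma.
Local Notation vec := (vec R d).
Local Notation J := {ffun 'I_d -> nat}.
Local Notation box := (@box d).
Local Notation L2 := (L2 d gamma).
Local Notation nu := (@wlebesgue R d gamma).
Variable O : 'M[R]_d.
Hypothesis OO : O *m O^T = 1%:M.
Variable rho : R.
Hypothesis rho1 : 1 < rho.
Hypothesis rhog : rho < gamma.

Let rho0 : 0 < rho. Proof. exact: lt_trans rho1. Qed.

Definition cvec (x : J -> R) m : Defs.vec R (size (@bx d m)) :=
  [tuple x (nth j0 (@bx d m) i) | i < size (@bx d m)].

Lemma psi_cvec x m t : psi O (cvec x m) t =
  \sum_(al <- box m) bco (deg al) * x al * mono (mxv O^T t) al.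
Proof.
rewrite /psi; under eq_bigr do rewrite tnth_mktuple.
rewrite (@sum_bx R d m (fun al => bco (deg al) * x al * mono (mxv O^T t) al))//.
have -> : deg (j0 : J) = 0%N by apply/eqP; rewrite deg0P.
by rewrite /bco eqxx !mul0r.
Qed.

Section series_element.
Variables (x : J -> R) (K : R).
Hypothesis K0 : 0 <= K.
Hypothesis xK : forall m, \sum_(al <- box m) x al ^+ 2 / rho ^+ deg al <= K ^+ 2.

Lemma series_pt_cvg t : exists l : R,
  (fun m => \sum_(al <- box m) bco (deg al) * x al * mono t al) @ \oo --> l.
Proof.
apply: (@box_abs_cvg _ _ _ (2 * K * env rho t)) => m.
have aB (k : nat) : `| `|bco (R := R) k| | <= 2 by rewrite normr_id bco_norm.
have h := weighted_CS (a := fun k => `|bco (R := R) k|) rho0 aB m xpredT (fun al => `|x al|) (fun al => `|mono t al|).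
rewrite (eq_bigr (fun al => `|bco (deg al)| * `|x al| * `|mono t al|)); last by move=> al _; rewrite !normrM.
apply: (le_trans (ler_norm _)); apply: (le_trans h); rewrite -mulrA ler_wpM2l//.
under eq_bigr do rewrite real_normK ?num_real//.
under [X in _ * X]eq_bigr do rewrite real_normK ?num_real//.
have s0 : 0 <= \sum_(al <- box m) x al ^+ 2 / rho ^+ deg al.
  by apply: sumr_ge0 => al _; rewrite divr_ge0 ?sqr_ge0// exprn_ge0// ltW.
rewrite sqrtrM// ler_pM ?sqrtr_ge0//.
  by rewrite -[leRHS]ger0_norm// -sqrtr_sqr; apply: ler_wsqrtr; exact: xK.
have -> : env rho t = Num.sqrt (expR (rho * vdot t t)).
  have -> : expR (rho * vdot t t) = env rho t ^+ 2 by rewrite /env expr2 -expRD; congr expR; field.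
  by rewrite sqrtr_sqr ger0_norm// env_ge0.
apply: ler_wsqrtr; apply: (@box_le_lim _ _ (fun al => rho ^+ deg al * mono t al ^+ 2) _ m xpredT).
  by move=> al; rewrite mulr_ge0 ?sqr_ge0// exprn_ge0// ltW.
by apply: cvgn_ext (@mono_cvg _ _ rho t t) => n; apply: eq_bigr => al _; rewrite expr2.
Qed.

Lemma series_element : exists (F : L2) (S : vec -> R),
  [/\ measurable_fun setT S, L2fun F = S %[ae nu] & forall t,
  (fun m => \sum_(al <- box m) bco (deg al) * x al * mono (mxv O^T t) al) @ \oo --> S t].
Proof.
have [S hS] := choice (fun t => series_pt_cvg (mxv O^T t)).
have mS : measurable_fun setT S.
  apply: (@measurable_fun_cvg _ (Defs.vec R d) R setT (fun m t => psi O (cvec x m) t) S).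
    by move=> m; exact: measurable_psi.
  by move=> t _; apply: cvgn_ext (hS t) => m; rewrite psi_cvec.
have [F hF] : exists F : L2, L2fun F = S %[ae nu].
  apply: (@L2_exists_env _ _ _ S (2 * K) rho) => // t.
  apply: (lim_norm_le (hS t)) => m; rewrite -(env_orth OO rho t).
  apply: (le_trans (series_bound rho0 (@bco_norm R) m xpredT x _)).
  rewrite ler_wpM2r ?env_ge0// ler_wpM2l//.
  by rewrite -[leRHS]ger0_norm// -sqrtr_sqr; apply: ler_wsqrtr; exact: xK.
by exists F, S.
Qed.

Lemma tail_small (e : R) : 0 < e -> exists m0, forall m, (m0 <= m)%N -> forall n,
  \sum_(al <- box (m + n) | al \notin box m) x al ^+ 2 / rho ^+ deg al <= e.
Proof.
move=> e0; pose F al := x al ^+ 2 / rho ^+ deg al.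
have F0 al : 0 <= F al by rewrite /F divr_ge0 ?sqr_ge0// exprn_ge0// ltW.
have [l hl] : exists l : R, (fun m => \sum_(al <- box m) F al) @ \oo --> l.
  apply: (@box_abs_cvg _ _ F (K ^+ 2)) => m; rewrite (eq_bigr F) ?xK// => al _.
  by rewrite ger0_norm.
have /cvgrPdist_le/(_ e e0)[m0 _ hm] := hl.
have le_l m : \sum_(al <- box m) F al <= l by exact: (@box_le_lim _ _ F l m xpredT).
exists m0 => m mm n; have := hm m mm; rewrite /= ger0_norm ?subr_ge0// => h.
have E := box_sub F (leq_addr n m); have := le_l (m + n)%N; rewrite E.
rewrite -/(F _); lra.
Qed.

End series_element.

Lemma Phi_series_dist x (F : L2) (S : vec -> R) m D : 0 <= D -> measurable_fun setT S ->
  L2fun F = S %[ae nu] -> (forall t, `|S t - psi O (cvec x m) t| <= 2 * D * env rho t) ->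
  L2dist F (Phi gamma1 OO (cvec x m)) <= 2 * D * env_norm rho (d := d) (gamma := gamma).
Proof.
move=> D0 mS FS h.
apply: (L2dist_env mS (measurable_psi O (cvec x m)) FS (PhiE _ _ _)) => //.
by rewrite mulr_ge0.
Qed.

Section random_series.
Context {dT : measure_display} {T : measurableType dT}.
Variables (P : probability T R) (xi : J -> T -> R).
Hypothesis mxi : forall al, measurable_fun setT (xi al).
Hypothesis xi2 : forall al, L1 P (fun w => xi al w ^+ 2) /\ \int[P]_w (xi al w ^+ 2) <= 1.

Definition bounded_coefs (w : T) := exists k : nat, forall m, xisum rho xi m xpredT w <= k%:R.

(** The bound k + 1 fails for some truncation with probability at most C / (k + 1), by
    [xisum_event]; the complement lies in all these events. *)
Lemma bounded_coefs_as : measurable [set w | bounded_coefs w] /\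
  P (~` [set w | bounded_coefs w]) = 0%E.
Proof.
have [C [C0 [wC _]]] := wsum_tail (d := d) rho1.
pose A k := \bigcup_m [set w | k.+1%:R < xisum rho xi m xpredT w].
have hA k := xisum_event rho1 xi2 (C := C) (a := k.+1%:R) wC (ltr0Sn _ k).
have E : ~` [set w | bounded_coefs w] = \bigcap_k A k.
  apply/seteqP; split => w /=.
    move=> nb k _; apply: contrapT => nA; apply: nb; exists k.+1 => m.
    by rewrite leNgt; apply/negP => h; apply: nA; exists m.
  move=> h [k hk]; have [m _ /=] := h k I.
  by apply/negP; rewrite -leNgt (le_trans (hk m))// ler_nat.
have mN : measurable (~` [set w | bounded_coefs w]).
  by rewrite E; apply: bigcapT_measurable => k; exact: (hA k).1.
split; first by rewrite -[X in measurable X]setCK; exact: measurableC.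
apply/eqP; rewrite eq_le measure_ge0 andbT.
apply/lee_addgt0Pr => e e0; rewrite add0e.
pose k := Num.truncn (C / e).
apply: (@le_trans _ _ (P (A k))).
  by apply: le_measure; rewrite ?inE//; [exact: (hA k).1|rewrite E; exact: bigcap_inf].
apply: (le_trans (hA k).2); rewrite lee_fin ler_pdivrMl//.
by rewrite -ler_pdivrMr// ltW// truncnS_gt.
Qed.

(* vanishing on a null set, so that the series converges everywhere *)
Definition xi0 (al : J) (w : T) : R := xi al w * \1_[set w | bounded_coefs w] w.

Lemma measurable_xi0 al : measurable_fun setT (xi0 al).
Proof.
apply: measurable_funM => //; apply: measurable_indic; exact: bounded_coefs_as.1.
Qed.

Lemma xi0_bounded w : exists K, 0 <= K /\ forall m, \sum_(al <- box m) xi0 al w ^+ 2 / rho ^+ deg al <= K ^+ 2.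
Proof.
rewrite /xi0 indicE; case: (boolP (w \in _)) => [|_]; last first.
  exists 0; split => // m; rewrite big1 ?expr0n// => al _; by rewrite mulr0 expr0n mul0r.
(* k <= (k + 1)^2 brings the bound into the form K^2. *)
rewrite inE /= => -[k hk]; exists k.+1%:R; split => // m.
under eq_bigr do rewrite mulr1; apply: (le_trans (hk m)).
by rewrite -natrX ler_nat -mulnn (leq_trans (leqnSn k))// leq_pmulr.
Qed.

Lemma xi0_ae : \forall w \ae P, forall al, xi0 al w = xi al w.
Proof.
exists (~` [set w | bounded_coefs w]); split.
- by apply: measurableC; exact: bounded_coefs_as.1.
- exact: bounded_coefs_as.2.
- move=> w /= h nb; apply: h => al; rewrite /xi0 indicE mem_set//= mulr1//.
Qed.

(** With the coefficients [xi0] the truncations converge in L^2 at every w, not just almost surely,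
    so W is a random element as a pointwise limit. *)
Lemma limit_element : exists (W : T -> L2) (S : T -> vec -> R),
  [/\ forall w, measurable_fun setT (S w), forall w, L2fun (W w) = S w %[ae nu],
    forall w t, (fun m => \sum_(al <- box m) bco (deg al) * xi0 al w * mono (mxv O^T t) al) @ \oo --> S w t,
    forall w (e : R), 0 < e -> exists N, forall m, (N <= m)%N ->
      L2dist (Phi gamma1 OO (cvec (xi0 ^~ w) m)) (W w) < e &
    random_element W].
Proof.
have /choice[FS hFS] w : exists FS : L2 * (vec -> R),
    [/\ measurable_fun setT FS.2, L2fun FS.1 = FS.2 %[ae nu] & forall t,
    (fun m => \sum_(al <- box m) bco (deg al) * xi0 al w * mono (mxv O^T t) al) @ \oo --> FS.2 t].
  have [K [K0 hK]] := xi0_bounded w.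
  by have [F [S [h1 h2 h3]]] := series_element K0 hK; exists (F, S).
have lim w (e : R) : 0 < e -> exists N, forall m, (N <= m)%N ->
    L2dist (Phi gamma1 OO (cvec (xi0 ^~ w) m)) (FS w).1 < e.
  move=> e0; have [K [K0 hK]] := xi0_bounded w; have [mS FSe hS] := hFS w.
  set N := env_norm (d := d) (gamma := gamma) rho.
  have N0 : 0 <= N by exact: env_norm_ge0.
  pose D := e / (4 * (N + 1)).
  have N1 : 0 < N + 1 by lra.
  have D0 : 0 < D by rewrite divr_gt0// mulr_gt0.
  have [m0 hm0] := tail_small hK (exprn_gt0 2 D0).
  exists m0 => m mm; rewrite L2distC.
  have h t : `|(FS w).2 t - psi O (cvec (xi0 ^~ w) m) t| <= 2 * D * env rho t.
    rewrite psi_cvec -(env_orth OO rho t).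
    exact: (series_tail_bound rho0 (@bco_norm R) (ltW D0) (hS t) (hm0 m mm)).
  apply: (le_lt_trans (Phi_series_dist (ltW D0) mS FSe h)); rewrite -/N.
  have DE : D * (4 * (N + 1)) = e by rewrite /D divfK// gt_eqF// mulr_gt0.
  nra.
exists (fun w => (FS w).1), (fun w => (FS w).2); split => //; try by move=> w; have [] := hFS w.
apply: (random_element_lim (V_ := fun m w => Phi gamma1 OO (cvec (xi0 ^~ w) m))) => // m.
apply: Phi_random; apply: measurable_vecP => i; under eq_fun do rewrite tnth_mktuple.
exact: measurable_xi0.
Qed.

End random_series.
End limit_element.

(** * Convergence for bounded Lipschitz functionals *)

Lemma measurable_Ustat {R : realType} {d : nat} n (x : nat -> Defs.vec R d) :
  measurable_fun setT (Ustat n x).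
Proof.
have md j : measurable_fun setT (fun t : Defs.vec R d => dotv (colvec t) (residual n x j)).
  rewrite /dotv; under eq_fun do rewrite mxE; apply: measurable_sum => i.
  by under eq_fun do rewrite !mxE; apply: measurable_funM => //; exact: measurable_tnthR.
apply: measurable_funM => //; apply: measurable_funB => //; apply: measurable_funM.
- by apply: measurable_funM => //; apply: measurable_sum => j; exact: (measurableT_comp (continuous_measurable_fun (@continuous_cos R)) (md j)).
- by apply: measurable_funM => //; apply: measurable_sum => j; exact: (measurableT_comp (@measurable_expR R) (md j)).
Qed.

Section projection_error.
Context {R : realType} {d : nat} {gamma : R}.
Hypothesis gamma1 : 1 < gamma.
Local Notation vec := (vec R d).
Local Notation J := {ffun 'I_d -> nat}.
Local Notation box := (@box d).
Local Notation L2 := (L2 d gamma).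
Local Notation nu := (@wlebesgue R d gamma).
Context {dT : measure_display} {T : measurableType dT}.
Variables (P : probability T R) (Z : nat -> {RV P >-> vec}).
Hypothesis Z_indep : mutually_independent Z.
Hypothesis Z_law : forall i B, measurable B -> P (Z i @^-1` B) = @gauss R d B.
Local Notation zs w := (fun j => Z j w).
Variables (A : 'M[R]_d) (mm : 'cV[R]_d).
Hypothesis uA : A \in unitmx.
Local Notation O := (inv_sqrtmx (A *m A^T) *m A).
Hypothesis OO : O *m O^T = 1%:M.
Variable U : nat -> T -> L2.
Hypothesis UE : forall n w, L2fun (U n w) = Ustat n (fun j => affine_map mm A (Z j w)) %[ae nu].
Hypothesis mU : forall n, random_element (U n).
Variables (h : L2 -> R) (M L : R).
Hypothesis hM : forall F, `|h F| <= M.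
Hypothesis L0 : 0 <= L.
Hypothesis hL : forall F G, `|h F - h G| <= L * L2dist F G.

Lemma projection_error (e : R) : 0 < e -> exists m1, forall m, (m1 <= m)%N -> exists N, forall n, (N < n)%N ->
  `|\int[P]_w h (U n w) - \int[P]_w h (Phi gamma1 OO (cvec (coef n (zs w)) m))| <= e.
Proof.
(* [statistic_approx] needs the envelope exponent 1 + 5 ep below gamma. *)
move=> e0; pose ep := Num.min 1 ((gamma - 1) / 10).
have ep0 : 0 < ep by rewrite lt_min ltr01 divr_gt0// subr_gt0.
have ep1 : ep <= 1 by rewrite ge_min lexx.
have epg : 1 + 5 * ep < gamma.
  have : ep <= (gamma - 1) / 10 by rewrite ge_min lexx orbT.
  lra.
pose rho := 1 + ep; have rho1 : 1 < rho by rewrite ltrDl.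
have rho0 : 0 < rho by exact: lt_trans rho1.
have M0 : 0 <= M by exact: le_trans (normr_ge0 _) (hM (Phi gamma1 OO (cvec (fun=> 0) 0))).
(* Probability allowed to each of the three bad events; off the good event the integrands differ by
   at most 2 M, which costs 2 M (3 p) <= e / 2. *)
pose p := e / (12 * (M + 1)).
have p0 : 0 < p by rewrite divr_gt0// mulr_gt0// ltr_wpDl.
have pE : p * (12 * (M + 1)) = e by rewrite divfK// gt_eqF// mulr_gt0// ltr_wpDl.
have [C [C0 [wC tC]]] := wsum_tail (d := d) rho1.
have [C' hC'] := avg_moment Z_law rho1.
(* K p exceeds C and C', and K >= 1, so Markov's inequality at the levels K^2 and K gives
   probability at most p. *)
pose K := 1 + (C + `|C'|) / p.
have C'0 : 0 <= `|C'| by exact: normr_ge0.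
have Kp : K * p = p + C + `|C'| by rewrite /K mulrDl mul1r divfK ?gt_eqF// addrA.
have K1 : 1 <= K by rewrite lerDl divr_ge0 ?addr_ge0// ltW.
have K0 : 0 < K by exact: lt_le_trans K1.
set N := env_norm (d := d) (gamma := gamma) (1 + 5 * ep).
have N0 : 0 <= N by exact: env_norm_ge0.
have LN0 : 0 <= L * N by exact: mulr_ge0.
(* On the good event the L^2 distance is at most 4 D N, and L (4 D N) <= e / 2. *)
pose D := e / (8 * (L * N + 1)).
have D0 : 0 < D by rewrite divr_gt0// mulr_gt0// ltr_wpDl.
have DE : D * (8 * (L * N + 1)) = e by rewrite divfK// gt_eqF// mulr_gt0// ltr_wpDl.
have D2p : 0 < D ^+ 2 * p by rewrite mulr_gt0// exprn_gt0.
have [m1 hm1] := tC _ D2p; exists m1 => m mm1.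
have D20 : 0 < 2 * D by rewrite mulr_gt0.
have [n0 hn0] := statistic_approx mm uA ep0 ep1 (ltW K0) D20.
exists n0 => n nn; have n_gt0 : (0 < n)%N by exact: leq_ltn_trans nn.
pose xi al w := coef n (zs w) al.
have xi2 al : L1 P (fun w => xi al w ^+ 2) /\ \int[P]_w (xi al w ^+ 2) <= 1 by exact: coef_moment.
have [mA PA] := xisum_event rho1 xi2 wC (exprn_gt0 2 K0).
have [mC PC] := xisum_tail_event rho1 xi2 (exprn_gt0 2 D0) (hm1 m mm1).
have [lavg iavg] := hC' n.
pose f w := avg n (zs w) (fun y => expR (vdot y y / (2 * rho))).
have f0 w : 0 <= f w by rewrite /f /avg mulr_ge0// sumr_ge0// => j _; exact: expR_ge0.
have PB := markov_R lavg f0 K0.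
have mB : measurable [set w | K < f w].
  rewrite (_ : [set w | _] = f @^-1` `]K, +oo[).
    by rewrite -[X in measurable X]setTI; exact: (L1_meas lavg).
  by apply/seteqP; split => w /=; rewrite in_itv /= andbT.
have leA : (P (\bigcup_m [set w | (K ^+ 2 < xisum rho xi m xpredT w)%R]) <= p%:E)%E.
  apply: (le_trans PA); rewrite lee_fin ler_pdivrMl ?exprn_gt0//.
  nra.
have leB : (P [set w | (K < f w)%R] <= p%:E)%E.
  apply: (le_trans PB); rewrite lee_fin ler_pdivrMl//.
  have := ler_norm C'; lra.
have mNA := measurableC mA; have mNB := measurableC mB; have mNC := measurableC mC.
have PG := prob_setC3 mA mB mC leA leB PC.
have ch : continuous h by exact: (L2_lip_continuous hL).
have l1 : L1 P (fun w => h (U n w)).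
  by apply: (@bound_L1 _ _ _ P _ M) => //; exact: (measurable_comp_random (mU n) ch).
have l2 : L1 P (fun w => h (Phi gamma1 OO (cvec (coef n (zs w)) m))).
  apply: (@bound_L1 _ _ _ P _ M) => //.
  apply: (measurable_comp_random (V := fun w => Phi gamma1 OO (cvec (coef n (zs w)) m)) _ ch).
  apply: Phi_random; apply: measurable_vecP => i; under eq_fun do rewrite tnth_mktuple.
  exact: measurable_coef.
apply: (@le_trans _ _ (e / 2 + (2 * M) * (3 * p))); last nra.
apply: (Rint_event_close l1 l2 _ _ _ _ _ PG).
- by apply: measurableI => //; apply: measurableI.
- by rewrite divr_ge0// ltW.
- by rewrite mulr_ge0.
- move=> w /= [[nA nB] nC].
  have cle : coef_le n (zs w) rho K.
    by move=> k; rewrite leNgt; apply/negP => hk; apply: nA; exists k.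
  have ale : avg n (zs w) (fun y => expR (vdot y y / (2 * rho))) <= K.
    by rewrite leNgt; apply/negP => hk; apply: nB.
  have tle k : \sum_(al <- box (m + k) | al \notin box m) xi al w ^+ 2 / rho ^+ deg al <= D ^+ 2.
    by rewrite leNgt; apply/negP => hk; apply: nC; exists k.
  apply: (le_trans (hL _ _)).
  (* 2 D comes from [statistic_approx] and 2 D from the tail of the series, [bco] being at most
     2. *)
  have h1 t : `|Ustat n (fun j => affine_map mm A (Z j w)) t - psi O (cvec (coef n (zs w)) m) t| <=
      (4 * D) * env (1 + 5 * ep) t.
    have b1 := hn0 n (zs w) nn cle ale t.
    have b2 := series_tail_bound rho0 (@bco_norm R) (ltW D0) (@Vstat_cvg _ _ n (zs w) (mxv O^T t)) tle.
    rewrite (env_orth OO) in b2; rewrite psi_cvec.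
    have b3 : env rho t <= env (1 + 5 * ep) t by apply: env_le; rewrite /rho; lra.
    have := ler_normD (Ustat n (fun j => affine_map mm A (Z j w)) t - Vstat n (zs w) (mxv O^T t))
       (Vstat n (zs w) (mxv O^T t) - \sum_(al <- box m) bco (deg al) * xi al w * mono (mxv O^T t) al).
    rewrite addrA subrK => b4; apply: (le_trans b4).
    have b5 : 2 * D * env rho t <= 2 * D * env (1 + 5 * ep) t by apply: ler_wpM2l => //; exact: ltW.
    by rewrite /xi in b2 *; lra.
  have D40 : 0 <= 4 * D by rewrite mulr_ge0// ltW.
  have := L2dist_env (measurable_Ustat n _) (measurable_psi O _) (UE n w) (PhiE gamma1 OO _) D40 epg h1.
  rewrite -/N => h2.
  have : L * L2dist (U n w) (Phi gamma1 OO (cvec (coef n (zs w)) m)) <= L * (4 * D * N) by exact: ler_wpM2l.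
  nra.
- move=> w; apply: (le_trans (ler_normB _ _)); have := hM (U n w).
  have := hM (Phi gamma1 OO (cvec (coef n (zs w)) m)); lra.
Qed.

End projection_error.

Lemma Rint_indic {R : realType} (d : measure_display) (T : measurableType d)
  (mu : {measure set T -> \bar R}) A : measurable A -> \int[mu]_x \1_A x = fine (mu A).
Proof. by move=> mA; rewrite /Rintegral integral_indic// setIT. Qed.

Lemma L1_indic {R : realType} (d : measure_display) (T : measurableType d)
  (mu : {measure set T -> \bar R}) A : measurable A -> (mu setT < +oo)%E -> L1 mu (\1_A : T -> R).
Proof.
move=> mA mT; apply: (L1_bounded (M := 1) mT); first exact: measurable_indic.
by move=> w; rewrite indicE; case: (w \in A); rewrite ?normr1 ?normr0.
Qed.

Lemma gauss_coord_law {R : realType} k (i : 'I_k) (A : set (measurableTypeR R)) : measurable A ->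
  @gauss R k [set t | A (tnth t i)] = N01 A.
Proof.
move=> mA; have mB : measurable [set t : Defs.vec R k | A (tnth t i)].
  have := @measurable_tnth _ (measurableTypeR R) k i measurableT A mA.
  by rewrite setTI.
have f1 : @gauss R k [set t | A (tnth t i)] \is a fin_num.
  rewrite ge0_fin_numE//; apply: (@le_lt_trans _ _ (@gauss R k setT)); last exact: gauss_lty; apply: le_measure; rewrite ?inE//.
have f2 : @N01 R A \is a fin_num by exact: fin_num_measure.
rewrite -(fineK f1) -(fineK f2); congr EFin; rewrite -!Rint_indic//.
have Nlt : (@N01 R setT < +oo)%E by rewrite N01T ltry.
have l1 : L1 (@N01 R) (fun=> 1 : R) by exact: L1_cst.
have lA : L1 (@N01 R) (\1_A : _ -> R) by exact: L1_indic.
pose f (a : 'I_k) (x : measurableTypeR R) : R := if a == i then \1_A x else 1.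
have lf a : L1 (@N01 R) (f a) by rewrite /f; case: eqP.
have [_ e] := @L1_power_prod _ _ _ (@N01 R) k f (@N01T R) lf.
rewrite (bigD1 i)//= [X in _ * X]big1 ?mulr1 in e; last first.
  by move=> a /negbTE ai; rewrite /f ai; apply: Rint_cst1; exact: N01T.
rewrite {2}/f eqxx in e; rewrite -e; apply: eq_Rintegral => t _.
rewrite (bigD1 i)//= big1 ?mulr1 /f ?eqxx//.
by move=> a /negbTE ->.
Qed.

(** * Combining truncation and central limit theorem *)

Section weak_limit.
Context {R : realType} {d : nat} {gamma : R}.
Hypothesis d0 : (0 < d)%N.
Hypothesis gamma1 : 1 < gamma.
Local Notation vec := (vec R d).
Local Notation J := {ffun 'I_d -> nat}.
Local Notation box := (@box d).
Local Notation L2 := (L2 d gamma).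
Local Notation nu := (@wlebesgue R d gamma).
Context {dT : measure_display} {T : measurableType dT}.
Variables (P : probability T R) (Z : nat -> {RV P >-> vec}).
Hypothesis Z_indep : mutually_independent Z.
Hypothesis Z_law : forall i B, measurable B -> P (Z i @^-1` B) = @gauss R d B.
Local Notation zs w := (fun j => Z j w).

(* first coordinates of the sample: the limit then lives on the same probability space *)
Lemma normal_family : exists Y : nat -> {RV P >-> measurableTypeR R},
  mutually_independent Y /\ forall i A, measurable A -> P (Y i @^-1` A) = N01 A.
Proof.
pose i0 := Ordinal d0; pose g (z : vec) : measurableTypeR R := tnth z i0.
have mg : measurable_fun setT g by exact: measurable_tnth.
have /choice[Y hY] j : exists V : {RV P >-> measurableTypeR R}, (V : T -> _) = g \o Z j.
  by apply: RV_ex; exact: (measurableT_comp mg (measurable_RV Z j)).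
exists Y; split; first by apply: (indep_comp mg (X := Z)) => // i w; rewrite hY.
move=> i A mA; rewrite hY -(gauss_coord_law i0 mA) -(Z_law i)//.
by rewrite -[X in measurable X]setTI; exact: mg.
Qed.

Variable Y : nat -> {RV P >-> measurableTypeR R}.
Hypothesis Y_indep : mutually_independent Y.
Hypothesis Y_law : forall i A, measurable A -> P (Y i @^-1` A) = N01 A.

(** [pickle] is injective, so distinct multi-indices receive independent variables. *)
Definition xiY (al : J) (w : T) : R := Y (pickle al) w.

Lemma measurable_xiY al : measurable_fun setT (xiY al).
Proof. exact: (measurable_RV Y (pickle al)). Qed.

Lemma xiY2 al : L1 P (fun w => xiY al w ^+ 2) /\ \int[P]_w (xiY al w ^+ 2) <= 1.
Proof.
have [l e] := RV_L1 Y_law (pickle al) (f := fun x => x ^+ 2) (L1_N01_monom 2).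
by split => //; rewrite /xiY e N01_var.
Qed.

Lemma cvec_xiY_law m (F : Defs.vec R (size (@bx d m)) -> R) : L1 (gauss _) F ->
  L1 P (fun w => F (cvec (xiY ^~ w) m)) /\
  \int[P]_w F (cvec (xiY ^~ w) m) = \int[gauss _]_x F x.
Proof.
move=> lF; have si : {in gtn (size (@bx d m)) &, injective (fun i => pickle (nth j0 (@bx d m) i))}.
  move=> i j; rewrite !inE => im jm /(pcan_inj pickleK)/eqP.
  by rewrite nth_uniq// ?filter_uniq ?box_uniq// => /eqP.
have [l e] := tup_L1 Y_indep Y_law si lF.
by split; [exact: l|rewrite -e].
Qed.

Variable O : 'M[R]_d.
Hypothesis OO : O *m O^T = 1%:M.
Variable rho : R.
Hypothesis rho1 : 1 < rho.
Hypothesis rhog : rho < gamma.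
Local Notation xi0 := (xi0 rho xiY).
Variables (h : L2 -> R) (M L : R).
Hypothesis hM : forall F, `|h F| <= M.
Hypothesis L0 : 0 <= L.
Hypothesis hL : forall F G, `|h F - h G| <= L * L2dist F G.

Let ch : continuous h. Proof. exact: (L2_lip_continuous hL). Qed.

Let L1_hPhi m (dT' : measure_display) (T' : measurableType dT') (Q : {measure set T' -> \bar R})
    (phi : T' -> Defs.vec R (size (@bx d m))) :
  (Q setT < +oo)%E -> measurable_fun setT phi -> L1 Q (fun x => h (Phi gamma1 OO (phi x))).
Proof.
move=> Q1 mp; apply: (L1_bounded (M := M) Q1) => //.
by apply: (measurable_comp_random (V := fun x => Phi gamma1 OO (phi x))) => //; exact: Phi_random.
Qed.

Lemma data_clt m : (fun n => \int[P]_w h (Phi gamma1 OO (cvec (coef n (zs w)) m))) @ \oo -->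
  \int[gauss _]_x h (@Phi _ _ _ gamma1 _ OO m x).
Proof.
apply: cvgn_ext (@clt_Phi R d gamma gamma1 O OO m h M L hM L0 hL) => n.
set psm := psum _ _.
have mY : measurable_fun setT (fun z : vec => [tuple heta z (nth j0 (@bx d m) i) | i < size (@bx d m)]).
  by apply: measurable_vecP => i; under eq_fun do rewrite tnth_mktuple; exact: measurable_heta.
have mp : measurable_fun setT (psm n) by exact: measurable_psum.
have lF : L1 (power_measure (@gauss R d) n) (fun t => h (Phi gamma1 OO (psm n t))).
  have Plt : (power_measure (@gauss R d) n setT < +oo)%E by rewrite (power_measureT _ (@gaussT R d)) ltry.
  exact: (L1_hPhi (phi := psm n) Plt mp).
have si : {in gtn n &, injective (id : nat -> nat)} by move=> i j _ _.
rewrite (tup_L1 Z_indep Z_law si lF).2; apply: eq_Rintegral => w _.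
congr (h (Phi _ _ _)); apply: eq_from_tnth => a; rewrite !tnth_mktuple /coef.
have := mem_nth j0 (ltn_ord a); rewrite mem_filter => /andP[/negbTE -> _].
by congr (_ * _); apply: eq_bigr => j _; rewrite !tnth_mktuple.
Qed.

(** The coefficients [xi0] provide the convergence, [xiY] the exact law of each truncation; they
    agree almost surely. *)
Lemma series_limit (W : T -> L2) : random_element W ->
  (forall w (e : R), 0 < e -> exists N, forall m, (N <= m)%N ->
      L2dist (Phi gamma1 OO (cvec (xi0 ^~ w) m)) (W w) < e) ->
  (fun m => \int[gauss _]_x h (@Phi _ _ _ gamma1 _ OO m x)) @ \oo --> \int[P]_w h (W w).
Proof.
move=> rW lW; have mc m (x : J -> T -> R) : (forall al, measurable_fun setT (x al)) ->
    measurable_fun setT (fun w => cvec (x ^~ w) m).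
  by move=> mx; apply: measurable_vecP => i; under eq_fun do rewrite tnth_mktuple; exact: mx.
have m0 := measurable_xi0 rho1 measurable_xiY xiY2.
have cvp w : (fun m => h (Phi gamma1 OO (cvec (xi0 ^~ w) m))) @ \oo --> h (W w).
  apply/cvgrPdist_le => e e0; have L1 : 0 < L + 1 by rewrite ltr_wpDl.
  have [N hN] := lW w _ (divr_gt0 e0 L1); exists N => // m /= /hN hm.
  apply: (le_trans (hL _ _)); rewrite L2distC; apply: (@le_trans _ _ ((L + 1) * (e / (L + 1)))).
    by apply: ler_pM => //; [exact: L2dist_ge0|rewrite lerDl|exact: ltW].
  by rewrite mulrC divfK// gt_eqF.
have lM : L1 P (fun=> M) by apply: L1_cst; exact: prob_lty.
have [_ cv] := @DCT _ _ _ P (fun m w => h (Phi gamma1 OO (cvec (xi0 ^~ w) m))) (fun w => h (W w)) (fun=> M)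
  (fun m => L1_meas (L1_hPhi (prob_lty P) (mc m xi0 m0))) (measurable_comp_random rW ch) cvp lM (fun m w => hM _).
apply: cvgn_ext cv => m; rewrite -(cvec_xiY_law _).2; last first.
  have lF := @L1_hPhi m _ _ (@gauss R (size (@bx d m))) id (@gauss_lty R (size (@bx d m))) (@measurable_id _ _ setT). exact lF.
apply: Rint_ae.
- have lF := @L1_hPhi m _ _ P _ (prob_lty P) (mc m _ measurable_xiY). exact (L1_meas lF).
- have lF := @L1_hPhi m _ _ P _ (prob_lty P) (mc m _ m0). exact (L1_meas lF).
apply: filterS (xi0_ae rho1 xiY2) => w hw _; congr (h (Phi _ _ _)).
by apply: eq_from_tnth => i; rewrite !tnth_mktuple hw.
Qed.

Variables (A : 'M[R]_d) (mm : 'cV[R]_d).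
Hypothesis uA : A \in unitmx.
Hypothesis OE : O = inv_sqrtmx (A *m A^T) *m A.
Variable U : nat -> T -> L2.
Hypothesis UE : forall n w, L2fun (U n w) = Ustat n (fun j => affine_map mm A (Z j w)) %[ae nu].
Hypothesis mU : forall n, random_element (U n).

(** Three comparisons within e / 3: U_n with its truncation, the truncation with its normal limit,
    and this limit with W. The first and the last fix m, after which n is taken large. *)
Lemma weak_limit (W : T -> L2) : random_element W ->
  (forall w (e : R), 0 < e -> exists N, forall m, (N <= m)%N ->
      L2dist (Phi gamma1 OO (cvec (xi0 ^~ w) m)) (W w) < e) ->
  (fun n => \int[P]_w h (U n w)) @ \oo --> \int[P]_w h (W w).
Proof.
move=> rW lW; have cs := series_limit rW lW.
apply/cvgrPdist_le => e e0; have e3 : 0 < e / 3 by rewrite divr_gt0.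
have [m1 hm1] : exists m1, forall m, (m1 <= m)%N -> exists N, forall n, (N < n)%N ->
  `|\int[P]_w h (U n w) - \int[P]_w h (Phi gamma1 OO (cvec (coef n (zs w)) m))| <= e / 3.
  (* [Phi] takes the orthogonality proof as an argument, so it is generalized before O is
     replaced. *)
  move: OO; rewrite OE => OO'.
  exact: (projection_error gamma1 Z_indep Z_law uA OO' UE mU hM L0 hL e3).
have /cvgrPdist_le/(_ _ e3)[m2 _ hm2] := cs.
pose m := maxn m1 m2.
have [N hN] := hm1 m (leq_maxl _ _).
have /cvgrPdist_le/(_ _ e3)[N2 _ hN2] := @data_clt m.
exists (maxn N.+1 N2) => // n; rewrite /= geq_max => /andP[nN nN2].
have b1 := hN n nN; have b2 := hm2 m (leq_maxr _ _); have b3 := hN2 n nN2.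
rewrite /= in b2 b3; move: b1 b2 b3; rewrite !ler_norml => /andP[? ?] /andP[? ?] /andP[? ?].
apply/andP; split; lra.
Qed.

End weak_limit.

(** * Measurability of the statistic *)

Section residual_perturbation.
Context {R : realType} {d : nat}.
Local Notation vec := (Defs.vec R d).

Lemma norm_cosB (a b : R) : `|cos a - cos b| <= `|a - b|.
Proof.
have -> : a = (a + b) / 2 + (a - b) / 2 by field.
have -> : cos b = cos ((a + b) / 2 - (a - b) / 2) by congr cos; field.
set p := (a + b) / 2; set q := (a - b) / 2; rewrite cosB cosD.
have -> : cos p * cos q - sin p * sin q - (cos p * cos q + sin p * sin q) = - (2 * (sin p * sin q)) by ring.
have -> : p + q - b = 2 * q by rewrite /p /q; field.
rewrite normrN [leLHS]normrM [leRHS]normrM ler_wpM2l// normrM -[leRHS]mul1r ler_pM ?norm_sin_le//.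
exact: sin_max.
Qed.

Lemma dotv_onorm (t : vec) (v : 'cV[R]_d) : `|dotv (colvec t) v| <= mxN v * onorm t.
Proof.
rewrite dotvE (le_trans (ler_norm_sum _ _ _))// /onorm mulr_sumr; apply: ler_sum => i _.
by rewrite mxE normrM mulrC ler_wpM2r// mxN_entry.
Qed.

Lemma mean_close n (f g : nat -> R) c : 0 <= c -> (forall j, (j < n)%N -> `|f j - g j| <= c) ->
  `|n%:R^-1 * \sum_(j < n) f j - n%:R^-1 * \sum_(j < n) g j| <= c.
Proof.
move=> c0 h; rewrite -mulrBr -sumrB normrM ger0_norm ?invr_ge0//.
have [->|n0] := posnP n; first by rewrite invr0 mul0r.
rewrite ler_pdivrMl ?ltr0n// (le_trans (ler_norm_sum _ _ _))//.
apply: (@le_trans _ _ (\sum_(j < n) c)); first by apply: ler_sum => j _; exact: h.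
by rewrite sumr_const card_ord mulr_natl.
Qed.

Lemma mean_bound n (f : nat -> R) c : 0 <= c -> (forall j, (j < n)%N -> `|f j| <= c) ->
  `|n%:R^-1 * \sum_(j < n) f j| <= c.
Proof.
move=> c0 h; have := mean_close (n := n) (f := f) (g := fun=> 0) c0.
by rewrite [X in _ - _ * X]big1 // mulr0 subr0; apply=> j jn; rewrite subr0 h.
Qed.

Variables (n : nat) (K : R).
Hypothesis K0 : 0 <= K.

(** In the exponent, K |t|_1 bounds exp(t.residual). The additional 2 |t|_1 covers exp(t.residual)
    changing by a factor with |exp(b - a) - 1| <= eta w exp(w), where w = |t|_1 is itself at most
    exp(w). *)
Lemma Ustat_perturb (x y : nat -> vec) (eta : R) t : 0 <= eta <= 1 ->
  (forall j, (j < n)%N -> mxN (residual n x j) <= K) ->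
  (forall j, (j < n)%N -> mxN (residual n y j - residual n x j) <= eta) ->
  `|Ustat n x t - Ustat n y t| <= Num.sqrt n%:R * (2 * eta * expR ((K + 2) * onorm t)).
Proof.
move=> /andP[e0 e1] hK hd; set w := onorm t; have w0 : 0 <= w by exact: onorm_ge0.
pose a j := dotv (colvec t) (residual n x j); pose b j := dotv (colvec t) (residual n y j).
have ha j : (j < n)%N -> `|a j| <= K * w.
  by move=> jn; rewrite (le_trans (dotv_onorm _ _))// ler_wpM2r// hK.
have hb j : (j < n)%N -> `|b j - a j| <= eta * w.
  move=> jn; have -> : b j - a j = dotv (colvec t) (residual n y j - residual n x j).
    by rewrite -[- residual n x j]scaleN1r dotvDr dotvZr mulN1r.
  by rewrite (le_trans (dotv_onorm _ _))// ler_wpM2r// hd.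
have w1 : w <= expR w by apply: le_trans (expR_ge1Dx w); rewrite lerDr.
have ew : eta * w <= w by rewrite ler_piMl.
have hE j : (j < n)%N -> `|expR (a j) - expR (b j)| <= eta * expR ((K + 2) * w).
  move=> jn; have -> : expR (a j) - expR (b j) = - (expR (a j) * (expR (b j - a j) - 1)).
    by rewrite mulrBr -expRD mulr1 opprB [a j + _]addrC subrK.
  rewrite normrN normrM ger0_norm ?expR_ge0//.
  have h1 : expR (a j) <= expR (K * w) by rewrite ler_expR (le_trans (ler_norm _))// ha.
  have h2 : `|expR (b j - a j) - 1| <= eta * (expR w * expR w).
    apply: (le_trans (expR_sub1_le _)); rewrite mulrA; apply: ler_pM; rewrite ?expR_ge0//.
      by apply: (le_trans (hb j jn)); exact: ler_wpM2l.
    by rewrite ler_expR (le_trans (hb j jn)).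
  have -> : eta * expR ((K + 2) * w) = expR (K * w) * (eta * (expR w * expR w)).
    by rewrite -expRD mulrCA -expRD; congr (_ * expR _); ring.
  by apply: ler_pM; rewrite ?expR_ge0.
have E1 : 1 <= expR ((K + 2) * w) by rewrite expR_ge1// mulr_ge0// addr_ge0.
have hR : `|Rstat n x t - Rstat n y t| <= eta * w.
  apply: (mean_close (f := fun j => cos (a j)) (g := fun j => cos (b j))); first by rewrite mulr_ge0.
  by move=> j jn; rewrite (le_trans (norm_cosB _ _))// distrC hb.
have hM : `|Mstat n x t - Mstat n y t| <= eta * expR ((K + 2) * w).
  by apply: (mean_close (f := fun j => expR (a j)) (g := fun j => expR (b j))) => //; rewrite mulr_ge0 ?expR_ge0.
have hMx : `|Mstat n x t| <= expR (K * w).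
  apply: (mean_bound (f := fun j => expR (a j))) => [|j jn]; first exact: expR_ge0.
  by rewrite ger0_norm ?expR_ge0// ler_expR (le_trans (ler_norm _))// ha.
have hRy : `|Rstat n y t| <= 1.
  by apply: (mean_bound (f := fun j => cos (b j))) => // j jn; rewrite cos_max.
rewrite /Ustat -mulrBr normrM ger0_norm ?sqrtr_ge0// ler_wpM2l ?sqrtr_ge0//.
set rx := Rstat n x t in hR *; set ry := Rstat n y t in hR hRy *.
set mx := Mstat n x t in hM hMx *; set my := Mstat n y t in hM *.
have -> : rx * mx - 1 - (ry * my - 1) = (rx - ry) * mx + ry * (mx - my) by ring.
apply: (le_trans (ler_normD _ _)); rewrite (normrM (rx - ry)) (normrM ry).
rewrite [leRHS](_ : _ = eta * expR ((K + 2) * w) + eta * expR ((K + 2) * w)); last by ring.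
apply: lerD; last by rewrite -[leRHS]mul1r; apply: ler_pM.
apply: (@le_trans _ _ (eta * w * expR (K * w))); first exact: ler_pM.
rewrite -mulrA; apply: ler_wpM2l => //.
have -> : expR ((K + 2) * w) = expR (2 * w) * expR (K * w) by rewrite -expRD; congr expR; ring.
rewrite ler_wpM2r ?expR_ge0// (le_trans w1)// ler_expR; lra.
Qed.

End residual_perturbation.

(* tuples carry no topology in the library *)
Definition near_vec {R : realType} k (x : Defs.vec R k) : set_system (Defs.vec R k) :=
  filter_from [set a : R | 0 < a] (fun a => [set y | forall i, `|tnth y i - tnth x i| < a]).

Instance near_vec_filter {R : realType} k (x : Defs.vec R k) : Filter (near_vec x).
Proof.
apply: filter_from_filter; first by exists 1; exact: ltr01.
move=> a b /= a0 b0; exists (Num.min a b); first by rewrite /= lt_min a0.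
by move=> y /= h; split => i; have := h i; rewrite lt_min => /andP[].
Qed.

(** * Continuity in the sample *)

Section continuity.
Context {R : realType} {k : nat}.
Variable x : Defs.vec R k.
Local Notation F := (near_vec x).

Lemma cvg_sumR {T : Type} {G : set_system T} {FG : Filter G} (I : Type) (r : seq I) (f : I -> T -> R) (l : I -> R) :
  (forall i, f i @ G --> l i) -> (fun y => \sum_(i <- r) f i y) @ G --> \sum_(i <- r) l i.
Proof.
move=> h; elim: r => [|i r IH].
  rewrite big_nil (_ : (fun _ => _) = fun=> 0); first exact: cvg_cst.
  by apply/funext => y; rewrite big_nil.
rewrite big_cons (_ : (fun _ => _) = fun y => f i y + \sum_(j <- r) f j y); first exact: cvgD.
by apply/funext => y; rewrite big_cons.
Qed.

Definition mxcvg p q (f : Defs.vec R k -> 'M[R]_(p, q)) := forall i j, (fun y => f y i j) @ F --> f x i j.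

Lemma mxcvgM p q r f g : @mxcvg p q f -> @mxcvg q r g -> mxcvg (fun y => f y *m g y).
Proof.
move=> hf hg i j; rewrite mxE (_ : (fun _ => _) = fun y => \sum_l f y i l * g y l j).
  by apply: cvg_sumR => l; apply: cvgM; [exact: hf|exact: hg].
by apply/funext => y; rewrite mxE.
Qed.

Lemma mxcvgB p q f g : @mxcvg p q f -> @mxcvg p q g -> mxcvg (fun y => f y - g y).
Proof.
move=> hf hg i j; rewrite !mxE (_ : (fun _ => _) = fun y => f y i j - g y i j).
  by apply: cvgB; [exact: hf|exact: hg].
by apply/funext => y; rewrite !mxE.
Qed.

Lemma mxcvg_tr p q f : @mxcvg p q f -> mxcvg (fun y => (f y)^T).
Proof.
move=> hf i j; rewrite mxE (_ : (fun _ => _) = fun y => f y j i); first exact: hf.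
by apply/funext => y; rewrite mxE.
Qed.

Lemma mxcvg_mean p q n (f : nat -> Defs.vec R k -> 'M[R]_(p, q)) : (forall j, mxcvg (f j)) ->
  mxcvg (fun y => n%:R^-1 *: \sum_(j < n) f j y).
Proof.
move=> hf i j; rewrite mxE summxE (_ : (fun _ => _) = fun y => n%:R^-1 * \sum_(l < n) f l y i j).
  by apply: cvgM; [exact: cvg_cst|apply: cvg_sumR => l; exact: hf].
by apply/funext => y; rewrite mxE summxE.
Qed.

Lemma mxcvg_mxN p q f : @mxcvg p q f -> (fun y => mxN (f y - f x)) @ F --> 0.
Proof.
move=> hf; rewrite (_ : 0 = \sum_(i < p) \sum_(j < q) (0 : R)); last first.
  by rewrite big1// => i _; rewrite big1.
apply: cvg_sumR => i; apply: cvg_sumR => j.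
rewrite (_ : (fun _ => _) = fun y => `|f y i j - f x i j|); last by apply/funext => y; rewrite !mxE.
rewrite -[X in _ --> X](normr0 R) -(subrr (f x i j)).
by apply: cvg_norm; apply: cvgB; [exact: hf|exact: cvg_cst].
Qed.

Lemma cvg_nth j : (fun y : Defs.vec R k => nth 0 y j) @ F --> nth 0 x j.
Proof.
have [jk|jk] := ltnP j k; last first.
  rewrite nth_default ?size_tuple// (_ : (fun _ => _) = fun=> 0); first exact: cvg_cst.
  by apply/funext => y; rewrite nth_default// size_tuple.
apply/cvgrPdist_lt => e e0; exists e => // y /= /(_ (Ordinal jk)).
by rewrite !(tnth_nth 0) /= distrC.
Qed.

End continuity.

Section sample_continuity.
Context {R : realType} {d : nat}.
Local Notation vec := (Defs.vec R d).

Lemma sample_cov_psd n (x : nat -> vec) v : 0 <= dotv v (sample_cov n x *m v).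
Proof.
rewrite /sample_cov -scalemxAl dotvZr mulr_ge0 ?invr_ge0// mulmx_suml.
rewrite /dotv mulmx_sumr summxE; apply: sumr_ge0 => j _.
set c := _ - _; rewrite -mulmxA mulmxA mxE big_ord1.
have -> : (v^T *m c) 0 ord0 = (c^T *m v) ord0 0 := dotvC v c.
by rewrite -expr2 sqr_ge0.
Qed.

(** A vector v with v.Sv = 0 satisfies Sv = 0, by Cauchy-Schwarz for the form of S between Sv and v.
    So the sample covariance is singular or positive definite, with nothing in between. *)
Lemma sample_cov_posdef n (x : nat -> vec) : sample_cov n x \in unitmx -> posdefmx (sample_cov n x).
Proof.
move=> uS v v0; rewrite lt_neqAle sample_cov_psd andbT eq_sym; apply: contra v0 => /eqP h.
have := form_CS (sample_cov n x *m v) v (sample_cov_sym n x) (@sample_cov_psd n x).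
rewrite h mulr0 => h2.
have : dotv (sample_cov n x *m v) (sample_cov n x *m v) == 0 by rewrite -sqrf_eq0 eq_le h2 sqr_ge0.
move=> /eqP h3; have [/eqP e|/dotv_gt0] := eqVneq (sample_cov n x *m v) 0; last by rewrite h3 ltxx.
by rewrite -[v]mul1mx -(mulVmx uS) -mulmxA (eqP e) mulmx0.
Qed.

Lemma inv_sqrtmx_sing (S : 'M[R]_d) : S \notin unitmx -> inv_sqrtmx S = 0.
Proof.
by move=> uS; apply: xgetPN => B [] /=; rewrite (negbTE uS).
Qed.

(** The default value 0 of [inv_sqrtmx] makes all residuals vanish, so R_n = M_n = 1; for n = 0 the
    factor sqrt n vanishes. *)
Lemma Ustat_sing n (x : nat -> vec) t : sample_cov n x \notin unitmx -> Ustat n x t = 0.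
Proof.
move=> uS; have r j : dotv (colvec t) (residual n x j) = 0.
  by rewrite /residual inv_sqrtmx_sing// mul0mx dotvE big1// => i _; rewrite !mxE mulr0.
rewrite /Ustat /Rstat /Mstat; have [->|n0] := posnP n; first by rewrite sqrtr0 mul0r.
under eq_bigr do rewrite r cos0; under [X in _ * (_ * X)]eq_bigr do rewrite r expR0.
by rewrite !sumr_const card_ord mulVf ?pnatr_eq0 -?lt0n// mulr1 subrr mulr0.
Qed.

Lemma Ustat_ext n (x y : nat -> vec) t : (forall j, (j < n)%N -> x j = y j) -> Ustat n x t = Ustat n y t.
Proof.
move=> h; have m : sample_mean n x = sample_mean n y.
  by congr (_ *: _); apply: eq_bigr => j _; rewrite h.
have c : sample_cov n x = sample_cov n y.
  by congr (_ *: _); apply: eq_bigr => j _; rewrite h// m.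
have r j : (j < n)%N -> residual n x j = residual n y j.
  by move=> jn; rewrite /residual c m h.
have E (g : R -> R) : \sum_(j < n) g (dotv (colvec t) (residual n x j)) =
    \sum_(j < n) g (dotv (colvec t) (residual n y j)) by apply: eq_bigr => j _; rewrite r.
exact (congr2 (fun r m => Num.sqrt n%:R * (n%:R^-1 * r * (n%:R^-1 * m) - 1)) (E cos) (E expR)).
Qed.

Lemma Ustat_bound n (x : nat -> vec) : exists c, 0 <= c /\ forall t, `|Ustat n x t| <= c * env 1 t.
Proof.
pose K := \sum_(j < n) mxN (residual n x j).
have K0 : 0 <= K by apply: sumr_ge0 => j _; exact: mxN_ge0.
have hK j : (j < n)%N -> mxN (residual n x j) <= K.
  move=> jn; rewrite /K (bigD1 (Ordinal jn))//= lerDl; apply: sumr_ge0 => i _; exact: mxN_ge0.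
have [C [C1 hC]] := exp_onorm_env (d := d) K0 ltr01.
exists (Num.sqrt n%:R * (C + 1)); split; first by rewrite mulr_ge0 ?sqrtr_ge0//; lra.
move=> t; rewrite /Ustat normrM ger0_norm ?sqrtr_ge0// -[leRHS]mulrA; apply: ler_wpM2l; rewrite ?sqrtr_ge0//.
have ha j : (j < n)%N -> `|dotv (colvec t) (residual n x j)| <= K * onorm t.
  by move=> jn; rewrite (le_trans (dotv_onorm _ _))// ler_wpM2r ?onorm_ge0// hK.
have hM : `|Mstat n x t| <= expR (K * onorm t).
  apply: (mean_bound (f := fun j => expR (dotv (colvec t) (residual n x j)))) => [|j jn]; first exact: expR_ge0.
  by rewrite ger0_norm ?expR_ge0// ler_expR (le_trans (ler_norm _))// ha.
have hR : `|Rstat n x t| <= 1.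
  by apply: (mean_bound (f := fun j => cos (dotv (colvec t) (residual n x j)))) => // j jn; rewrite cos_max.
apply: (le_trans (ler_normB _ _)); rewrite normr1 normrM mulrDl mul1r; apply: lerD.
  by apply: (le_trans _ (hC t)); rewrite -[leRHS]mul1r; apply: ler_pM.
by rewrite /env expR_ge1// divr_ge0// mul1r vdot_ge0.
Qed.

(** Reads n vectors off one tuple, so that the sample becomes a point of a finite-dimensional space
    as in [random_element_cont]. *)
Definition unflat n (y : Defs.vec R (n * d)) (j : nat) : vec := [tuple nth 0 y (j * d + i) | i < d].

Lemma residual_cvg n (y : Defs.vec R (n * d)) j : sample_cov n (unflat y) \in unitmx ->
  mxcvg y (fun z => residual n (unflat z) j).
Proof.
move=> uS; have hx i : mxcvg y (fun z => colvec (unflat z i)).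
  move=> a b; rewrite !mxE tnth_mktuple.
  rewrite (_ : (fun _ => _) = fun z : Defs.vec R (n * d) => nth 0 z (i * d + a)); first exact: cvg_nth.
  by apply/funext => z; rewrite mxE tnth_mktuple.
have hm : mxcvg y (fun z => sample_mean n (unflat z)) by exact: (mxcvg_mean (f := fun i z => colvec (unflat z i))).
have hc i : mxcvg y (fun z => colvec (unflat z i) - sample_mean n (unflat z)) by exact: mxcvgB.
have hS : mxcvg y (fun z => sample_cov n (unflat z)).
  apply: (mxcvg_mean (f := fun i z => (colvec (unflat z i) - sample_mean n (unflat z)) *m
    (colvec (unflat z i) - sample_mean n (unflat z))^T)) => i.
  by apply: mxcvgM; [exact: hc|apply: mxcvg_tr; exact: hc].
apply: mxcvgM => // a b.
have sub (A B : 'M[R]_d) : `|B a b - A a b| <= mxN (A - B).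
  by rewrite distrC; have := mxN_entry (A - B) a b; rewrite !mxE.
have [e [C [e0 C0 hC]]] := inv_sqrtmx_lip (sample_cov_sym n (unflat y)) (sample_cov_posdef uS).
have h0 := mxcvg_mxN hS.
have C1 : 0 < C + 1 by rewrite ltr_wpDl.
apply/cvgrPdist_lt => eps eps0.
have /cvgr0Pnorm_lt/(_ _ e0) f1 := h0.
have /cvgr0Pnorm_lt/(_ _ (divr_gt0 eps0 C1)) f2 := h0.
near=> z.
have z1 : mxN (sample_cov n (unflat z) - sample_cov n (unflat y)) < e.
  by apply: le_lt_trans (ler_norm _) _; near: z; exact: f1.
have z2 : mxN (sample_cov n (unflat z) - sample_cov n (unflat y)) < eps / (C + 1).
  by apply: le_lt_trans (ler_norm _) _; near: z; exact: f2.
have [_ hz] := hC _ (sample_cov_sym n (unflat z)) (ltW z1).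
apply: (le_lt_trans (sub _ _)); apply: (le_lt_trans hz).
have N0 := mxN_ge0 (sample_cov n (unflat z) - sample_cov n (unflat y)).
move: z2; rewrite ltr_pdivlMr//; nra.
Unshelve. all: by end_near. Qed.

Lemma Ustat_continuous n (gamma : R) (F : Defs.vec R (n * d) -> L2 d gamma) (y : Defs.vec R (n * d)) :
  1 < gamma -> (forall z, L2fun (F z) = Ustat n (unflat z) %[ae wlebesgue gamma]) ->
  sample_cov n (unflat y) \in unitmx -> forall e : R, 0 < e -> exists a : R, 0 < a /\
    forall z, (forall i, `|tnth z i - tnth y i| < a) -> L2dist (F y) (F z) < e.
Proof.
move=> gamma1 hF uS e e0.
pose K := \sum_(j < n) mxN (residual n (unflat y) j).
have K0 : 0 <= K by apply: sumr_ge0 => j _; exact: mxN_ge0.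
have hK j : (j < n)%N -> mxN (residual n (unflat y) j) <= K.
  move=> jn; rewrite /K (bigD1 (Ordinal jn))//= lerDl; apply: sumr_ge0 => i _; exact: mxN_ge0.
have K20 : 0 <= K + 2 by rewrite addr_ge0.
have [C [C1 hC]] := exp_onorm_env (d := d) K20 ltr01.
pose N := Num.sqrt (\int[@wlebesgue R d gamma]_t env (2 * 1) t) * (2 * Num.sqrt n%:R * C).
have N0 : 0 <= N by rewrite !mulr_ge0 ?sqrtr_ge0//; lra.
pose eta := Num.min 1 (e / (N + 1)).
have eta0 : 0 < eta by rewrite lt_min ltr01 divr_gt0// ltr_wpDl.
have eta1 : eta <= 1 by rewrite ge_min lexx.
have etaN : eta * N < e.
  have : eta <= e / (N + 1) by rewrite ge_min lexx orbT.
  rewrite ler_pdivlMr ?ltr_wpDl//; nra.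
have : \forall z \near near_vec y, \sum_(j < n) mxN (residual n (unflat z) j - residual n (unflat y) j) < eta.
  have cv : (fun z => \sum_(j < n) mxN (residual n (unflat z) j - residual n (unflat y) j)) @ near_vec y --> 0.
    rewrite [X in _ --> X](_ : 0 = \sum_(j < n) (0 : R)); last by rewrite big1.
    apply: (cvg_sumR (f := fun (j : 'I_n) z => mxN (residual n (unflat z) j - residual n (unflat y) j))) => j.
    exact (mxcvg_mxN (@residual_cvg n y j uS)).
  have /cvgr0Pnorm_lt/(_ _ eta0) := cv; apply: filterS => z; exact: le_lt_trans (ler_norm _).
move=> [a a0 ha]; exists a; split => // z hz.
have hd j : (j < n)%N -> mxN (residual n (unflat z) j - residual n (unflat y) j) <= eta.
  move=> jn; apply: (le_trans _ (ltW (ha z hz))); rewrite (bigD1 (Ordinal jn))//= lerDl.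
  by apply: sumr_ge0 => i _; exact: mxN_ge0.
have b t : `|Ustat n (unflat y) t - Ustat n (unflat z) t| <= (2 * Num.sqrt n%:R * C * eta) * env 1 t.
  have eta01 : 0 <= eta <= 1 by rewrite (ltW eta0).
  apply: (le_trans (Ustat_perturb K0 t eta01 hK hd)).
  rewrite [leRHS](_ : _ = Num.sqrt n%:R * (2 * eta * (C * env 1 t))); last by ring.
  apply: ler_wpM2l; rewrite ?sqrtr_ge0//; apply: ler_wpM2l => //; by rewrite mulr_ge0// ltW.
have c0 : 0 <= 2 * Num.sqrt n%:R * C * eta.
  by rewrite !mulr_ge0 ?sqrtr_ge0// ?(ltW eta0)//; lra.
have := L2dist_env (measurable_Ustat n _) (measurable_Ustat n _) (hF y) (hF z) c0 gamma1 b.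
move=> h; apply: (le_lt_trans h); apply: le_lt_trans etaN.
by rewrite le_eqVlt /N; apply/orP; left; apply/eqP; ring.
Qed.

(** As a function of the flattened sample, the element is continuous on the measurable set [C] of
    samples with nonzero determinant of the covariance, and equal to the fixed element [F0] outside;
    [random_element_cont] covers this situation. *)
Lemma Ustat_element n (gamma : R) (dT : measure_display) (T : measurableType dT) (X : T -> nat -> vec) :
  (0 < d)%N -> 1 < gamma -> (forall j, measurable_fun setT (fun w => X w j)) ->
  exists U : T -> L2 d gamma, (forall w, L2fun (U w) = Ustat n (X w) %[ae wlebesgue gamma]) /\ random_element U.
Proof.
move=> d0 gamma1 mX.
have /choice[F1 hF1] (y : Defs.vec R (n * d)) : exists F : L2 d gamma, L2fun F = Ustat n (unflat y) %[ae wlebesgue gamma].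
  have [c [c0 hc]] := Ustat_bound n (unflat y).
  exact: (L2_exists_env (measurable_Ustat n (unflat y)) gamma1 hc).
have [F0 hF0] : exists F0 : L2 d gamma, L2fun F0 = cst 0 %[ae wlebesgue gamma].
  apply: (@L2_exists_env _ _ _ (cst 0) 0 1) => // t; by rewrite normr0 mul0r.
pose F (y : Defs.vec R (n * d)) := if sample_cov n (unflat y) \in unitmx then F1 y else F0.
have hF y : L2fun (F y) = Ustat n (unflat y) %[ae wlebesgue gamma].
  rewrite /F; case: ifPn => // uS; rewrite (_ : Ustat n (unflat y) = cst 0)//.
  by apply/funext => t; exact: Ustat_sing.
pose phi w : Defs.vec R (n * d) := [tuple nth 0 (X w (k %/ d)%N) (k %% d)%N | k < n * d].
have phiE w j : (j < n)%N -> unflat (phi w) j = X w j.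
  move=> jn; apply: eq_from_tnth => i; rewrite tnth_mktuple.
  have h : (j * d + i < n * d)%N.
    by apply: (@leq_trans (j.+1 * d)); [rewrite mulSn addnC ltn_add2r|rewrite leq_mul2r jn orbT].
  rewrite -(tnth_nth 0 (phi w) (Ordinal h)) tnth_mktuple /=.
  by rewrite divnMDl// divn_small// addn0 modnMDl modn_small// -tnth_nth.
have UE w : Ustat n (unflat (phi w)) = Ustat n (X w).
  by apply/funext => t; apply: Ustat_ext => j; exact: phiE.
exists (fun w => F (phi w)); split; first by move=> w; rewrite -UE; exact: hF.
have mphi : measurable_fun setT phi.
  apply: measurable_vecP => k; under eq_fun do rewrite tnth_mktuple.
  have kd : (k %% d < d)%N by rewrite ltn_mod.
  under eq_fun do rewrite -(tnth_nth 0 _ (Ordinal kd)).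
  exact: (measurableT_comp (measurable_tnthR _) (mX _)).
pose C := [set y : Defs.vec R (n * d) | sample_cov n (unflat y) \in unitmx].
have mC : measurable C.
  have md : measurable_fun setT (fun y : Defs.vec R (n * d) => \det (sample_cov n (unflat y))).
    have mx j : measurable_fun setT (fun y : Defs.vec R (n * d) => nth 0 y j : R).
      have [jk|jk] := ltnP j (n * d).
        by under eq_fun do rewrite -(tnth_nth 0 _ (Ordinal jk)); exact: measurable_tnthR.
      by under eq_fun do rewrite nth_default ?size_tuple//; exact: measurable_cst.
    have mu j i : measurable_fun setT (fun y : Defs.vec R (n * d) => colvec (unflat y j) i 0).
      by under eq_fun do rewrite mxE tnth_mktuple; exact: mx.
    have mm i : measurable_fun setT (fun y : Defs.vec R (n * d) => sample_mean n (unflat y) i 0).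
      under eq_fun do rewrite mxE summxE; apply: measurable_funM => //.
      by apply: measurable_sum => j; exact: mu.
    have mS a b : measurable_fun setT (fun y : Defs.vec R (n * d) => sample_cov n (unflat y) a b).
      under eq_fun do rewrite mxE summxE; apply: measurable_funM => //.
      apply: measurable_sum => j; under eq_fun do rewrite mxE big_ord1 [X in _ * X]mxE.
      have h i : measurable_fun setT (fun y : Defs.vec R (n * d) => (colvec (unflat y j) - sample_mean n (unflat y)) i 0).
        under eq_fun do rewrite mxE [X in _ + X]mxE; apply: measurable_funB; [exact: mu|exact: mm].
      exact: (measurable_funM (h a) (h b)).
    rewrite /determinant; apply: measurable_sum => p; apply: measurable_funM => //.
    by apply: measurable_prod => i _; exact: mS.
  rewrite (_ : C = ~` ((fun y : Defs.vec R (n * d) => \det (sample_cov n (unflat y))) @^-1` [set 0])).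
    by apply: measurableC; rewrite -[X in measurable X]setTI; exact: md.
  by apply/seteqP; split => y /=; rewrite /C /= unitmxE unitfE => /eqP.
apply: (random_element_cont (C := C) (Phi := F) (F0 := F0) mphi).
- by rewrite -[X in measurable X]setTI; exact: mphi.
- by [].
- by move=> w nC; rewrite /F; case: ifPn.
- by move=> y Cy e e0; have [a [a0 ha]] := Ustat_continuous gamma1 hF Cy e0; exists a; split => // z _; exact: ha.
Qed.

End sample_continuity.

(** * From Lipschitz to continuous functionals *)

Section portmanteau.
Context {R : realType} {d : nat} {gamma : R}.
Local Notation L2 := (L2 d gamma).

(** The Lipschitz regularization of h: it is k-Lipschitz, stays below h, keeps the bound of h, and
    tends to h wherever h is continuous. *)
Definition infconv (h : L2 -> R) (k : R) (F : L2) : R :=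
  inf [set r | exists G, r = h G + k * L2dist F G].

Section inf_convolution.
Variables (h : L2 -> R) (M k : R).
Hypothesis hM : forall F, `|h F| <= M.
Hypothesis k0 : 0 <= k.

Let hb F G : - M <= h G + k * L2dist F G.
Proof.
have := hM G; rewrite ler_norml => /andP[h1 _].
by have := mulr_ge0 k0 (L2dist_ge0 F G); lra.
Qed.

Let ne F : [set r | exists G, r = h G + k * L2dist F G] !=set0.
Proof. by exists (h F + k * L2dist F F); exists F. Qed.

Lemma infconv_le F G : infconv h k F <= h G + k * L2dist F G.
Proof. by apply: ge_inf; [exists (- M) => _ [H ->]; exact: hb|exists G]. Qed.

Lemma infconv_ge F c : (forall G, c <= h G + k * L2dist F G) -> c <= infconv h k F.
Proof. by move=> hc; apply: lb_le_inf => [|_ [G ->]]; [exact: ne|exact: hc]. Qed.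

Lemma infconv_id_le F : infconv h k F <= h F.
Proof. by have := infconv_le F F; rewrite L2distxx mulr0 addr0. Qed.

Lemma infconv_norm F : `|infconv h k F| <= M.
Proof.
rewrite ler_norml; apply/andP; split; first by apply: infconv_ge => G; exact: hb.
by apply: (le_trans (infconv_id_le F)); apply: le_trans (hM F); exact: ler_norm.
Qed.

Lemma infconv_lip F G : `|infconv h k F - infconv h k G| <= k * L2dist F G.
Proof.
have H A B : infconv h k A - infconv h k B <= k * L2dist A B.
  rewrite lerBlDr -lerBlDl; apply: infconv_ge => C.
  have := infconv_le A C; have := ler_wpM2l k0 (L2dist_tri B A C); rewrite mulrDr; lra.
by rewrite ler_norml lerNl opprB [X in k * X]L2distC H /= L2distC H.
Qed.

End inf_convolution.

Lemma infconv_cvg (h : L2 -> R) M F : continuous h -> (forall F, `|h F| <= M) ->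
  (fun k : nat => infconv h k%:R F) @ \oo --> h F.
Proof.
move=> ch hM; apply/cvgrPdist_le => e e0.
have [del [del0 hd]] := L2_continuous_at F ch e0.
(* For such k a point G at distance at least del costs k del >= 2 M, at least as much as h can gain
   there; nearer points are covered by continuity. *)
exists (Num.truncn (2 * M / del)).+1 => // k /= hk.
have k0 := ler0n R k.
have kM : 2 * M <= k%:R * del.
  have h1 : (Num.truncn (2 * M / del)).+1%:R <= k%:R :> R by rewrite ler_nat.
  have h2 := le_trans (ltW (truncnS_gt (2 * M / del))) h1.
  by rewrite ler_pdivrMr in h2.
rewrite ger0_norm ?subr_ge0 ?(infconv_id_le hM)// lerBlDr -lerBlDl.
apply: infconv_ge => G; have [dG|dG] := ltP (L2dist F G) del.
  have := hd G dG; have := mulr_ge0 k0 (L2dist_ge0 F G); have := ler_norm (h F - h G); rewrite distrC; lra.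
have := hM F; have := hM G; rewrite !ler_norml => /andP[? _] /andP[_ ?].
have := ler_wpM2l k0 dG; lra.
Qed.

Context {dT : measure_display} {T : measurableType dT} {dT' : measure_display} {T' : measurableType dT'}.
Variables (P : probability T R) (U : nat -> T -> L2) (P' : probability T' R) (W : T' -> L2).
Hypothesis mU : forall n, random_element (U n).
Hypothesis mW : random_element W.
Hypothesis lipU : forall (h : L2 -> R) (M L : R), (forall F, `|h F| <= M) -> 0 <= L ->
  (forall F G, `|h F - h G| <= L * L2dist F G) ->
  (fun n => \int[P]_w h (U n w)) @ \oo --> \int[P']_w h (W w).

(** One half of the convergence: under P' the regularizations converge to h by dominated
    convergence, and under P only [infconv] <= h is used, which is uniform in n. The other half is
    this one for -h. *)
Let lower (h : L2 -> R) M : continuous h -> (forall F, `|h F| <= M) -> forall e : R, 0 < e ->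
  exists N, forall n, (N <= n)%N -> \int[P']_w h (W w) - e <= \int[P]_w h (U n w).
Proof.
move=> ch hM e e0; have e2 : 0 < e / 2 by rewrite divr_gt0.
have ck k : continuous (infconv h k%:R) by apply: (L2_lip_continuous (L := k%:R)) => F G; exact: infconv_lip.
have [_ cv] := @DCT _ _ _ P' (fun k w => infconv h k%:R (W w)) (fun w => h (W w)) (fun=> M)
  (fun k => measurable_comp_random mW (ck k)) (measurable_comp_random mW ch)
  (fun w => @infconv_cvg h M (W w) ch hM) (L1_cst M (prob_lty P')) (fun k w => infconv_norm hM (ler0n _ _) _).
have /cvgrPdist_le/(_ _ e2)[k _ /(_ _ (leqnn k))/= hk] := cv.
have cU := lipU (fun F => infconv_norm hM (ler0n R k) F) (ler0n R k) (infconv_lip hM (ler0n R k)).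
have /cvgrPdist_le/(_ _ e2)[N _ hN] := cU.
exists N => n Nn; have := hN n Nn; move: hk; rewrite /= !ler_norml => /andP[h1 h2] /andP[h3 h4].
have : \int[P]_w infconv h k%:R (U n w) <= \int[P]_w h (U n w).
  apply: Rint_le => [||w].
  - by apply: (@bound_L1 _ _ _ P _ M); [exact: (measurable_comp_random (mU n) (ck k))|move=> w; exact: infconv_norm].
  - by apply: (@bound_L1 _ _ _ P _ M) => //; exact: (measurable_comp_random (mU n) ch).
  - exact: (infconv_id_le hM).
lra.
Qed.

Lemma portmanteau (h : L2 -> R) M : continuous h -> (forall F, `|h F| <= M) ->
  (fun n => \int[P]_w h (U n w)) @ \oo --> \int[P']_w h (W w).
Proof.
move=> ch hM; apply/cvgrPdist_le => e e0.
have cN : continuous (fun F => - h F) by move=> F; exact: (cvgN (ch F)).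
have NM F : `|- h F| <= M by rewrite normrN.
have [N1 h1] := lower ch hM e0; have [N2 h2] := lower cN NM e0.
exists (maxn N1 N2) => // n; rewrite /= geq_max => /andP[/h1 a1 /h2 a2].
have lW : L1 P' (fun w => h (W w)) by apply: (@bound_L1 _ _ _ P' _ M) => //; exact: (measurable_comp_random mW ch).
have lU : L1 P (fun w => h (U n w)) by apply: (@bound_L1 _ _ _ P _ M) => //; exact: (measurable_comp_random (mU n) ch).
have e1 : \int[P']_w (- h (W w)) = - \int[P']_w h (W w).
  by rewrite -mulN1r -RintZ//; apply: eq_Rintegral => w _; rewrite mulN1r.
have e2 : \int[P]_w (- h (U n w)) = - \int[P]_w h (U n w).
  by rewrite -mulN1r -RintZ//; apply: eq_Rintegral => w _; rewrite mulN1r.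
move: a2; rewrite e1 e2 => a2; rewrite ler_norml; apply/andP; split; lra.
Qed.

End portmanteau.

(** * The limit is Gaussian with the stated kernel *)

Section law_uniqueness.
Context {R : realType} {d1 d2 : measure_display} {T1 : measurableType d1} {T2 : measurableType d2}.
Variables (P : probability T1 R) (Q : probability T2 R) (I : T1 -> measurableTypeR R) (J : T2 -> measurableTypeR R).
Hypothesis mI : measurable_fun setT I.
Hypothesis mJ : measurable_fun setT J.
Hypothesis lipE : forall (phi : R -> R) (L : R), 0 <= L -> (forall x, `|phi x| <= 1) ->
  (forall x y, `|phi x - phi y| <= L * `|x - y|) -> \int[P]_w phi (I w) = \int[Q]_w phi (J w).

(** Lipschitz functions with values in [0, 1] that approach the indicator of ]a, +oo[ as k grows. *)
Let ramp (a : R) (k : nat) (x : R) : R := Num.max 0 (Num.min 1 (k%:R * (x - a))).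

Let ramp01 a k x : 0 <= ramp a k x <= 1.
Proof. by rewrite /ramp le_max lexx /= ge_max ler01 /= ge_min lexx. Qed.

Let ramp_norm a k x : `|ramp a k x| <= 1.
Proof. by have /andP[h ?] := ramp01 a k x; rewrite ger0_norm. Qed.

Let ramp_lip a k x y : `|ramp a k x - ramp a k y| <= k%:R * `|x - y|.
Proof.
have h : `|k%:R * (x - a) - k%:R * (y - a)| = k%:R * `|x - y|.
  have -> : k%:R * (x - a) - k%:R * (y - a) = k%:R * (x - y) by ring.
  by rewrite normrM ger0_norm.
rewrite -h /ramp; set u := k%:R * _; set v := k%:R * _.
have a1 := ler_norm (u - v); have a2 := ler_norm (v - u); rewrite distrC in a2.
have a3 := normr_ge0 (u - v); move: (`|u - v|) a1 a2 a3 => n a1 a2 a3.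
rewrite /Num.max /Num.min ler_norml.
by case: (ltP 1 u) => ?; case: (ltP 1 v) => ?; case: ltP => ?; case: ltP => ?; apply/andP; split; lra.
Qed.

Let ramp_cvg a x : (fun k => ramp a k x) @ \oo --> (\1_(`]a, +oo[%classic : set R) x : R).
Proof.
have -> : \1_(`]a, +oo[%classic : set R) x = (a < x)%R%:R :> R.
  rewrite indicE; congr (nat_of_bool _)%:R; apply/idP/idP; rewrite inE /= in_itv /= andbT//.
have [xa|ax] := leP x a.
  apply: (cvgn_ext (v := fun=> 0)); last exact: cvg_cst.
  move=> k; rewrite /ramp; apply/max_idPl; rewrite ge_min; apply/orP; right.
  by rewrite mulr_ge0_le0// subr_le0.
apply: cvg_near_cst; exists (Num.truncn (x - a)^-1).+1 => // k /= hk.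
have h1 : (Num.truncn (x - a)^-1).+1%:R <= k%:R :> R by rewrite ler_nat.
have h2 := le_trans (ltW (truncnS_gt (x - a)^-1)) h1.
have : 1 <= k%:R * (x - a) by rewrite -ler_pdivrMr ?subr_gt0// div1r.
by rewrite /ramp => /min_idPl ->; apply/max_idPr.
Qed.

Let ramp_int (d : measure_display) (T : measurableType d) (S : probability T R) (K : T -> measurableTypeR R) a :
  measurable_fun setT K ->
  (fun k => \int[S]_w ramp a k (K w)) @ \oo --> fine (S (K @^-1` `]a, +oo[)).
Proof.
move=> mK; have mA : measurable (K @^-1` `]a, +oo[).
  by rewrite -[X in measurable X]setTI; apply: mK => //; exact: measurable_itv.
rewrite -Rint_indic//.
have mr k : measurable_fun setT (fun w => ramp a k (K w)).
  apply: measurable_maxr => //; apply: measurable_minr => //.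
  by apply: measurable_funM => //; apply: measurable_funB.
have lT : L1 S (fun=> 1 : R) by apply: L1_cst; exact: prob_lty.
have [_ cv] := @DCT _ _ _ S (fun k w => ramp a k (K w)) (\1_(K @^-1` `]a, +oo[) : T -> R) (fun=> 1) mr
  (measurable_indic mA) (fun w => @ramp_cvg a (K w)) lT (fun k w => ramp_norm a k (K w)).
exact: cv.
Qed.

(** The half-lines ]a, +oo[ are stable under intersection and generate the Borel sets; their
    probabilities are the limits of the integrals of [ramp]. *)
Lemma law_eq A : measurable A -> P (I @^-1` A) = Q (J @^-1` A).
Proof.
have [m1 m1E] := pushforward_measure_ex P mI; have [m2 m2E] := pushforward_measure_ex Q mJ.
move=> mA; rewrite -m1E -m2E; move: A mA.
apply: (@measure_unique _ R (measurableTypeR R) (@RGenOInfty.G R) (fun k : nat => `]- k%:R, +oo[%classic)).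
- exact: RGenOInfty.measurableE.
- move=> _ _ [x ->] [y ->]; exists (Num.max x y); apply/seteqP; split => z /=; rewrite !in_itv /= !andbT gt_max.
    by move=> [-> ->].
  by move=> /andP[].
- by move=> k; exists (- k%:R).
- apply/seteqP; split => // x _; exists (Num.truncn (- x)).+1 => //=.
  by rewrite in_itv /= andbT ltrNl; exact: truncnS_gt.
- move=> _ [x ->]; rewrite m1E m2E.
  have mIA : measurable (I @^-1` `]x, +oo[).
    by rewrite -[X in measurable X]setTI; apply: mI => //; exact: measurable_itv.
  have mJA : measurable (J @^-1` `]x, +oo[).
    by rewrite -[X in measurable X]setTI; apply: mJ => //; exact: measurable_itv.
  rewrite -[LHS]fineK ?fin_num_measure// -[RHS]fineK ?fin_num_measure//; congr EFin.
  apply: (Rlim_unique (@ramp_int _ _ P I x mI)); apply: cvgn_ext (@ramp_int _ _ Q J x mJ) => k.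
  by rewrite (lipE (ler0n R k) (ramp_norm x k) (ramp_lip x k)).
- by move=> k; rewrite m1E; apply: le_lt_trans (prob_lty P); apply: le_measure; rewrite ?inE//;
    rewrite -[X in measurable X]setTI; apply: mI => //; exact: measurable_itv.
Qed.

End law_uniqueness.

Lemma normal_law1_scale {R : realType} (s : R) (A : set (measurableTypeR R)) : 0 <= s -> measurable A ->
  @N01 R ((fun x => s * x) @^-1` A) = normal_law1 0 s A.
Proof.
move=> s0 mA; rewrite /normal_law1; case: eqVneq => [->|sn].
  rewrite diracE; case: (boolP (0 \in A)) => [|] h.
    rewrite (_ : _ @^-1` A = setT) ?N01T//; apply/seteqP; split => // x _ /=.
    by rewrite mul0r; rewrite inE in h.
  rewrite (_ : _ @^-1` A = set0) ?measure0//; apply/seteqP; split => // x /=.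
  by rewrite mul0r => h0; move: h; rewrite mem_set.
have sp : 0 < s by rewrite lt_neqAle eq_sym sn.
have mB : measurable ((fun x : measurableTypeR R => s * x : measurableTypeR R) @^-1` A).
  by rewrite -[X in measurable X]setTI; exact: (measurable_funM (measurable_cst s) (@measurable_id _ _ setT)).
pose F (x : R) : \bar R := ((fun x => (normal_pdf 0 s x)%:E) \_ A) x.
have F0 x : (0 <= F x)%E by rewrite /F patchE; case: ifP => // _; rewrite lee_fin normal_pdf_ge0.
have mF : measurable_fun setT F.
  apply/(measurable_restrictT _ _).1 => //; apply: measurable_funTS; apply/measurable_EFinP.
  exact: measurable_normal_pdf.
rewrite /N01 /= /normal_prob [LHS]integral_mkcond [RHS]integral_mkcond.
rewrite [RHS](ge0_integral_affine 0 sn mF F0) -ge0_integralZl//; last first.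
  by apply: (measurableT_comp mF); apply: measurable_funD => //; exact: measurable_funM.
apply: eq_integral => x _; rewrite /F !patchE addr0.
have -> : (x \in (fun x => s * x) @^-1` A) = (s * x \in A) by apply/idP/idP; rewrite !inE.
case: ifP => _; last by rewrite mule0.
rewrite -EFinM; congr EFin; rewrite /normal_pdf oner_eq0 (negbTE sn) /normal_peak /normal_fun !subr0 expr1n mul1r.
rewrite gtr0_norm// -mulrnAr sqrtrM ?sqr_ge0// sqrtr_sqr gtr0_norm// invfM !mulrA mulfV// mul1r.
by congr (_ * expR _); rewrite exprMn; field.
Qed.

(** * The covariance kernel as a series *)

Section kernel_limit.
Context {R : realType} {d : nat} {gamma : R}.
Hypothesis gamma1 : 1 < gamma.
Local Notation vec := (vec R d).
Local Notation J := {ffun 'I_d -> nat}.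
Local Notation box := (@box d).
Local Notation L2 := (L2 d gamma).
Local Notation nu := (@wlebesgue R d gamma).
Variable O : 'M[R]_d.
Hypothesis OO : O *m O^T = 1%:M.
Implicit Types (F G : L2) (al : J).

Lemma vdot_orth (s t : vec) : vdot (mxv O^T s) (mxv O^T t) = vdot s t.
Proof. by rewrite -!dotv_colvec !colvec_mxv dotv_mulmx trmxK mulmxA OO mul1mx. Qed.

(** Covariance of the truncated series with standard normal coefficients. The orthogonal O
    disappears only in the limit, where s and t enter through s.t alone. *)
Definition kern m (s t : vec) : R :=
  \sum_(al <- box m) bco (deg al) ^+ 2 * (mono (mxv O^T s) al * mono (mxv O^T t) al).

(** For k >= 2 this is (1 + c)^2 with c = Re i^k and c^2 = (1 + (-1)^k) / 2; the last two terms
    correct k = 1 and k = 0. Each summand belongs to one elementary function in the kernel. *)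
Lemma bco_sqr k : (bco k : R) ^+ 2 = 1 + 2 * (ipow k).1 + 2^-1 * (1 + (-1) ^+ k) - (k == 1%N)%:R - 4 * (k == 0%N)%:R.
Proof.
rewrite /bco; case: k => [|[|k]]; rewrite /= ?expr0n ?expr0 ?expr1 ?oppr0 ?mulr0n ?mulr1n.
- by rewrite /=; field.
- by rewrite /=; field.
rewrite !addr0 mulr0 subr0 (_ : (-1) ^+ k.+2 = (-1) ^+ k); last by rewrite !exprS; ring.
set c := (ipow k).1; have -> : (-1) ^+ k = 2 * c ^+ 2 - 1.
  rewrite /c ipowE /= exprMn -exprM mulnC exprM sqrrN !expr1n mulr1 -signr_odd.
  by case: (odd k) => /=; rewrite ?mulr1n ?mulr0n; ring.
by field.
Qed.

Lemma kern_cvg s t : (fun m => kern m s t) @ \oo --> covkernel s t.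
Proof.
set s' := mxv O^T s; set t' := mxv O^T t.
have st : vdot s' t' = vdot s t by exact: vdot_orth.
pose F al := mono s' al * mono t' al.
have c1 := @mono_cvg R d 1 s' t'; have c2 := @mono_trig_cvg R d s' t'; have c3 := @mono_cvg R d (-1) s' t'.
rewrite mul1r st in c1; rewrite st in c2; rewrite mulN1r st in c3.
rewrite -(cvg_shiftn 2%N).
rewrite /covkernel dotv_colvec.
have -> : expR (vdot s t) + 2^-1 * (expR (vdot s t) + expR (- vdot s t)) + 2 * cos (vdot s t) - vdot s t - 4 =
  (expR (vdot s t) + 2 * cos (vdot s t)) + 2^-1 * (expR (vdot s t) + expR (- vdot s t)) - (vdot s t + 4) by ring.
apply: (cvgn_ext (v := fun m =>
  (\sum_(al <- box (m + 2)) 1 ^+ deg al * F al + 2 * \sum_(al <- box (m + 2)) (ipow (deg al)).1 * F al) +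
  2^-1 * (\sum_(al <- box (m + 2)) 1 ^+ deg al * F al + \sum_(al <- box (m + 2)) (-1) ^+ deg al * F al) - (vdot s t + 4))).
  move=> m; rewrite /kern.
  have e0 : \sum_(al <- box (m + 2)) (deg al == 0%N)%:R * F al = 1.
    by rewrite addn2 sum_deg0 /F !mono_j0 mulr1.
  have e1 : \sum_(al <- box (m + 2)) (deg al == 1%N)%:R * F al = vdot s t.
    by rewrite addn2 sum_deg1 -st; apply: eq_bigr => i _; rewrite /F !mono_ei.
  have -> : vdot s t + 4 = \sum_(al <- box (m + 2)) ((deg al == 1%N)%:R * F al + 4 * ((deg al == 0%N)%:R * F al)).
    by rewrite big_split /= e1 -mulr_sumr e0 mulr1.
  rewrite -!big_split /= !mulr_sumr -!big_split /= -sumrB.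
  apply: eq_bigr => al _; rewrite -/s' -/t' -/(F al) bco_sqr expr1n; ring.
have sh (u : nat -> R) l : u @ \oo --> l -> (fun m => u (m + 2)%N) @ \oo --> l by rewrite -(cvg_shiftn 2%N).
apply: cvgB; last exact: cvg_cst.
apply: cvgD.
  by apply: cvgD; [exact: sh c1|apply: cvgM; [exact: cvg_cst|exact: sh c2]].
by apply: cvgM; [exact: cvg_cst|apply: cvgD; [exact: sh c1|exact: sh c3]].
Qed.

Lemma kern_bound m s t : `|kern m s t| <= 4 * env 1 s * env 1 t.
Proof.
have b4 k : `|(bco k : R) ^+ 2| <= 4.
  by rewrite normrX (_ : 4 = 2 ^+ 2) ?lerXn2r ?nnegrE// ?bco_norm//; ring.
have := series_bound (a := fun k => (bco k : R) ^+ 2) ltr01 b4 m xpredT (fun al => mono (mxv O^T s) al) (mxv O^T t).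
rewrite (env_orth OO) /kern => h.
rewrite (eq_bigr (fun al => bco (deg al) ^+ 2 * mono (mxv O^T s) al * mono (mxv O^T t) al)); last by move=> al _; rewrite mulrA.
apply: (le_trans h); rewrite ler_wpM2r ?env_ge0// ler_wpM2l//.
have -> : env 1 s = Num.sqrt (expR (1 * vdot s s)).
  have -> : expR (1 * vdot s s) = env 1 s ^+ 2 by rewrite /env expr2 -expRD; congr expR; field.
  by rewrite sqrtr_sqr ger0_norm// env_ge0.
apply: ler_wsqrtr; apply: (@box_le_lim _ _ (fun al => mono (mxv O^T s) al ^+ 2 / 1 ^+ deg al) _ m xpredT).
  by move=> al; rewrite divr_ge0 ?sqr_ge0// expr1n.
have := @mono_cvg R d 1 (mxv O^T s) (mxv O^T s); rewrite vdot_orth; apply: cvgn_ext => n.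
by apply: eq_bigr => al _; rewrite expr1n divr1 mul1r expr2.
Qed.

Lemma L1_envF a F : a < gamma -> L1 nu (fun t => env a t * `|L2fun F t|).
Proof.
move=> ag; apply: L1_sqrM.
- exact: measurable_env.
- by apply: measurableT_comp => //; exact: measurable_L2fun.
- by under eq_fun do rewrite env_sqr; apply: L1_env; rewrite ltr_pM2l.
- by under eq_fun do rewrite real_normK ?num_real//; exact: L2fun_sqr.
Qed.

Let mm al : measurable_fun setT (fun t : vec => mono (mxv O^T t) al).
Proof. exact: (measurableT_comp (measurable_mono al) (measurable_mxv O^T)). Qed.

Lemma L1_monoF F al : L1 nu (fun t => mono (mxv O^T t) al * L2fun F t).
Proof.
apply: (L1_le _ _ (L1_envF F gamma1)).
- by apply: measurable_funM => //; exact: measurable_L2fun.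
- by move=> t; rewrite normrM ler_wpM2r// -(env_orth OO) mono_env.
Qed.

(** Coordinates of the functional given by F: the inner product of a truncated series with F is
    linear in the coefficients, with these weights ([inner_Phi]). *)
Definition fco F al : R := bco (deg al) * \int[nu]_t (mono (mxv O^T t) al * L2fun F t).

Lemma inner_Phi x m F : L2inner (Phi gamma1 OO (cvec x m)) F =
  vdot (cvec x m) (cvec (fco F) m).
Proof.
rewrite (L2innerE (measurable_psi O (cvec x m)) (measurable_L2fun F) (PhiE gamma1 OO _) (aeW _ (fun t _ => erefl))).
transitivity (\int[nu]_t (\sum_(i < size (@bx d m)) (bco (deg (nth j0 (@bx d m) i)) * tnth (cvec x m) i) *
   (mono (mxv O^T t) (nth j0 (@bx d m) i) * L2fun F t))).
  apply: eq_Rintegral => t _; rewrite /psi mulr_suml; apply: eq_bigr => i _; by rewrite mulrA.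
rewrite Rint_sum; last by move=> i _; apply: L1Z; exact: L1_monoF.
apply: eq_bigr => i _; rewrite RintZ; last exact: L1_monoF.
by rewrite !tnth_mktuple /fco mulrAC mulrC.
Qed.

Lemma vdot_cvec (x y : J -> R) m : x j0 = 0 ->
  vdot (cvec x m) (cvec y m) = \sum_(al <- box m) x al * y al.
Proof.
move=> x0; rewrite -(@sum_bx R d m (fun al => x al * y al)) ?x0 ?mul0r//.
by apply: eq_bigr => i _; rewrite !tnth_mktuple.
Qed.

Lemma inner_bound rho x m F : 0 < rho -> rho < gamma ->
  `|L2inner (Phi gamma1 OO (cvec x m)) F| <=
  2 * Num.sqrt (\sum_(al <- box m) x al ^+ 2 / rho ^+ deg al) * \int[nu]_t (env rho t * `|L2fun F t|).
Proof.
move=> rho0 rhog; have mF := measurable_L2fun F.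
rewrite (L2innerE (measurable_psi O (cvec x m)) mF (PhiE gamma1 OO _) (aeW _ (fun t _ => erefl))).
set B := 2 * Num.sqrt _; have b t : `|psi O (cvec x m) t * L2fun F t| <= B * (env rho t * `|L2fun F t|).
  rewrite normrM mulrA ler_wpM2r// psi_cvec -(env_orth OO rho t).
  exact: (series_bound rho0 (@bco_norm R) m xpredT x _).
have lb : L1 nu (fun t => B * (env rho t * `|L2fun F t|)) by apply: L1Z; exact: L1_envF.
have lp : L1 nu (fun t => psi O (cvec x m) t * L2fun F t).
  by apply: (L1_le _ b lb); apply: measurable_funM => //; exact: measurable_psi.
apply: (le_trans (Rint_abs lp)); rewrite -RintZ; last exact: L1_envF.
by apply: Rint_le => //; exact: L1_abs.
Qed.

Lemma fco_j0 F : fco F j0 = 0.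
Proof. by rewrite /fco (_ : deg (j0 : J) = 0%N) ?/bco ?mul0r//; apply/eqP; rewrite deg0P. Qed.

(** The partial sum is the double integral of the truncated kernel [kern]. Dominated convergence is
    applied in t for fixed s and then in s; [kern_bound] supplies a majorant that factors. *)
Lemma fco_kernel F G : (fun m => \sum_(al <- box m) fco F al * fco G al) @ \oo -->
  \int[nu]_s \int[nu]_t (covkernel s t * L2fun F s * L2fun G t).
Proof.
have mF := measurable_L2fun F; have mG := measurable_L2fun G.
pose BG := \int[nu]_t (env 1 t * `|L2fun G t|).
have lin m s : L1 nu (fun t => kern m s t * L2fun F s * L2fun G t) /\
   \int[nu]_t (kern m s t * L2fun F s * L2fun G t) =
   \sum_(al <- box m) (bco (deg al) * fco G al) * (mono (mxv O^T s) al * L2fun F s).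
  have E : (fun t => kern m s t * L2fun F s * L2fun G t) = fun t =>
     \sum_(al <- box m) (bco (deg al) ^+ 2 * mono (mxv O^T s) al * L2fun F s) * (mono (mxv O^T t) al * L2fun G t).
    by apply/funext => t; rewrite /kern !mulr_suml; apply: eq_bigr => al _; ring.
  rewrite E; split; first by apply: L1_sum => al _; apply: L1Z; exact: L1_monoF.
  rewrite Rint_sum; last by move=> al _; apply: L1Z; exact: L1_monoF.
  by apply: eq_bigr => al _; rewrite RintZ; [rewrite /fco; ring|exact: L1_monoF].
have mk m s : measurable_fun setT (fun t => kern m s t * L2fun F s * L2fun G t).
  exact: L1_meas (lin m s).1.
have lG := L1_envF G gamma1.
have bt m s t : `|kern m s t * L2fun F s * L2fun G t| <= (4 * (env 1 s * `|L2fun F s|)) * (env 1 t * `|L2fun G t|).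
  rewrite !normrM; have := ler_wpM2r (mulr_ge0 (normr_ge0 (L2fun F s)) (normr_ge0 (L2fun G t))) (kern_bound m s t).
  by congr (_ <= _); ring.
have cvin s : (fun m => \int[nu]_t (kern m s t * L2fun F s * L2fun G t)) @ \oo -->
   \int[nu]_t (covkernel s t * L2fun F s * L2fun G t).
  have cv t : (fun m => kern m s t * L2fun F s * L2fun G t) @ \oo --> covkernel s t * L2fun F s * L2fun G t.
    by apply: cvgM; [apply: cvgM; [exact: kern_cvg|exact: cvg_cst]|exact: cvg_cst].
  have mc : measurable_fun setT (fun t : vec => covkernel s t * L2fun F s * L2fun G t).
    by apply: (@measurable_fun_cvg _ vec R setT (fun m t => kern m s t * L2fun F s * L2fun G t)).
  exact: (DCT (mk ^~ s) mc cv (L1Z _ lG) (fun m t => bt m s t)).2.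
have E2 m : \sum_(al <- box m) fco F al * fco G al = \int[nu]_s \int[nu]_t (kern m s t * L2fun F s * L2fun G t).
  under eq_Rintegral do rewrite (lin m _).2.
  rewrite Rint_sum; last by move=> al _; apply: L1Z; exact: L1_monoF.
  by apply: eq_bigr => al _; rewrite RintZ; [rewrite /fco; ring|exact: L1_monoF].
apply: cvgn_ext E2 _.
have mo m : measurable_fun setT (fun s => \int[nu]_t (kern m s t * L2fun F s * L2fun G t)).
  under eq_fun do rewrite (lin m _).2; apply: measurable_sum => al; apply: measurable_funM => //.
  exact: measurable_funM.
have mlim : measurable_fun setT (fun s => \int[nu]_t (covkernel s t * L2fun F s * L2fun G t)).
  exact: (@measurable_fun_cvg _ vec R setT (fun m s => \int[nu]_t (kern m s t * L2fun F s * L2fun G t))).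
have lF := L1Z (4 * BG) (L1_envF F gamma1).
apply: (DCT mo mlim cvin lF _).2 => m s.
apply: (le_trans (Rint_abs (lin m s).1)).
rewrite [leRHS](_ : _ = (4 * (env 1 s * `|L2fun F s|)) * BG); last by ring.
rewrite -RintZ//; apply: Rint_le; [exact: L1_abs (lin m s).1|exact: L1Z|exact: bt].
Qed.

End kernel_limit.

Lemma L1_mono_lim {R : realType} (dT : measure_display) (T : measurableType dT) (mu : {measure set T -> \bar R})
  (f : nat -> T -> R) (A : T -> R) (C : R) : (forall m, L1 mu (f m)) -> (forall m w, 0 <= f m w) ->
  (forall m w, f m w <= f m.+1 w) -> (forall m, \int[mu]_w f m w <= C) ->
  (forall w, (fun m => f m w) @ \oo --> A w) -> L1 mu A.
Proof.
move=> lf f0 fS fC fA.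
have mA : measurable_fun setT A.
  by apply: (@measurable_fun_cvg _ T R setT f) => // m; exact: L1_meas (lf m).
have A0 w : 0 <= A w.
  by rewrite -(cvg_lim (@Rhausdorff R) (fA w)); apply: limr_ge; [apply/cvg_ex; exists (A w)|apply: nearW].
apply: L1P => //.
have nd w : {homo (fun m => (f m w)%:E) : m n / (m <= n)%N >-> (m <= n)%E}.
  by apply/nondecreasing_seqP => m; rewrite lee_fin.
have cv := @cvg_monotone_convergence _ T R mu setT measurableT (fun m w => (f m w)%:E)
  (fun m => (measurable_EFinP _ _).2 (L1_meas (lf m))) (fun m w _ => ltac:(by rewrite lee_fin)) (fun w _ => nd w).
have E : (\int[mu]_w `|A w|%:E = \int[mu]_w limn (fun m => (f m w)%:E))%E.
  apply: eq_integral => w _; rewrite ger0_norm//; apply/esym/cvg_lim => //.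
  by apply: cvg_EFin; [exact: nearW|exact: fA].
rewrite E -(cvg_lim _ cv)//; apply: (@le_lt_trans _ _ C%:E); last by rewrite ltry.
apply: lime_le; first by apply/cvg_ex; eexists; exact: cv.
by apply: nearW => m; rewrite -RintE// lee_fin.
Qed.

Lemma gauss_vdot {R : realType} k (a b : Defs.vec R k) :
  [/\ L1 (@gauss R k) (fun z => vdot z a), \int[@gauss R k]_z vdot z a = 0,
    L1 (@gauss R k) (fun z => vdot z a * vdot z b) & \int[@gauss R k]_z (vdot z a * vdot z b) = vdot a b].
Proof.
have l1 i : L1 (@gauss R k) (fun z => tnth a i * tnth z i) by apply: L1Z; exact: (gauss_coord i).1.
have E1 : (fun z : Defs.vec R k => vdot z a) = fun z => \sum_(i < k) tnth a i * tnth z i.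
  by apply/funext => z; apply: eq_bigr => i _; rewrite mulrC.
have l2 i j : L1 (@gauss R k) (fun z => (tnth a i * tnth b j) * (tnth z i * tnth z j)).
  by apply: L1Z; exact: (gauss_coord2 i j).1.
have E2 : (fun z : Defs.vec R k => vdot z a * vdot z b) =
    fun z => \sum_(i < k) \sum_(j < k) (tnth a i * tnth b j) * (tnth z i * tnth z j).
  apply/funext => z; rewrite /vdot mulr_suml; apply: eq_bigr => i _.
  by rewrite mulr_sumr; apply: eq_bigr => j _; ring.
split.
- by rewrite E1; apply: L1_sum.
- rewrite E1 Rint_sum// big1// => i _; rewrite RintZ ?(gauss_coord i).2 ?mulr0//; exact: (gauss_coord i).1.
- by rewrite E2; apply: L1_sum => i _; apply: L1_sum.
rewrite E2 Rint_sum => [|i _]; last by apply: L1_sum.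
apply: eq_bigr => i _; rewrite Rint_sum// (bigD1 i)//= big1 ?addr0.
  by rewrite RintZ ?(gauss_coord2 i i).2 ?eqxx ?mulr1//; exact: (gauss_coord2 i i).1.
move=> j /negbTE ji; rewrite RintZ ?(gauss_coord2 i j).2 1?eq_sym ?ji ?mulr0//.
exact: (gauss_coord2 i j).1.
Qed.

(** * Law of the limit element *)

Section limit_law.
Context {R : realType} {d : nat} {gamma : R}.
Hypothesis gamma1 : 1 < gamma.
Local Notation vec := (vec R d).
Local Notation J := {ffun 'I_d -> nat}.
Local Notation box := (@box d).
Local Notation L2 := (L2 d gamma).
Local Notation nu := (@wlebesgue R d gamma).
Context {dT : measure_display} {T : measurableType dT}.
Variables (P : probability T R) (Y : nat -> {RV P >-> measurableTypeR R}).
Hypothesis Y_indep : mutually_independent Y.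
Hypothesis Y_law : forall i A, measurable A -> P (Y i @^-1` A) = N01 A.
Variable O : 'M[R]_d.
Hypothesis OO : O *m O^T = 1%:M.
Variable rho : R.
Hypothesis rho1 : 1 < rho.
Hypothesis rhog : rho < gamma.
Local Notation xi0 := (xi0 (d := d) rho (xiY Y)).
Variable W : T -> L2.
Hypothesis rW : random_element W.
Hypothesis lW : forall w (e : R), 0 < e -> exists N, forall m, (N <= m)%N ->
  L2dist (Phi gamma1 OO (cvec (xi0 ^~ w) m)) (W w) < e.
Implicit Types F G : L2.

Let rho0 : 0 < rho. Proof. exact: lt_trans rho1. Qed.

Let mxi0 al : measurable_fun setT (xi0 al).
Proof. exact: (measurable_xi0 rho1 (measurable_xiY Y) (xiY2 Y_law)). Qed.

Definition Xm F m w : R := vdot (cvec (xi0 ^~ w) m) (cvec (fco O F) m).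

Let XmE F m w : Xm F m w = L2inner (Phi gamma1 OO (cvec (xi0 ^~ w) m)) F.
Proof. by rewrite inner_Phi. Qed.

Let mcv m (x : J -> T -> R) : (forall al, measurable_fun setT (x al)) ->
  measurable_fun setT (fun w => cvec (x ^~ w) m).
Proof. by move=> mx; apply: measurable_vecP => i; under eq_fun do rewrite tnth_mktuple; exact: mx. Qed.

Let mXm F m : measurable_fun setT (Xm F m).
Proof.
apply: measurable_sum => i; apply: measurable_funM => //.
by under eq_fun do rewrite tnth_mktuple; exact: mxi0.
Qed.

Lemma inner_cvg F w : (fun m => Xm F m w) @ \oo --> L2inner (W w) F.
Proof.
apply/cvgrPdist_le => e e0; set q := Num.sqrt (\int[nu]_t (L2fun F t ^+ 2)).
have q0 : 0 <= q by exact: sqrtr_ge0.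
have q1 : 0 < q + 1 by rewrite ltr_wpDl.
have [N hN] := lW w (divr_gt0 e0 q1); exists N => // m /= /hN hm.
rewrite XmE distrC; apply: (le_trans (L2inner_lip _ _ _)); rewrite -/q.
have D0 := L2dist_ge0 (Phi gamma1 OO (cvec (xi0 ^~ w) m)) (W w).
by move: hm; rewrite ltr_pdivlMr//; nra.
Qed.

Lemma inner_measurable F : measurable_fun setT (fun w => L2inner (W w) F).
Proof.
apply: (measurable_comp_random (h := fun G => L2inner G F) rW).
apply: (L2_lip_continuous (L := Num.sqrt (\int[nu]_t (L2fun F t ^+ 2)))) => G H.
by rewrite mulrC; exact: L2inner_lip.
Qed.

Lemma cvec_xi0_law m (psi : Defs.vec R (size (@bx d m)) -> R) : L1 (gauss _) psi ->
  \int[P]_w psi (cvec (xi0 ^~ w) m) = \int[gauss _]_z psi z.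
Proof.
move=> lpsi; have [l <-] := cvec_xiY_law Y_indep Y_law lpsi.
apply: Rint_ae.
- exact (measurableT_comp (L1_meas lpsi) (@mcv m _ mxi0)).
- exact: L1_meas l.
apply: filterS (xi0_ae (d := d) rho1 (xiY2 Y_law)) => w hw _; congr psi.
by apply: eq_from_tnth => i; rewrite !tnth_mktuple hw.
Qed.

(** The limit A of the weighted square sums is finite at every point since [xi0] is bounded in this
    sense everywhere, and integrable by monotone convergence. It dominates the inner products of all
    truncations. *)
Lemma dominating : exists A : T -> R, L1 P A /\ forall m w, xisum rho xi0 m xpredT w <= A w.
Proof.
have x2 al : L1 P (fun w => xi0 al w ^+ 2) /\ \int[P]_w (xi0 al w ^+ 2) <= 1.
  have [l i] := xiY2 Y_law al.
  have h : (fun w => xiY Y al w ^+ 2) = (fun w => xi0 al w ^+ 2) %[ae P].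
    by apply: filterS (xi0_ae (d := d) rho1 (xiY2 Y_law)) => w hw _; rewrite hw.
  have m2 : measurable_fun setT (fun w => xi0 al w ^+ 2) by exact: measurable_funX.
  by split; [exact: L1_ae h l|rewrite -(Rint_ae (L1_meas l) m2 h)].
have [C [C0 [wC _]]] := wsum_tail (d := d) rho1.
have /choice[A hA] w : exists l : R, (fun m => xisum rho xi0 m xpredT w) @ \oo --> l.
  have [K [K0 hK]] := @xi0_bounded R d rho dT T (xiY Y) w.
  apply: (@box_abs_cvg _ _ (fun al => xi0 al w ^+ 2 / rho ^+ deg al) (K ^+ 2)) => m.
  apply: le_trans (hK m); apply: ler_sum => al _; rewrite ger0_norm//.
  by rewrite divr_ge0 ?sqr_ge0// exprn_ge0// ltW.
exists A; split.
  apply: (L1_mono_lim (f := fun m w => xisum rho xi0 m xpredT w) (C := C)) => //.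
  - by move=> m; exact: (L1_xisum rho1 x2 m xpredT).1.
  - by move=> m w; exact: xisum_ge0.
  - by move=> m w; exact: xisum_le.
  - by move=> m; exact: le_trans (L1_xisum rho1 x2 m xpredT).2 (wC m).
move=> m w; apply: (@box_le_lim _ _ (fun al => xi0 al w ^+ 2 / rho ^+ deg al) (A w) m xpredT); last exact: hA.
by move=> al; rewrite divr_ge0 ?sqr_ge0// exprn_ge0// ltW.
Qed.

Definition env_int F : R := \int[nu]_t (env rho t * `|L2fun F t|).

Let env_int_ge0 F : 0 <= env_int F.
Proof. by apply: Rint_ge0 => t; rewrite mulr_ge0// env_ge0. Qed.

Lemma Xm_bound F m w : `|Xm F m w| <= 2 * Num.sqrt (xisum rho xi0 m xpredT w) * env_int F.
Proof. by rewrite XmE; exact: inner_bound. Qed.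

(** For the truncations these are moments of linear forms in a standard normal vector. They pass to
    the limit by dominated convergence, with 1 + A as majorant for the mean and A for the
    product. *)
Lemma inner_moments F G : [/\ L1 P (fun w => L2inner (W w) F), \int[P]_w L2inner (W w) F = 0,
  L1 P (fun w => L2inner (W w) F * L2inner (W w) G) &
  \int[P]_w (L2inner (W w) F * L2inner (W w) G) =
    \int[nu]_s \int[nu]_t (covkernel s t * L2fun F s * L2fun G t)].
Proof.
have [A [lA hA]] := dominating.
have A0 w : 0 <= A w by apply: le_trans (hA 0%N w); exact: xisum_ge0.
have bX H m w : `|Xm H m w| <= 2 * Num.sqrt (A w) * env_int H.
  apply: (le_trans (Xm_bound H m w)); rewrite ler_wpM2r// ler_wpM2l//.
  by apply: ler_wsqrtr; exact: hA.
have sA w : Num.sqrt (A w) ^+ 2 = A w by rewrite sqr_sqrtr.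
have l1 : L1 P (fun w => env_int F * (1 + A w)).
  by apply: L1Z; apply: L1D => //; apply: L1_cst; exact: prob_lty.
have b1 m w : `|Xm F m w| <= env_int F * (1 + A w).
  apply: (le_trans (bX F m w)); rewrite mulrC ler_wpM2l//.
  have := sA w; have := sqr_ge0 (Num.sqrt (A w) - 1); nra.
have l2 : L1 P (fun w => (4 * env_int F * env_int G) * A w) by exact: L1Z.
have b2 m w : `|Xm F m w * Xm G m w| <= (4 * env_int F * env_int G) * A w.
  rewrite normrM; have := ler_pM (normr_ge0 _) (normr_ge0 _) (bX F m w) (bX G m w).
  move=> h; apply: (le_trans h).
  rewrite [leLHS](_ : _ = 4 * env_int F * env_int G * Num.sqrt (A w) ^+ 2); last by ring.
  by rewrite sA.
have [lI cI] := DCT (mXm F) (inner_measurable F) (@inner_cvg F) l1 b1.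
have cFG w : (fun m => Xm F m w * Xm G m w) @ \oo --> L2inner (W w) F * L2inner (W w) G.
  by apply: cvgM; exact: inner_cvg.
have [lII cII] := DCT (fun m => measurable_funM (mXm F m) (mXm G m))
  (measurable_funM (inner_measurable F) (inner_measurable G)) cFG l2 b2.
split => //.
  apply: (Rlim_unique cI); apply: (cvgn_ext (v := fun=> 0)); last exact: cvg_cst.
  move=> m; have [la ea _ _] := gauss_vdot (cvec (fco O F) m) (cvec (fco O F) m).
  by rewrite (cvec_xi0_law la).
apply: (Rlim_unique cII); apply: cvgn_ext (@fco_kernel R d gamma gamma1 O OO F G) => m.
have [_ _ lab eab] := gauss_vdot (cvec (fco O F) m) (cvec (fco O G) m).
by rewrite (cvec_xi0_law lab) eab vdot_cvec// fco_j0.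
Qed.

(** The truncated inner product has law N(0, Q m), and Q m tends to V by [fco_kernel]. Integrals of
    bounded Lipschitz functions converge on both sides, and [law_eq] concludes; the point mass V = 0
    is included. *)
Lemma inner_gaussian F : exists s : R, forall A, measurable A ->
  P ((fun w => L2inner (W w) F) @^-1` A) = normal_law1 0 s A.
Proof.
pose V := \int[nu]_s \int[nu]_t (covkernel s t * L2fun F s * L2fun F t).
pose Q m := \sum_(al <- box m) fco O F al * fco O F al.
have cQ : Q @ \oo --> V by exact: fco_kernel.
exists (Num.sqrt V) => A mA.
have mA' : measurable (A : set (measurableTypeR R)) by [].
rewrite -(normal_law1_scale (sqrtr_ge0 V) mA').
have ms (s : R) : measurable_fun setT (fun x : measurableTypeR R => s * x : measurableTypeR R).
  exact: (measurable_funM (measurable_cst s) (@measurable_id _ _ setT)).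
apply: (law_eq (I := fun w => L2inner (W w) F) (inner_measurable F) (ms (Num.sqrt V))) => // phi L L0 phi1 phiL.
have cphi : continuous phi.
  move=> x; apply/cvgrPdist_lt => e e0.
  have L1 : 0 < L + 1 by rewrite ltr_wpDl.
  exists (e / (L + 1)); rewrite /= ?divr_gt0// => y /= h.
  by apply: (le_lt_trans (phiL _ _)); move: h; rewrite ltr_pdivlMr//; have := normr_ge0 (x - y); nra.
have mphi : measurable_fun setT phi by exact: continuous_measurable_fun.
have c1 w : (fun m => phi (Xm F m w)) @ \oo --> phi (L2inner (W w) F).
  by apply: (continuous_cvg _ (cphi _)); exact: inner_cvg.
have l1 : L1 P (fun=> 1 : R) by apply: L1_cst; exact: prob_lty.
have [_ e1] := DCT (fun m => measurableT_comp mphi (mXm F m)) (measurableT_comp mphi (inner_measurable F)) c1 l1 (fun m w => phi1 _).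
apply: (Rlim_unique e1).
have c2 (x : R) : (fun m => phi (Num.sqrt (Q m) * x)) @ \oo --> phi (Num.sqrt V * x).
  apply: (continuous_cvg _ (cphi _)); apply: cvgM; last exact: cvg_cst.
  by apply: (continuous_cvg _ (@sqrt_continuous R V)); exact: cQ.
have l2 : L1 (@N01 R) (fun=> 1 : R) by apply: L1_cst; exact: prob_lty.
have [_ e2] := DCT (fun m => measurableT_comp mphi (ms (Num.sqrt (Q m)))) (measurableT_comp mphi (ms (Num.sqrt V))) c2 l2 (fun m w => phi1 _).
apply: cvgn_ext e2 => m.
have mg : measurable_fun setT (fun z : Defs.vec R (size (@bx d m)) => phi (vdot z (cvec (fco O F) m))).
  apply: (measurableT_comp mphi); apply: measurable_sum => i; apply: measurable_funM => //.
  exact: measurable_tnthR.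
have lg := L1_bounded (@gauss_lty R (size (@bx d m))) mg (fun z => phi1 _).
rewrite (cvec_xi0_law lg) (Rint_gauss_linear _ mphi).
by rewrite vdot_cvec ?fco_j0//.
Qed.

Lemma limit_gaussian : gaussian_element P W.
Proof.
by split => // F; have [s hs] := inner_gaussian F; exists 0, s.
Qed.

Lemma limit_centered : centered P W.
Proof.
by move=> F; have [l e _ _] := inner_moments F F; rewrite unlock -RintE// e.
Qed.

Lemma limit_covariance : has_covariance_kernel P W (@covkernel R d).
Proof.
by move=> F G; have [_ _ l e] := inner_moments F G; rewrite unlock -RintE// e.
Qed.

End limit_law.

(** * Standardization *)

Section standardized_sample.
Context {R : realType} {d : nat} {dT : measure_display} {T : measurableType dT}.
Local Notation vec := (Defs.vec R d).
Variables (P : probability T R) (X : nat -> {RV P >-> vec}).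
Hypothesis X_indep : mutually_independent X.
Hypothesis X_ident : identically_distributed X.

Lemma affine_mapK (m : 'cV[R]_d) (A : 'M[R]_d) : A \in unitmx ->
  cancel (affine_map m A) (affine_map (- (invmx A *m m)) (invmx A)) /\
  cancel (affine_map (- (invmx A *m m)) (invmx A)) (affine_map m A).
Proof.
move=> uA; have colE m' A' z : colvec (affine_map m' A' z) = m' + A' *m colvec z.
  by apply/matrixP => i k; rewrite ord1 mxE tnth_mktuple.
have inj (x y : vec) : colvec x = colvec y -> x = y.
  by move=> /matrixP h; apply: eq_from_tnth => i; have := h i 0; rewrite !mxE.
split=> z; apply: inj; rewrite !colE.
  by rewrite mulmxDr addrA addNr add0r mulmxA mulVmx// mul1mx.
by rewrite mulmxDr mulmxN !mulmxA mulmxV// !mul1mx addrA subrr add0r.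
Qed.

Lemma measurable_affine_map (m : 'cV[R]_d) (A : 'M[R]_d) : measurable_fun setT (affine_map m A).
Proof.
apply: measurable_vecP => i; under eq_fun do rewrite tnth_mktuple mxE.
apply: measurable_funD => //; under eq_fun do rewrite mxE.
apply: measurable_sum => j; apply: measurable_funM => //; under eq_fun do rewrite mxE.
exact: measurable_tnthR.
Qed.

Lemma standardize (m : 'cV[R]_d) (A : 'M[R]_d) : A \in unitmx ->
  (forall B, measurable B -> distribution P (X 0%N) B = pushforward (@std_normal R d) (affine_map m A) B) ->
  exists Z : nat -> {RV P >-> vec}, [/\ mutually_independent Z,
    forall i B, measurable B -> P (Z i @^-1` B) = @gauss R d B &
    forall i w, X i w = affine_map m A (Z i w)].
Proof.
move=> uA law; have [K1 K2] := affine_mapK m uA.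
pose g := affine_map (- (invmx A *m m)) (invmx A).
have mg : measurable_fun setT g by exact: measurable_affine_map.
have /choice[Z hZ] j : exists V : {RV P >-> vec}, (V : T -> vec) = g \o X j.
  by apply: RV_ex; exact: (measurableT_comp mg (measurable_RV X j)).
exists Z; split.
- by apply: (indep_comp mg (X := X)) => // i w; rewrite hZ.
- move=> i B mB; have mgB : measurable (g @^-1` B) by rewrite -[X in measurable X]setTI; exact: mg.
  have -> : Z i @^-1` B = X i @^-1` (g @^-1` B) by rewrite hZ.
  have e1 : P (X i @^-1` (g @^-1` B)) = distribution P (X 0%N) (g @^-1` B) := X_ident i 0%N mgB.
  rewrite e1 law// /pushforward; congr (gauss d _).
  by apply/seteqP; split => z /=; rewrite /g K1.
- by move=> i w; rewrite hZ /= K2.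
Qed.

End standardized_sample.

Theorem theorem5p1 (R : realType) (d : nat) (d_gt0 : (0 < d)%N)
    (gamma : R) (gamma_gt1 : 1 < gamma)
    (dT : measure_display) (T : measurableType dT) (P : probability T R)
    (X : nat -> {RV P >-> vec R d})
    (X_indep : mutually_independent X)
    (X_ident : identically_distributed X)
    (X_normal : nondegenerate_normal (distribution P (X 0%N))) :
  exists U : nat -> T -> L2 d gamma,
    [/\ forall n w, L2fun (U n w) = Ustat n (fun j => X j w)
          %[ae wlebesgue gamma],
        forall n, random_element (U n) &
        exists (dT' : measure_display) (T' : measurableType dT')
               (P' : probability T' R) (W : T' -> L2 d gamma),
          [/\ gaussian_element P' W,
              centered P' W,
              has_covariance_kernel P' W (@covkernel R d) &
              cvg_in_distribution P U P' W]].
Proof.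
have [m [A [uA law]]] := X_normal.
have [Z [Z_indep Z_law XZ]] := standardize X_indep X_ident uA law.
have /choice[U hU] n := Ustat_element n d_gt0 gamma_gt1 (X := fun w j => X j w) (fun j => measurable_RV X j).
exists U; split; [by move=> n; exact: (hU n).1|by move=> n; exact: (hU n).2|].
have [Y [Y_indep Y_law]] := normal_family d_gt0 Z_indep Z_law.
have [OO _] := inv_sqrtmx_orth uA.
pose O := inv_sqrtmx (A *m A^T) *m A.
have OO' : O *m O^T = 1%:M by apply: mulmx1C; exact: OO.
(* Any value strictly between 1 and gamma serves: above 1 for summable weights, below gamma for
   square integrable envelopes. *)
pose rho := (1 + gamma) / 2.
have rho1 : 1 < rho by rewrite /rho; lra.
have rhog : rho < gamma by rewrite /rho; lra.
have [W [S [_ _ _ lW rW]]] := limit_element gamma_gt1 OO' rho1 rhog (measurable_xiY Y) (xiY2 Y_law).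
have UE n w : L2fun (U n w) = Ustat n (fun j => affine_map m A (Z j w)) %[ae wlebesgue gamma].
  rewrite (_ : (fun j => affine_map m A (Z j w)) = fun j => X j w); first exact: (hU n).1.
  by apply/funext => j; rewrite XZ.
exists dT, T, P, W; split.
- exact (limit_gaussian Y_indep Y_law rho1 rW lW).
- exact (limit_centered Y_indep Y_law rho1 rhog rW lW).
- exact (limit_covariance Y_indep Y_law rho1 rhog rW lW).
move=> h ch [M hM].
have mU n : random_element (U n) := (hU n).2.
have cv := portmanteau mU rW (fun h M L hM L0 hL =>
  weak_limit Z_indep Z_law Y_indep Y_law rho1 hM L0 hL uA erefl UE mU rW lW) ch hM.
have lU n : L1 P (h \o U n) := @bound_L1 _ _ _ P _ M (measurable_comp_random (mU n) ch) (fun w => hM _).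
have lWh : L1 P (h \o W) := @bound_L1 _ _ _ P _ M (measurable_comp_random rW ch) (fun w => hM _).
rewrite unlock -RintE// (_ : (fun n => _) = fun n => (\int[P]_w h (U n w))%:E).
  by apply: cvg_EFin; [exact: nearW|exact: cv].
by apply/funext => n; rewrite -RintE.
Qed.
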